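(* For each $1\le p<\infty$ the mapping $\phi:H_p(\mathbb{T}^\infty)\to H_p(\mathbb{D}^\infty)$ defined by $$\phi(f)(z)=\sum_{\alpha\in\mathbb{N}_0^{(\mathbb{N})}}\hat f(\alpha)z^\alpha,\qquad z\in\mathbb{D}^\infty\cap\ell_2,$$ is an isometry (not necessarily onto), which is onto if $1<p<\infty$; and for $p=1$, $$\phi(H_1(\mathbb{T}^\infty))=\overline{\operatorname{span}}^{\|\cdot\|_1}\{z^\alpha:\alpha\in\mathbb{N}_0^{(\mathbb{N})}\},$$ the closure in $H_1(\mathbb{D}^\infty)$ of the linear span of the monomial functions $z\mapsto z^\alpha$.
   Context: $\mathbb{D}^\infty$ is the open unit ball of the complex Banach space $\ell_\infty$; $\mathbb{D}^\infty\cap\ell_2=\{z\in\ell_2:\sup_n|z_n|<1\}$ is regarded as an open subset of the Hilbert space $\ell_2$, and $H(\mathbb{D}^\infty\cap\ell_2)$ is the space of holomorphic (Fréchet complex-differentiable) functions $g:\mathbb{D}^\infty\cap\ell_2\to\mathbb{C}$. $\mathbb{T}^n$ and $\mathbb{T}^\infty$ are the finite and countably infinite products of unit circles, with $m_n$ and $m$ the respective products of normalized Lebesgue measure. $\mathbb{Z}^{(\mathbb{N})}$ (resp. $\mathbb{N}_0^{(\mathbb{N})}$) is the set of finitely supported sequences of integers (resp. non-negative integers), and $z^\alpha=\prod_jz_j^{\alpha_j}$. For $f\in L_p(\mathbb{T}^\infty)$, $\hat f(\alpha)=\int_{\mathbb{T}^\infty}f(w)w^{-\alpha}\,dm(w)$,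 and $$H_p(\mathbb{T}^\infty)=\{f\in L_p(\mathbb{T}^\infty):\hat f(\alpha)=0\ \ \forall\alpha\in\mathbb{Z}^{(\mathbb{N})}\setminus\mathbb{N}_0^{(\mathbb{N})}\}$$ with the $L_p$-norm. The Banach space $H_p(\mathbb{D}^\infty)$ consists of all $g\in H(\mathbb{D}^\infty\cap\ell_2)$ with $$\|g\|_{H_p(\mathbb{D}^\infty)}=\sup_{n\in\mathbb{N}}\sup_{0<r<1}\Big(\int_{\mathbb{T}^n}|g(rw_1,\ldots,rw_n,0,0,\ldots)|^p\,dm_n(w_1,\ldots,w_n)\Big)^{1/p}<\infty.$$ The norm $\|\cdot\|_1$ in the closure above is $\|\cdot\|_{H_1(\mathbb{D}^\infty)}$. *)

(* Defs.v *)
From HB Require Import structures.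
From mathcomp Require Import all_boot all_order all_algebra.
From mathcomp Require Import finmap.
From mathcomp Require Import complex.
From mathcomp Require Import all_classical all_reals all_analysis.
From mathcomp Require Import measurable_realfun zify lra ring.
Set Implicit Arguments. Unset Strict Implicit. Unset Printing Implicit Defensive.
Import Order.TTheory GRing.Theory Num.Theory.
Import numFieldNormedType.Exports.
Local Open Scope classical_set_scope.
Local Open Scope complex_scope.
Local Open Scope ring_scope.

Notation cabs := (@ComplexField.Normc.normc _).

Section ell2.
Context {R : realType}.
Implicit Types (u v : nat -> R[i]) (a : R[i]).

Definition l2norm u : \bar R := 'N[counting]_2%:E[EFin \o (fun n => cabs (u n))]%E.

Lemma cabs_ge0 (x : R[i]) : 0 <= cabs x.
Proof. by case: x => a b; exact: sqrtr_ge0. Qed.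

Lemma cabsE (x : R[i]) : `|x| = (cabs x)%:C.
Proof. by case: x. Qed.

Lemma l2normE u :
  l2norm u = ((\sum_(0 <= n <oo) (cabs (u n) ^+ 2)%:E) `^ 2^-1)%E.
Proof.
rewrite /l2norm Lnorm_counting//; congr (_ `^ _)%E.
apply: eq_eseriesr => n _.
by rewrite abse_EFin ger0_norm ?cabs_ge0// poweR_EFin powR_mulrn ?cabs_ge0.
Qed.

Lemma l2normD u v : (l2norm (fun n => (u n + v n)%R) <= l2norm u + l2norm v)%E.
Proof.
have m (f : nat -> R) : measurable_fun setT f by [].
apply: le_trans (minkowski_EFin counting (m (cabs \o u)) (m (cabs \o v)) _); last first.
  by rewrite ler1n.
rewrite /l2norm !Lnorm_counting//; apply: gt0_ler_poweR; rewrite ?invr_ge0//.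
- by rewrite in_itv/= leey andbT nneseries_ge0// => *; exact: poweR_ge0.
- by rewrite in_itv/= leey andbT nneseries_ge0// => *; exact: poweR_ge0.
apply: lee_nneseries => [*|n _]; first exact: poweR_ge0.
rewrite /= lee_fin ge0_ler_powR ?nnegrE//.
rewrite ger0_norm ?cabs_ge0// ger0_norm ?addr_ge0 ?cabs_ge0//.
exact: le_normcD.
Qed.

Lemma l2normZ a u : l2norm (fun n => a * u n) = ((cabs a)%:E * l2norm u)%E.
Proof.
rewrite !l2normE.
under eq_eseriesr do rewrite ComplexField.Normc.normcM exprMn EFinM.
rewrite nneseriesZl; last by move=> *; rewrite lee_fin exprn_ge0 ?cabs_ge0.
rewrite poweRM ?lee_fin ?exprn_ge0 ?cabs_ge0//; last first.
  by rewrite nneseries_ge0// => *; rewrite lee_fin exprn_ge0 ?cabs_ge0.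
congr (_ * _)%E; rewrite poweR_EFin -powR_mulrn ?cabs_ge0// -powRrM.
by rewrite mulfV ?pnatr_eq0// powRr1 ?cabs_ge0.
Qed.

Lemma l2norm0 : l2norm (fun=> 0) = 0%E.
Proof.
have -> : (fun=> 0) = (fun n : nat => (0 : R[i]) * 0 : R[i]).
  by apply/funext => n; rewrite mulr0.
by rewrite l2normZ ComplexField.Normc.normc0 mul0e.
Qed.

Lemma l2norm_eq0 u : l2norm u = 0%E -> forall n, u n = 0.
Proof.
rewrite l2normE => u0 n; apply: ComplexField.Normc.eq0_normc.
apply/eqP; rewrite -sqrf_eq0; apply/eqP.
have c0 k : (0 <= (cabs (u k) ^+ 2)%:E)%E by rewrite lee_fin exprn_ge0 ?cabs_ge0.
have s0 : (\sum_(0 <= n <oo) (cabs (u n) ^+ 2)%:E = 0)%E.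
  by apply: poweR_eq0_eq0 u0; exact: nneseries_ge0.
suff : ((cabs (u n) ^+ 2)%:E <= 0)%E.
  by rewrite lee_fin => h; apply/eqP; rewrite eq_le h exprn_ge0 ?cabs_ge0.
rewrite -[X in (_ <= X)%E]s0.
apply: le_trans (nneseries_lim_ge n.+1 _) => //.
by rewrite big_nat_recr//= leeDr// sume_ge0.
Qed.

Record ell2 := Ell2 {
  ell2_val :> nat -> R[i];
  ell2P : (l2norm ell2_val < +oo)%E }.

Lemma ell2_inj (x y : ell2) : (forall n, x n = y n) -> x = y.
Proof.
case: x y => [u hu] [v hv] /= /funext uv; case: _ / uv in hv *.
by congr Ell2; exact: Prop_irrelevance.
Qed.

HB.instance Definition _ := gen_eqMixin ell2.
HB.instance Definition _ := gen_choiceMixin ell2.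

Definition ell2_zero : ell2.
Proof. by exists (fun=> 0); rewrite l2norm0. Defined.

Definition ell2_add (x y : ell2) : ell2.
Proof.
exists (fun n => x n + y n); apply: le_lt_trans (l2normD _ _) _.
by rewrite lte_add_pinfty ?ell2P.
Defined.

Definition ell2_scale a (x : ell2) : ell2.
Proof.
exists (fun n => a * x n); rewrite l2normZ.
by rewrite lte_mul_pinfty ?lee_fin ?cabs_ge0// ell2P.
Defined.

Let ell2_addA : associative ell2_add.
Proof. by move=> x y z; apply: ell2_inj => n /=; rewrite addrA. Qed.

Let ell2_addC : commutative ell2_add.
Proof. by move=> x y; apply: ell2_inj => n /=; rewrite addrC. Qed.

Let ell2_add0 : left_id ell2_zero ell2_add.
Proof. by move=> x; apply: ell2_inj => n /=; rewrite add0r. Qed.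

Let ell2_addN : left_inverse ell2_zero (ell2_scale (- 1)) ell2_add.
Proof. by move=> x; apply: ell2_inj => n /=; rewrite mulN1r addNr. Qed.

HB.instance Definition _ :=
  GRing.isZmodule.Build ell2 ell2_addA ell2_addC ell2_add0 ell2_addN.

Let ell2_scaleA a b (x : ell2) :
  ell2_scale a (ell2_scale b x) = ell2_scale (a * b) x.
Proof. by apply: ell2_inj => n /=; rewrite mulrA. Qed.

Let ell2_scale1 : left_id 1 ell2_scale.
Proof. by move=> x; apply: ell2_inj => n /=; rewrite mul1r. Qed.

Let ell2_scaleDr : right_distributive ell2_scale +%R.
Proof. by move=> a x y; apply: ell2_inj => n /=; rewrite mulrDr. Qed.

Let ell2_scaleDl (x : ell2) : {morph ell2_scale^~ x : a b / a + b}.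
Proof. by move=> a b; apply: ell2_inj => n /=; rewrite mulrDl. Qed.

HB.instance Definition _ := GRing.Zmodule_isLmodule.Build R[i] ell2
  ell2_scaleA ell2_scale1 ell2_scaleDr ell2_scaleDl.

(* A normed module over R[i] has a norm with values in R[i], whence the cast. *)
Definition ell2_norm (x : ell2) : R[i] := (fine (l2norm x))%:C.

Lemma l2norm_fin (x : ell2) : l2norm x = (fine (l2norm x))%:E.
Proof. by rewrite fineK// ge0_fin_numE ?ell2P// /l2norm Lnorm_ge0. Qed.

Let ell2_normD (x y : ell2) : ell2_norm (x + y) <= ell2_norm x + ell2_norm y.
Proof.
rewrite /ell2_norm -rmorphD lecR -lee_fin EFinD -!l2norm_fin.
exact: l2normD.
Qed.

Let ell2_normZ a (x : ell2) : ell2_norm (a *: x) = `|a| * ell2_norm x.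
Proof.
rewrite cabsE /ell2_norm -rmorphM; congr (_%:C); apply: EFin_inj.
by rewrite EFinM -!l2norm_fin; exact: l2normZ.
Qed.

Let ell2_norm0_eq0 (x : ell2) : ell2_norm x = 0 -> x = 0.
Proof.
move=> /(congr1 (@complex.Re R))/= x0; apply: ell2_inj.
by apply: l2norm_eq0; rewrite l2norm_fin x0.
Qed.

HB.instance Definition _ := @Lmodule_isNormed.Build R[i] ell2
  ell2_norm ell2_normD ell2_normZ ell2_norm0_eq0.

End ell2.
Arguments ell2 : clear implicits.

Section prod_space.
Context (I : Type) {d} (T : measurableType d).

Definition cylinders : set (set (I -> T)) :=
  \bigcup_(i in [set: I]) preimage_set_system setT (fun w => w i) measurable.

Definition prod_space := g_sigma_algebraType cylinders.

HB.instance Definition _ := Measurable.on prod_space.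
End prod_space.
Arguments cylinders I {d} T.
Arguments prod_space I {d} T.

Lemma measurable_coord (I : Type) {d} (T : measurableType d) (i : I) :
  measurable_fun [set: prod_space I T] (fun w : prod_space I T => w i).
Proof.
by move=> _ A mA; apply: sub_sigma_algebra; exists i => //; exists A.
Qed.

Lemma measurable_to_prod (I : Type) {d d'} (T : measurableType d)
  (X : measurableType d') (f : X -> prod_space I T) :
  (forall i, measurable_fun [set: X] (fun x => f x i)) ->
  measurable_fun [set: X] f.
Proof.
move=> mf; apply: (@measurability _ _ X (prod_space I T) setT f (cylinders I T)) => //.
by move=> _ [_ [i _ [A mA <-]] <-]; rewrite setTI setTI; have := mf i measurableT A mA; rewrite setTI.
Qed.

(* This property determines m, since the sets it mentions form a pi-system
   generating the sigma-algebra of prod_space I T. Existence for a countable I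
   is product_measure_exists below: the binary digits of a uniform random
   number are independent fair coins, the double sequence obtained by splitting
   them gives independent uniform random numbers, to which X is applied. *)
Definition is_product_measure (R : realType) (I : choiceType) d (T : measurableType d)
    (mu : set T -> \bar R) (m : set (prod_space I T) -> \bar R) :=
  forall (J : {fset I}) (A : I -> set T), (forall i, measurable (A i)) ->
  m [set w | forall i, i \in J -> A i (w i)] = (\prod_(i <- J) mu (A i))%E.

Section coins.
Context {R : realType}.
Local Notation h n := ((2^-1 : R) ^+ n).

(* bsum n t = \sum_(i < n) 2^-(i+1) d_i, where d_i is the i-th binary digit of
   t in [0, 1[ (greedy expansion). *)
Fixpoint bsum (n : nat) (t : R) : R :=
  if n is m.+1 then
    (if bsum m t + h m.+1 <= t then bsum m t + h m.+1 else bsum m t)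
  else 0.

Definition bdigit (n : nat) (t : R) : bool := bsum n t + h n.+1 <= t.

Let h_gt0 n : 0 < h n. Proof. by rewrite exprn_gt0. Qed.

Let h_half n : h n = h n.+1 + h n.+1.
Proof. by rewrite exprS; lra. Qed.

Lemma bsum_bound n t : 0 <= t < 1 -> bsum n t <= t < bsum n t + h n.
Proof.
move=> /andP[t0 t1]; elim: n => [|n /andP[IH1 IH2]] /=.
  by rewrite t0 add0r expr0.
case: ifPn => [H|]; first by rewrite H -addrA -h_half.
by rewrite -ltNge => ->; rewrite IH1.
Qed.

Lemma bsum_cvg t : 0 <= t < 1 -> bsum n t @[n --> \oo] --> t.
Proof.
move=> t01; apply: (@squeeze_cvgr _ _ _ _ (fun n => t - h n) (fun=> t)).
- near=> n; have /andP[-> /ltW] := bsum_bound n t01.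
  by rewrite andbT lerBlDr.
- rewrite -[X in _ --> X]subr0; apply: cvgB; first exact: cvg_cst.
  by apply: cvg_expr; rewrite ger0_norm ?invf_lt1// ltr1n.
- exact: cvg_cst.
Unshelve. all: by end_near. Qed.

Lemma bsumE n t : bsum n t = \sum_(i < n) (bdigit i t)%:R * h i.+1.
Proof.
elim: n => [|n IH]; first by rewrite big_ord0.
rewrite big_ord_recr/= -IH /bdigit; case: ifP => _.
  by rewrite mul1r.
by rewrite mul0r addr0.
Qed.

Lemma measurable_bsum n : measurable_fun setT (bsum n).
Proof.
elim: n => [|n IH] /=; first exact: measurable_cst.
have m1 : measurable_fun setT (fun t => bsum n t + h n.+1).
  by apply: measurable_funD => //; exact: measurable_cst.
apply: measurable_fun_ifT => //.
by apply: measurable_fun_ler => //; exact: measurable_id.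
Qed.

Lemma measurable_bdigit n : measurable_fun setT (bdigit n).
Proof.
apply: measurable_fun_ler; last exact: measurable_id.
by apply: measurable_funD; [exact: measurable_bsum|exact: measurable_cst].
Qed.

Local Notation lam := (@lebesgue_measure R).

Let E (e : pred nat) m S k : set R :=
  [set t | S <= t < S + h m /\ forall i, (m <= i < m + k)%N -> e i -> bdigit i t].

Let mE e m S k : measurable (E e m S k).
Proof.
have -> : E e m S k = `[S, S + h m[ `&`
   \bigcap_(i in [set i | (m <= i < m + k)%N /\ e i]) (bdigit i @^-1` [set true]).
  apply/seteqP; split => t /=.
    by move=> [St H]; split=> [|i /= [? ?]]; [rewrite in_itv|exact: H].
  move=> [St H]; split=> [|i ? ?]; first by move: St; rewrite /= in_itv.
  by apply: H; split.
apply: measurableI => //; apply: bigcap_measurableType => i _.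
by rewrite -[X in measurable X]setTI; exact: measurable_bdigit.
Qed.

Let lamE e k m S : (forall t, S <= t < S + h m -> bsum m t = S) ->
  lam (E e m S k) = (h m * \prod_(m <= i < m + k) (if e i then 2^-1 else 1))%:E.
Proof.
elim: k m S => [|k IH] m S Sm.
  have -> : E e m S 0 = `[S, S + h m[%classic.
    apply/seteqP; split=> t /=; rewrite in_itv/=; first by case.
    by move=> tS; split=> // i; rewrite addn0 => /andP[mi]; rewrite ltnNge mi.
  rewrite lebesgue_measure_itv/= lte_fin ltrDl h_gt0 addn0 big_geq// mulr1.
  by rewrite -EFinD addrAC subrr add0r.
have half1 t : S <= t < S + h m.+1 -> S <= t < S + h m.
  by have := h_half m; have := h_gt0 m.+1; lra.
have half2 t : S + h m.+1 <= t < S + h m.+1 + h m.+1 -> S <= t < S + h m.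
  by have := h_half m; have := h_gt0 m.+1; lra.
have dL t : S <= t < S + h m.+1 -> bdigit m t = false.
  move=> tS; rewrite /bdigit (Sm _ (half1 _ tS)).
  by apply/negbTE; rewrite -ltNge; case/andP: tS.
have dR t : S + h m.+1 <= t < S + h m.+1 + h m.+1 -> bdigit m t = true.
  by move=> tS; rewrite /bdigit (Sm _ (half2 _ tS)); case/andP: tS.
have HL t : S <= t < S + h m.+1 -> bsum m.+1 t = S.
  move=> tS; have := dL _ tS; rewrite /bdigit /= => ->.
  exact/Sm/half1.
have HR t : S + h m.+1 <= t < S + h m.+1 + h m.+1 -> bsum m.+1 t = S + h m.+1.
  move=> tS; have := dR _ tS; rewrite /bdigit /= => ->.
  by rewrite (Sm _ (half2 _ tS)).
have idx i : (m <= i < m + k.+1)%N = (i == m) || (m.+1 <= i < m.+1 + k)%N.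
  by rewrite addSnnS leq_eqVlt eq_sym; case: eqVneq => //= ->; lia.
have EE : E e m S k.+1 =
    (if e m then set0 else E e m.+1 S k) `|` E e m.+1 (S + h m.+1) k.
  apply/seteqP; split=> t.
    move=> [tS H]; have [tS1|tS1] := ltP t (S + h m.+1).
      have tS2 : S <= t < S + h m.+1 by rewrite tS1 andbT; case/andP: tS.
      left; case: ifPn => em.
        by have := H m; rewrite idx eqxx dL// => /(_ isT em).
      by split=> // i mi; apply: H; rewrite idx mi orbT.
    right; split=> [|i mi]; first by rewrite tS1 -addrA -h_half; case/andP: tS.
    by apply: H; rewrite idx mi orbT.
  case.
    case: ifPn => // /negP em [tS H]; split; first exact: half1.
    by move=> i; rewrite idx => /orP[/eqP->//|]; exact: H.
  move=> [tS H]; split; first exact: half2.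
  by move=> i; rewrite idx => /orP[/eqP-> _|]; [exact: dR|exact: H].
have dis : (if e m then set0 else E e m.+1 S k) `&` E e m.+1 (S + h m.+1) k = set0.
  rewrite -subset0 => t [+ [/andP[S1 _] _]].
  by case: ifPn => // _ [/andP[_ S2] _]; move: (le_lt_trans S1 S2); rewrite ltxx.
have mL : measurable (if e m then set0 else E e m.+1 S k) by case: ifPn.
pose L : set R := if e m then set0 else E e m.+1 S k.
pose Q : set R := E e m.+1 (S + h m.+1) k.
rewrite EE; transitivity (lam L + lam Q)%E; first (have := measureU lam mL (mE e m.+1 (S + h m.+1) k) dis; exact).
have mk : (m < m + k.+1)%N by lia.
rewrite [lam Q](IH _ _ HR) (big_ltn mk).
rewrite addSnnS /L; case: ifPn => em.
  by rewrite measure0 add0e mulrA -exprSr.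
rewrite (IH _ _ HL) addSnnS mul1r -EFinD; congr (_%:E).
by rewrite -mulrDl -h_half.
Qed.

Lemma lam_bdigit (J : {fset nat}) :
  lam [set t | 0 <= t < 1 /\ forall i, i \in J -> bdigit i t]
  = (2^-1 ^+ #|` J|)%:E.
Proof.
have [N JN] : exists N, forall i, i \in J -> (i < N)%N.
  exists (\max_(i <- J) i).+1 => i iJ; rewrite ltnS.
  by rewrite (big_fsetD1 i iJ) /= leq_max leqnn.
have -> : [set t | 0 <= t < 1 /\ forall i, i \in J -> bdigit i t] =
    E [pred i | i \in J] 0 0 N.
  apply/seteqP; split=> t /=.
    by move=> [t01 H]; split; [rewrite add0r expr0|move=> i _; exact: H].
  move=> []; rewrite add0r expr0 => t01 H; split => // i iJ.
  by apply: H => //=; rewrite add0n JN.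
rewrite lamE => [|t]; last by [].
rewrite expr0 mul1r add0n -big_mkcond/= big_const_seq iter_mulr_1 -size_filter.
congr (_ ^+ _)%:E; apply: perm_size; apply: uniq_perm.
- by rewrite filter_uniq// iota_uniq.
- exact: fset_uniq.
- move=> i; rewrite mem_filter mem_index_iota/= andb_idr//; exact: JN.
Qed.

End coins.

Section coin_measure.
Context {R : realType}.
Local Notation D := (prod_space nat bool).
Local Notation U := (uniform_prob (@ltr01 R)).

Lemma uniform01E (X : set R) : measurable X ->
  U X = lebesgue_measure (X `&` `[0, 1[).
Proof.
move=> mX; rewrite /uniform_prob integral_uniform_pdf.
have mX1 : measurable (X `&` [set 1]) by exact: measurableI.
have mXI : measurable (X `&` `[0, 1[) by exact: measurableI.
transitivity (lebesgue_measure (X `&` `[0, 1])).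
  rewrite (eq_integral (cst 1%E)).
    by rewrite integral_cst ?mul1e//; exact: measurableI.
  move=> x; rewrite inE/= in_itv/= => -[_ x01].
  by rewrite /uniform_pdf x01 subr0 invr1.
have -> : X `&` `[0, 1] = (X `&` `[0, 1[) `|` (X `&` [set 1]).
  rewrite -setIUr; congr (_ `&` _); apply/seteqP; split=> t /=.
    rewrite !in_itv/= (le_eqVlt t) => /andP[->].
    by move=> /orP[/eqP|]; [right|left].
  by rewrite !in_itv/= => -[/andP[-> /ltW->]|->]//; rewrite ler01 lexx.
apply: measureU0 => //; apply/eqP; rewrite eq_le measure_ge0 andbT.
by rewrite -(lebesgue_measure_set1 1) le_measure ?inE.
Qed.

Definition digits (t : measurableTypeR R) : D := fun n => bdigit n t.

Lemma measurable_digits : measurable_fun setT digits.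
Proof. by apply: measurable_to_prod => i; exact: measurable_bdigit. Qed.

HB.instance Definition _ :=
  isMeasurableFun.Build _ _ _ _ digits measurable_digits.

Definition coin : probability D R := distribution U digits.

Definition heads (J : {fset nat}) : set D := [set x | forall i, i \in J -> x i].

Lemma measurable_heads J : measurable (heads J).
Proof.
have -> : heads J = \bigcap_(i in [set i | i \in J])
    ((fun x : D => x i) @^-1` [set true]) by [].
apply: bigcap_measurableType => i _.
by rewrite -[X in measurable X]setTI; exact: measurable_coord.
Qed.

Lemma coin_heads J : coin (heads J) = (2^-1 ^+ #|` J|)%:E.
Proof.
rewrite -lam_bdigit; transitivity (U (digits @^-1` heads J)); first by [].
rewrite uniform01E; last first.
  rewrite -[X in measurable X]setTI; apply: measurable_digits => //.
  exact: measurable_heads.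
congr (lebesgue_measure _); apply/seteqP; split=> t /=; rewrite in_itv/=.
  by case.
by case.
Qed.

Lemma headsI J K : heads J `&` heads K = heads (J `|` K)%fset.
Proof.
apply/seteqP; split=> x /=.
  by move=> [xJ xK] i; rewrite inE => /orP[/xJ|/xK].
by move=> H; split=> i iJ; apply: H; rewrite inE iJ ?orbT.
Qed.

Lemma measurable_headsE : @measurable _ D = <<s range heads >>.
Proof.
apply/seteqP; split; last first.
  by apply: smallest_sub => [|_ [J _ <-]];
    [exact: sigma_algebra_measurable|exact: measurable_heads].
apply: smallest_sub; first exact: smallest_sigma_algebra.
move=> _ [i _ [A _ <-]]; rewrite setTI.
pose G := g_sigma_algebraType (range heads).
have mi : measurable_fun [set: G] (fun x : G => x i).
  move=> mT; apply: (measurable_fun_bool true) => //; rewrite setTI.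
  have -> : (fun x : G => x i) @^-1` [set true] = heads [fset i]%fset.
    apply/seteqP; split=> x /=; first by move=> xi j; rewrite inE => /eqP->.
    by apply; rewrite inE.
  by apply: sub_sigma_algebra; exists [fset i]%fset.
by have := mi measurableT A I; rewrite setTI.
Qed.

Lemma heads_unique (m1 m2 : {measure set D -> \bar R}) :
  (forall J, m1 (heads J) = m2 (heads J)) -> (m1 setT < +oo)%E ->
  forall A, measurable A -> m1 A = m2 A.
Proof.
move=> m12 moo A; rewrite measurable_headsE.
have h0 : heads fset0 = setT by apply/seteqP; split.
apply: (g_sigma_algebra_measure_unique (range heads) _ (fun=> setT)).
- by move=> _ [J _ <-]; exact: measurable_heads.
- by move=> _; exists fset0.
- by rewrite bigcup_const//; exists 0%N.
- by move=> _ _ [J _ <-] [K _ <-]; rewrite headsI; exists (J `|` K)%fset.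
- by move=> _ [J _ <-].
- by [].
Qed.

Definition evens (x : D) : D := fun n => x n.*2.
Definition odds (x : D) : D := fun n => x n.*2.+1.

Lemma measurable_evens : measurable_fun setT evens.
Proof. by apply: measurable_to_prod => i; exact: measurable_coord. Qed.

Lemma measurable_odds : measurable_fun setT odds.
Proof. by apply: measurable_to_prod => i; exact: measurable_coord. Qed.

HB.instance Definition _ :=
  isMeasurableFun.Build _ _ _ _ evens measurable_evens.
HB.instance Definition _ :=
  isMeasurableFun.Build _ _ _ _ odds measurable_odds.

Lemma coin_evens_odds A B : measurable A -> measurable B ->
  coin (evens @^-1` A `&` odds @^-1` B) = (coin A * coin B)%E.
Proof.
have pE J : evens @^-1` heads J = heads [fset j.*2 | j in J]%fset.
  apply/seteqP; split=> x /= H i.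
    by move=> /imfsetP[j /= jJ ->]; exact: H.
  by move=> iJ; apply: H; apply/imfsetP; exists i.
have pO J : odds @^-1` heads J = heads [fset j.*2.+1 | j in J]%fset.
  apply/seteqP; split=> x /= H i.
    by move=> /imfsetP[j /= jJ ->]; exact: H.
  by move=> iJ; apply: H; apply/imfsetP; exists i.
have step1 J K : coin (evens @^-1` heads J `&` odds @^-1` heads K) =
    (coin (heads J) * coin (heads K))%E.
  rewrite pE pO headsI !coin_heads -EFinM -exprD; congr (_ ^+ _)%:E.
  rewrite cardfsU (_ : (_ `&` _)%fset = fset0) ?cardfs0 ?subn0.
    by rewrite !card_imfset//; [move=> i j [] /double_inj|exact: double_inj].
  apply/fsetP => i; rewrite inE [RHS]inE; apply/negP => /andP[].
  by move=> /imfsetP[j /= _ ->] /imfsetP[k /= _ /(congr1 odd)]; rewrite /= !odd_double.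
have mE C : measurable C -> measurable (evens @^-1` C).
  by move=> mC; rewrite -[X in measurable X]setTI; exact: measurable_evens.
have mO C : measurable C -> measurable (odds @^-1` C).
  by move=> mC; rewrite -[X in measurable X]setTI; exact: measurable_odds.
have fin C : measurable C -> coin C = (fine (coin C))%:E by move=> mC; rewrite fineK// fin_num_measure.
have nn C : 0 <= fine (coin C) by rewrite fine_ge0.
have step2 K C : measurable C -> coin (evens @^-1` C `&` odds @^-1` heads K) =
    (coin C * coin (heads K))%E.
  move=> mC; have mK := mO _ (measurable_heads K).
  pose m1 : {measure set D -> \bar R} := pushforward (mrestr coin mK) evens.
  pose m2 : {measure set D -> \bar R} := mscale (NngNum (nn (heads K))) coin.
  pose mu1 := m1 measurable_evens.
  have e2 X : measurable X -> m2 X = (coin X * coin (heads K))%E.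
    move=> mX; rewrite muleC [in RHS](fin _ (measurable_heads K)).
    by [].
  rewrite -e2//; transitivity (mu1 C) => //.
  apply: heads_unique => // [J|].
    by rewrite e2 -?step1//; exact: measurable_heads.
  have -> : mu1 setT = coin (odds @^-1` heads K) by rewrite /mu1 /m1 /= /pushforward /mrestr preimage_setT setTI.
  by rewrite fin ?ltry.
move=> mA mB; have mEA := mE _ mA.
pose m1 : {measure set D -> \bar R} := pushforward (mrestr coin mEA) odds.
pose m2 : {measure set D -> \bar R} := mscale (NngNum (nn A)) coin.
pose mu1 := m1 measurable_odds.
have e2 X : measurable X -> m2 X = (coin A * coin X)%E.
  by move=> mX; rewrite [in RHS](fin _ mA).
rewrite -e2//; transitivity (mu1 B); first by rewrite setIC.
apply: heads_unique => // [J|].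
  have mJ := measurable_heads J.
  rewrite (e2 _ mJ) -(step2 J A mA).
  transitivity (coin (odds @^-1` heads J `&` evens @^-1` A)); first by [].
  by rewrite setIC.
have -> : mu1 setT = coin (evens @^-1` A) by rewrite /mu1 /m1 /= /pushforward /mrestr preimage_setT setTI.
by rewrite (fin _ mEA) ltry.
Qed.

Definition coin_row (k : nat) (x : D) : D := evens (iter k odds x).

Lemma measurable_iter_odds k : measurable_fun setT (iter k odds).
Proof.
elim: k => [|k IH]; first exact: measurable_id.
exact: measurableT_comp measurable_odds IH.
Qed.

Lemma measurable_row k : measurable_fun setT (coin_row k).
Proof. exact: measurableT_comp measurable_evens (measurable_iter_odds k). Qed.

Let measurable_rows (J : set nat) (A : nat -> set D) :
  (forall k, measurable (A k)) ->
  measurable [set x | forall k, J k -> A k (coin_row k x)].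
Proof.
move=> mA; have -> : [set x | forall k, J k -> A k (coin_row k x)] =
    \bigcap_(k in J) (coin_row k @^-1` A k) by [].
apply: bigcap_measurableType => k _.
by rewrite -[X in measurable X]setTI; exact: measurable_row.
Qed.

Lemma coin_rows_ord n (A : nat -> set D) : (forall k, measurable (A k)) ->
  coin [set x | forall k, (k < n)%N -> A k (coin_row k x)] =
  (\prod_(k < n) coin (A k))%E.
Proof.
elim: n A => [|n IH] A mA.
  rewrite big_ord0 (_ : [set x | _] = setT) ?probability_setT//.
  by apply/seteqP; split.
rewrite big_ord_recl/= -(IH (fun k => A k.+1))// -coin_evens_odds//; last first.
  exact: (@measurable_rows [set k | (k < n)%N] (fun k => A k.+1)).
congr (coin _); apply/seteqP; split=> x /=.
  move=> H; split; first exact: (H 0%N).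
  by move=> k kn; have := H k.+1 kn; rewrite /coin_row iterSr.
by move=> [H0 H] [|k] // kn; have := H k kn; rewrite /coin_row iterSr.
Qed.

Lemma coin_rows (J : {fset nat}) (A : nat -> set D) :
  (forall k, measurable (A k)) ->
  coin [set x | forall k, k \in J -> A k (coin_row k x)] =
  (\prod_(k <- J) coin (A k))%E.
Proof.
move=> mA; have [N JN] : exists N, forall i, i \in J -> (i < N)%N.
  exists (\max_(i <- J) i).+1 => i iJ; rewrite ltnS.
  by rewrite (big_fsetD1 i iJ) /= leq_max leqnn.
have := @coin_rows_ord N (fun k => if k \in J then A k else setT).
have -> : [set x | forall k, (k < N)%N -> (if k \in J then A k else setT) (coin_row k x)] =
    [set x | forall k, k \in J -> A k (coin_row k x)].
  apply/seteqP; split=> x /= H k.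
    by move=> kJ; have := H k (JN _ kJ); rewrite kJ.
  by case: ifPn => // kJ _; exact: H.
move=> -> => [|k]; last by case: ifPn.
rewrite -(big_mkord xpredT (fun k => coin (if k \in J then A k else setT))).
under eq_bigr => k _ do rewrite (fun_if coin) probability_setT.
rewrite -big_mkcond/= -big_filter; apply: perm_big; apply: uniq_perm.
- by rewrite filter_uniq// iota_uniq.
- exact: fset_uniq.
- by move=> i; rewrite mem_filter mem_index_iota/= andb_idr//; exact: JN.
Qed.

End coin_measure.

Section product_measure.
Context {R : realType}.
Local Notation D := (prod_space nat bool).
Local Notation U := (uniform_prob (@ltr01 R)).
Local Notation coin := (@coin R).
Local Notation h n := ((2^-1 : R) ^+ n).

Let binsum (x : D) (n : nat) : R := \sum_(i < n) (x i)%:R * h i.+1.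

Definition binval (x : D) : R := limn (binsum x).

Let binsum_cvg x : binsum x @ \oo --> binval x.
Proof.
apply: nondecreasing_is_cvgn.
  apply/nondecreasing_seqP => n; rewrite /binsum big_ord_recr/= lerDl.
  by rewrite mulr_ge0// exprn_ge0.
have hS n : \sum_(i < n) h i.+1 = 1 - h n.
  elim: n => [|n IH]; first by rewrite big_ord0 expr0 subrr.
  by rewrite big_ord_recr/= IH exprS; lra.
exists 1 => _ [n _ <-]; apply: (@le_trans _ _ (1 - h n)).
  rewrite -hS; apply: ler_sum => i _; rewrite ler_piMl ?exprn_ge0//.
  by case: (x i).
by rewrite lerBlDr lerDl exprn_ge0.
Qed.

Lemma measurable_binval : measurable_fun setT binval.
Proof.
apply: (@measurable_fun_cvg _ _ _ setT (fun n x => binsum x n)) => [n|x _]; last first.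
  exact: binsum_cvg.
apply: measurable_sum => i.
have mx : measurable_fun setT (fun x : D => (x i)%:R : R).
  have -> : (fun x : D => (x i)%:R : R) = (fun x : D => if x i then 1 else 0).
    by apply/funext => x; case: (x i).
  apply: measurable_fun_ifT; [|exact: measurable_cst..].
  exact: (measurable_coord (T := bool)).
exact: measurable_funM mx (measurable_cst _).
Qed.

Lemma coin_binval (A : set (measurableTypeR R)) : measurable A ->
  coin (binval @^-1` A) = U A.
Proof.
move=> mA; transitivity (U (digits @^-1` (binval @^-1` A))); first by [].
have mb : measurable (binval @^-1` A).
  by rewrite -[X in measurable X]setTI; exact: measurable_binval.
rewrite !uniform01E//; last first.
  by rewrite -[X in measurable X]setTI; exact: measurable_digits.
congr (lebesgue_measure _).
have vd t : 0 <= t < 1 -> binval (digits t) = t.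
  move=> t01; apply/cvg_lim => //.
  have -> : binsum (digits t) = bsum^~ t by apply/funext => n; rewrite bsumE.
  exact: bsum_cvg.
by apply/seteqP; split=> t /=; rewrite in_itv/= => -[+ t01]; rewrite vd.
Qed.

Theorem product_measure_exists (I : countType) d (T : measurableType d)
    (X : {mfun measurableTypeR R >-> T}) :
  exists m : probability (prod_space I T) R,
    is_product_measure (distribution U X) m.
Proof.
pose f (x : D) : prod_space I T := fun i => X (binval (coin_row (choice.pickle i) x)).
have mf : measurable_fun setT f.
  apply: measurable_to_prod => i; apply: measurableT_comp (measurable_funPT X) _.
  exact: measurableT_comp measurable_binval (measurable_row _).
exists (distribution coin (mfun_Sub (mem_set mf))) => J A mA.
pose B k := if (pickle_inv k : option I) is Some i then
  binval @^-1` (X @^-1` A i) else setT.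
have mXA i : measurable (X @^-1` A i).
  exact: measurable_funPTI.
have mB k : measurable (B k).
  rewrite /B; case: pickle_inv => // i.
  by rewrite -[Y in measurable Y]setTI; apply: measurable_binval => //; exact: mXA.
transitivity (coin [set x | forall k, k \in [fset choice.pickle i | i in J]%fset ->
    B k (coin_row k x)]).
  congr (coin _); apply/seteqP; split=> x /= H.
    by move=> _ /imfsetP[i /= iJ ->]; rewrite /B pickleK_inv; exact: H.
  move=> i iJ; have := H (choice.pickle i); rewrite /B pickleK_inv; apply.
  by apply/imfsetP; exists i.
rewrite coin_rows// big_imfset/=; last by move=> i j _ _; exact: (pcan_inj pickleK_inv).
apply: eq_bigr => i _; rewrite /B pickleK_inv.
exact: coin_binval.
Qed.

Definition product_measure (I : countType) d (T : measurableType d)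
    (X : {mfun measurableTypeR R >-> T}) : probability (prod_space I T) R :=
  sval (cid (product_measure_exists I X)).

Lemma product_measureP (I : countType) d (T : measurableType d)
    (X : {mfun measurableTypeR R >-> T}) :
  is_product_measure (distribution U X) (product_measure I X).
Proof. exact: (svalP (cid (product_measure_exists I X))). Qed.

End product_measure.

Section torus.
Context {R : realType}.

Definition unit_circle := {z : R[i] | `|z| == 1}.

Let unit_circle1 : unit_circle.
Proof. by exists 1; rewrite normr1. Defined.

HB.instance Definition _ := Choice.on unit_circle.
HB.instance Definition _ := isPointed.Build unit_circle unit_circle1.

Definition circle_coords (w : unit_circle) : R * R :=
  (complex.Re (val w), complex.Im (val w)).

(* The sigma-algebra is generated by the coordinates, i.e., it consists of the
   traces on the circle of the Borel sets of the plane. *)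
Definition circle := g_sigma_algebra_preimageType circle_coords.

Definition circle_val (w : circle) : R[i] := val (w : unit_circle).

Definition circle_exp (t : measurableTypeR R) : circle.
Proof.
exists (cos (2 * pi * t) +i* sin (2 * pi * t)).
by rewrite cabsE /= cos2Dsin2 sqrtr1.
Defined.

Lemma measurable_circle_exp : measurable_fun setT circle_exp.
Proof.
have mpi : measurable_fun setT (fun t : R => 2 * pi * t).
  by apply: measurable_funM; [exact: measurable_cst|exact: measurable_id].
move=> _ _ [B mB <-]; rewrite setTI setTI.
rewrite -[X in measurable X]setTI.
have /= mc : measurable_fun setT
    (fun t : R => (cos (2 * pi * t), sin (2 * pi * t))).
  apply: measurable_fun_pair.
    apply: measurableT_comp mpi; apply: continuous_measurable_fun.
    exact: continuous_cos.
  apply: measurableT_comp mpi; apply: continuous_measurable_fun.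
  exact: continuous_sin.
exact: mc.
Qed.

HB.instance Definition _ :=
  isMeasurableFun.Build _ _ _ _ circle_exp measurable_circle_exp.

Definition circle_measure : probability circle R :=
  distribution (uniform_prob (@ltr01 R)) circle_exp.

Definition torus (I : Type) := prod_space I circle.

Definition torus_measure (I : countType) : probability (torus I) R :=
  product_measure I circle_exp.

Lemma torus_measureP (I : countType) :
  is_product_measure circle_measure (torus_measure I).
Proof. exact: product_measureP. Qed.

End torus.
Arguments circle : clear implicits.
Arguments torus : clear implicits.
Arguments torus_measure : clear implicits.

Notation midx := {fsfun nat -> nat with 0%N}.
Notation zmidx := {fsfun nat -> int with 0}.

Definition zmidx_of (alpha : midx) : zmidx :=
  [fsfun j in finsupp alpha => (alpha j)%:Z | 0].

Section unordered_sum.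
Context {I : choiceType}.

(* unordered_sum is the limit of the finite partial sums along the directed set
   of finite subsets of I; for complex families its existence is equivalent to
   absolute summability. *)
Definition fset_filter : set_system {fset I} :=
  [set P | exists A, forall B, (A `<=` B)%fset -> P B].

#[global] Instance fset_filter_filter : ProperFilter fset_filter.
Proof.
split; first by move=> [A /(_ A (fsubset_refl A))].
split; first by exists fset0.
- move=> P Q [A PA] [B QB]; exists (A `|` B)%fset => C; rewrite fsubUset.
  by move=> /andP[/PA ? /QB].
- by move=> P Q PQ [A PA]; exists A => B /PA /PQ.
Qed.

Definition fset_sum {R : realType} (a : I -> R[i]) (A : {fset I}) : R[i]^o :=
  \sum_(i <- A) a i.

Definition unordered_summable {R : realType} (a : I -> R[i]) : Prop :=
  cvg (fset_sum a @ fset_filter).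

Definition unordered_sum {R : realType} (a : I -> R[i]) : R[i] :=
  lim (fset_sum a @ fset_filter).

End unordered_sum.

Definition cintegral {R : realType} {d} {T : measurableType d}
    (mu : {measure set T -> \bar R}) (f : T -> R[i]) : R[i] :=
  (\int[mu]_x complex.Re (f x)) +i* (\int[mu]_x complex.Im (f x)).

(* Elements of L_p are represented by functions rather than by their classes
   modulo almost-everywhere equality. *)
Section hardy_torus.
Context {R : realType}.
Implicit Types (p : R) (f : torus R nat -> R[i]).

Definition fourier_coef f (alpha : zmidx) : R[i] :=
  cintegral (torus_measure R nat)
    (fun w => f w * \prod_(j <- finsupp alpha) circle_val (w j) ^ (- alpha j)).

Definition Lp_norm p f : \bar R :=
  'N[torus_measure R nat]_p%:E[EFin \o (fun w => cabs (f w))]%E.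

Definition Lp p : set (torus R nat -> R[i]) :=
  [set f | [/\ measurable_fun setT (fun w => complex.Re (f w)),
               measurable_fun setT (fun w => complex.Im (f w)) &
               (Lp_norm p f < +oo)%E]].

Definition Hp_torus p : set (torus R nat -> R[i]) :=
  [set f | Lp p f /\ forall alpha : zmidx,
     ~ (forall j, 0 <= alpha j) -> fourier_coef f alpha = 0].

End hardy_torus.

(* Functions on polydisc2 are represented by total functions on ell2, of which
   only the restriction to polydisc2 is relevant: none of the predicates and
   norms below depends on the other values. *)
Section hardy_ball.
Context {R : realType}.
Implicit Types (p : R) (g : ell2 R -> R[i]).

Definition polydisc2 : set (ell2 R) :=
  [set z | (ereal_sup (range (fun n => (cabs (z n))%:E)) < 1)%E].

Definition holomorphic g : Prop :=
  forall z, polydisc2 z -> differentiable (g : ell2 R -> R[i]^o) z.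

Definition torus_point_seq n (r : R) (w : torus R 'I_n) (j : nat) : R[i] :=
  if (insub j : option 'I_n) is Some i then r%:C * circle_val (w i) else 0.

Lemma torus_point_subproof n r (w : torus R 'I_n) :
  (l2norm (torus_point_seq r w) < +oo)%E.
Proof.
rewrite l2normE; apply: poweR_lty.
rewrite (nneseries_split 0 n) => [|k _]; last first.
  by rewrite lee_fin exprn_ge0 ?cabs_ge0.
rewrite add0n eseries0 ?adde0 ?sumEFin ?ltry// => k nk _.
rewrite /torus_point_seq insubN -?leqNgt//.
by rewrite ComplexField.Normc.normc0 expr0n.
Qed.

Definition torus_point n r (w : torus R 'I_n) : ell2 R :=
  Ell2 (torus_point_subproof r w).

Definition Hp_norm p g : \bar R :=
  ereal_sup [set N | exists (n : nat) (r : R), [/\ (0 < n)%N, 0 < r < 1 &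
    N = 'N[torus_measure R 'I_n]_p%:E[
          EFin \o (fun w => cabs (g (torus_point r w)))]%E]].

Definition Hp_ball p : set (ell2 R -> R[i]) :=
  [set g | holomorphic g /\ (Hp_norm p g < +oo)%E].

Definition monomial (alpha : midx) (z : ell2 R) : R[i] :=
  \prod_(j <- finsupp alpha) z j ^+ alpha j.

Definition monomial_span : set (ell2 R -> R[i]) :=
  [set h | exists (s : seq midx) (c : midx -> R[i]),
     h = fun z => \sum_(alpha <- s) c alpha * monomial alpha z].

Definition Hp_closure p (S : set (ell2 R -> R[i])) : set (ell2 R -> R[i]) :=
  [set g | Hp_ball p g /\ forall e : R, 0 < e ->
     exists2 h, S h & (Hp_norm p (fun z => g z - h z)%R < e%:E)%E].

Definition hardy_term (f : torus R nat -> R[i]) (z : ell2 R) (alpha : midx)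
  : R[i] := fourier_coef f (zmidx_of alpha) * monomial alpha z.

Definition phi (f : torus R nat -> R[i]) (z : ell2 R) : R[i] :=
  unordered_sum (hardy_term f z).

End hardy_ball.

(* Main.v *)
Require Import Defs.
From HB Require Import structures.
From mathcomp Require Import all_boot all_order all_algebra.
From mathcomp Require Import finmap.
From mathcomp Require Import complex.
From mathcomp Require Import all_classical all_reals all_analysis.
From mathcomp Require Import measurable_realfun zify lra ring.
Set Implicit Arguments.
Unset Strict Implicit.
Unset Printing Implicit Defensive.
Import Order.TTheory GRing.Theory Num.Theory.
Import numFieldNormedType.Exports.
Import HBSimple.
Local Open Scope classical_set_scope.
Local Open Scope complex_scope.
Local Open Scope ring_scope.

(* For f in H_1 of the torus, testing the sections of an analytic polynomial
   against suitable multipliers of modulus close to 1 shows that the sum of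
   |c_alpha| rho^alpha is at most prod_j (1 + 2 (rho_j / (1 - rho_j))^2) times
   the L_1 norm of f, c_alpha being the Fourier coefficients. The product
   converges for square-summable rho, so the power series of f converges
   absolutely on the polydisc of ell_2 and is holomorphic there. On the torus of
   radius r in n variables phi f is the Poisson integral of f; Poisson integrals
   contract the L_p norm (Jensen) and converge to f in L_1 as r -> 1 and
   n -> oo, hence the isometry.
   Conversely, the Fourier coefficients of the slice of a holomorphic g on the
   torus of radius r scale as r^alpha (Goursat's lemma in polar coordinates), so
   each slice of g is a Poisson integral of the larger ones. When they are bounded in
   L_p for some p > 1, they are uniformly integrable, and the integrals of
   sqrt (1 + |x|^2), which increase along the slices, have a finite supremum; by
   strict convexity the slices are then Cauchy in L_1. Their limit f satisfies
   phi f = g. For p = 1, Poisson integrals with truncated kernels approximate f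
   by polynomials, and conversely the isometry turns approximating polynomials
   into a Cauchy sequence in L_1. *)

(** * Complex-valued integrable functions *)

(** The bound |c_alpha| <= |f|_1 by itself would make the power series converge only at summable
    points. Square-summable points are reached because the constant coefficient and a higher one can
    be bounded together, |a_0| + x |a_n| <= sqrt (1 + 4 x^2) |F|_1, so that each variable costs a
    factor 1 + O(rho^2) instead of 1 + O(rho). H_p lies in H_1, the measure being finite; hence
    holomorphy and all statements on coefficients are proved once, for p = 1, and the exponent
    enters only through integrals of |f|^p. Surjectivity is obtained without weak compactness. A
    function of linear growth is integrable along with every L_1 function, and Jensen's inequality
    makes its integrals monotone along slices; an L_p bound with p > 1 controls the set where the
    slices are large, and on the rest nearly equal integrals force small L_1 distances. Uniqueness
    of holomorphic functions on the polydisc needs no Taylor series: it is checked at finitely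
    supported points, where a continuous slice is the limit of its Poisson integrals. *)

Section complex_modulus.
Context {R : realType}.
Implicit Types (x y z : R[i]).

Lemma cabs0 : cabs (0 : R[i]) = 0.
Proof. exact: ComplexField.Normc.normc0. Qed.

Lemma cabs1 : cabs (1 : R[i]) = 1.
Proof. exact: ComplexField.Normc.normc1. Qed.

Lemma cabsM x y : cabs (x * y) = cabs x * cabs y.
Proof. exact: ComplexField.Normc.normcM. Qed.

Lemma cabsV x : cabs x^-1 = (cabs x)^-1.
Proof. exact: ComplexField.Normc.normcV. Qed.

Lemma cabsD x y : cabs (x + y) <= cabs x + cabs y.
Proof. exact: le_normcD. Qed.

Lemma cabsN x : cabs (- x) = cabs x.
Proof. by rewrite -mulN1r cabsM /= oppr0 expr0n/= addr0 sqrrN expr1n sqrtr1 mul1r. Qed.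

Lemma cabsB x y : cabs (x - y) <= cabs x + cabs y.
Proof. by rewrite -(cabsN y); exact: cabsD. Qed.

Lemma cabs_distC x y : cabs (x - y) = cabs (y - x).
Proof. by rewrite -cabsN opprB. Qed.

Lemma cabs_real (t : R) : cabs t%:C = `|t|.
Proof. by rewrite /= expr0n/= addr0 sqrtr_sqr. Qed.

Lemma cabsX x n : cabs (x ^+ n) = cabs x ^+ n.
Proof. by elim: n => [|n IH]; rewrite ?expr0 ?cabs1// !exprS cabsM IH. Qed.

Lemma cabsXz x (n : int) : cabs (x ^ n) = cabs x ^ n.
Proof. by case: n => n; rewrite ?NegzE -?exprnP -?exprnN ?cabsV cabsX. Qed.

Lemma cabs_eq0 x : (cabs x == 0) = (x == 0).
Proof.
apply/eqP/eqP => [|->]; last exact: cabs0.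
exact: ComplexField.Normc.eq0_normc.
Qed.

Lemma cabs_gt0 x : (0 < cabs x) = (x != 0).
Proof. by rewrite lt_def cabs_eq0 cabs_ge0 andbT. Qed.

Lemma cabs_sum (I : Type) (s : seq I) (P : pred I) (F : I -> R[i]) :
  cabs (\sum_(i <- s | P i) F i) <= \sum_(i <- s | P i) cabs (F i).
Proof.
elim/big_rec2: _ => [|i y1 y2 _ h]; first by rewrite cabs0.
by apply: (le_trans (cabsD _ _)); rewrite lerD2l.
Qed.

Lemma cabs_prod (I : Type) (s : seq I) (P : pred I) (F : I -> R[i]) :
  cabs (\prod_(i <- s | P i) F i) = \prod_(i <- s | P i) cabs (F i).
Proof. by elim/big_rec2: _ => [|i y1 y2 _ <-]; rewrite ?cabs1 ?cabsM. Qed.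

Lemma cabs_sqr x : cabs x ^+ 2 = complex.Re x ^+ 2 + complex.Im x ^+ 2.
Proof. by case: x => a b /=; rewrite sqr_sqrtr// addr_ge0// sqr_ge0. Qed.

Lemma Re_le_cabs x : `|complex.Re x| <= cabs x.
Proof.
rewrite -ler_sqr ?nnegrE ?cabs_ge0// cabs_sqr -normrX ger0_norm ?sqr_ge0//.
by rewrite lerDl sqr_ge0.
Qed.

Lemma Im_le_cabs x : `|complex.Im x| <= cabs x.
Proof.
rewrite -ler_sqr ?nnegrE ?cabs_ge0// cabs_sqr -normrX ger0_norm ?sqr_ge0//.
by rewrite lerDr sqr_ge0.
Qed.

Lemma cabs_le_ReIm x : cabs x <= `|complex.Re x| + `|complex.Im x|.
Proof.
rewrite -ler_sqr ?nnegrE ?cabs_ge0 ?addr_ge0// cabs_sqr.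
rewrite -(real_normK (num_real (complex.Re x))) -(real_normK (num_real (complex.Im x))).
by rewrite sqrrD -addrA lerD2l lerDr mulrn_wge0// mulr_ge0.
Qed.

Lemma cabsJ x : cabs x^*%C = cabs x.
Proof. by case: x => a b /=; rewrite sqrrN. Qed.

Lemma mulJc x : x * x^*%C = (cabs x ^+ 2)%:C.
Proof.
rewrite cabs_sqr; case: x => a b; apply/eqP; rewrite eq_complex /=; apply/andP.
by split; apply/eqP; ring.
Qed.

Lemma cReD x y : complex.Re (x + y) = complex.Re x + complex.Re y.
Proof. by case: x; case: y. Qed.

Lemma cImD x y : complex.Im (x + y) = complex.Im x + complex.Im y.
Proof. by case: x; case: y. Qed.

Lemma cReN x : complex.Re (- x) = - complex.Re x.
Proof. by case: x. Qed.

Lemma cImN x : complex.Im (- x) = - complex.Im x.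
Proof. by case: x. Qed.

Lemma cReM x y : complex.Re (x * y) =
  complex.Re x * complex.Re y - complex.Im x * complex.Im y.
Proof. by case: x; case: y. Qed.

Lemma cImM x y : complex.Im (x * y) =
  complex.Re x * complex.Im y + complex.Im x * complex.Re y.
Proof. by case: x; case: y. Qed.

Lemma complex_eqE x y : complex.Re x = complex.Re y ->
  complex.Im x = complex.Im y -> x = y.
Proof. by case: x => a b; case: y => c d /= -> ->. Qed.

Lemma complex_ReIm (a b : R) : a +i* b = a%:C + 'i * b%:C.
Proof. by apply: complex_eqE => /=; ring. Qed.

Lemma cabs_dist_dist x y : `|cabs x - cabs y| <= cabs (x - y).
Proof.
rewrite ler_norml; apply/andP; split.
  rewrite lerNl opprB lerBlDr cabs_distC; have := cabsD (y - x) x.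
  by rewrite subrK.
by rewrite lerBlDr; have := cabsD (x - y) y; rewrite subrK.
Qed.

Lemma RtoCD (a b : R) : (a + b)%:C = a%:C + b%:C. Proof. exact: rmorphD. Qed.

Lemma RtoCM (a b : R) : (a * b)%:C = a%:C * b%:C. Proof. exact: rmorphM. Qed.

(** The value 1 at 0 keeps the modulus equal to 1 everywhere, so that [phaseE] and [phaseJ] hold
    without exceptions. *)
Definition phase x : R[i] := if x == 0 then 1 else x / (cabs x)%:C.

Lemma cabs_phase x : cabs (phase x) = 1.
Proof.
rewrite /phase; case: eqVneq => [_|x0]; first exact: cabs1.
by rewrite cabsM cabsV cabs_real ger0_norm ?cabs_ge0// divff// cabs_eq0.
Qed.

Lemma phaseE x : x = (cabs x)%:C * phase x.
Proof.
rewrite /phase; case: eqVneq => [->|x0]; first by rewrite cabs0 mul0r.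
by rewrite mulrCA divff ?mulr1//; apply/eqP => -[]; apply/eqP; rewrite cabs_eq0.
Qed.

Lemma phaseJ x : phase x * (phase x)^*%C = 1.
Proof. by rewrite mulJc cabs_phase expr1n. Qed.

Lemma sum_Re (I : Type) (s : seq I) (P : pred I) (F : I -> R[i]) :
  complex.Re (\sum_(i <- s | P i) F i) = \sum_(i <- s | P i) complex.Re (F i).
Proof. by elim/big_rec2: _ => [//|i y1 y2 _ <-]; rewrite cReD. Qed.

End complex_modulus.

(** The norm of [R[i]] is itself complex; distances are measured here by the real [cabs], in which
    the bounds of the proof are stated. *)
Definition ccvg {R : realType} (u : nat -> R[i]) (l : R[i]) :=
  (fun n => cabs (u n - l)) @ \oo --> (0 : R).

Section ccvg_theory.
Context {R : realType}.
Implicit Types (u v : nat -> R[i]) (l k : R[i]).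

Lemma ccvgP u l : ccvg u l <-> forall e : R, 0 < e ->
  \forall n \near \oo, cabs (u n - l) < e.
Proof.
split.
  move=> /cvgrPdist_lt h e e0; have := h e e0; apply: filterS => n.
  by rewrite sub0r normrN ger0_norm ?cabs_ge0.
move=> h; apply/cvgrPdist_lt => e e0; have := h e e0; apply: filterS => n.
by rewrite sub0r normrN ger0_norm ?cabs_ge0.
Qed.

Lemma ccvg_cst l : ccvg (fun=> l) l.
Proof. by rewrite /ccvg subrr cabs0; exact: cvg_cst. Qed.

Lemma ccvg_dom u l (e : nat -> R) : (\forall n \near \oo, cabs (u n - l) <= e n) ->
  e @ \oo --> (0 : R) -> ccvg u l.
Proof.
move=> ue e0; apply: squeeze_cvgr e0; last exact: (cvg_cst (0 : R)).
by apply: filterS ue => n ->; rewrite cabs_ge0.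
Qed.

Lemma ccvgD u v l k : ccvg u l -> ccvg v k -> ccvg (fun n => u n + v n) (l + k).
Proof.
move=> ul vk; apply: (@ccvg_dom _ _ (fun n => cabs (u n - l) + cabs (v n - k))).
  by near=> n; rewrite opprD addrACA; exact: cabsD.
by rewrite -[0]addr0; exact: cvgD.
Unshelve. all: by end_near. Qed.

Lemma ccvgZ u l a : ccvg u l -> ccvg (fun n => a * u n) (a * l).
Proof.
move=> ul; apply: (@ccvg_dom _ _ (fun n => cabs a * cabs (u n - l))).
  by near=> n; rewrite -mulrBr cabsM.
by rewrite -(mulr0 (cabs a)); apply: cvgM => //; exact: cvg_cst.
Unshelve. all: by end_near. Qed.

Lemma ccvgN u l : ccvg u l -> ccvg (fun n => - u n) (- l).
Proof.
by move=> /(ccvgZ (-1)); rewrite mulN1r; under eq_fun do rewrite mulN1r.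
Qed.

Lemma ccvgB u v l k : ccvg u l -> ccvg v k -> ccvg (fun n => u n - v n) (l - k).
Proof. by move=> ul vk; apply: ccvgD => //; exact: ccvgN. Qed.

Lemma ccvg_cabs u l : ccvg u l -> (fun n => cabs (u n)) @ \oo --> cabs l.
Proof.
move=> /ccvgP ul; apply/cvgrPdist_lt => e e0; have := ul e e0.
apply: filterS => n; apply: le_lt_trans; rewrite distrC.
exact: cabs_dist_dist.
Qed.

Lemma ccvg_Re u l : ccvg u l -> (fun n => complex.Re (u n)) @ \oo --> complex.Re l.
Proof.
move=> /ccvgP ul; apply/cvgrPdist_lt => e e0; have := ul e e0.
apply: filterS => n; apply: le_lt_trans; rewrite distrC -cReN -cReD.
exact: Re_le_cabs.
Qed.

Lemma ccvg_Im u l : ccvg u l -> (fun n => complex.Im (u n)) @ \oo --> complex.Im l.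
Proof.
move=> /ccvgP ul; apply/cvgrPdist_lt => e e0; have := ul e e0.
apply: filterS => n; apply: le_lt_trans; rewrite distrC -cImN -cImD.
exact: Im_le_cabs.
Qed.

Lemma ccvg_ReIm u l : (fun n => complex.Re (u n)) @ \oo --> complex.Re l ->
  (fun n => complex.Im (u n)) @ \oo --> complex.Im l -> ccvg u l.
Proof.
move=> hr hi.
apply: (@ccvg_dom _ _ (fun n => `|complex.Re (u n) - complex.Re l| +
   `|complex.Im (u n) - complex.Im l|)).
  by near=> n; rewrite -cReN -cReD -cImN -cImD; exact: cabs_le_ReIm.
rewrite -[X in _ --> X]addr0; apply: cvgD.
  rewrite -[X in _ --> X](@normr0 _ R); apply: cvg_norm.
  by rewrite -[X in _ --> X](subrr (complex.Re l)); apply: cvgB => //; exact: cvg_cst.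
rewrite -[X in _ --> X](@normr0 _ R); apply: cvg_norm.
by rewrite -[X in _ --> X](subrr (complex.Im l)); apply: cvgB => //; exact: cvg_cst.
Unshelve. all: by end_near. Qed.

Lemma ccvg_unique u l k : ccvg u l -> ccvg u k -> l = k.
Proof.
move=> ul uk; apply: complex_eqE.
  exact: (cvg_unique _ (ccvg_Re ul) (ccvg_Re uk)).
exact: (cvg_unique _ (ccvg_Im ul) (ccvg_Im uk)).
Qed.

Lemma ccvgM u v l k : ccvg u l -> ccvg v k -> ccvg (fun n => u n * v n) (l * k).
Proof.
move=> ul vk; apply: ccvg_ReIm.
  under eq_fun do rewrite cReM.
  by rewrite cReM; apply: cvgB; apply: cvgM; (exact: ccvg_Re || exact: ccvg_Im).
under eq_fun do rewrite cImM.
by rewrite cImM; apply: cvgD; apply: cvgM; (exact: ccvg_Re || exact: ccvg_Im).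
Qed.

Lemma ccvgX u l n : ccvg u l -> ccvg (fun i => u i ^+ n) (l ^+ n).
Proof.
move=> ul; elim: n => [|n IH]; first by under eq_fun do rewrite expr0; rewrite expr0; exact: ccvg_cst.
by rewrite exprS; under eq_fun do rewrite exprS; exact: ccvgM.
Qed.

Lemma ccvg_sum (I : Type) (s : seq I) (P : pred I) (u : I -> nat -> R[i]) (l : I -> R[i]) :
  (forall i, P i -> ccvg (u i) (l i)) ->
  ccvg (fun n => \sum_(i <- s | P i) u i n) (\sum_(i <- s | P i) l i).
Proof.
move=> ul; elim: s => [|i s IH].
  by rewrite big_nil; under eq_fun do rewrite big_nil; exact: ccvg_cst.
rewrite big_cons; under eq_fun do rewrite big_cons.
by case: ifPn => // Pi; apply: ccvgD => //; exact: ul.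
Qed.

Lemma ccvg_prod (I : Type) (s : seq I) (P : pred I) (u : I -> nat -> R[i]) (l : I -> R[i]) :
  (forall i, P i -> ccvg (u i) (l i)) ->
  ccvg (fun n => \prod_(i <- s | P i) u i n) (\prod_(i <- s | P i) l i).
Proof.
move=> ul; elim: s => [|i s IH].
  by rewrite big_nil; under eq_fun do rewrite big_nil; exact: ccvg_cst.
rewrite big_cons; under eq_fun do rewrite big_cons.
by case: ifPn => // Pi; apply: ccvgM => //; exact: ul.
Qed.

Lemma ccvg_bound u l (B : R) : (\forall n \near \oo, cabs (u n) <= B) -> ccvg u l ->
  cabs l <= B.
Proof.
move=> uB /ccvg_cabs ul.
rewrite -(cvg_lim _ ul)//; apply: limr_le => //.
by apply/cvg_ex; eexists; exact: ul.
Qed.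

End ccvg_theory.

Arguments ComplexField.Normc.normc : simpl never.

Section complex_measurable.
Context {R : realType} {d} {T : measurableType d}.
Implicit Types f g : T -> R[i].

Definition cmeas f := measurable_fun setT (fun x => complex.Re (f x)) /\
  measurable_fun setT (fun x => complex.Im (f x)).

Lemma cmeas_cst c : cmeas (fun=> c).
Proof. by split; exact: measurable_cst. Qed.

Lemma cmeasD f g : cmeas f -> cmeas g -> cmeas (fun x => f x + g x).
Proof.
move=> [f1 f2] [g1 g2]; split.
  by under eq_fun do rewrite cReD; exact: measurable_funD.
by under eq_fun do rewrite cImD; exact: measurable_funD.
Qed.

Lemma cmeasM f g : cmeas f -> cmeas g -> cmeas (fun x => f x * g x).
Proof.
move=> [f1 f2] [g1 g2]; split.
  by under eq_fun do rewrite cReM; apply: measurable_funB; exact: measurable_funM.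
by under eq_fun do rewrite cImM; apply: measurable_funD; exact: measurable_funM.
Qed.

Lemma cmeasZ c f : cmeas f -> cmeas (fun x => c * f x).
Proof. by apply: cmeasM; exact: cmeas_cst. Qed.

Lemma cmeasN f : cmeas f -> cmeas (fun x => - f x).
Proof. by move=> /(cmeasZ (-1)); under eq_fun do rewrite mulN1r. Qed.

Lemma cmeasB f g : cmeas f -> cmeas g -> cmeas (fun x => f x - g x).
Proof. by move=> mf mg; apply: cmeasD => //; exact: cmeasN. Qed.

Lemma cmeasJ f : cmeas f -> cmeas (fun x => (f x)^*%C).
Proof.
move=> [f1 f2]; split.
  by rewrite (_ : (fun x => _) = (fun x => complex.Re (f x)))//; apply/funext => x; case: (f x).
rewrite (_ : (fun x => _) = (fun x => - complex.Im (f x))); first exact: measurableT_comp.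
by apply/funext => x; case: (f x).
Qed.

Lemma cmeas_sum (I : Type) (s : seq I) (P : pred I) (F : I -> T -> R[i]) :
  (forall i, cmeas (F i)) -> cmeas (fun x => \sum_(i <- s | P i) F i x).
Proof.
move=> mF; elim: s => [|i s IH].
  by under eq_fun do rewrite big_nil; exact: cmeas_cst.
under eq_fun do rewrite big_cons.
by case: (P i) => //; exact: cmeasD.
Qed.

Lemma cmeas_prod (I : Type) (s : seq I) (P : pred I) (F : I -> T -> R[i]) :
  (forall i, cmeas (F i)) -> cmeas (fun x => \prod_(i <- s | P i) F i x).
Proof.
move=> mF; elim: s => [|i s IH].
  by under eq_fun do rewrite big_nil; exact: cmeas_cst.
under eq_fun do rewrite big_cons.
by case: (P i) => //; exact: cmeasM.
Qed.

Lemma cmeasX f n : cmeas f -> cmeas (fun x => f x ^+ n).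
Proof.
move=> mf; elim: n => [|n IH]; first by under eq_fun do rewrite expr0; exact: cmeas_cst.
by under eq_fun do rewrite exprS; exact: cmeasM.
Qed.

Lemma cmeas_real (h : T -> R) : measurable_fun setT h -> cmeas (fun x => (h x)%:C).
Proof. by move=> mh; split => //=; exact: measurable_cst. Qed.

Lemma cmeas_cabs f : cmeas f -> measurable_fun setT (fun x => cabs (f x)).
Proof.
move=> [f1 f2].
rewrite (_ : (fun x => _) = Num.sqrt \o
  (fun x => complex.Re (f x) ^+ 2 + complex.Im (f x) ^+ 2)); last first.
  by apply/funext => x /=; case: (f x).
apply: measurableT_comp; last by apply: measurable_funD; exact: measurable_funX.
by apply: continuous_measurable_fun; exact: sqrt_continuous.
Qed.

Lemma cmeas_cabsE f : cmeas f -> measurable_fun setT (fun x => (cabs (f x))%:E).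
Proof. by move=> /cmeas_cabs mf; exact/measurable_EFinP. Qed.

Lemma cmeas_lim (F : nat -> T -> R[i]) f : (forall n, cmeas (F n)) ->
  (forall x, ccvg (F^~ x) (f x)) -> cmeas f.
Proof.
move=> mF Ff; split.
  apply: (@measurable_fun_cvg _ _ _ setT (fun n x => complex.Re (F n x))) => [n|x _].
    by case: (mF n).
  exact: ccvg_Re.
apply: (@measurable_fun_cvg _ _ _ setT (fun n x => complex.Im (F n x))) => [n|x _].
  by case: (mF n).
exact: ccvg_Im.
Qed.

End complex_measurable.

Lemma cmeas_comp {R : realType} {d d'} {T : measurableType d} {U : measurableType d'}
  (f : U -> R[i]) (h : T -> U) : cmeas f -> measurable_fun setT h -> cmeas (f \o h).
Proof.
by move=> [f1 f2] mh; split;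
  [exact: (measurableT_comp f1 mh)|exact: (measurableT_comp f2 mh)].
Qed.

Lemma cmeas_pair1 {R : realType} {d d'} {T : measurableType d} {U : measurableType d'}
  (F : T * U -> R[i]) x : cmeas F -> cmeas (fun y => F (x, y)).
Proof. by move=> mF; apply: (cmeas_comp mF); exact: measurable_pair1. Qed.

Lemma cmeas_pair2 {R : realType} {d d'} {T : measurableType d} {U : measurableType d'}
  (F : T * U -> R[i]) y : cmeas F -> cmeas (fun x => F (x, y)).
Proof. by move=> mF; apply: (cmeas_comp mF); exact: measurable_pair2. Qed.

Lemma eq_cmeas {R : realType} {d} {T : measurableType d} (f g : T -> R[i]) :
  f =1 g -> cmeas g -> cmeas f.
Proof. by move=> /funext ->. Qed.

Section complex_integral.
Context {R : realType} {d} {T : measurableType d}.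
Variable mu : {measure set T -> \bar R}.
Implicit Types f g : T -> R[i].

Definition cintb f := cmeas f /\ (\int[mu]_x (cabs (f x))%:E < +oo)%E.

Lemma eq_cintb f g : f =1 g -> cintb g -> cintb f.
Proof. by move=> /funext ->. Qed.

Lemma cintb_cabs f : cintb f -> mu.-integrable setT (fun x => (cabs (f x))%:E).
Proof.
move=> [mf foo]; apply/integrableP; split; first exact: cmeas_cabsE.
by under eq_integral do rewrite gee0_abs ?lee_fin ?cabs_ge0//.
Qed.

Lemma cintb_dom f (h : T -> R) : cmeas f -> mu.-integrable setT (EFin \o h) ->
  (forall x, cabs (f x) <= h x) -> cintb f.
Proof.
move=> mf ih fh; split=> //; have /integrableP[_] := ih; apply: le_lt_trans.
apply: ge0_le_integral => //.
- by move=> x _; rewrite lee_fin cabs_ge0.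
- exact: cmeas_cabsE.
- by apply: measurableT_comp => //; case/integrableP: ih.
- by move=> x _ /=; rewrite lee_fin (le_trans (fh x))// ler_norm.
Qed.

Lemma cintb_Re f : cintb f -> mu.-integrable setT (EFin \o (fun x => complex.Re (f x))).
Proof.
move=> fi; have [[f1 f2] _] := fi.
apply: le_integrable (cintb_cabs fi) => //; first exact/measurable_EFinP.
by move=> x _ /=; rewrite lee_fin [X in _ <= X]ger0_norm ?cabs_ge0// Re_le_cabs.
Qed.

Lemma cintb_Im f : cintb f -> mu.-integrable setT (EFin \o (fun x => complex.Im (f x))).
Proof.
move=> fi; have [[f1 f2] _] := fi.
apply: le_integrable (cintb_cabs fi) => //; first exact/measurable_EFinP.
by move=> x _ /=; rewrite lee_fin [X in _ <= X]ger0_norm ?cabs_ge0// Im_le_cabs.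
Qed.

Lemma cintbD f g : cintb f -> cintb g -> cintb (fun x => f x + g x).
Proof.
move=> fi gi; have [mf _] := fi; have [mg _] := gi.
apply: (@cintb_dom _ (fun x => cabs (f x) + cabs (g x))) => [||x].
- exact: cmeasD.
- exact: (integrableD _ (cintb_cabs fi) (cintb_cabs gi)).
- exact: cabsD.
Qed.

Lemma cintbZ c f : cintb f -> cintb (fun x => c * f x).
Proof.
move=> fi; have [mf _] := fi.
apply: (@cintb_dom _ (fun x => cabs c * cabs (f x))) => [||x].
- exact: cmeasZ.
- exact: (integrableZl _ _ (cintb_cabs fi)).
- by rewrite cabsM.
Qed.

Lemma cintbN f : cintb f -> cintb (fun x => - f x).
Proof. by move=> /(cintbZ (-1)); under eq_fun do rewrite mulN1r. Qed.

Lemma cintbB f g : cintb f -> cintb g -> cintb (fun x => f x - g x).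
Proof. by move=> mf mg; apply: cintbD => //; exact: cintbN. Qed.

Lemma cintb0 : cintb (fun=> 0).
Proof.
split; first exact: cmeas_cst.
by rewrite integral0_eq// => x _; rewrite cabs0.
Qed.

Lemma cintb_sum (I : Type) (s : seq I) (P : pred I) (F : I -> T -> R[i]) :
  (forall i, cintb (F i)) -> cintb (fun x => \sum_(i <- s | P i) F i x).
Proof.
move=> mF; elim: s => [|i s IH].
  by under eq_fun do rewrite big_nil; exact: cintb0.
under eq_fun do rewrite big_cons.
by case: (P i) => //; exact: cintbD.
Qed.

Lemma cintbM f g (B : R) : cintb f -> cmeas g -> (forall x, cabs (g x) <= B) ->
  cintb (fun x => f x * g x).
Proof.
move=> fi mg gB; have [mf _] := fi.
apply: (@cintb_dom _ (fun x => B * cabs (f x))) => [||x].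
- exact: cmeasM.
- exact: (integrableZl _ _ (cintb_cabs fi)).
- by rewrite cabsM mulrC ler_wpM2r ?cabs_ge0.
Qed.

Lemma cintegralD f g : cintb f -> cintb g ->
  cintegral mu (fun x => f x + g x) = cintegral mu f + cintegral mu g.
Proof.
move=> fi gi; apply: complex_eqE; rewrite ?cReD ?cImD /cintegral /=.
  under eq_Rintegral do rewrite cReD.
  by rewrite RintegralD//; exact: cintb_Re.
under eq_Rintegral do rewrite cImD.
by rewrite RintegralD//; exact: cintb_Im.
Qed.

Lemma cintegralZ c f : cintb f ->
  cintegral mu (fun x => c * f x) = c * cintegral mu f.
Proof.
move=> fi; have fr := cintb_Re fi; have fm := cintb_Im fi.
have iz (a : R) h : mu.-integrable setT (EFin \o h) ->
  mu.-integrable setT (EFin \o (fun x => a * h x)).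
  by move=> ih; exact: (integrableZl _ _ ih).
apply: complex_eqE; rewrite ?cReM ?cImM /cintegral /=.
  under eq_Rintegral do rewrite cReM.
  by rewrite RintegralB ?RintegralZl//; exact: iz.
under eq_Rintegral do rewrite cImM.
by rewrite RintegralD ?RintegralZl//; exact: iz.
Qed.

Lemma cintegralN f : cintb f -> cintegral mu (fun x => - f x) = - cintegral mu f.
Proof.
by move=> fi; rewrite -mulN1r -cintegralZ//; congr cintegral; apply/funext => x; rewrite mulN1r.
Qed.

Lemma cintegralB f g : cintb f -> cintb g ->
  cintegral mu (fun x => f x - g x) = cintegral mu f - cintegral mu g.
Proof. by move=> fi gi; rewrite cintegralD ?cintegralN//; exact: cintbN. Qed.

Lemma cintegral0 : cintegral mu (fun=> 0) = 0.
Proof. by rewrite /cintegral /= /Rintegral integral0. Qed.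

Lemma cintegral_sum (I : Type) (s : seq I) (P : pred I) (F : I -> T -> R[i]) :
  (forall i, cintb (F i)) ->
  cintegral mu (fun x => \sum_(i <- s | P i) F i x) =
  \sum_(i <- s | P i) cintegral mu (F i).
Proof.
move=> mF; elim: s => [|i s IH].
  by under eq_fun do rewrite big_nil; rewrite big_nil cintegral0.
under eq_fun do rewrite big_cons.
rewrite big_cons; case: (P i) => //; rewrite cintegralD ?IH//.
exact: cintb_sum.
Qed.

(** Multiplying by the conjugate phase of the integral makes the integral real and nonnegative, so
    its modulus is the integral of a real part. *)
Lemma cabs_cintegral f : cintb f ->
  ((cabs (cintegral mu f))%:E <= \int[mu]_x (cabs (f x))%:E)%E.
Proof.
move=> fi; pose u := (phase (cintegral mu f))^*%C.
have cu : cabs u = 1 by rewrite cabsJ cabs_phase.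
have -> : cabs (cintegral mu f) = complex.Re (cintegral mu (fun x => u * f x)).
  by rewrite cintegralZ// {2}(phaseE (cintegral mu f)) mulrCA mulrC [u * _]mulrC phaseJ mul1r.
have ui := cintbZ u fi.
have ur := cintb_Re ui.
apply: (@le_trans _ _ (\int[mu]_x (complex.Re (u * f x))%:E)%E).
  by rewrite /cintegral /= /Rintegral fineK//; exact: integrable_fin_num.
apply: le_integral => //; first exact: cintb_cabs.
by move=> x _; rewrite lee_fin (le_trans (ler_norm _))// (le_trans (Re_le_cabs _))// cabsM cu mul1r.
Qed.

Lemma cintb_cvg1 f (F : nat -> T -> R[i]) : cintb f -> (forall n, cintb (F n)) ->
  (fun n => \int[mu]_x (cabs (F n x - f x))%:E)%E @ \oo --> 0%E ->
  ccvg (fun n => cintegral mu (F n)) (cintegral mu f).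
Proof.
move=> fi Fi cv; apply/ccvgP => e e0.
have /fine_cvgP[_ /cvgrPdist_lt/(_ e e0)] := cv; have /fine_cvgP[+ _] := cv.
apply: filterS2 => n fn; rewrite sub0r normrN.
rewrite ger0_norm ?fine_ge0 ?integral_ge0// => [|x _]; last by rewrite lee_fin cabs_ge0.
apply: le_lt_trans; rewrite -lee_fin fineK// -cintegralB//.
by apply: cabs_cintegral; exact: cintbB.
Qed.

Lemma cint_dct1 f (F : nat -> T -> R[i]) (h : T -> R) :
  (forall n, cmeas (F n)) -> (forall x, ccvg (F^~ x) (f x)) ->
  mu.-integrable setT (EFin \o h) -> (forall n x, cabs (F n x) <= h x) ->
  cintb f /\ (fun n => \int[mu]_x (cabs (F n x - f x))%:E)%E @ \oo --> 0%E.
Proof.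
move=> mF Ff hi Fh; have mf := cmeas_lim mF Ff.
(* The bound passes to the limit, so the distances are dominated by [2 * h]. *)
have fh x : cabs (f x) <= h x by apply: (ccvg_bound _ (Ff x)); near=> n; exact: Fh.
split; first exact: (cintb_dom mf hi).
have h0 x : 0 <= h x by rewrite (le_trans _ (fh x))// cabs_ge0.
have [] := @dominated_convergence _ _ _ mu setT measurableT
  (fun n x => (cabs (F n x - f x))%:E) (cst 0%E) (fun x => (2 * h x)%:E).
- by move=> n; apply: cmeas_cabsE; exact: cmeasB.
- exact: measurable_cst.
- by apply/aeW => x _; apply: cvg_EFin; [near=> n|exact: Ff].
- exact: (integrableZl _ 2 hi).
- apply/aeW => x n _; rewrite gee0_abs ?lee_fin ?cabs_ge0//.
  by rewrite (le_trans (cabsB _ _))// mulr2n mulrDl mul1r lerD.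
by rewrite integral0.
Unshelve. all: by end_near. Qed.

Lemma cint_dct f (F : nat -> T -> R[i]) (h : T -> R) :
  (forall n, cmeas (F n)) -> (forall x, ccvg (F^~ x) (f x)) ->
  mu.-integrable setT (EFin \o h) -> (forall n x, cabs (F n x) <= h x) ->
  ccvg (fun n => cintegral mu (F n)) (cintegral mu f).
Proof.
move=> mF Ff hi Fh; have [fi cv] := cint_dct1 mF Ff hi Fh.
by apply: cintb_cvg1 => // n; exact: cintb_dom hi _.
Qed.

End complex_integral.

Lemma eq_cintegral {R : realType} {d} {T : measurableType d}
  (mu : {measure set T -> \bar R}) (f g : T -> R[i]) : f =1 g ->
  cintegral mu f = cintegral mu g.
Proof. by move=> /funext ->. Qed.

Lemma cintegral_pushforward {R : realType} {d d'} {T : measurableType d}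
  {U : measurableType d'} (mu : {measure set T -> \bar R}) (nu : {measure set U -> \bar R})
  (h : T -> U) (f : U -> R[i]) : measurable_fun setT h ->
  (forall A, measurable A -> nu A = mu (h @^-1` A)) -> cintb mu (f \o h) -> cmeas f ->
  cintegral nu f = cintegral mu (f \o h).
Proof.
move=> mh nuE fi [mr mi].
have nuE' A : measurable A -> setT `<=` A -> nu A = pushforward mu h A by move=> mA _; exact: nuE.
have e (k : U -> R) : measurable_fun setT k ->
    mu.-integrable setT (EFin \o (k \o h)) -> \int[nu]_x k x = \int[mu]_x k (h x).
  move=> mk ik; rewrite /Rintegral; congr fine.
  rewrite -(@integral_pushforward _ _ _ _ _ _ mh _ setT (EFin \o k))//; last exact/measurable_EFinP.
  by apply: eq_measure_integral => A mA _; rewrite nuE.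
rewrite /cintegral; congr (_ +i* _); apply: e => //.
  exact: (cintb_Re fi).
exact: (cintb_Im fi).
Qed.

Section complex_integral_prob.
Context {R : realType} {d} {T : measurableType d}.
Variable mu : probability T R.

Lemma integrable_cst_prob (B : R) : mu.-integrable setT (EFin \o (fun=> B)).
Proof.
apply/integrableP; split; first exact: measurable_cst.
rewrite integral_cst//= probability_setT mule1.
exact: ltry.
Qed.

Lemma cintb_bound (f : T -> R[i]) (B : R) : cmeas f -> (forall x, cabs (f x) <= B) ->
  cintb mu f.
Proof. by move=> mf fB; apply: (cintb_dom mf (integrable_cst_prob B)). Qed.

Lemma cintb_cst c : cintb mu (fun=> c).
Proof. by apply: (@cintb_bound _ (cabs c)) => //; exact: cmeas_cst. Qed.

Lemma cintegral_cst c : cintegral mu (fun=> c) = c.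
Proof.
apply: complex_eqE; rewrite /cintegral /= Rintegral_cst//= probability_setT mulr1//.
Qed.

End complex_integral_prob.

Section complex_fubini.
Context {R : realType} {d1 d2} {T1 : measurableType d1} {T2 : measurableType d2}.
Variables (m1 : probability T1 R) (m2 : probability T2 R).

Lemma Rintegral_fubini (f : T1 * T2 -> R) :
  (m1 \x m2)%E.-integrable setT (EFin \o f) ->
  (forall x, m2.-integrable setT (fun y => (f (x, y))%:E)) ->
  (forall y, m1.-integrable setT (fun x => (f (x, y))%:E)) ->
  [/\ \int[m1]_x \int[m2]_y f (x, y) = \int[m2]_y \int[m1]_x f (x, y),
     measurable_fun setT (fun x => \int[m2]_y f (x, y)) &
     measurable_fun setT (fun y => \int[m1]_x f (x, y))].
Proof.
move=> fi f1 f2.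
have e1 x : (\int[m2]_y f (x, y))%:E = fubini_F m2 (EFin \o f) x.
  by rewrite /Rintegral /fubini_F fineK//; apply: integrable_fin_num => //; exact: f1.
have e2 y : (\int[m1]_x f (x, y))%:E = fubini_G m1 (EFin \o f) y.
  by rewrite /Rintegral /fubini_G fineK//; apply: integrable_fin_num => //; exact: f2.
split.
- rewrite [LHS]/Rintegral [RHS]/Rintegral; congr fine.
  under eq_integral do rewrite e1.
  rewrite integral12_prod_meas1// -integral21_prod_meas1//.
  by apply: eq_integral => y _; rewrite e2.
- apply/measurable_EFinP; rewrite (_ : _ \o _ = fubini_F m2 (EFin \o f)).
    exact: (measurable_fubini_F fi).
  by apply/funext => x /=; rewrite e1.
- apply/measurable_EFinP; rewrite (_ : _ \o _ = fubini_G m1 (EFin \o f)).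
    exact: (measurable_fubini_G fi).
  by apply/funext => x /=; rewrite e2.
Qed.

Lemma cintegral_fubini (F : T1 * T2 -> R[i]) :
  cintb (m1 \x m2)%E F ->
  (forall x, cintb m2 (fun y => F (x, y))) -> (forall y, cintb m1 (fun x => F (x, y))) ->
  [/\ cintegral m1 (fun x => cintegral m2 (fun y => F (x, y))) =
      cintegral m2 (fun y => cintegral m1 (fun x => F (x, y))),
      cmeas (fun x => cintegral m2 (fun y => F (x, y))) &
      cmeas (fun y => cintegral m1 (fun x => F (x, y)))].
Proof.
move=> Fi F1 F2.
have [r1 r2 r3] := Rintegral_fubini (cintb_Re Fi)
  (fun x => cintb_Re (F1 x)) (fun y => cintb_Re (F2 y)).
have [i1 i2 i3] := Rintegral_fubini (cintb_Im Fi)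
  (fun x => cintb_Im (F1 x)) (fun y => cintb_Im (F2 y)).
by rewrite /cintegral; split => //=; rewrite r1 i1.
Qed.

Lemma cintb_prod (F : T1 * T2 -> R[i]) : cmeas F ->
  (\int[m1]_x \int[m2]_y (cabs (F (x, y)))%:E < +oo)%E -> cintb (m1 \x m2)%E F.
Proof.
move=> mF h; split=> //; rewrite fubini_tonelli1//; first exact: cmeas_cabsE.
by move=> z; rewrite lee_fin cabs_ge0.
Qed.

Lemma cintegral_fubini_bound (F : T1 * T2 -> R[i]) (B : R) : cmeas F ->
  (forall z, cabs (F z) <= B) ->
  [/\ cintegral m1 (fun x => cintegral m2 (fun y => F (x, y))) =
      cintegral m2 (fun y => cintegral m1 (fun x => F (x, y))),
      cmeas (fun x => cintegral m2 (fun y => F (x, y))) &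
      cmeas (fun y => cintegral m1 (fun x => F (x, y)))].
Proof.
move=> mF FB.
have m_1 x := cmeas_pair1 x mF; have m_2 y := cmeas_pair2 y mF.
apply: cintegral_fubini.
- apply: cintb_prod => //; apply: (@le_lt_trans _ _ (\int[m1]_x (B%:E))%E).
    apply: ge0_le_integral => //.
    + by move=> x _; apply: integral_ge0 => y _; rewrite lee_fin cabs_ge0.
    + apply: (@measurable_fun_fubini_tonelli_F _ _ _ _ _ m2 (fun z => (cabs (F z))%:E)) => [|z].
        exact: cmeas_cabsE.
      by rewrite lee_fin cabs_ge0.
    + move=> x _; apply: (@le_trans _ _ (\int[m2]_y (B%:E))%E).
        apply: ge0_le_integral => //.
        * by move=> y _; rewrite lee_fin cabs_ge0.
        * exact: cmeas_cabsE.
        * by move=> y _; rewrite lee_fin.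
      by rewrite integral_cst//= probability_setT mule1.
  by rewrite integral_cst//= probability_setT mule1 ltry.
- by move=> x; exact: (@cintb_bound _ _ _ _ _ B).
- by move=> y; exact: (@cintb_bound _ _ _ _ _ B).
Qed.

End complex_fubini.

(** * Haar measure and characters of the torus *)

Section product_measure_uniqueness.
Context {R : realType} {I : choiceType} {d} {T : measurableType d}.
Variable mu : {measure set T -> \bar R}.

Definition box_set (J : {fset I}) (A : I -> set T) : set (prod_space I T) :=
  [set w | forall i, i \in J -> A i (w i)].

Lemma measurable_box_set J A : (forall i, measurable (A i)) -> measurable (box_set J A).
Proof.
move=> mA; rewrite (_ : box_set J A = \bigcap_(i in [set i | i \in J])
  ((fun w : prod_space I T => w i) @^-1` A i))//.
apply: fin_bigcap_measurable => [|i _]; first exact: finite_fset.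
by rewrite -[X in measurable X]setTI; apply: measurable_coord.
Qed.

(** Boxes restricting finitely many coordinates form a pi-system that generates the product
    sigma-algebra. *)
Lemma product_measure_uniq (m1 m2 : probability (prod_space I T) R) :
  is_product_measure mu m1 -> is_product_measure mu m2 ->
  forall A, measurable A -> m1 A = m2 A.
Proof.
move=> h1 h2 E mE.
pose G : set (set (prod_space I T)) :=
  [set X | exists J A, (forall i, measurable (A i)) /\ X = box_set J A].
apply: (g_sigma_algebra_measure_unique G _ (fun=> setT)).
- by move=> _ [J [A [mA ->]]]; exact: measurable_box_set.
- by move=> _; exists fset0, (fun=> setT); split=> //; apply/seteqP; split.
- by rewrite bigcup_const//; exists 0%N.
- move=> _ _ [J [A [mA ->]]] [K [B [mB ->]]].
  (* Each family is padded with the full space outside its own index set, so that a single box over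
     the union is the intersection. *)
  exists (J `|` K)%fset, (fun i => (if i \in J then A i else setT) `&`
    (if i \in K then B i else setT)); split.
    by move=> i; apply: measurableI; case: ifP.
  apply/seteqP; split=> w /=.
    by move=> [wJ wK] i _; split; case: ifPn => // iJ; [exact: wJ|exact: wK].
  move=> h; split=> i iJ.
    by have [] := h i; rewrite ?inE ?iJ.
  by have [] := h i; rewrite ?inE ?iJ ?orbT.
- by move=> _ [J [A [mA ->]]]; exact: (etrans (h1 J A mA) (esym (h2 J A mA))).
- by move=> _; apply: le_lt_trans (ltry 1); exact: probability_le1.
- suff : measurable `<=` <<s G >> by apply.
  apply: smallest_sub; first exact: smallest_sigma_algebra.
  move=> _ [i _ [A mA <-]]; rewrite setTI; apply: sub_sigma_algebra.
  exists [fset i]%fset, (fun=> A); split=> //; apply/seteqP; split=> w /=.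
    by move=> wA j; rewrite inE => /eqP ->.
  by apply; rewrite inE.
Qed.

End product_measure_uniqueness.

Section circle_group.
Context {R : realType}.
Local Notation S := (circle R).
Implicit Types a b : S.

Lemma cabs_circle a : cabs (circle_val a) = 1.
Proof.
have := valP (a : unit_circle); rewrite cabsE => /eqP /(congr1 (@complex.Re R)).
by [].
Qed.

Definition circle_of (z : R[i]) (z1 : cabs z = 1) : S :=
  exist _ z (introT eqP (etrans (cabsE z) (congr1 (real_complex R) z1))).

Lemma circle_ofE z z1 : circle_val (@circle_of z z1) = z. Proof. by []. Qed.

Lemma circle_inj a b : circle_val a = circle_val b -> a = b.
Proof. exact: val_inj. Qed.

Lemma circle_mul_subproof a b : cabs (circle_val a * circle_val b) = 1.
Proof. by rewrite cabsM !cabs_circle mulr1. Qed.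

Definition circle_mul a b : S := circle_of (circle_mul_subproof a b).

Definition circle_one : S := circle_of (@cabs1 R).

Lemma circle_mulE a b : circle_val (circle_mul a b) = circle_val a * circle_val b.
Proof. by []. Qed.

Lemma circle_neq0 a : circle_val a != 0.
Proof. by rewrite -cabs_gt0 cabs_circle. Qed.

Lemma circle_conjE a : (circle_val a)^*%C = (circle_val a)^-1.
Proof.
by apply: (mulfI (circle_neq0 a)); rewrite mulJc cabs_circle expr1n divff// circle_neq0.
Qed.

Lemma measurable_to_circle {d} {T : measurableType d} (h : T -> S) :
  cmeas (fun x => circle_val (h x)) -> measurable_fun setT h.
Proof.
move=> [hr hi] _ _ [B mB <-]; rewrite setTI setTI -[X in measurable X]setTI.
exact: (measurable_fun_pair hr hi).
Qed.

Lemma cmeas_circle_val : cmeas (fun a : S => circle_val a).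
Proof.
split => _ B mB; rewrite setTI; first exists (B `*` setT).
- exact: measurableX.
- by rewrite setTI; apply/seteqP; split=> [x []|x ?].
- exists (setT `*` B); first exact: measurableX.
  by rewrite setTI; apply/seteqP; split=> [x []|x ?].
Qed.

Lemma measurable_circle_mul a : measurable_fun setT (circle_mul a).
Proof.
apply: measurable_to_circle; under eq_fun do rewrite circle_mulE.
by apply: cmeasZ; exact: cmeas_circle_val.
Qed.

Lemma circle_exp_val (t : R) :
  circle_val (circle_exp t) = cos (2 * pi * t) +i* sin (2 * pi * t).
Proof. by []. Qed.

Lemma circle_expD (s t : R) :
  circle_exp (s + t) = circle_mul (circle_exp s) (circle_exp t).
Proof.
apply: circle_inj; rewrite circle_mulE !circle_exp_val mulrDr cosD sinD.
by apply: complex_eqE => /=; ring.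
Qed.

Lemma circle_exp1 : circle_exp (1 : R) = circle_one.
Proof. by apply: circle_inj; rewrite circle_exp_val mulr1 mulr_natl cos2pi sin2pi. Qed.

Lemma circle_mul1 a : circle_mul a circle_one = a.
Proof. by apply: circle_inj; rewrite circle_mulE mulr1. Qed.

Lemma circle_expB1 (t : R) : circle_exp (t - 1) = circle_exp t.
Proof.
have -> : circle_exp t = circle_exp ((t - 1) + 1) by rewrite subrK.
by rewrite (circle_expD (t - 1) 1) circle_exp1 circle_mul1.
Qed.

Lemma circle_exp_surj a : exists2 s : R, 0 <= s <= 1 & a = circle_exp s.
Proof.
pose x := complex.Re (circle_val a); pose y := complex.Im (circle_val a).
have xy : x ^+ 2 + y ^+ 2 = 1 by rewrite -cabs_sqr cabs_circle expr1n.
have x1 : -1 <= x <= 1 by have := Re_le_cabs (circle_val a); rewrite cabs_circle ler_norml.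
have p0 : 0 < 2 * pi :> R by rewrite mulr_gt0 ?pi_gt0.
have [/andP[a0 api] acx] := acos_def x1.
have sx : sin (acos x) = `|y|.
  by rewrite sin_acos// -sqrtr_sqr; congr Num.sqrt; rewrite -xy addrAC subrr add0r.
have [y0|y0] := leP 0 y.
  exists (acos x / (2 * pi)).
    rewrite divr_ge0 ?(ltW p0)//= ler_pdivrMr// mul1r (le_trans api)// ler_peMl ?pi_ge0//.
    by rewrite ler1n.
  apply: circle_inj; rewrite circle_exp_val mulrC divfK ?gt_eqF// acx sx ger0_norm//.
  exact: complex_eqE.
(* On the lower half-circle the angle is 2 pi - acos x. *)
exists (1 - acos x / (2 * pi)).
  rewrite subr_ge0 gerBl divr_ge0 ?(ltW p0)// andbT ler_pdivrMr// mul1r (le_trans api)//.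
  by rewrite ler_peMl ?pi_ge0// ler1n.
apply: circle_inj; rewrite circle_exp_val mulrBr mulr1 [_ * (_ / _)]mulrC divfK ?gt_eqF//.
rewrite mulr_natl cosB sinB cos2pi sin2pi !mul1r !mul0r addr0 sub0r acx sx ltr0_norm// opprK.
exact: complex_eqE.
Qed.

Lemma lebesgue_shift (s : R) (X : set (measurableTypeR R)) : measurable X ->
  lebesgue_measure ((fun t => t + s) @^-1` X) = lebesgue_measure X.
Proof.
move=> mX.
have ms : measurable_fun setT (fun t : measurableTypeR R => t + s : measurableTypeR R).
  by apply: measurable_funD; [exact: measurable_id|exact: measurable_cst].
have := @lebesgue_measure_unique R (measure_function_pushforward__canonical__measure_function_Measure lebesgue_measure ms) _ X mX.
rewrite /pushforward => -> // _ [[a b] _ <-] /=; rewrite /pushforward.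
rewrite lebesgue_measure_itv/=.
rewrite (_ : _ @^-1` _ = `]a - s, b - s]%classic); last first.
  by apply/seteqP; split=> t /=; rewrite !in_itv/= ltrBlDr lerBrDr.
by rewrite lebesgue_measure_itv/= !lte_fin ltrD2r; case: ifP => // _; rewrite -!EFinD; congr EFin; ring.
Qed.

(** Rotation by exp (2 pi i s) is translation by s modulo 1. The translated window [[s, s + 1[] is
    cut at 1 and its upper part is moved back to [[0, s[], which the periodicity of [circle_exp]
    allows. *)
Lemma circle_measure_mul a (A : set S) : measurable A ->
  circle_measure (circle_mul a @^-1` A) = circle_measure A.
Proof.
move=> mA; have [s /andP[s0 s1] ->] := circle_exp_surj a.
have mB : measurable ((@circle_exp R) @^-1` A).
  by rewrite -[X in measurable X]setTI; exact: measurable_circle_exp.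
pose B : set (measurableTypeR R) := (@circle_exp R) @^-1` A.
have mBs (r : R) : measurable ((fun t : R => t + r) @^-1` B).
  rewrite -[X in measurable X]setTI.
  have ms : measurable_fun setT (fun t : measurableTypeR R => t + r : measurableTypeR R).
    by apply: measurable_funD; [exact: measurable_id|exact: measurable_cst].
  exact: ms.
transitivity (lebesgue_measure ((fun t => t + s) @^-1` B `&` `[0, 1[)).
  rewrite -uniform01E//; congr (uniform_prob _ _); apply/seteqP; split=> t /=.
    by rewrite -circle_expD addrC.
  by rewrite /B /= addrC circle_expD.
transitivity (lebesgue_measure (B `&` `[0, 1[)); last by rewrite -uniform01E.
have -> : (fun t => t + s) @^-1` B `&` `[0, 1[ = (fun t => t + s) @^-1` (B `&` `[s, s + 1[).
  apply/seteqP; split=> t /= [Bt]; rewrite !in_itv/= => h; split=> //; lra.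
have mi (u v : R) : measurable (B `&` `[u, v[) by exact: measurableI.
rewrite lebesgue_shift//.
have -> : B `&` `[s, s + 1[ = (B `&` `[s, 1[) `|` (fun t => t + - 1) @^-1` (B `&` `[0, s[).
  have Bp t : B (t - 1) = B t.
    by rewrite /B /= circle_expB1.
  apply/seteqP; split=> t /=; rewrite !in_itv/=.
    move=> [Bt h]; have [t1|t1] := ltP t 1; [left|right]; split=> //; try lra.
    by rewrite Bp.
  by move=> [[Bt h]|[]]; [split=> //; lra|rewrite Bp => Bt h; split=> //; lra].
have mi1 : measurable ((fun t => t + - 1) @^-1` (B `&` `[0, s[)).
  rewrite -[X in measurable X]setTI.
  have ms : measurable_fun setT (fun t : measurableTypeR R => t + -1 : measurableTypeR R).
    by apply: measurable_funD; [exact: measurable_id|exact: measurable_cst].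
  exact: ms.
rewrite measureU//; last first.
  by rewrite -subset0 => t /= [[_]]; rewrite !in_itv/= => h1 [_ h2]; lra.
transitivity (lebesgue_measure (B `&` `[s, 1%R[) + lebesgue_measure (B `&` `[0%R, s[))%E.
  by congr (_ + _)%E; exact: lebesgue_shift.
rewrite -measureU//; last first.
  by rewrite -subset0 => t /= [[_]]; rewrite !in_itv/= => h1 [_ h2]; lra.
congr lebesgue_measure; apply/seteqP; split=> t /=; rewrite !in_itv/=.
  by move=> [[Bt h]|[Bt h]]; split=> //; lra.
by move=> [Bt h]; have [t1|t1] := ltP t s; [right|left]; split=> //; lra.
Qed.

End circle_group.

Section torus_group.
Context {R : realType}.

Definition tcoord {I : Type} (w : torus R I) (i : I) : R[i] := circle_val (w i).

Definition tmul {I : Type} (a w : torus R I) : torus R I := fun i => circle_mul (a i) (w i).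

Lemma tmulE {I : Type} (a w : torus R I) i : tcoord (tmul a w) i = tcoord a i * tcoord w i.
Proof. by []. Qed.

Lemma cabs_tcoord {I : Type} (w : torus R I) i : cabs (tcoord w i) = 1.
Proof. exact: cabs_circle. Qed.

Lemma cmeas_tcoord {I : Type} i : cmeas (fun w : torus R I => tcoord w i).
Proof. exact: (cmeas_comp cmeas_circle_val (measurable_coord i)). Qed.

Lemma measurable_to_torus {I : Type} {d} {T : measurableType d} (h : T -> torus R I) :
  (forall i, cmeas (fun x => tcoord (h x) i)) -> measurable_fun setT h.
Proof.
move=> mh; apply: measurable_to_prod => i; apply: measurable_to_circle; exact: mh.
Qed.

Lemma measurable_tmul {I : Type} (a : torus R I) : measurable_fun setT (tmul a).
Proof.
apply: measurable_to_torus => i.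
exact: (cmeasZ (tcoord a i) (cmeas_tcoord i)).
Qed.

Section haar.
Context {I : countType}.
Local Notation m := (torus_measure R I).

(** The image of the measure under a rotation is a product measure with the same factors, hence the
    measure itself by uniqueness. *)
Lemma haar_tmul (a : torus R I) A : measurable A -> m (tmul a @^-1` A) = m A.
Proof.
move=> mA; pose h : {mfun torus R I >-> torus R I} := mfun_Sub (mem_set (measurable_tmul a)).
suff : is_product_measure circle_measure (distribution m h).
  by move=> hm; exact: (product_measure_uniq hm (@torus_measureP R I) mA).
move=> J B mB; rewrite -(eq_bigr _ (fun i _ => circle_measure_mul (a i) (mB i))).
rewrite -(@torus_measureP R I) // => i.
by rewrite -[X in measurable X]setTI; exact: measurable_circle_mul.
Qed.

End haar.

Definition tres {n} (w : torus R nat) : torus R 'I_n := fun i => w (val i).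

Lemma measurable_tres n : measurable_fun setT (@tres n).
Proof. by apply: measurable_to_prod => i; exact: measurable_coord. Qed.

(** Transfers the integrals over finite tori that define [Hp_norm] to the infinite torus, where
    everything else takes place. *)
Lemma haar_tres n A : measurable A ->
  torus_measure R 'I_n A = torus_measure R nat (@tres n @^-1` A).
Proof.
move=> mA; pose h : {mfun torus R nat >-> torus R 'I_n} := mfun_Sub (mem_set (@measurable_tres n)).
suff : is_product_measure circle_measure (distribution (torus_measure R nat) h).
  by move=> /product_measure_uniq/(_ (@torus_measureP R 'I_n)) <-.
move=> J B mB.
pose B' (k : nat) : set (circle R) := if insub k is Some i then B i else setT.
have mB' k : measurable (B' k) by rewrite /B'; case: insubP.
transitivity (torus_measure R nat (box_set [fset val i | i in J]%fset B')).
  congr (torus_measure _ _ _); apply/seteqP; split=> w /= H.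
    by move=> _ /imfsetP[i /= iJ ->]; rewrite /B' valK; exact: H.
  by move=> i iJ; have := H (val i); rewrite /B' valK; apply; apply/imfsetP; exists i.
rewrite [LHS](@torus_measureP R nat _ _ mB') big_imfset/=; last by move=> i j _ _; exact: val_inj.
by apply: eq_bigr => i _; rewrite /B' valK.
Qed.

Lemma haar_coord (j : nat) A : measurable A ->
  circle_measure A = torus_measure R nat ((fun w => w j) @^-1` A).
Proof.
move=> mA; transitivity (torus_measure R nat (box_set [fset j]%fset (fun=> A))).
  by rewrite [RHS](@torus_measureP R nat)// big_seq_fset1.
congr (torus_measure _ _ _); apply/seteqP; split=> w /=.
  by apply; rewrite inE.
by move=> wA i; rewrite inE => /eqP ->.
Qed.

End torus_group.

Lemma ge0_integral_mp {R : realType} {d d'} {T : measurableType d}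
  {U : measurableType d'} (mu : {measure set T -> \bar R}) (nu : {measure set U -> \bar R})
  (h : T -> U) (f : U -> \bar R) : measurable_fun setT h ->
  (forall A, measurable A -> nu A = mu (h @^-1` A)) -> measurable_fun setT f ->
  (forall x, 0 <= f x)%E -> (\int[nu]_x f x = \int[mu]_x f (h x))%E.
Proof.
move=> mh nuE mf f0.
rewrite -(@ge0_integral_pushforward _ _ _ _ _ _ mh _ setT f)//.
by apply: eq_measure_integral => A mA _; rewrite nuE.
Qed.

Lemma cintb_mp {R : realType} {d d'} {T : measurableType d}
  {U : measurableType d'} (mu : {measure set T -> \bar R}) (nu : {measure set U -> \bar R})
  (h : T -> U) (f : U -> R[i]) : measurable_fun setT h ->
  (forall A, measurable A -> nu A = mu (h @^-1` A)) -> cintb nu f -> cintb mu (f \o h).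
Proof.
move=> mh nuE [mf fi]; split; first exact: cmeas_comp.
rewrite /comp -(ge0_integral_mp mh nuE (f := fun x => (cabs (f x))%:E))//.
- exact: cmeas_cabsE.
- by move=> x; rewrite lee_fin cabs_ge0.
Qed.

Lemma cintegral_mp {R : realType} {d d'} {T : measurableType d}
  {U : measurableType d'} (mu : {measure set T -> \bar R}) (nu : {measure set U -> \bar R})
  (h : T -> U) (f : U -> R[i]) : measurable_fun setT h ->
  (forall A, measurable A -> nu A = mu (h @^-1` A)) -> cintb nu f ->
  cintegral nu f = cintegral mu (f \o h).
Proof.
move=> mh nuE fi; apply: cintegral_pushforward => //; first exact: (cintb_mp mh nuE fi).
by case: fi.
Qed.

Section torus_invariance.
Context {R : realType} {I : countType}.
Local Notation m := (torus_measure R I).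

Lemma haar_tmulE (a : torus R I) A : measurable A -> m A = m (tmul a @^-1` A).
Proof. by move=> mA; rewrite haar_tmul. Qed.

Lemma ge0_integral_tmul (a : torus R I) (f : torus R I -> \bar R) :
  measurable_fun setT f -> (forall x, 0 <= f x)%E ->
  (\int[m]_w f w = \int[m]_w f (tmul a w))%E.
Proof. by move=> mf f0; apply: ge0_integral_mp => //; [exact: measurable_tmul|exact: haar_tmulE]. Qed.

Lemma cintegral_tmul (a : torus R I) (f : torus R I -> R[i]) : cintb m f ->
  cintegral m f = cintegral m (fun w => f (tmul a w)).
Proof. by move=> fi; apply: cintegral_mp => //; [exact: measurable_tmul|exact: haar_tmulE]. Qed.

End torus_invariance.

Section characters.
Context {R : realType}.
Local Notation m := (torus_measure R nat).
Implicit Types (w v : torus R nat) (a b : nat -> int).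

Definition chi n a w : R[i] := \prod_(j < n) tcoord w j ^ a j.

Lemma cabs_chi n a w : cabs (chi n a w) = 1.
Proof.
by rewrite /chi cabs_prod big1// => j _; rewrite cabsXz cabs_tcoord exp1rz.
Qed.

Lemma tcoord_neq0 {I : Type} (w : torus R I) j : tcoord w j != 0.
Proof. exact: circle_neq0. Qed.

Lemma cmeasV {d} {T : measurableType d} (f : T -> R[i]) : (forall x, cabs (f x) = 1) ->
  cmeas f -> cmeas (fun x => (f x)^-1).
Proof.
move=> f1 mf; rewrite (_ : (fun x => _) = (fun x => (f x)^*%C)); first exact: cmeasJ.
apply/funext => x; have fx0 : f x != 0 by rewrite -cabs_gt0 f1.
by apply: (mulfI fx0); rewrite mulJc f1 expr1n divff.
Qed.

Lemma cmeas_tcoordX {I : Type} j (n : int) : cmeas (fun w : torus R I => tcoord w j ^ n).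
Proof.
case: n => n; first by apply: cmeasX; exact: cmeas_tcoord.
apply: (@eq_cmeas _ _ _ _ (fun w : torus R I => (tcoord w j ^+ n.+1)^-1)) => //.
apply: cmeasV => [w|].
  by rewrite cabsX cabs_tcoord expr1n.
by apply: cmeasX; exact: cmeas_tcoord.
Qed.

Lemma cmeas_chi n a : cmeas (chi n a).
Proof. by apply: cmeas_prod => j; exact: cmeas_tcoordX. Qed.

Lemma cintb_chi n a : cintb m (chi n a).
Proof. by apply: (@cintb_bound _ _ _ _ _ 1) => [|w]; [exact: cmeas_chi|rewrite cabs_chi]. Qed.

Lemma chi_tmul n a w v : chi n a (tmul w v) = chi n a w * chi n a v.
Proof.
rewrite /chi -big_split; apply: eq_bigr => j _.
by rewrite tmulE exprzMl// unitfE tcoord_neq0.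
Qed.

Lemma chiD n a b w : chi n (fun j => a j + b j) w = chi n a w * chi n b w.
Proof.
by rewrite /chi -big_split; apply: eq_bigr => j _; rewrite expfzDr// tcoord_neq0.
Qed.

Lemma circle_exp_natmul (t : R) n :
  circle_val (circle_exp (n%:R * t)) = circle_val (circle_exp t) ^+ n.
Proof.
elim: n => [|n IH]; first by rewrite mul0r circle_exp_val mulr0 cos0 sin0.
by rewrite exprS -IH -[n.+1%:R]nat1r mulrDl mul1r circle_expD.
Qed.

Lemma circle_exp_half : circle_val (circle_exp (2^-1 : R)) = -1.
Proof.
rewrite circle_exp_val mulrAC divff ?pnatr_eq0// mul1r cospi sinpi.
by apply: complex_eqE => /=; rewrite ?oppr0.
Qed.

(** If some [a j] is nonzero, the rotation of coordinate j by the angle pi / |a j| turns the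
    character into its opposite, while the integral is invariant. *)
Lemma cintegral_chi n a :
  cintegral m (chi n a) = [forall j : 'I_n, a j == 0]%:R.
Proof.
case: (boolP [forall j : 'I_n, _]) => [/forallP h|/forallPn[j aj]].
  under eq_cintegral => w.
    by rewrite /chi big1; [over|move=> j _; rewrite (eqP (h j)) expr0z].
  by rewrite cintegral_cst.
pose t : torus R nat := fun i => if i == j then circle_exp (2^-1 / `|a j|%:R) else circle_one.
have tE : chi n a t = -1.
  rewrite /chi (bigD1 j)//= big1 => [|i ij].
    rewrite mulr1 /tcoord /t eqxx.
    have : circle_val (circle_exp (2^-1 / `|a j|%:R : R)) ^+ `|a j| = -1.
      rewrite -circle_exp_natmul mulrC divfK ?circle_exp_half//.
      by rewrite pnatr_eq0 absz_eq0.
    move: aj; case: (a j) => k ak //= h.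
    by rewrite NegzE -exprnN h invrN invr1.
  by rewrite /tcoord /t -val_eqE in ij *; rewrite (negbTE ij) circle_ofE exp1rz.
have : cintegral m (chi n a) = - cintegral m (chi n a).
  rewrite {1}(cintegral_tmul t); last exact: cintb_chi.
  rewrite -mulN1r -tE -cintegralZ; last exact: cintb_chi.
  by apply: eq_cintegral => w; rewrite chi_tmul.
by move/eqP; rewrite -subr_eq0 opprK -mulr2n mulrn_eq0 => /eqP.
Qed.

(* Only the entries a i with i < n matter. *)
Definition four n a (f : torus R nat -> R[i]) : R[i] :=
  cintegral m (fun w => f w * chi n (fun j => - a j) w).

Lemma cintb_four n a f : cintb m f -> cintb m (fun w => f w * chi n a w).
Proof.
move=> fi; apply: (@cintbM _ _ _ _ _ _ 1) => // [|w]; first exact: cmeas_chi.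
by rewrite cabs_chi.
Qed.

Lemma four_chi n a b : four n a (chi n b) = [forall j : 'I_n, b j == a j]%:R.
Proof.
rewrite /four; under eq_cintegral do rewrite -chiD.
rewrite cintegral_chi; congr (nat_of_bool _)%:R; apply/eq_forallb => j.
by rewrite subr_eq0.
Qed.

Lemma fourier_coefE n (f : torus R nat -> R[i]) (alpha : zmidx) :
  (forall j, (n <= j)%N -> alpha j = 0) -> fourier_coef f alpha = four n alpha f.
Proof.
move=> h; apply: eq_cintegral => w; congr (_ * _).
rewrite /chi -(big_mkord xpredT (fun j => tcoord w j ^ (- alpha j))).
have -> : \prod_(j <- finsupp alpha) circle_val (w j) ^ (- alpha j) =
  \prod_(j <- finsupp alpha) tcoord w j ^ (- alpha j) by [].
symmetry; rewrite (bigID [pred j | j \in finsupp alpha])/= [X in _ * X]big1 ?mulr1.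
  rewrite -big_filter; apply: perm_big; apply: uniq_perm.
  - by rewrite filter_uniq// iota_uniq.
  - exact: fset_uniq.
  - move=> j; rewrite mem_filter mem_index_iota/= andb_idr// mem_finsupp => aj; rewrite ltnNge; apply/negP => nj.
    by rewrite h ?eqxx in aj.
by move=> j; rewrite mem_finsupp negbK => /eqP ->; rewrite oppr0 expr0z.
Qed.

Definition zmk n a : zmidx := [fsfun j in [fset j | j in iota 0 n]%fset => a j | 0].

Lemma zmkE n a j : zmk n a j = if (j < n)%N then a j else 0.
Proof. by rewrite /zmk fsfunE !inE mem_iota. Qed.

Lemma fourE n a f : four n a f = fourier_coef f (zmk n a).
Proof.
rewrite (@fourier_coefE n) => [|j nj]; last by rewrite zmkE ltnNge nj.
apply: eq_cintegral => w; congr (_ * _); apply: eq_bigr => j _.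
by rewrite zmkE ltn_ord.
Qed.

Lemma cabs_four n a f : cintb m f ->
  ((cabs (four n a f))%:E <= \int[m]_w (cabs (f w))%:E)%E.
Proof.
move=> fi; apply: (le_trans (cabs_cintegral (cintb_four n _ fi))).
by rewrite (eq_integral (fun w => (cabs (f w))%:E))// => w _; rewrite cabsM cabs_chi mulr1.
Qed.

End characters.

(** * Poisson integrals *)

Section poisson_kernel.
Context {R : realType}.
Local Notation m := (torus_measure R nat).
Implicit Types (w v : torus R nat) (r : R) (u : R[i]).

Definition pkern r u : R := (1 - r ^+ 2) / cabs (1 - r%:C * u) ^+ 2.

(** Codes the exponents from -(M + 1) to M by a finite type; with [Negz] the exponent 0 has only one
    code. *)
Definition ngexp M (c : bool * 'I_M.+1) : int := if c.1 then Negz c.2 else Posz c.2.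

(** Partial sums of the Fourier series of the Poisson kernel. *)
Definition psum r M u : R[i] :=
  \sum_(c : bool * 'I_M.+1) r%:C ^+ `|ngexp c| * u ^ ngexp c.

Lemma psumE r M u : psum r M u = \sum_(k < M.+1) (r%:C * u) ^+ k +
  \sum_(k < M.+1) (r%:C * u^-1) ^+ k.+1.
Proof.
rewrite /psum -(pair_bigA _ (fun b (k : 'I_M.+1) =>
  r%:C ^+ `|ngexp (b, k)| * u ^ ngexp (b, k))) /= big_bool addrC.
by congr (_ + _); apply: eq_bigr => k _; rewrite /ngexp /= ?NegzE -?exprnN ?exprMn ?exprVn.
Qed.

Lemma geom_psum (z : R[i]) n : 1 - z != 0 ->
  \sum_(k < n) z ^+ k = (1 - z ^+ n) / (1 - z).
Proof.
move=> z1; apply: (mulIf z1); rewrite divfK// -[in RHS](expr1n _ n) subrXX mulrC.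
by congr (_ * _); apply: eq_bigr => k _; rewrite expr1n mul1r.
Qed.

Lemma ccvg_geom (z : R[i]) : cabs z < 1 -> ccvg (fun n => z ^+ n) 0.
Proof.
move=> z1; rewrite /ccvg; under eq_fun do rewrite subr0 cabsX.
by apply: cvg_expr; rewrite ger0_norm ?cabs_ge0.
Qed.

Lemma ccvg_geom_sum (z : R[i]) : cabs z < 1 ->
  ccvg (fun n => \sum_(k < n) z ^+ k) (1 - z)^-1.
Proof.
move=> z1; have z10 : 1 - z != 0.
  by apply: contraTneq z1 => /eqP; rewrite subr_eq0 => /eqP <-; rewrite cabs1 ltxx.
under eq_fun do rewrite geom_psum//.
suff : ccvg (fun n => (1 - z ^+ n) / (1 - z)) ((1 - 0) / (1 - z)) by rewrite subr0 mul1r.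
apply: ccvgM; last exact: ccvg_cst.
by apply: ccvgB; [exact: ccvg_cst|exact: ccvg_geom].
Qed.

Lemma ccvg_shiftS (u : nat -> R[i]) l : ccvg u l -> ccvg (fun n => u n.+1) l.
Proof.
move=> /ccvgP h; apply/ccvgP => e e0; have [N _ hN] := h e e0.
by exists N => // n /= Nn; apply: hN => /=; exact: leqW.
Qed.

Lemma psum_cvg r u : 0 <= r < 1 -> cabs u = 1 ->
  ccvg (fun M => psum r M u) (pkern r u)%:C.
Proof.
move=> /andP[r0 r1] u1; have u0 : u != 0 by rewrite -cabs_gt0 u1.
have ru : cabs (r%:C * u) < 1 by rewrite cabsM cabs_real ger0_norm// u1 mulr1.
have ru' : cabs (r%:C * u^-1) < 1.
  by rewrite cabsM cabs_real ger0_norm// cabsV u1 invr1 mulr1.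
have nz (z : R[i]) : cabs z < 1 -> 1 - z != 0.
  by move=> z1; apply: contraTneq z1 => /eqP; rewrite subr_eq0 => /eqP <-; rewrite cabs1 ltxx.
(* The two series in powers of r u and r / u are geometric; as 1 / u is the conjugate of u, their
   sum has the denominator |1 - r u|^2. *)
have -> : (pkern r u)%:C = (1 - r%:C * u)^-1 + (r%:C * u^-1) * (1 - r%:C * u^-1)^-1.
  have uJ : u^-1 = u^*%C by apply: (mulfI u0); rewrite divff// mulJc u1 expr1n.
  have nJ : 1 - r%:C * u^-1 = (1 - r%:C * u)^*%C.
    by rewrite uJ rmorphB rmorph1 rmorphM/= oppr0.
  rewrite /pkern rmorphM rmorphB rmorphXn rmorph1/= fmorphV/= -mulJc -nJ.
  have -> : 1 - r%:C ^+ 2 = (1 - r%:C / u) + (r%:C / u) * (1 - r%:C * u) by field.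
  move: (nz _ ru) (nz _ ru') => h1 h2.
  apply: (mulIf (mulf_neq0 h1 h2)); rewrite divfK ?mulf_neq0// mulrDl mulKf//.
  by congr (_ + _); rewrite -[RHS]mulrA (mulrCA (1 - r%:C / u)^-1) mulVf// mulr1.
under eq_fun do rewrite psumE.
apply: ccvgD; first exact: (ccvg_shiftS (ccvg_geom_sum ru)).
under eq_fun => M do (under eq_bigr do rewrite exprS); under eq_fun do rewrite -mulr_sumr.
by apply: ccvgZ; exact: (ccvg_shiftS (ccvg_geom_sum ru')).
Qed.

Lemma real_geom_sum_le r M : 0 <= r < 1 -> \sum_(k < M) r ^+ k <= (1 - r)^-1.
Proof.
move=> /andP[r0 r1]; have r10 : 0 < 1 - r by rewrite subr_gt0.
rewrite -(ler_pM2r r10) mulVf ?gt_eqF//.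
have -> : (\sum_(k < M) r ^+ k) * (1 - r) = 1 - r ^+ M.
  elim: M => [|M IH]; first by rewrite big_ord0 mul0r expr0 subrr.
  by rewrite big_ord_recr/= mulrDl IH exprSr; ring.
by rewrite gerBl exprn_ge0.
Qed.

Lemma psum_bound r M u : 0 <= r < 1 -> cabs u = 1 -> cabs (psum r M u) <= 2 / (1 - r).
Proof.
move=> r01 u1; have /andP[r0 r1] := r01; rewrite psumE (le_trans (cabsD _ _))//.
have -> : 2 / (1 - r) = (1 - r)^-1 + (1 - r)^-1 by ring.
apply: lerD.
  apply: (le_trans (cabs_sum _ _ _)); apply: le_trans (real_geom_sum_le M.+1 r01).
  by apply: ler_sum => k _; rewrite cabsX cabsM cabs_real u1 mulr1 ger0_norm.
apply: (le_trans (cabs_sum _ _ _)); apply: le_trans (real_geom_sum_le M.+1 r01).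
apply: ler_sum => k _; rewrite cabsX cabsM cabs_real cabsV u1 invr1 mulr1 ger0_norm//.
by rewrite exprS ler_piMl ?exprn_ge0// ltW.
Qed.

Lemma pkern_ge0 r u : 0 <= r < 1 -> 0 <= pkern r u.
Proof.
move=> /andP[r0 r1]; rewrite /pkern divr_ge0 ?sqr_ge0// subr_ge0.
by rewrite expr_le1// ltW.
Qed.

Lemma cmeas_psum {d} {T : measurableType d} r M (f : T -> R[i]) :
  (forall x, cabs (f x) = 1) -> cmeas f -> cmeas (fun x => psum r M (f x)).
Proof.
move=> f1 mf; apply: cmeas_sum => -[b k]; apply: cmeasZ; rewrite /ngexp /=; case: b.
  apply: (@cmeasV _ _ _ (fun x => f x ^+ k.+1)); last exact: cmeasX.
  by move=> x; rewrite cabsX f1 expr1n.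
exact: cmeasX.
Qed.

(** Variables of index n and above are absent, so that integrating against this kernel averages them
    out. *)
Definition kern n r w v : R := \prod_(j < n) pkern r (tcoord w j / tcoord v j).

Definition kernM n r M w v : R[i] := \prod_(j < n) psum r M (tcoord w j / tcoord v j).

Lemma cabs_tdiv w v j : cabs (tcoord w j / tcoord v j) = 1.
Proof. by rewrite cabsM cabsV !cabs_tcoord invr1 mulr1. Qed.

Lemma kernM_cvg n r w v : 0 <= r < 1 -> ccvg (fun M => kernM n r M w v) (kern n r w v)%:C.
Proof.
move=> r01; rewrite /kern rmorph_prod; apply: ccvg_prod => j _.
by apply: psum_cvg => //; exact: cabs_tdiv.
Qed.

Lemma kernM_bound n r M w v : 0 <= r < 1 -> cabs (kernM n r M w v) <= (2 / (1 - r)) ^+ n.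
Proof.
move=> r01; rewrite cabs_prod -[X in _ <= _ ^+ X]card_ord -prodr_const.
apply: ler_prod => j _; rewrite cabs_ge0/=; apply: psum_bound => //.
exact: cabs_tdiv.
Qed.

Lemma kern_ge0 n r w v : 0 <= r < 1 -> 0 <= kern n r w v.
Proof. by move=> r01; apply: prodr_ge0 => j _; exact: pkern_ge0. Qed.

Lemma kern_bound n r w v : 0 <= r < 1 -> kern n r w v <= (2 / (1 - r)) ^+ n.
Proof.
move=> r01; rewrite -[leLHS]ger0_norm ?kern_ge0// -cabs_real.
by apply: (ccvg_bound _ (kernM_cvg n w v r01)); near=> M; exact: kernM_bound.
Unshelve. all: by end_near. Qed.

Lemma kernC n r w v : 0 <= r < 1 -> kern n r w v = kern n r v w.
Proof.
move=> r01; apply: eq_bigr => j _; rewrite /pkern; congr (_ / _ ^+ 2).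
rewrite -cabsJ rmorphB rmorph1 rmorphM/= oppr0; congr (cabs (1 - _ * _)).
rewrite rmorphM fmorphV/= !circle_conjE invrK mulrC//.
Qed.

Lemma cmeas_kernM2 n r M : cmeas (fun z : torus R nat * torus R nat => kernM n r M z.1 z.2).
Proof.
apply: cmeas_prod => j; apply: cmeas_psum => [z|]; first exact: cabs_tdiv.
apply: cmeasM; first exact: (cmeas_comp (@cmeas_tcoord R nat j) measurable_fst).
apply: cmeasV; first by move=> z; rewrite cabs_tcoord.
exact: (cmeas_comp (@cmeas_tcoord R nat j) measurable_snd).
Qed.

Lemma cmeas_kern2 n r : 0 <= r < 1 ->
  cmeas (fun z : torus R nat * torus R nat => (kern n r z.1 z.2)%:C).
Proof.
move=> r01; apply: (cmeas_lim (fun M => cmeas_kernM2 n r M)) => z.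
exact: kernM_cvg.
Qed.

Lemma cmeas_kern n r w : 0 <= r < 1 -> cmeas (fun v => (kern n r w v)%:C).
Proof. by move=> /(cmeas_kern2 n) h; exact: (cmeas_pair1 w h). Qed.

Lemma cmeas_kernM n r M w : cmeas (fun v => kernM n r M w v).
Proof. exact: (cmeas_pair1 w (cmeas_kernM2 n r M)). Qed.

Definition poisson n r (f : torus R nat -> R[i]) w : R[i] :=
  cintegral m (fun v => f v * (kern n r w v)%:C).

Definition poissonM n r M (f : torus R nat -> R[i]) w : R[i] :=
  cintegral m (fun v => f v * kernM n r M w v).

Lemma poissonM_cvg n r f w : 0 <= r < 1 -> cintb m f ->
  ccvg (fun M => poissonM n r M f w) (poisson n r f w).
Proof.
move=> r01 fi; have [mf _] := fi.
apply: (@cint_dct _ _ _ _ _ _ (fun v => (2 / (1 - r)) ^+ n * cabs (f v))).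
- by move=> M; apply: cmeasM => //; exact: cmeas_kernM.
- by move=> v; apply: ccvgZ; exact: kernM_cvg.
- exact: (integrableZl _ _ (cintb_cabs fi)).
- by move=> M v; rewrite cabsM mulrC ler_wpM2r ?cabs_ge0// kernM_bound.
Qed.

Lemma cintb_kern n r f w : 0 <= r < 1 -> cintb m f ->
  cintb m (fun v => f v * (kern n r w v)%:C).
Proof.
move=> r01 fi; apply: (cintbM (B := (2 / (1 - r)) ^+ n)) => //; first exact: cmeas_kern.
by move=> v; rewrite cabs_real ger0_norm ?kern_ge0 ?kern_bound.
Qed.

Definition fexp n M (p : {ffun 'I_n -> bool * 'I_M.+1}) (j : nat) : int :=
  if (insub j : option 'I_n) is Some i then ngexp (p i) else 0.

Lemma fexpE n M (p : {ffun 'I_n -> bool * 'I_M.+1}) (j : 'I_n) : fexp p j = ngexp (p j).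
Proof. by rewrite /fexp valK. Qed.

Lemma kernME n r M w v : kernM n r M w v =
  \sum_(p : {ffun 'I_n -> bool * 'I_M.+1})
    (\prod_(j < n) r%:C ^+ `|fexp p j|) * chi n (fexp p) w * chi n (fun j => - fexp p j) v.
Proof.
rewrite /kernM /psum bigA_distr_bigA/=; apply: eq_bigr => p _.
rewrite /chi -!big_split; apply: eq_bigr => j _ /=; rewrite fexpE -mulrA; congr (_ * _).
by rewrite exprzMl ?unitfE ?invr_eq0 ?tcoord_neq0// exprz_inv.
Qed.

(** The link between Poisson integrals and Fourier coefficients: with a truncated kernel the
    integral is a trigonometric polynomial whose coefficients are those of [f] damped by powers of
    [r]. *)
Lemma poissonME n r M f w : cintb m f -> poissonM n r M f w =
  \sum_(p : {ffun 'I_n -> bool * 'I_M.+1})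
    (\prod_(j < n) r%:C ^+ `|fexp p j|) * chi n (fexp p) w * four n (fexp p) f.
Proof.
move=> fi; rewrite /poissonM; under eq_cintegral do rewrite kernME mulr_sumr.
rewrite cintegral_sum => [|p].
  apply: eq_bigr => p _; rewrite -cintegralZ; last exact: cintb_four.
  by apply: eq_cintegral => v; rewrite mulrCA.
apply: (eq_cintb (fun v => mulrCA _ _ _)).
by apply: cintbZ; exact: cintb_four.
Qed.

Definition ngcode M (k : int) : bool * 'I_M.+1 :=
  match k with Posz i => (false, inord i) | Negz i => (true, inord i) end.

Lemma ngcodeK M k : (`|k| <= M)%N -> ngexp (ngcode M k) = k.
Proof. by case: k => k /= kM; rewrite /ngexp /= inordK//; lia. Qed.

Lemma ngexp_inj M : injective (@ngexp M).
Proof.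
move=> [[] i] [[] j] // [ij]; congr (_, _); exact: val_inj.
Qed.

(** By orthogonality one term of the truncated expansion survives, and it is present as soon as M
    reaches all |a j|; from then on the truncated integrals do not depend on M. *)
Lemma poisson_chi n r (a : nat -> int) w : 0 <= r < 1 ->
  poisson n r (chi n a) w = (\prod_(j < n) r%:C ^+ `|a j|) * chi n a w.
Proof.
move=> r01; apply: (ccvg_unique (poissonM_cvg n w r01 (cintb_chi n a))).
pose N := (\sum_(j < n) `|a j|)%N; apply/ccvgP => e e0; exists N => // M /= NM.
pose p : {ffun 'I_n -> bool * 'I_M.+1} := [ffun j : 'I_n => ngcode M (a j)].
have pE (j : 'I_n) : fexp p j = a j.
  rewrite fexpE ffunE ngcodeK// (leq_trans _ NM)//.
  by rewrite /N (bigD1 j)//= leq_addr.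
rewrite poissonME; last exact: cintb_chi.
rewrite (bigD1 p)//= [X in _ + X - _]big1 => [|q qp].
  rewrite addr0 four_chi (_ : [forall j, _]) ?mulr1; last by apply/forallP => j; rewrite pE.
  rewrite (_ : _ * _ - _ = 0) ?cabs0//; apply/eqP; rewrite subr_eq0; apply/eqP.
  by congr (_ * _); apply: eq_bigr => j _; rewrite pE.
rewrite four_chi; case: (boolP [forall j, _]) => [/forallP h|]; last by rewrite mulr0.
case/eqP: qp; apply/ffunP => j; apply: ngexp_inj; rewrite -!fexpE pE.
by rewrite (eqP (h j)).
Qed.

End poisson_kernel.

Section poisson_theory.
Context {R : realType}.
Local Notation m := (torus_measure R nat).
Implicit Types (w v : torus R nat) (r : R).

Lemma poissonD n r f g w : 0 <= r < 1 -> cintb m f -> cintb m g ->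
  poisson n r (fun v => f v + g v) w = poisson n r f w + poisson n r g w.
Proof.
move=> r01 fi gi; rewrite /poisson -cintegralD; [|exact: cintb_kern..].
by apply: eq_cintegral => v; rewrite mulrDl.
Qed.

Lemma poissonZ n r c f w : 0 <= r < 1 -> cintb m f ->
  poisson n r (fun v => c * f v) w = c * poisson n r f w.
Proof.
move=> r01 fi; rewrite /poisson -cintegralZ; last exact: cintb_kern.
by apply: eq_cintegral => v; rewrite mulrA.
Qed.

Lemma poissonB n r f g w : 0 <= r < 1 -> cintb m f -> cintb m g ->
  poisson n r (fun v => f v - g v) w = poisson n r f w - poisson n r g w.
Proof.
move=> r01 fi gi; rewrite /poisson -cintegralB; [|exact: cintb_kern..].
by apply: eq_cintegral => v; rewrite mulrBl.
Qed.

Lemma poisson_cst n r c w : 0 <= r < 1 -> poisson n r (fun=> c) w = c.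
Proof.
move=> r01; have := poisson_chi n (fun=> 0) w r01.
have c0 v : chi n (fun=> 0) v = 1 by rewrite /chi big1// => j _; rewrite expr0z.
rewrite c0 mulr1 big1// => h; rewrite -[RHS]mulr1 -h -poissonZ//; last exact: cintb_chi.
by congr (poisson n r _ w); apply/funext => v; rewrite c0 mulr1.
Qed.

Lemma poisson_tcoord n r (j : nat) w : 0 <= r < 1 -> (j < n)%N ->
  poisson n r (fun v => tcoord v j) w = r%:C * tcoord w j.
Proof.
move=> r01 jn; have := poisson_chi n (fun i => (i == j)%:Z) w r01.
have c0 v : chi n (fun i => (i == j)%:Z) v = tcoord v j.
  rewrite /chi (bigD1 (Ordinal jn))//= eqxx expr1z big1 ?mulr1// => i.
  by rewrite -val_eqE/= => /negbTE ->; rewrite expr0z.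
rewrite c0 (bigD1 (Ordinal jn))//= eqxx expr1 big1 ?mulr1 => [<-|i]; last first.
  by rewrite -val_eqE/= => /negbTE ->; rewrite expr0.
by congr (poisson n r _ w); apply/funext.
Qed.

Lemma cmeas_poisson n r f : 0 <= r < 1 -> cintb m f -> cmeas (poisson n r f).
Proof.
move=> r01 fi; apply: (@cmeas_lim _ _ _ (fun M => poissonM n r M f)) => [M|w].
  apply: (eq_cmeas (fun w => poissonME n r M w fi)).
  by apply: cmeas_sum => p; apply: cmeasM; [apply: cmeasZ; exact: cmeas_chi|exact: cmeas_cst].
exact: poissonM_cvg.
Qed.

Lemma integral_kern n r w : 0 <= r < 1 -> (\int[m]_v (kern n r w v)%:E = 1)%E.
Proof.
move=> r01; have := poisson_cst n 1 w r01; rewrite /poisson.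
under eq_cintegral do rewrite mul1r.
move=> /(congr1 (@complex.Re R)) /= h; rewrite -[in RHS]h /Rintegral fineK//.
have k1 : cintb m (fun v => (kern n r w v)%:C).
  apply: (eq_cintb (fun v => esym (mul1r _))).
  by apply: cintb_kern => //; exact: cintb_cst.
by apply: integrable_fin_num => //; exact: (cintb_Re k1).
Qed.

Lemma integral_kernC n r v : 0 <= r < 1 -> (\int[m]_w (kern n r w v)%:E = 1)%E.
Proof.
by move=> r01; rewrite -(integral_kern n v r01); apply: eq_integral => w _; rewrite kernC.
Qed.

Lemma measurable_kern2 n r : 0 <= r < 1 ->
  measurable_fun setT (fun z : torus R nat * torus R nat => kern n r z.1 z.2).
Proof. by move=> r01; have [] := cmeas_kern2 n r01. Qed.

(* Phi has an affine minorant touching it at each point; this is convexity. *)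
Lemma poisson_jensen n r f (Phi : R[i] -> R) : 0 <= r < 1 -> cintb m f ->
  (forall x, 0 <= Phi x) ->
  (forall g : torus R nat -> R[i], cmeas g -> measurable_fun setT (fun v => Phi (g v))) ->
  (forall a, exists c, forall x, Phi a + complex.Re (c * (x - a)) <= Phi x) ->
  (\int[m]_w (Phi (poisson n r f w))%:E <= \int[m]_w (Phi (f w))%:E)%E.
Proof.
move=> r01 fi P0 mPhi sup; have mP := mPhi _ (proj1 fi).
pose G (z : torus R nat * torus R nat) := (Phi (f z.2) * kern n r z.1 z.2)%:E.
have mG : measurable_fun setT G.
  apply/measurable_EFinP; apply: measurable_funM; last exact: measurable_kern2.
  exact: (measurableT_comp mP measurable_snd).
have G0 z : (0 <= G z)%E by rewrite lee_fin mulr_ge0// kern_ge0.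
have mG1 w : measurable_fun setT (fun v => G (w, v)).
  exact: (measurableT_comp mG (measurable_pair1 w)).
have pw w : ((Phi (poisson n r f w))%:E <= \int[m]_v G (w, v))%E.
  set a := poisson n r f w; have [c cP] := sup a.
  (* An infinite right-hand side needs no argument; otherwise the affine minorant can be compared
     under the integral. *)
  have [->|fin] := eqVneq (\int[m]_v G (w, v))%E +oo%E; first by rewrite leey.
  have iG : m.-integrable setT (fun v => G (w, v)).
    apply/integrableP; split => //.
    by under eq_integral do rewrite gee0_abs//; rewrite ltey.
  (* The affine minorant at [a], composed with [f] and weighted by the kernel. Its integral is
     exactly [Phi a], because [a] is the Poisson integral of [f] at [w]. *)
  pose h v := ((Phi a)%:C - c * a + c * f v) * (kern n r w v)%:C.
  have cst1 : cintb m (fun=> (Phi a)%:C - c * a) by exact: cintb_cst.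
  have hi := cintbD cst1 (cintbZ c fi).
  have hh : cintegral m h = (Phi a)%:C.
    rewrite -[LHS]/(poisson n r (fun v => (Phi a)%:C - c * a + c * f v) w).
    rewrite poissonD//; last exact: cintbZ.
    by rewrite poisson_cst// poissonZ// subrK.
  have hk : cintb m h by exact: (cintb_kern n w r01 hi).
  have -> : Phi a = \int[m]_v complex.Re (h v).
    by move/(congr1 (@complex.Re R)) : hh.
  rewrite /Rintegral fineK; last by apply: integrable_fin_num => //; exact: cintb_Re.
  apply: le_integral => //; first exact: cintb_Re.
  move=> v _; rewrite /G lee_fin /h cReM /= mulr0 subr0 ler_wpM2r ?kern_ge0//.
  by rewrite -addrA cReD [- _ + _]addrC -mulrBr /=; exact: cP.
apply: (@le_trans _ _ (\int[m]_w \int[m]_v G (w, v))%E).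
  apply: ge0_le_integral => //.
  - by move=> w _; rewrite lee_fin.
  - by apply/measurable_EFinP; apply: mPhi; exact: cmeas_poisson.
  - exact: (measurable_fun_fubini_tonelli_F G mG G0).
(* By symmetry the kernel has mass 1 in its first variable too, so integrating over [w] first leaves
   [Phi (f v)]. *)
rewrite fubini_tonelli// (eq_integral (fun v => (Phi (f v))%:E))// => v _.
rewrite /G; under eq_integral do rewrite EFinM /=.
rewrite ge0_integralZl ?lee_fin//; last 2 first.
- by apply/measurable_EFinP; exact: (measurableT_comp (measurable_kern2 n r01) (measurable_pair2 v)).
- by move=> w _; rewrite lee_fin kern_ge0.
by rewrite integral_kernC// mule1.
Qed.

Lemma poisson_L1 n r f : 0 <= r < 1 -> cintb m f ->
  (\int[m]_w (cabs (poisson n r f w))%:E <= \int[m]_w (cabs (f w))%:E)%E.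
Proof.
move=> r01 fi; apply: poisson_jensen => //.
- exact: cabs_ge0.
- by move=> g; exact: cmeas_cabs.
(* The modulus is supported at [a] by the real part of conj (phase a) x. *)
- move=> a; exists (phase a)^*%C => x.
  rewrite mulrBr cReD cReN.
  have -> : complex.Re ((phase a)^*%C * a) = cabs a.
    by rewrite [X in _ * X](phaseE a) mulrCA [_^*%C * _]mulrC phaseJ mulr1.
  rewrite addrC subrK (le_trans (ler_norm _))// (le_trans (Re_le_cabs _))//.
  by rewrite cabsM cabsJ cabs_phase mul1r.
Qed.

Lemma cintb_poisson n r f : 0 <= r < 1 -> cintb m f -> cintb m (poisson n r f).
Proof.
move=> r01 fi; split; first exact: cmeas_poisson.
by apply: le_lt_trans (poisson_L1 n r01 fi) _; case: fi.
Qed.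

Lemma ge0_intD (u v : torus R nat -> R) : measurable_fun setT u -> measurable_fun setT v ->
  (forall w, 0 <= u w) -> (forall w, 0 <= v w) ->
  (\int[m]_w (u w + v w)%:E = \int[m]_w (u w)%:E + \int[m]_w (v w)%:E)%E.
Proof.
move=> mu mv u0 v0; under eq_integral do rewrite EFinD.
rewrite ge0_integralD//.
- by move=> w _; rewrite lee_fin.
- exact/measurable_EFinP.
- by move=> w _; rewrite lee_fin.
- exact/measurable_EFinP.
Qed.

Lemma ge0_intZ (c : R) (u : torus R nat -> R) : 0 <= c -> measurable_fun setT u ->
  (forall w, 0 <= u w) -> (\int[m]_w (c * u w)%:E = c%:E * \int[m]_w (u w)%:E)%E.
Proof.
move=> c0 mu u0; under eq_integral do rewrite EFinM.
rewrite ge0_integralZl//; first exact/measurable_EFinP.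
by move=> w _; rewrite lee_fin.
Qed.

Lemma ge0_int_le (u v : torus R nat -> R) : measurable_fun setT u -> measurable_fun setT v ->
  (forall w, 0 <= u w) -> (forall w, u w <= v w) ->
  (\int[m]_w (u w)%:E <= \int[m]_w (v w)%:E)%E.
Proof.
move=> mu mv u0 uv; apply: ge0_le_integral => //.
- by move=> w _; rewrite lee_fin.
- exact/measurable_EFinP.
- exact/measurable_EFinP.
- by move=> w _; rewrite lee_fin.
Qed.

Lemma poisson_bound n r f w (B : R) : 0 <= r < 1 -> cmeas f -> (forall v, cabs (f v) <= B) ->
  cabs (poisson n r f w) <= B.
Proof.
move=> r01 mf fB; have fi := cintb_bound m mf fB.
have B0 : 0 <= B by rewrite (le_trans (cabs_ge0 (f w))).
have mk : measurable_fun setT (fun v => kern n r w v) by have [] := cmeas_kern n w r01.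
rewrite -lee_fin; apply: (le_trans (cabs_cintegral (cintb_kern n w r01 fi))).
apply: (@le_trans _ _ (\int[m]_v (B * kern n r w v)%:E)%E).
  apply: ge0_int_le.
  - exact: cmeas_cabs (cintb_kern n w r01 fi).1.
  - by apply: measurable_funM => //; exact: measurable_cst.
  - by move=> v; exact: cabs_ge0.
  - move=> v; rewrite cabsM cabs_real ger0_norm ?kern_ge0//.
    by rewrite ler_wpM2r ?kern_ge0.
rewrite ge0_intZ//; last by move=> v; exact: kern_ge0.
by rewrite integral_kern// mule1.
Qed.

(* Chebyshev: the kernel has mass at most 2(1 - r)/d^2 outside |v_j - w_j| < d. *)
Lemma poisson_approx n n' r (F : torus R nat -> R[i]) w (B e d : R) : 0 <= r < 1 ->
  cmeas F -> (forall v, cabs (F v) <= B) -> 0 < d -> 0 <= e -> (n <= n')%N ->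
  (forall v, (forall j, (j < n)%N -> cabs (tcoord v j - tcoord w j) < d) ->
    cabs (F v - F w) <= e) ->
  cabs (poisson n' r F w - F w) <= e + 2 * B / d ^+ 2 * (n%:R * (2 * (1 - r))).
Proof.
move=> r01 mF FB d0 e0 nn' Fd.
have B0 : 0 <= B by rewrite (le_trans _ (FB w))// cabs_ge0.
have Fi := cintb_bound m mF FB.
have c0 : 0 <= 2 * B / d ^+ 2 by rewrite divr_ge0 ?sqr_ge0// mulr_ge0.
rewrite -[X in _ - X](poisson_cst n' (F w) w r01) -poissonB//; last exact: cintb_cst.
have Di : cintb m (fun v => F v - F w) by apply: cintbB => //; exact: cintb_cst.
(* The real part of [H] majorises |F v - F w| and is affine in the coordinates: on the torus |v_j -
   w_j|^2 is the real part of 2 - 2 conj (w_j) v_j, whose Poisson integral at [w] is 2 (1 - r). *)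
pose H v : R[i] := e%:C + (2 * B / d ^+ 2)%:C *
  \sum_(j < n) (2 + - 2 * (tcoord w j)^*%C * tcoord v j).
have ci j : cintb m (fun v => tcoord v j : R[i]).
  by apply: (@cintb_bound _ _ _ _ _ 1) => [|v]; [exact: cmeas_tcoord|rewrite cabs_tcoord].
have si : cintb m (fun v => \sum_(j < n) (2 + - 2 * (tcoord w j)^*%C * tcoord v j)).
  apply: cintb_sum => j; apply: cintbD; first exact: cintb_cst.
  by apply: cintbZ; exact: ci.
have Hi : cintb m H by apply: cintbD; [exact: cintb_cst|exact: cintbZ].
have PH : poisson n' r H w = (e + 2 * B / d ^+ 2 * (n%:R * (2 * (1 - r))))%:C.
  rewrite poissonD ?poisson_cst ?poissonZ//; [|exact: cintb_cst|exact: cintbZ].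
  rewrite [RHS]RtoCD [in RHS]RtoCM; congr (_ + _ * _).
  have -> : poisson n' r (fun v => \sum_(j < n) (2 + - 2 * (tcoord w j)^*%C * tcoord v j)) w =
    \sum_(j < n) poisson n' r (fun v => 2 + - 2 * (tcoord w j)^*%C * tcoord v j) w.
    rewrite /poisson; under eq_cintegral do rewrite mulr_suml.
    rewrite cintegral_sum; first by [].
    by move=> j; apply: (cintb_kern n' w r01); apply: cintbD; [exact: cintb_cst|apply: cintbZ; exact: ci].
  rewrite (eq_bigr (fun=> (2 * (1 - r))%:C)).
    have -> : n%:R * (2 * (1 - r)) = \sum_(i < n) (2 * (1 - r)) by rewrite sumr_const card_ord mulr_natl.
    by rewrite rmorph_sum.
  move=> j _; rewrite (poissonD n' w r01 (cintb_cst m _) (cintbZ _ (ci j))).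
  rewrite (poisson_cst _ _ _ r01) (poissonZ _ _ _ r01 (ci j)).
  rewrite poisson_tcoord//; last by rewrite (leq_trans _ nn').
  rewrite [_%:C * _]mulrC -mulrA [_^*%C * _]mulrA [_^*%C * _]mulrC mulJc cabs_tcoord expr1n.
  by rewrite mul1r [RHS]RtoCM rmorphB rmorph1 rmorph_nat mulrBr mulr1 mulNr.
rewrite -lee_fin; apply: (le_trans (cabs_cintegral (cintb_kern n' w r01 Di))).
have -> : e + 2 * B / d ^+ 2 * (n%:R * (2 * (1 - r))) = \int[m]_v complex.Re (H v * (kern n' r w v)%:C).
  by have /(congr1 (@complex.Re R)) := PH.
have Hk := cintb_kern n' w r01 Hi.
rewrite /Rintegral fineK; last by apply: integrable_fin_num => //; exact: cintb_Re.
apply: le_integral => //; [exact: (cintb_cabs (cintb_kern n' w r01 Di))|exact: cintb_Re|].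
move=> v _; rewrite lee_fin cabsM cabs_real ger0_norm ?kern_ge0//.
rewrite cReM /= mulr0 subr0 ler_wpM2r ?kern_ge0//.
have ReH : complex.Re (H v) = e + 2 * B / d ^+ 2 * \sum_(j < n) cabs (tcoord v j - tcoord w j) ^+ 2.
  rewrite /H cReD cReM /= mul0r subr0 sum_Re; congr (_ + _ * _); apply: eq_bigr => j _.
  rewrite [RHS]cabs_sqr; have := cabs_sqr (tcoord v j); have := cabs_sqr (tcoord w j); rewrite !cabs_tcoord expr1n.
  by case: (tcoord v j) => a b; case: (tcoord w j) => a' b' /=; lra.
rewrite ReH; have s0 : 0 <= \sum_(j < n) cabs (tcoord v j - tcoord w j) ^+ 2.
  by apply: sumr_ge0 => j _; rewrite sqr_ge0.
(* If every coordinate is within [d], the constant [e] suffices; otherwise one term of the sum is at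
   least d^2 and the second part alone is at least 2 B. *)
case: (pselect (forall j, (j < n)%N -> cabs (tcoord v j - tcoord w j) < d)) => [h|].
  by apply: (le_trans (Fd v h)); rewrite lerDl mulr_ge0.
move=> /existsNP[j /not_implyP[jn /negP]]; rewrite -leNgt => dj.
apply: (@le_trans _ _ (2 * B)).
  by rewrite (le_trans (cabsB _ _))// mulr2n mulrDl mul1r lerD.
apply: (@le_trans _ _ (2 * B / d ^+ 2 * \sum_(j < n) cabs (tcoord v j - tcoord w j) ^+ 2)); last first.
  by rewrite lerDr.
rewrite -mulrA ler_peMr// ?mulr_ge0// mulrC ler_pdivlMr ?exprn_gt0// mul1r.
rewrite (bigD1 (Ordinal jn))//= ler_wpDr//; first by apply: sumr_ge0 => i _; rewrite sqr_ge0.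
by rewrite ler_sqr ?nnegrE ?cabs_ge0// ltW.
Qed.

End poisson_theory.

(** * Convergence of Poisson integrals in L_1 *)

(** Starting at 1 / 2, these radii are positive for every [k], as the definition of [Hp_norm]
    requires. *)
Definition prad {R : realType} (k : nat) : R := 1 - (k.+2%:R)^-1.

Section L1_convergence.
Context {R : realType}.
Local Notation m := (torus_measure R nat).
Implicit Types (w v : torus R nat) (r : R) (f g : torus R nat -> R[i]).

Lemma prad01 k : 0 <= (prad k : R) < 1.
Proof.
rewrite /prad subr_ge0 ltrBlDr ltrDl invr_gt0 ltr0n andbT invf_le1 ?ltr0n//.
by rewrite ler1n.
Qed.

Lemma prad_gt0 k : 0 < (prad k : R) < 1.
Proof.
have /andP[_ ->] := prad01 k; rewrite andbT subr_gt0 invf_lt1 ?ltr0n//.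
by rewrite ltr1n.
Qed.

Lemma prad_cvg : (fun k => 1 - (prad k : R)) @ \oo --> (0 : R).
Proof.
rewrite /prad; under eq_fun do rewrite opprB addrC subrK.
have := @cvg_harmonic R; rewrite -(cvg_shiftS (@harmonic R)).
exact.
Qed.

Lemma ccvg_prad : ccvg (fun k => (prad k : R)%:C) 1.
Proof.
apply: ccvg_ReIm => /=; last exact: cvg_cst.
rewrite -[X in _ --> X]subr0 (_ : (fun k => prad k) = fun k => 1 - (1 - (prad k : R))).
  by apply: cvgB; [exact: cvg_cst|exact: prad_cvg].
by apply/funext => k; rewrite opprB addrC subrK.
Qed.

(* Continuity at w with respect to finitely many coordinates. *)
Definition cylc f w := exists n, forall e : R, 0 < e -> exists2 d : R, 0 < d &
  forall v, (forall j, (j < n)%N -> cabs (tcoord v j - tcoord w j) < d) ->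
    cabs (f v - f w) <= e.

(** [N] is left general: the number of variables is constant in [poisson_slice] and grows with the
    radius in [pgood_cylc]. *)
Lemma poisson_cvg_pt (N : nat -> nat) n f w (B : R) : (\forall k \near \oo, (n <= N k)%N) -> cmeas f -> (forall v, cabs (f v) <= B) ->
  (forall e : R, 0 < e -> exists2 d : R, 0 < d &
    forall v, (forall j, (j < n)%N -> cabs (tcoord v j - tcoord w j) < d) -> cabs (f v - f w) <= e) ->
  ccvg (fun k => poisson (N k) (prad k) f w) (f w).
Proof.
move=> nN mf fB fc; apply/ccvgP => e e0.
have e20 : 0 < e / 2 by rewrite divr_gt0.
have [d d0 fd] := fc _ e20.
have cv : (fun k => 2 * B / d ^+ 2 * (n%:R * (2 * (1 - (prad k : R))))) @ \oo --> (0 : R).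
  rewrite -(mulr0 (2 * B / d ^+ 2)) -(mulr0 n%:R) -(mulr0 2).
  by do 3 (apply: cvgM; [exact: cvg_cst|]); exact: prad_cvg.
move/cvgrPdist_lt : cv => /(_ _ e20).
move: nN; apply: filterS2 => k nk; rewrite sub0r normrN => h.
apply: le_lt_trans (poisson_approx (prad01 k) mf fB d0 (ltW e20) nk fd) _.
have := ler_norm (2 * B / d ^+ 2 * (n%:R * (2 * (1 - (prad k : R))))); lra.
Qed.

Definition L1cvg (F : nat -> torus R nat -> R[i]) f :=
  (fun k => \int[m]_w (cabs (F k w - f w))%:E)%E @ \oo --> 0%E.

(* The class of pgood functions is closed under linear combinations and L_1
   limits; monotone classes then carry it from cylinder sets to all of L_1. *)
Definition pgood f := cintb m f /\ L1cvg (fun k => poisson k (prad k) f) f.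

Lemma pgood_cylc f (B : R) : cmeas f -> (forall v, cabs (f v) <= B) ->
  (forall w, cylc f w) -> pgood f.
Proof.
move=> mf fB fc; have fi := cintb_bound m mf fB; split=> //.
apply: (proj2 (@cint_dct1 _ _ _ m f (fun k => poisson k (prad k) f) (fun=> B) _ _ _ _)).
- by move=> k; apply: cmeas_poisson => //; exact: prad01.
- by move=> w; have [n fn] := fc w; exact: poisson_cvg_pt (nbhs_infty_ge n) mf fB fn.
- exact: integrable_cst_prob.
- by move=> k w; apply: poisson_bound => //; exact: prad01.
Qed.

Lemma L1_triangle f g : cintb m f -> cintb m g ->
  (\int[m]_w (cabs (f w + g w))%:E <=
   \int[m]_w (cabs (f w))%:E + \int[m]_w (cabs (g w))%:E)%E.
Proof.
move=> [mf _] [mg _].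
have c0 (h : torus R nat -> R[i]) w : [set: torus R nat] w -> (0 <= (cabs (h w))%:E)%E.
  by rewrite lee_fin cabs_ge0.
rewrite -ge0_integralD//; [|exact: c0|exact: cmeas_cabsE|exact: c0|exact: cmeas_cabsE].
apply: ge0_le_integral => //; first exact: c0.
- by apply: cmeas_cabsE; exact: cmeasD.
- by apply: emeasurable_funD; exact: cmeas_cabsE.
- by move=> w _; rewrite -EFinD lee_fin cabsD.
Qed.

Lemma L1cvgP (F : nat -> torus R nat -> R[i]) f : (forall k, cintb m (F k)) -> cintb m f ->
  L1cvg F f <-> forall e : R, 0 < e ->
    \forall k \near \oo, (\int[m]_w (cabs (F k w - f w))%:E <= e%:E)%E.
Proof.
move=> Fi fi.
have fin k : (\int[m]_w (cabs (F k w - f w))%:E \is a fin_num)%E.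
  by rewrite ge0_fin_numE ?integral_ge0// => [|w _]; [case: (cintbB (Fi k) fi)|rewrite lee_fin cabs_ge0].
split.
  move=> /fine_cvgP[_ /cvgrPdist_le h] e e0; have := h e e0; apply: filterS => k.
  rewrite sub0r normrN => hk; rewrite -(fineK (fin k)) lee_fin.
  by rewrite (le_trans (ler_norm _)).
move=> h; apply/fine_cvgP; split; first by near=> k; exact: fin.
apply/cvgrPdist_le => e e0; have := h e e0; apply: filterS => k.
rewrite sub0r normrN /= -{1}(fineK (fin k)) lee_fin ger0_norm// fine_ge0//.
by apply: integral_ge0 => w _; rewrite lee_fin cabs_ge0.
Unshelve. all: by end_near. Qed.

(** Three epsilons: Poisson integration contracts L_1, so the error made in replacing [f] by [g] is
    not enlarged. *)
Lemma pgood_lim f : cintb m f -> (forall e : R, 0 < e -> exists2 g, pgood g &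
  (\int[m]_w (cabs (f w - g w))%:E <= e%:E)%E) -> pgood f.
Proof.
move=> fi h; split; first exact: fi.
apply/(L1cvgP (fun k => cintb_poisson k (prad01 k) fi) fi) => e e0.
have e30 : 0 < e / 3 by rewrite divr_gt0.
have [g [gi gc] fg] := h _ e30.
have pi k : cintb m (poisson k (prad k) g) by apply: cintb_poisson => //; exact: prad01.
move/(L1cvgP pi gi) : gc => /(_ _ e30); apply: filterS => k gk.
have dfg := cintbB fi gi.
have E w : poisson k (prad k) f w - f w =
    poisson k (prad k) (fun v => f v - g v) w + ((poisson k (prad k) g w - g w) + - (f w - g w)).
  by rewrite poissonB ?prad01//; ring.
under eq_integral do rewrite E.
have i1 := cintb_poisson k (prad01 k) dfg.
have i2 := cintbB (pi k) gi.
apply: (le_trans (L1_triangle i1 (cintbD i2 (cintbN dfg)))).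
have -> : e%:E = ((e / 3)%:E + ((e / 3)%:E + (e / 3)%:E))%E by rewrite -!EFinD; congr EFin; lra.
apply: leeD; first exact: le_trans (poisson_L1 k (prad01 k) dfg) fg.
apply: (le_trans (L1_triangle i2 (cintbN dfg))); apply: leeD => //.
by under eq_integral do rewrite cabsN.
Qed.

Lemma pgoodD f g : pgood f -> pgood g -> pgood (fun w => f w + g w).
Proof.
move=> [fi fc] [gi gc]; have fgi := cintbD fi gi; split=> //.
have pf k := cintb_poisson k (prad01 k) fi; have pg k := cintb_poisson k (prad01 k) gi.
have pfg k := cintb_poisson k (prad01 k) fgi.
apply/(L1cvgP pfg fgi) => e e0; have e20 : 0 < e / 2 by rewrite divr_gt0.
move/(L1cvgP pf fi) : fc => /(_ _ e20); move/(L1cvgP pg gi) : gc => /(_ _ e20).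
apply: filterS2 => k gk fk.
have E w : poisson k (prad k) (fun v => f v + g v) w - (f w + g w) =
    (poisson k (prad k) f w - f w) + (poisson k (prad k) g w - g w).
  by rewrite poissonD ?prad01//; ring.
under eq_integral do rewrite E.
apply: (le_trans (L1_triangle (cintbB (pf k) fi) (cintbB (pg k) gi))).
have -> : e%:E = ((e / 2)%:E + (e / 2)%:E)%E by rewrite -EFinD; congr EFin; lra.
exact: leeD.
Qed.

Lemma pgoodZ c f : pgood f -> pgood (fun w => c * f w).
Proof.
move=> [fi fc]; have cfi := cintbZ c fi; split=> //.
have pf k := cintb_poisson k (prad01 k) fi.
have pcf k := cintb_poisson k (prad01 k) cfi.
apply/(L1cvgP pcf cfi) => e e0; have e20 : 0 < e / (cabs c + 1).
  by rewrite divr_gt0// ltr_wpDl ?cabs_ge0.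
move/(L1cvgP pf fi) : fc => /(_ _ e20); apply: filterS => k fk.
have E w : (cabs (poisson k (prad k) (fun v => c * f v) w - c * f w))%:E =
    ((cabs c)%:E * (cabs (poisson k (prad k) f w - f w))%:E)%E.
  by rewrite poissonZ ?prad01// -mulrBr cabsM.
under eq_integral do rewrite E.
rewrite ge0_integralZl//; last 3 first.
- by apply: cmeas_cabsE; exact: (proj1 (cintbB (pf k) fi)).
- by move=> w _; rewrite lee_fin cabs_ge0.
- by rewrite lee_fin cabs_ge0.
apply: (@le_trans _ _ ((cabs c)%:E * (e / (cabs c + 1))%:E)%E).
  by apply: lee_wpmul2l => //; rewrite lee_fin cabs_ge0.
rewrite -EFinM lee_fin mulrCA; apply: ler_piMr; first exact: ltW.
by rewrite ler_pdivrMr ?mul1r ?lerDl// ltr_wpDl ?cabs_ge0.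
Qed.

Lemma pgood_cst c : pgood (fun=> c).
Proof.
apply: (pgood_cylc (cmeas_cst c) (fun=> lexx _)).
by move=> w; exists 0%N => e e0; exists 1 => // v _; rewrite subrr cabs0 ltW.
Qed.

Definition cind (A : set (torus R nat)) w : R[i] := (\1_A w)%:C.

Lemma cmeas_cind A : measurable A -> cmeas (cind A).
Proof. by move=> mA; apply: cmeas_real; exact: measurable_indic. Qed.

Lemma cintb_cind A : measurable A -> cintb m (cind A).
Proof.
move=> mA; apply: (@cintb_bound _ _ _ _ _ 1) => [|w]; first exact: cmeas_cind.
by rewrite /cind cabs_real indicE; case: (_ \in _); rewrite ?normr1 ?normr0.
Qed.

Definition cyl_fun f := [/\ cmeas f, forall w, cabs (f w) <= 1 & forall w, cylc f w].

Lemma cyl_funM f g : cyl_fun f -> cyl_fun g -> cyl_fun (fun w => f w * g w).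
Proof.
move=> [mf f1 fc] [mg g1 gc]; split=> [|w|w]; first exact: cmeasM.
  by rewrite cabsM mulr_ile1 ?cabs_ge0.
have [n nf] := fc w; have [k kg] := gc w; exists (maxn n k) => e e0.
have e20 : 0 < e / 2 by rewrite divr_gt0.
have [d d0 hd] := nf _ e20; have [d' d'0 hd'] := kg _ e20.
exists (Num.min d d') => [|v hv]; first by rewrite lt_min d0.
have E : f v * g v - f w * g w = (f v - f w) * g v + f w * (g v - g w) by ring.
have hf : cabs (f v - f w) <= e / 2.
  by apply: hd => j jn; apply: lt_le_trans (hv j _) _; rewrite ?leq_max ?jn// ge_min lexx.
have hg : cabs (g v - g w) <= e / 2.
  by apply: hd' => j jn; apply: lt_le_trans (hv j _) _; rewrite ?leq_max ?jn ?orbT// ge_min lexx orbT.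
rewrite E (le_trans (cabsD _ _))// !cabsM.
have : cabs (f v - f w) * cabs (g v) <= e / 2 * 1 by rewrite ler_pM ?cabs_ge0.
have : cabs (f w) * cabs (g v - g w) <= 1 * (e / 2) by rewrite ler_pM ?cabs_ge0.
lra.
Qed.

(** A pi-system fit for Dynkin's theorem: approximants may be multiplied, the sets generate the
    sigma-algebra, and their indicators are [pgood] by dominated convergence. *)
Definition cyl_set : set (set (torus R nat)) := [set A | exists F : nat -> torus R nat -> R[i],
  (forall k, cyl_fun (F k)) /\ forall w, ccvg (F^~ w) (cind A w)].

Lemma cyl_setI : setI_closed cyl_set.
Proof.
move=> A B [F [F1 FA]] [G [G1 GB]]; exists (fun k w => F k w * G k w); split.
  by move=> k; exact: cyl_funM.
by move=> w; rewrite /cind indicI /= RtoCM; exact: ccvgM.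
Qed.

(** Piecewise linear approximation of the indicator of []a, +oo[], with Lipschitz constant [k]. *)
Definition ramp (a : R) (k : nat) (x : R) : R := Num.min 1 (Num.max 0 (k%:R * (x - a))).

Lemma ramp01 a k x : 0 <= ramp a k x <= 1.
Proof. by rewrite /ramp le_min ler01 le_max lexx ge_min lexx. Qed.

Lemma ramp_lip a k x y : `|ramp a k x - ramp a k y| <= k%:R * `|x - y|.
Proof.
rewrite /ramp; have -> : k%:R * `|x - y| = `|k%:R * (x - a) - k%:R * (y - a)|.
  by rewrite -mulrBr normrM ger0_norm//; congr (_ * `|_|); ring.
set X := k%:R * _; set Y := k%:R * _; clearbody X Y.
have h1 := ler_norm (X - Y); have := ler_norm (Y - X); rewrite (distrC Y) => h2.
rewrite ler_norml !minEle !maxEle; apply/andP.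
by case: (leP 0 X) => hX; case: (leP 0 Y) => hY; rewrite ?ler10; case: (leP 1 X) => ?; case: (leP 1 Y) => ?; split; lra.
Qed.

Lemma ramp_cvg a x : (fun k => ramp a k x) @ \oo --> ((a < x)%R%:R : R).
Proof.
have [ax|xa] := ltP a x; last first.
  rewrite (_ : (fun k => ramp a k x) = fun=> 0); first exact: cvg_cst.
  apply/funext => k; rewrite /ramp max_l ?min_r// mulr_ge0_le0// subr_le0.
  exact.
apply/cvgrPdist_lt => e e0; exists (Num.truncn (x - a)^-1).+1 => // k /= ak.
rewrite /ramp min_l ?subrr ?normr0//.
rewrite le_max; apply/orP; right; rewrite -ler_pdivrMr ?subr_gt0// mul1r.
apply: ltW; apply: (lt_le_trans (truncnS_gt _)).
by rewrite ler_nat.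
Qed.

Lemma cyl_fun_ramp (u : torus R nat -> R) j a k : measurable_fun setT u ->
  (forall v w, `|u v - u w| <= cabs (tcoord v j - tcoord w j)) ->
  cyl_fun (fun w => (ramp a k (u w))%:C).
Proof.
move=> mu ul; split.
- apply: cmeas_real; apply: measurable_minr; first exact: measurable_cst.
  apply: measurable_maxr; first exact: measurable_cst.
  apply: measurable_funM; first exact: measurable_cst.
  by apply: measurable_funB => //; exact: measurable_cst.
- by move=> w; have /andP[r0 r1] := ramp01 a k (u w); rewrite cabs_real ger0_norm.
- move=> w; exists j.+1 => e e0; exists (e / k.+1%:R) => [|v hv]; first by rewrite divr_gt0.
  rewrite -rmorphB cabs_real (le_trans (ramp_lip _ _ _ _))//.
  have := le_lt_trans (ul v w) (hv j (ltnSn j)).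
  rewrite ltr_pdivlMr// mulrC => h; apply: ltW; apply: le_lt_trans h.
  by rewrite ler_wpM2r// ler_nat.
Qed.

(** The sets where the real or imaginary part of a coordinate exceeds [a] have indicators that are
    limits of ramps, and they generate the sigma-algebra. *)
Lemma cyl_set_measurable : (measurable : set (set (torus R nat))) `<=` <<s cyl_set >>.
Proof.
apply: smallest_sub; first exact: smallest_sigma_algebra.
move=> _ [j _ [A mA <-]]; rewrite setTI.
pose G := g_sigma_algebraType cyl_set.
have key (u : torus R nat -> R) : measurable_fun setT u ->
    (forall v w, `|u v - u w| <= cabs (tcoord v j - tcoord w j)) ->
    measurable_fun [set: G] u.
  move=> mu ul mT; apply: (measurability _ (RGenOInfty.measurableE R)) => //.
  move=> /= _ [_ [a ->] <-]; rewrite setTI; apply: sub_sigma_algebra.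
  exists (fun k w => (ramp a k (u w))%:C); split=> [k|w]; first exact: cyl_fun_ramp ul.
  apply: ccvg_ReIm => /=; last exact: cvg_cst.
  rewrite indicE (_ : (w \in _) = (a < u w)); first exact: ramp_cvg.
  by apply/idP/idP; rewrite inE /= in_itv/= andbT.
have mj : measurable_fun [set: G] (fun w : G => (w : torus R nat) j).
  apply: measurable_to_circle; split; apply: key.
  - by case: (@cmeas_tcoord R nat j).
  - by move=> v w; rewrite -cReN -cReD; exact: Re_le_cabs.
  - by case: (@cmeas_tcoord R nat j).
  - by move=> v w; rewrite -cImN -cImD; exact: Im_le_cabs.
by have := mj measurableT A mA; rewrite setTI.
Qed.

Lemma pgood_cyl_set A : measurable A -> cyl_set A -> pgood (cind A).
Proof.
move=> mA [F [F1 FA]]; apply: pgood_lim => [|e e0]; first exact: cintb_cind.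
have Fi k : cintb m (F k) by have [mF FB _] := F1 k; exact: cintb_bound FB.
have [_ cv] : cintb m (cind A) /\
    (fun n => \int[m]_x (cabs (F n x - cind A x))%:E)%E @ \oo --> 0%E.
  apply: (@cint_dct1 _ _ _ m (cind A) F (fun=> 1)) => // [k||k w].
  - by have [] := F1 k.
  - exact: integrable_cst_prob.
  - by have [] := F1 k.
move/(L1cvgP Fi (cintb_cind mA)) : cv => /(_ _ e0)[N _ /(_ N (leqnn N))] h.
exists (F N).
  by have [mF FB Fc] := F1 N; exact: pgood_cylc Fc.
by under eq_integral do rewrite cabs_distC.
Qed.

Lemma pgood_cind A0 : measurable A0 -> pgood (cind A0).
Proof.
move=> mA0.
pose D : set (set (torus R nat)) := [set A | measurable A /\ pgood (cind A)].
have dD : dynkin D.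
  split.
  - split; first exact: measurableT.
    by rewrite (_ : cind _ = fun=> 1); [exact: pgood_cst|apply/funext => w; rewrite /cind indicT].
  - move=> A [mA gA]; split; first exact: measurableC.
    rewrite (_ : cind _ = fun w => 1 + (-1) * cind A w).
      by apply: pgoodD; [exact: pgood_cst|exact: pgoodZ].
    apply/funext => w; rewrite /cind !indicE in_setC; case: (w \in A) => /=.
      by rewrite mulr1 subrr.
    by rewrite mulr0 addr0.
  - move=> F tF DF; have mF k : measurable (F k) by case: (DF k).
    have mU : measurable (\bigcup_k F k) by exact: bigcupT_measurable.
    split=> //; apply: pgood_lim => [|e e0]; first exact: cintb_cind.
    pose S n w : R[i] := \sum_(k < n) cind (F k) w.
    have gS n : pgood (S n).
      rewrite /S; elim: n => [|n IH].
        by rewrite (_ : (fun w => _) = fun=> 0); [exact: pgood_cst|apply/funext => w; rewrite big_ord0].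
      rewrite (_ : (fun w => _) = fun w => (\sum_(k < n) cind (F k) w) + cind (F n) w).
        by apply: pgoodD => //; case: (DF n).
      by apply/funext => w; rewrite big_ord_recr.
    (* As the sets are disjoint, the partial sums take only the values 0 and 1, which provides the
       domination. *)
    have S1 w k0 n : F k0 w -> S n w = (k0 < n)%N%:R.
      move=> wk; elim: n => [|n IH]; first by rewrite /S big_ord0.
      rewrite /S big_ord_recr/= -/(S n w) IH /cind indicE.
      have -> : (w \in F n) = (n == k0).
        apply/idP/eqP => [|->]; rewrite inE// => wn.
        by apply: (tF _ _ I I); exists w.
      have [->|nk] := eqVneq n k0; first by rewrite ltnn leqnn add0r.
      by rewrite addr0 [in RHS]ltnS [in RHS]leq_eqVlt (eq_sym k0) (negbTE nk).
    have S0 w n : ~ (\bigcup_k F k) w -> S n w = 0.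
      move=> nw; rewrite /S big1// => k _; rewrite /cind indicE memNset//.
      by move=> wk; apply: nw; exists k.
    have [_ cv] : cintb m (cind (\bigcup_k F k)) /\
        (fun n => \int[m]_x (cabs (S n x - cind (\bigcup_k F k) x))%:E)%E @ \oo --> 0%E.
      apply: (@cint_dct1 _ _ _ m _ S (fun=> 1)) => [n|w||n w].
      + by have [[]] := gS n.
      + have [[k0 _ wk]|nw] := pselect ((\bigcup_k F k) w).
          apply/ccvgP => e' e'0; exists k0.+1 => // n /= kn.
          by rewrite (S1 _ _ _ wk) kn /cind indicE mem_set ?subrr ?cabs0//; exists k0.
        apply/ccvgP => e' e'0; exists 0%N => // n _.
        by rewrite S0// /cind indicE memNset// subrr cabs0.
      + exact: integrable_cst_prob.
      + have [[k0 _ wk]|nw] := pselect ((\bigcup_k F k) w).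
          by rewrite (S1 _ _ _ wk); case: (_ < _)%N; rewrite ?cabs1 ?cabs0.
        by rewrite S0// cabs0.
    have Si n : cintb m (S n) by case: (gS n).
    move/(L1cvgP Si (cintb_cind mU)) : cv => /(_ _ e0)[N _ /(_ N (leqnn N))] h.
    by exists (S N) => //; under eq_integral do rewrite cabs_distC.
have GD : cyl_set `<=` D.
  move=> A cA.
  have mA : measurable A.
    have [F [F1 FA]] := cA.
    have [mi _] := cmeas_lim (fun k => let: And3 h _ _ := F1 k in h) FA.
    have := mi measurableT _ (measurable_set1 1); rewrite setTI.
    rewrite (_ : _ @^-1` _ = A)//; apply/seteqP; split=> w /=; rewrite indicE.
      by case: (boolP (w \in A)) => [|_ /eqP]; rewrite ?inE// eq_sym oner_eq0.
    by move=> wA; rewrite mem_set.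
  by split=> //; exact: pgood_cyl_set.
suff [] : D A0 by [].
suff : <<s cyl_set >> `<=` D by apply; exact: cyl_set_measurable.
rewrite -(setI_closed_g_dynkin_g_sigma_algebra cyl_setI).
exact: smallest_sub.
Qed.

Lemma pgood_sum (I : Type) (s : seq I) (F : I -> torus R nat -> R[i]) :
  (forall i, pgood (F i)) -> pgood (fun w => \sum_(i <- s) F i w).
Proof.
move=> gF; elim: s => [|i s IH].
  by rewrite (_ : (fun w => _) = fun=> 0); [exact: pgood_cst|apply/funext => w; rewrite big_nil].
rewrite (_ : (fun w => _) = fun w => F i w + (\sum_(i <- s) F i w)); first exact: pgoodD.
by apply/funext => w; rewrite big_cons.
Qed.

Lemma pgood_real (h : torus R nat -> R) : m.-integrable setT (EFin \o h) ->
  pgood (fun w => (h w)%:C).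
Proof.
move=> hi; have mh : measurable_fun setT h by case/integrableP: hi => /measurable_EFinP.
have ch : cintb m (fun w => (h w)%:C).
  apply: (@cintb_dom _ _ _ _ _ (fun w => `|h w|)) => [||w]; first exact: cmeas_real.
    exact: (integrable_norm hi).
  by rewrite cabs_real.
have [g [gi _ g0]] := approximation_sfun_integrable measurableT hi.
apply: pgood_lim => // e e0.
have gg n : pgood (fun w => (g n w)%:C).
  rewrite (_ : (fun w => _) = fun w => \sum_(y <- fset_set (range (g n)))
      y%:C * cind (g n @^-1` [set y]) w); last first.
    apply/funext => w; rewrite fimfunE fsbig_finite//= rmorph_sum.
    by apply: eq_bigr => y _; exact: RtoCM.
  by apply: pgood_sum => y; apply: pgoodZ; apply: pgood_cind.
have Gi n : cintb m (fun w => (g n w)%:C) by case: (gg n).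
have cv : L1cvg (fun n w => (g n w)%:C) (fun w => (h w)%:C).
  move: g0; rewrite /L1cvg; apply: cvg_trans; apply: near_eq_cvg; near=> n.
  apply: eq_integral => w _; rewrite -rmorphB cabs_real distrC.
  by rewrite -EFinB.
move/(L1cvgP Gi ch) : cv => /(_ _ e0)[N _ /(_ N (leqnn N))] hN.
by exists (fun w => (g N w)%:C) => //; under eq_integral do rewrite cabs_distC.
Unshelve. all: by end_near. Qed.

Lemma poisson_cvg_L1 f : cintb m f -> L1cvg (fun k => poisson k (prad k) f) f.
Proof.
move=> fi.
suff [_ //] : pgood f.
have -> : f = fun w => (complex.Re (f w))%:C + 'i * (complex.Im (f w))%:C.
  by apply/funext => w; rewrite -complex_ReIm; case: (f w).
apply: pgoodD; first exact: (pgood_real (cintb_Re fi)).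
by apply: pgoodZ; exact: (pgood_real (cintb_Im fi)).
Qed.

End L1_convergence.

(** * Absolute convergence of the power series on ell_2 *)

Section analytic_polynomials.
Context {R : realType}.
Local Notation m := (torus_measure R nat).
Implicit Types (w v : torus R nat) (alpha : midx) (f g : torus R nat -> R[i]).

Definition L1n f : R := fine (\int[m]_w (cabs (f w))%:E)%E.

Lemma L1nE f : cintb m f -> ((L1n f)%:E = \int[m]_w (cabs (f w))%:E)%E.
Proof.
move=> [mf foo]; rewrite /L1n fineK// ge0_fin_numE//.
by apply: integral_ge0 => w _; rewrite lee_fin cabs_ge0.
Qed.

Lemma L1n_ge0 f : 0 <= L1n f.
Proof. by rewrite /L1n fine_ge0// integral_ge0// => w _; rewrite lee_fin cabs_ge0. Qed.

Lemma cabs_cintegral_L1n f : cintb m f -> cabs (cintegral m f) <= L1n f.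
Proof. by move=> fi; rewrite -lee_fin L1nE//; exact: cabs_cintegral. Qed.

Lemma L1n_le f g (S : R) : cintb m f -> cintb m g ->
  (forall w, cabs (f w) <= S * cabs (g w)) -> 0 <= S -> L1n f <= S * L1n g.
Proof.
move=> fi gi fg S0; rewrite -lee_fin EFinM !L1nE// -ge0_integralZl//.
- apply: ge0_le_integral => //.
  + by move=> w _; rewrite lee_fin cabs_ge0.
  + by apply: cmeas_cabsE; case: fi.
  + by apply: measurable_funeM; apply: cmeas_cabsE; case: gi.
  + by move=> w _; rewrite -EFinM lee_fin.
- by apply: cmeas_cabsE; case: gi.
- by move=> w _; rewrite lee_fin cabs_ge0.
Qed.

Lemma cintegral_tcoordX j (k : int) :
  cintegral m (fun v => tcoord v j ^ k) = (k == 0)%:R :> R[i].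
Proof.
have h v : tcoord v j ^ k = chi j.+1 (fun i => if i == j then k else 0) v :> R[i].
  rewrite /chi (bigD1 ord_max)//= eqxx big1 ?mulr1// => i.
  by rewrite -val_eqE/= => /negbTE ->; rewrite expr0z.
under eq_cintegral do rewrite h.
rewrite cintegral_chi; congr (nat_of_bool _)%:R.
apply/forallP/eqP => [/(_ ord_max)/eqP /=|-> i]; first by rewrite eqxx.
by case: ifP.
Qed.

Lemma cintb_tcoordX j (k : int) : cintb m (fun v => tcoord v j ^ k : R[i]).
Proof.
apply: (@cintb_bound _ _ _ _ _ 1) => [|v]; first exact: cmeas_tcoordX.
by rewrite cabsXz cabs_tcoord exp1rz.
Qed.

Section one_variable_polynomial.
Variables (j M : nat) (a : nat -> R[i]).
Let F v : R[i] := \sum_(n < M) a n * tcoord v j ^+ n.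

Lemma cintb_poly1 : cintb m F.
Proof.
apply: cintb_sum => n; apply: cintbZ; exact: (cintb_tcoordX j (Posz n)).
Qed.

Let int_poly1 (k : int) : cintegral m (fun v => tcoord v j ^ k * F v) =
  \sum_(n < M) a n * (k + n%:Z == 0)%:R.
Proof.
rewrite (@eq_cintegral _ _ _ _ _ (fun v => \sum_(n < M) a n * tcoord v j ^ (k + n%:Z))).
  rewrite cintegral_sum => [|n]; last by apply: cintbZ; exact: cintb_tcoordX.
  by apply: eq_bigr => n _; rewrite cintegralZ ?cintegral_tcoordX//; exact: cintb_tcoordX.
move=> v; rewrite /F mulr_sumr; apply: eq_bigr => n _.
by rewrite expfzDr ?tcoord_neq0// mulrCA.
Qed.

(* Test F against the multiplier 1 + u - conj u with u = c conj(v_j)^(n+1) and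
   |c| = x; as u - conj u is imaginary, it has modulus at most sqrt (1 + 4x^2). *)
Lemma poly1_pair n (x : R) : (n.+1 < M)%N -> 0 <= x ->
  cabs (a 0) + x * cabs (a n.+1) <= Num.sqrt (1 + 4 * x ^+ 2) * L1n F.
Proof.
move=> nM x0.
(* The phases of [c] align [c * a n.+1] with [a 0], so that no cancellation takes place. *)
pose c := x%:C * phase (a 0) * (phase (a n.+1))^*%C.
pose u v : R[i] := c * tcoord v j ^ (Negz n).
pose psi v : R[i] := 1 + (u v - (u v)^*%C).
have Fi := cintb_poly1.
have cc : cabs c = x by rewrite /c !cabsM cabsJ !cabs_phase !mulr1 cabs_real ger0_norm.
have uJ v : (u v)^*%C = c^*%C * tcoord v j ^+ n.+1.
  rewrite /u rmorphM; congr (_ * _).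
  by rewrite NegzE -exprnN -exprVn rmorphXn/= fmorphV/= circle_conjE invrK.
have psi_bound v : cabs (psi v) <= Num.sqrt (1 + 4 * x ^+ 2).
  rewrite -(ler_sqr) ?nnegrE ?cabs_ge0 ?sqrtr_ge0//.
  rewrite sqr_sqrtr; last by rewrite addr_ge0// mulr_ge0// sqr_ge0.
  have : complex.Im (u v) ^+ 2 <= x ^+ 2.
    have -> : x = cabs (u v) by rewrite cabsM cabsXz cabs_tcoord exp1rz mulr1.
    by rewrite [leRHS]cabs_sqr lerDr sqr_ge0.
  by rewrite cabs_sqr /psi; case: (u v) => s t /=; nra.
(* The constant 1 picks out [a 0], [u] picks out [a n.+1], and conj u would pick out a coefficient
   of negative index, which [F] does not have: the term that keeps |psi| close to 1 costs
   nothing. *)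
have psi_int : cintegral m (fun v => psi v * F v) = a 0 + c * a n.+1.
  rewrite (@eq_cintegral _ _ _ _ _ (fun v => (tcoord v j ^ (0:int) * F v + c * (tcoord v j ^ (Negz n) * F v)) -
    c^*%C * (tcoord v j ^ (Posz n.+1) * F v))); last first.
    by move=> v; rewrite /psi uJ /u expr0z -exprnP; ring.
  have ki (k : int) : cintb m (fun v => tcoord v j ^ k * F v).
    apply: (eq_cintb (fun v => mulrC _ _)); apply: (@cintbM _ _ _ _ _ _ 1) => //.
      exact: cmeas_tcoordX.
    by move=> v; rewrite cabsXz cabs_tcoord exp1rz.
  rewrite cintegralB; [|by apply: cintbD => //; exact: cintbZ|exact: cintbZ].
  rewrite cintegralD//; last exact: cintbZ.
  rewrite !(cintegralZ _ (ki _)) !int_poly1.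
  have M0 : (0 < M)%N by exact: leq_trans nM.
  rewrite (bigD1 (Ordinal M0))//= mulr1 big1 ?addr0; last first.
    by move=> i; rewrite -val_eqE/= add0r => /negbTE i0; rewrite eqz_nat i0 mulr0.
  rewrite (bigD1 (Ordinal nM))//= NegzE addNr eqxx mulr1 big1 ?addr0; last first.
    by move=> i; rewrite -val_eqE/= addrC subr_eq0 eqz_nat => /negbTE ->; rewrite mulr0.
  by rewrite [X in _ - _ * X]big1 ?mulr0 ?subr0// => i _; rewrite mulr0.
have -> : cabs (a 0) + x * cabs (a n.+1) = cabs (a 0 + c * a n.+1).
  have -> : a 0 + c * a n.+1 = (cabs (a 0) + x * cabs (a n.+1))%:C * phase (a 0).
    rewrite [in LHS](phaseE (a 0)) [in LHS](phaseE (a n.+1)) /c RtoCD RtoCM.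
    have := phaseJ (a n.+1); set p := phase (a n.+1); set q := p^*%C => pq.
    have -> : x%:C * phase (a 0) * q * ((cabs (a n.+1))%:C * p) =
      x%:C * phase (a 0) * (p * q) * (cabs (a n.+1))%:C by ring.
    by rewrite pq; ring.
  by rewrite cabsM cabs_phase mulr1 cabs_real ger0_norm// addr_ge0 ?mulr_ge0 ?cabs_ge0.
have psi_m : cmeas psi.
  have mu : cmeas u by apply: cmeasZ; exact: cmeas_tcoordX.
  by apply: cmeasD; [exact: cmeas_cst|apply: cmeasB => //; exact: cmeasJ].
have pFi : cintb m (fun v => psi v * F v).
  by apply: (eq_cintb (fun v => mulrC _ _)); exact: cintbM psi_bound.
rewrite -psi_int; apply: (le_trans (cabs_cintegral_L1n pFi)).
apply: L1n_le (sqrtr_ge0 _) => // v.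
by rewrite cabsM ler_wpM2r ?cabs_ge0.
Qed.

Lemma poly1_head : (0 < M)%N -> cabs (a 0) <= L1n F.
Proof.
move=> M0; have Fi := cintb_poly1.
have -> : a 0 = cintegral m F.
  rewrite -[F]/(fun v => F v) (@eq_cintegral _ _ _ _ _ (fun v => tcoord v j ^ (0 : int) * F v)).
    rewrite int_poly1 (bigD1 (Ordinal M0))//= mulr1 big1 ?addr0// => i.
    by rewrite -val_eqE/= add0r => /negbTE i0; rewrite eqz_nat i0 mulr0.
  by move=> v; rewrite expr0z mul1r.
exact: cabs_cintegral_L1n.
Qed.

End one_variable_polynomial.

(* The deviation from 1 is quadratic in rho, so that the product of the factors
   converges along square-summable radii. *)
Definition Bfac (rho : R) : R := 1 + 2 * (rho / (1 - rho)) ^+ 2.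

Lemma Bfac_ge1 rho : 1 <= Bfac rho.
Proof. by rewrite /Bfac lerDl mulr_ge0// sqr_ge0. Qed.

(** Average of [poly1_pair] over n with weights rho^(n+1) / W, where W is the sum of these powers,
    and with x = W: this restores [a 0] once and each other coefficient with its power of rho. *)
Lemma poly1_sum j M (a : nat -> R[i]) (rho : R) : 0 <= rho < 1 ->
  \sum_(n < M.+1) rho ^+ n * cabs (a n) <=
  Bfac rho * L1n (fun v => \sum_(n < M.+1) a n * tcoord v j ^+ n).
Proof.
move=> /andP[r0 r1]; set N := L1n _; have N0 : 0 <= N := L1n_ge0 _.
rewrite big_ord_recl expr0 mul1r.
pose W : R := \sum_(n < M) rho ^+ n.+1.
have W0 : 0 <= W by apply: sumr_ge0 => n _; rewrite exprn_ge0.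
have q0 : 0 <= rho / (1 - rho) by rewrite divr_ge0// subr_ge0 ltW.
have Wq : W <= rho / (1 - rho).
  rewrite /W (eq_bigr (fun n : 'I_M => rho * rho ^+ n)) => [|n _]; last by rewrite exprS.
  by rewrite -mulr_sumr ler_wpM2l// real_geom_sum_le// r0.
have h0 : cabs (a 0) <= N by exact: poly1_head.
(* 1 + 4 y <= (1 + 2 y)^2 with y = W^2, and W is at most rho / (1 - rho). *)
have hs : Num.sqrt (1 + 4 * W ^+ 2) <= Bfac rho.
  have W2 : W ^+ 2 <= (rho / (1 - rho)) ^+ 2 by rewrite ler_sqr ?nnegrE.
  rewrite -ler_sqr ?nnegrE ?sqrtr_ge0 ?(le_trans ler01 (Bfac_ge1 _))//.
  rewrite sqr_sqrtr; last by rewrite addr_ge0// mulr_ge0// sqr_ge0.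
  rewrite /Bfac; have := sqr_ge0 W; set y := W ^+ 2 in W2 *; set z := _ ^+ 2 in W2 *.
  by clearbody y z; nra.
(* Without higher terms, or for rho = 0, the weights cannot be normalised, but then only [a 0]
   contributes. *)
have [W00|W00] := eqVneq W 0.
  rewrite big1 => [|n _].
    by rewrite addr0 (le_trans h0)// ler_peMl// Bfac_ge1.
  have : rho ^+ n.+1 <= W by rewrite /W (bigD1 n)//= lerDl sumr_ge0// => i _; rewrite exprn_ge0.
  rewrite W00 => h; have -> : rho ^+ n.+1 = 0 by apply/eqP; rewrite eq_le h exprn_ge0.
  by rewrite mul0r.
have Wgt : 0 < W by rewrite lt_def W00.
rewrite -(ler_pM2l Wgt).
have -> : W * (cabs (a 0) + \sum_(i < M) rho ^+ bump 0 i * cabs (a (bump 0 i))) =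
    \sum_(i < M) rho ^+ i.+1 * (cabs (a 0) + W * cabs (a i.+1)).
  under [in RHS]eq_bigr do rewrite mulrDr.
  rewrite big_split/= -mulr_suml mulrDr; congr (_ + _).
  by rewrite mulr_sumr; apply: eq_bigr => i _; rewrite mulrCA.
rewrite {2}/W mulr_suml; apply: ler_sum => i _; rewrite ler_wpM2l ?exprn_ge0//.
apply: (le_trans (poly1_pair j a (n := i) (M := M.+1) (ltn_ord i : (i.+1 < M.+1)%N) W0)).
exact: ler_wpM2r.
Qed.

Definition mono alpha w : R[i] := \prod_(i <- finsupp alpha) tcoord w i ^+ alpha i.

Lemma cmeas_mono alpha : cmeas (mono alpha).
Proof. by apply: cmeas_prod => i; apply: cmeasX; exact: cmeas_tcoord. Qed.

Lemma cabs_mono alpha w : cabs (mono alpha w) = 1.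
Proof. by rewrite cabs_prod big1// => i _; rewrite cabsX cabs_tcoord expr1n. Qed.

Lemma mono_tmul alpha w v : mono alpha (tmul w v) = mono alpha w * mono alpha v.
Proof. by rewrite /mono -big_split; apply: eq_bigr => i _; rewrite tmulE exprMn. Qed.

(** Multiplication by this point rotates coordinate [j] alone. Averaging over such rotations, which
    preserve the measure, takes the place of integrating in the single variable [j]. *)
Definition tproj j v : torus R nat := fun i => if i == j then v j else circle_one.

Lemma tcoord_tproj j v i : tcoord (tproj j v) i = if i == j then tcoord v j else 1.
Proof. by rewrite /tcoord /tproj; case: eqP. Qed.

Lemma measurable_tmul_tproj j :
  measurable_fun setT (fun z : torus R nat * torus R nat => tmul z.1 (tproj j z.2)).
Proof.
apply: measurable_to_torus => i.
apply: (@eq_cmeas _ _ _ _ (fun z : torus R nat * torus R nat =>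
   tcoord z.1 i * (if i == j then tcoord z.2 j else 1))).
  by move=> z; rewrite tmulE tcoord_tproj.
apply: cmeasM; first exact: (cmeas_comp (@cmeas_tcoord R nat i) measurable_fst).
case: eqP => _; last exact: cmeas_cst.
exact: (cmeas_comp (@cmeas_tcoord R nat j) measurable_snd).
Qed.

Lemma mono_tproj alpha j v : mono alpha (tproj j v) = tcoord v j ^+ alpha j.
Proof.
rewrite /mono; have [ja|ja] := boolP (j \in finsupp alpha).
  rewrite (big_fsetD1 j)//= tcoord_tproj eqxx big1_fset ?mulr1// => i.
  by rewrite !inE => /andP[/negbTE ij _] _; rewrite tcoord_tproj ij expr1n.
rewrite (fsfun_dflt ja) expr0 big_seq big1// => i ia; rewrite tcoord_tproj.
by case: eqP => [ij|]; rewrite ?expr1n//; move: ja; rewrite -ij ia.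
Qed.

Definition hpoly (A : {fset midx}) (c : midx -> R[i]) w : R[i] :=
  \sum_(alpha <- A) c alpha * mono alpha w.

Lemma cmeas_hpoly A c : cmeas (hpoly A c).
Proof. by apply: cmeas_sum => alpha; apply: cmeasZ; exact: cmeas_mono. Qed.

Lemma cintb_hpoly A c : cintb m (hpoly A c).
Proof.
apply: (@cintb_bound _ _ _ _ _ (\sum_(alpha <- A) cabs (c alpha))) => [|w].
  exact: cmeas_hpoly.
apply: (le_trans (cabs_sum _ _ _)); apply: ler_sum => alpha _.
by rewrite cabsM cabs_mono mulr1.
Qed.

(** The multi-indices keep their entry [n] at [j]: the factor w_j^n has modulus 1 and does not
    affect L_1 norms, and no index has to be shifted. *)
Definition csec (j n : nat) (c : midx -> R[i]) alpha : R[i] := if alpha j == n then c alpha else 0.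

Lemma hpoly_tproj (A : {fset midx}) c j M w v : (forall alpha, alpha \in A -> (alpha j <= M)%N) ->
  hpoly A c (tmul w (tproj j v)) = \sum_(n < M.+1) hpoly A (csec j n c) w * tcoord v j ^+ n.
Proof.
move=> AM; rewrite /hpoly.
under [RHS]eq_bigr do rewrite mulr_suml.
rewrite exchange_big/=; rewrite !big_seq; apply: eq_bigr => alpha alphaA.
have aM : (alpha j < M.+1)%N by rewrite ltnS AM.
rewrite (bigD1 (Ordinal aM))//= big1 ?addr0 => [|i].
  by rewrite /csec eqxx mono_tmul mono_tproj mulrA.
by rewrite -val_eqE/= eq_sym => /negbTE h; rewrite /csec h !mul0r.
Qed.

(** Along the rotations of coordinate [j] through a fixed [w] the polynomial has one variable, and
    its coefficients are the sections at [w]; [poly1_sum] is then integrated over [w]. *)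
Lemma L1n_section (A : {fset midx}) c j M (rho : R) : 0 <= rho < 1 ->
  (forall alpha, alpha \in A -> (alpha j <= M)%N) ->
  \sum_(n < M.+1) rho ^+ n * L1n (hpoly A (csec j n c)) <= Bfac rho * L1n (hpoly A c).
Proof.
move=> r01 AM; have /andP[r0 _] := r01.
have B0 : 0 <= Bfac rho by rewrite (le_trans ler01)// Bfac_ge1.
have c0 (F : torus R nat -> R[i]) w : [set: torus R nat] w -> (0 <= (cabs (F w))%:E)%E.
  by rewrite lee_fin cabs_ge0.
pose G (z : torus R nat * torus R nat) := (cabs (hpoly A c (tmul z.1 (tproj j z.2))))%:E.
have mG : measurable_fun setT G by apply: cmeas_cabsE; exact: (cmeas_comp (cmeas_hpoly A c) (measurable_tmul_tproj j)).
have G0 z : (0 <= G z)%E by rewrite lee_fin cabs_ge0.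
have mh : measurable_fun setT (fun w => (cabs (hpoly A c w))%:E).
  by apply: cmeas_cabsE; exact: cmeas_hpoly.
(* For fixed [v] the rotation by [tproj j v] preserves the L_1 norm, so averaging over [v] changes
   nothing. *)
have EG : (\int[m]_w \int[m]_v G (w, v) = (L1n (hpoly A c))%:E)%E.
  rewrite fubini_tonelli//.
  transitivity (\int[m]_v (L1n (hpoly A c))%:E)%E.
    apply: eq_integral => v _; rewrite L1nE; last exact: cintb_hpoly.
    rewrite [RHS](ge0_integral_tmul (tproj j v)) => [|//|w]; last by rewrite lee_fin cabs_ge0.
    apply: eq_integral => w _; rewrite /G /=; congr (cabs (hpoly A c _))%:E.
    by apply/funext => i; apply: circle_inj; rewrite !circle_mulE mulrC.
  by rewrite integral_cst//= probability_setT mule1.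
rewrite -lee_fin EFinM -EG -sumEFin.
under eq_bigr => n _ do rewrite EFinM (L1nE (cintb_hpoly _ _)).
have ms n : measurable_fun setT (fun w => (cabs (hpoly A (csec j n c) w))%:E).
  by apply: cmeas_cabsE; exact: cmeas_hpoly.
have key n : ((rho ^+ n)%:E * \int[m]_w (cabs (hpoly A (csec j n c) w))%:E =
    \int[m]_w ((rho ^+ n)%:E * (cabs (hpoly A (csec j n c) w))%:E))%E.
  by rewrite ge0_integralZl ?lee_fin ?exprn_ge0// => w _; rewrite lee_fin cabs_ge0.
under eq_bigr do rewrite key.
rewrite -ge0_integral_sum//; last 2 first.
- by move=> n; apply: measurable_funeM.
- by move=> n w _; rewrite -EFinM lee_fin mulr_ge0 ?cabs_ge0// exprn_ge0.
have mF := measurable_fun_fubini_tonelli_F G mG G0.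
rewrite -ge0_integralZl; [|by []|exact: (mF _)|by move=> w _; apply: integral_ge0|by rewrite lee_fin].
apply: ge0_le_integral; first by [].
- by move=> w _; apply: sume_ge0 => n _; rewrite -EFinM lee_fin mulr_ge0 ?cabs_ge0// exprn_ge0.
- by apply: emeasurable_sum => n; apply: measurable_funeM.
- by apply: measurable_funeM; exact: (mF _).
- move=> w _.
  have -> : (\int[m]_v G (w, v) = (L1n (fun v =>
      \sum_(n < M.+1) hpoly A (csec j n c) w * tcoord v j ^+ n))%:E)%E.
    rewrite L1nE; last exact: (cintb_poly1 j M.+1 (fun n => hpoly A (csec j n c) w)).
    by apply: eq_integral => v _; rewrite /G /= (hpoly_tproj _ _ _ AM).
  rewrite -EFinM; under eq_bigr do rewrite -EFinM.
  by rewrite sumEFin lee_fin; exact: (poly1_sum j M (fun n => hpoly A (csec j n c) w) r01).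
Qed.

(* One variable is integrated out at a time, which multiplies the constants. *)
Lemma hpoly_l1 (A : {fset midx}) (rho : nat -> R) N c : (forall j, 0 <= rho j < 1) ->
  (forall alpha beta, alpha \in A -> beta \in A -> c alpha != 0 -> c beta != 0 ->
     forall j, (N <= j)%N -> alpha j = beta j) ->
  \sum_(alpha <- A) cabs (c alpha) * \prod_(j < N) rho j ^+ alpha j <=
  (\prod_(j < N) Bfac (rho j)) * L1n (hpoly A c).
Proof.
move=> r01; elim: N c => [|N IH] c cA.
  (* For N = 0 all indices with a nonzero coefficient coincide, and a single monomial has constant
     modulus. *)
  rewrite big_ord0 mul1r; under eq_bigr do rewrite big_ord0 mulr1.
  have [[a0 a0A ca0]|nc] := pselect (exists2 a0, a0 \in A & c a0 != 0); last first.
    rewrite big_seq big1 ?L1n_ge0// => alpha aA; apply/eqP; rewrite cabs_eq0.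
    by apply/negPn/negP => ca; apply: nc; exists alpha.
  have cz alpha : alpha \in A -> alpha != a0 -> c alpha = 0.
    move=> aA aa0; apply/eqP/negPn/negP => ca; case/eqP: aa0; apply/fsfunP => j.
    exact: (cA _ _ aA a0A ca ca0).
  have hE w : hpoly A c w = c a0 * mono a0 w.
    rewrite /hpoly (big_fsetD1 a0)//= big1_fset ?addr0// => alpha.
    by rewrite !inE => /andP[aa0 aA] _; rewrite cz// mul0r.
  rewrite (big_fsetD1 a0)//= big1_fset ?addr0; last first.
    by move=> alpha; rewrite !inE => /andP[aa0 aA] _; rewrite cz// cabs0.
  rewrite -lee_fin L1nE; last exact: cintb_hpoly.
  under eq_integral do rewrite hE cabsM cabs_mono mulr1.
  by rewrite integral_cst//= probability_setT mule1.
pose M := (\sum_(alpha <- A) alpha N)%N.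
have AM alpha : alpha \in A -> (alpha N <= M)%N.
  by move=> aA; rewrite /M (big_fsetD1 alpha)//= leq_addr.
have B0 : 0 <= \prod_(j < N) Bfac (rho j).
  by apply: prodr_ge0 => j _; rewrite (le_trans ler01)// Bfac_ge1.
rewrite big_ord_recr/= -mulrA.
apply: (@le_trans _ _ (\prod_(j < N) Bfac (rho j) *
  \sum_(n < M.+1) rho N ^+ n * L1n (hpoly A (csec N n c)))); last first.
  by rewrite ler_wpM2l// L1n_section.
rewrite mulr_sumr.
have -> : \sum_(alpha <- A) cabs (c alpha) * \prod_(j < N.+1) rho j ^+ alpha j =
  \sum_(n < M.+1) rho N ^+ n * \sum_(alpha <- A) cabs (csec N n c alpha) * \prod_(j < N) rho j ^+ alpha j.
  under [RHS]eq_bigr do rewrite mulr_sumr.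
  rewrite exchange_big/= !big_seq; apply: eq_bigr => alpha aA.
  have aM : (alpha N < M.+1)%N by rewrite ltnS AM.
  rewrite (bigD1 (Ordinal aM))//= [X in _ + X]big1 ?addr0 => [|i].
    by rewrite /csec eqxx big_ord_recr/= mulrA mulrC.
  by rewrite -val_eqE/= eq_sym => /negbTE h; rewrite /csec h cabs0 mul0r mulr0.
apply: ler_sum => n _; have /andP[rN0 _] := r01 N.
rewrite mulrCA ler_wpM2l ?exprn_ge0//; apply: IH => alpha beta aA bA.
rewrite /csec; case: (eqVneq (alpha N) (n : nat)) => [an|_]; last by rewrite eqxx.
case: (eqVneq (beta N) (n : nat)) => [bn|_]; last by rewrite eqxx.
move=> ca cb j; rewrite leq_eqVlt => /orP[/eqP <-|Nj]; first by rewrite an bn.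
exact: cA.
Qed.

End analytic_polynomials.

Lemma fset_sum_le {R : realType} (K : choiceType) (a : K -> R) (A B : {fset K}) :
  (forall i, 0 <= a i) -> (A `<=` B)%fset -> \sum_(i <- A) a i <= \sum_(i <- B) a i.
Proof.
move=> a0 /fsubsetP AB; rewrite (big_fsetID _ (mem A) B)/=.
have -> : \sum_(i <- [fset x | x in B & x \in A]%fset) a i = \sum_(i <- A) a i.
  by apply: eq_fbigl => i; rewrite !inE; case: (boolP (i \in A)) => [/AB ->|]; rewrite ?andbF.
by rewrite lerDl; apply: sumr_ge0.
Qed.

(** * Unordered sums of complex families *)

Section complex_sums.
Context {R : realType} {I : choiceType}.
Implicit Types (a b : I -> R[i]) (A B : {fset I}).

Definition csum a (S : R[i]) := forall e : R, 0 < e -> exists A, forall B,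
  (A `<=` B)%fset -> cabs (\sum_(i <- B) a i - S) < e.

Lemma csum_cvg a S : csum a S -> fset_sum a @ fset_filter --> (S : R[i]^o).
Proof.
move=> h; apply/cvgrPdist_lt => e e0.
have ee : e = (complex.Re e)%:C by rewrite RRe_real// gtr0_real.
have e0' : 0 < complex.Re e by rewrite -ltcR -ee.
have [A hA] := h _ e0'; exists A => B AB.
by rewrite ee distrC cabsE ltcR; exact: hA.
Qed.

Lemma csum_summable a S : csum a S -> unordered_summable a.
Proof. by move=> /csum_cvg h; apply/cvg_ex; exists S. Qed.

Lemma csum_sum a S : csum a S -> unordered_sum a = S.
Proof. by move=> /csum_cvg h; apply: cvg_lim h. Qed.

Lemma csumD a b S T : csum a S -> csum b T -> csum (fun i => a i + b i) (S + T).
Proof.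
move=> ha hb e e0; have e20 : 0 < e / 2 by rewrite divr_gt0.
have [A hA] := ha _ e20; have [B hB] := hb _ e20.
exists (A `|` B)%fset => C; rewrite fsubUset => /andP[/hA h1 /hB h2].
rewrite big_split/= opprD addrACA (le_lt_trans (cabsD _ _))//; lra.
Qed.

Lemma csumZ a S c : csum a S -> csum (fun i => c * a i) (c * S).
Proof.
move=> ha e e0; have c0 : 0 < cabs c + 1 by rewrite ltr_wpDl ?cabs_ge0.
have [A hA] := ha _ (divr_gt0 e0 c0); exists A => B /hA.
rewrite ltr_pdivlMr// -mulr_sumr -mulrBr cabsM mulrC; apply: le_lt_trans.
by rewrite ler_wpM2r ?cabs_ge0// lerDl.
Qed.

Lemma csumB a b S T : csum a S -> csum b T ->
  csum (fun i => a i - b i) (S - T).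
Proof.
move=> aS bT; have := csumD aS (csumZ (-1) bT); rewrite mulN1r.
by have -> : (fun i => a i + -1 * b i) = (fun i => a i - b i)
  by apply/funext => i; rewrite mulN1r.
Qed.

Lemma csum_real_ge0 (a : I -> R) (C : R) : (forall i, 0 <= a i) ->
  (forall A, \sum_(i <- A) a i <= C) -> exists S, csum (fun i => (a i)%:C) S%:C.
Proof.
move=> a0 aC; pose X := range (fun A => \sum_(i <- A) a i).
have X0 : has_sup X by split; [exists (\sum_(i <- fset0) a i); exists fset0|exists C => _ [A _ <-]].
exists (sup X) => e e0.
have [_ [A _ <-] hA] := sup_adherent e0 X0; exists A => B AB.
have h1 : \sum_(i <- B) a i <= sup X by apply: ub_le_sup; [case: X0|exists B].
have h2 : \sum_(i <- A) a i <= \sum_(i <- B) a i by exact: fset_sum_le.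
rewrite -rmorph_sum -rmorphB cabs_real ler0_norm ?subr_le0//; lra.
Qed.

Lemma csum_ex a (C : R) : (forall A, \sum_(i <- A) cabs (a i) <= C) -> exists S, csum a S.
Proof.
move=> aC.
have key (u : I -> R) : (forall i, `|u i| <= cabs (a i)) -> exists S, csum (fun i => (u i)%:C) S.
  move=> ua.
  (* A real family is the difference of the nonnegative families |u| + u and |u|. *)
  have [i|A|S1 h1] := @csum_real_ge0 (fun i => `|u i| + u i) (C + C).
  - by have := ler_norm (- u i); rewrite normrN; lra.
  - rewrite big_split/=; apply: lerD; apply: le_trans (aC A); apply: ler_sum => i _ //.
    exact: le_trans (ler_norm _) (ua i).
  have [i|A|S2 h2] := @csum_real_ge0 (fun i => `|u i|) C.
  - exact: normr_ge0.
  - by apply: le_trans (aC A); apply: ler_sum.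
  exists (S1%:C + -1 * S2%:C); have := csumD h1 (csumZ (-1) h2).
  by congr csum; apply/funext => i; rewrite RtoCD mulN1r addrAC subrr add0r.
have [S1 h1] := key _ (fun i => Re_le_cabs (a i)).
have [S2 h2] := key _ (fun i => Im_le_cabs (a i)).
exists (S1 + 'i * S2); have := csumD h1 (csumZ 'i h2).
by congr csum; apply/funext => i; rewrite -complex_ReIm; case: (a i).
Qed.

Lemma csum_bound a S (C : R) : (forall A, \sum_(i <- A) cabs (a i) <= C) -> csum a S ->
  cabs S <= C.
Proof.
move=> aC aS; apply/ler_addgt0Pr => e e0; have [A /(_ A (fsubset_refl _)) hA] := aS _ e0.
have -> : S = \sum_(i <- A) a i - (\sum_(i <- A) a i - S) by rewrite opprB addrC subrK.
apply: (le_trans (cabsB _ _)); apply: lerD; last exact: ltW.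
exact: le_trans (cabs_sum _ _ _) (aC A).
Qed.

(** The sets [X n] need not be nested: once [X n] contains the part of [A] where [a] is nonzero,
    enlarging it by [A] only adds zero terms. *)
Lemma csum_seq a S (X : nat -> {fset I}) : csum a S ->
  (forall i, a i != 0 -> \forall n \near \oo, i \in X n) ->
  ccvg (fun n => \sum_(i <- X n) a i) S.
Proof.
move=> aS aX; apply/ccvgP => e e0; have [A hA] := aS _ e0.
have : \forall n \near \oo, forall i, i \in A -> a i != 0 -> i \in X n.
  have : forall s : seq I, \forall n \near \oo, forall i, i \in s -> a i != 0 -> i \in X n.
    elim=> [|i s IH]; first by near=> n.
    have [ai|ai] := eqVneq (a i) 0.
      by move: IH; apply: filterS => n h j; rewrite inE => /orP[/eqP ->|/h//]; rewrite ai eqxx.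
    move: IH (aX i ai); apply: filterS2 => n h iX j.
    by rewrite inE => /orP[/eqP ->|/h].
  by apply.
apply: filterS => n h.
have -> : \sum_(i <- X n) a i = \sum_(i <- (A `|` X n)%fset) a i.
  rewrite (big_fsetID _ (fun i => i \in X n) (A `|` X n)%fset)/= [X in _ + X]big1_fset ?addr0.
    apply: eq_fbigl => i; rewrite !inE; apply/idP/andP => [->|[]//]; first by rewrite orbT.
  move=> i; rewrite !inE => /andP[iAX iX] _; apply/eqP/negPn/negP => ai.
  by move: iAX; rewrite (negbTE iX) orbF => /h /(_ ai); rewrite (negbTE iX).
exact: hA (fsubsetUl _ _).
Unshelve. all: by end_near. Qed.

End complex_sums.

(** * Coefficient bounds for functions in H_1 *)

Section hardy_coefficients.
Context {R : realType}.
Local Notation m := (torus_measure R nat).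
Implicit Types (w v : torus R nat) (alpha : midx) (f g : torus R nat -> R[i]).

(** It contains [Hp_torus p] for every p >= 1, and what concerns [phi] apart from L_p norms is
    proved for this class. *)
Definition H1 f := cintb m f /\ forall alpha : zmidx,
  ~ (forall j, 0 <= alpha j) -> fourier_coef f alpha = 0.

Definition hcoef f alpha : R[i] := fourier_coef f (zmidx_of alpha).

Lemma zmidx_ofE alpha j : zmidx_of alpha j = (alpha j)%:Z.
Proof.
rewrite /zmidx_of fsfunE; case: ifPn => //.
by rewrite mem_finsupp negbK => /eqP ->.
Qed.

Lemma prod_finsupp n alpha (x : nat -> R[i]) : (forall j, (n <= j)%N -> alpha j = 0%N) ->
  \prod_(i <- finsupp alpha) x i ^+ alpha i = \prod_(j < n) x j ^+ alpha j.
Proof.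
move=> an; rewrite -(big_mkord xpredT (fun j => x j ^+ alpha j)).
rewrite [RHS](bigID [pred j | j \in finsupp alpha])/= [X in _ * X]big1 ?mulr1.
  rewrite -[RHS]big_filter; apply: perm_big; apply: uniq_perm.
  - exact: fset_uniq.
  - by rewrite filter_uniq// iota_uniq.
  - move=> j; rewrite mem_filter mem_index_iota/= andb_idr// mem_finsupp => aj.
    by rewrite ltnNge; apply/negP => nj; rewrite an ?eqxx in aj.
by move=> j; rewrite mem_finsupp negbK => /eqP ->; rewrite expr0.
Qed.

Lemma prod_finsuppR n alpha (x : nat -> R) : (forall j, (n <= j)%N -> alpha j = 0%N) ->
  \prod_(i <- finsupp alpha) x i ^+ alpha i = \prod_(j < n) x j ^+ alpha j.
Proof.
move=> an; apply: (@complexI R); rewrite !rmorph_prod.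
under eq_bigr do rewrite rmorphXn; rewrite (prod_finsupp (fun i => (x i)%:C) an).
by apply: eq_bigr => j _; rewrite rmorphXn.
Qed.

Definition mkm n M (p : {ffun 'I_n -> 'I_M.+1}) : midx :=
  [fsfun j in [fset j | j in iota 0 n]%fset =>
    (if (insub j : option 'I_n) is Some i then (p i : nat) else 0%N) | 0%N].

Lemma mkmE n M (p : {ffun 'I_n -> 'I_M.+1}) (j : 'I_n) : mkm p j = p j.
Proof. by rewrite /mkm fsfunE !inE mem_iota add0n ltn_ord/= valK. Qed.

Lemma mkm0 n M (p : {ffun 'I_n -> 'I_M.+1}) j : (n <= j)%N -> mkm p j = 0%N.
Proof. by move=> nj; rewrite /mkm fsfunE !inE mem_iota add0n ltnNge nj. Qed.

Lemma mkm_inj n M : injective (@mkm n M).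
Proof. by move=> p q pq; apply/ffunP => j; apply: val_inj; rewrite /= -!mkmE pq. Qed.

Definition mbox n M : {fset midx} := [fset mkm p | p in {: {ffun 'I_n -> 'I_M.+1}}]%fset.

Lemma mem_mbox n M alpha : (forall j, (n <= j)%N -> alpha j = 0%N) ->
  (forall j, (j < n)%N -> (alpha j <= M)%N) -> alpha \in mbox n M.
Proof.
move=> a0 aM; apply/imfsetP; exists [ffun j : 'I_n => inord (alpha j)] => //=.
apply/fsfunP => j; have [jn|nj] := ltnP j n.
  by rewrite (mkmE _ (Ordinal jn)) ffunE inordK// ltnS aM.
by rewrite mkm0 ?a0.
Qed.

Lemma mbox0 n M alpha j : alpha \in mbox n M -> (n <= j)%N -> alpha j = 0%N.
Proof. by move=> /imfsetP[p _ ->] nj; rewrite mkm0. Qed.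

Lemma sum_mbox (V : nmodType) n M (F : midx -> V) :
  \sum_(alpha <- mbox n M) F alpha = \sum_(p : {ffun 'I_n -> 'I_M.+1}) F (mkm p).
Proof. by rewrite big_imfset//= => [|p q _ _]; [rewrite big_enum|exact: mkm_inj]. Qed.

Lemma poissonM_H1 n r M f w : H1 f -> poissonM n r M f w =
  \sum_(alpha <- mbox n M) hcoef f alpha * \prod_(j < n) (r%:C * tcoord w j) ^+ alpha j.
Proof.
move=> [fi fh]; rewrite poissonME// sum_mbox.
(* Exponent vectors with a negative entry meet a vanishing Fourier coefficient; the others are those
   of [mbox n M]. *)
rewrite (bigID (fun p : {ffun 'I_n -> bool * 'I_M.+1} => [forall j, ~~ (p j).1]))/=.
rewrite [X in _ + X]big1 ?addr0 => [|p /forallPn[j]]; last first.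
  rewrite negbK => pj; rewrite fourE fh ?mulr0// => /(_ j).
  by rewrite zmkE ltn_ord fexpE /ngexp pj.
pose h (q : {ffun 'I_n -> 'I_M.+1}) : {ffun 'I_n -> bool * 'I_M.+1} := [ffun j => (false, q j)].
rewrite (reindex_onto h (fun p => [ffun j => (p j).2])) => [|p /forallP pf]; last first.
  by apply/ffunP => j; rewrite !ffunE; have := pf j; case: (p j) => [[] k].
apply: eq_big => [q|q _].
  apply/andP; split; first by apply/forallP => j; rewrite ffunE.
  by apply/eqP/ffunP => j; rewrite !ffunE.
rewrite mulrC; congr (_ * _).
  rewrite fourE; congr fourier_coef; apply/fsfunP => j; rewrite zmkE zmidx_ofE.
  case: ltnP => jn; last by rewrite mkm0.
  by rewrite (mkmE _ (Ordinal jn)) (fexpE _ (Ordinal jn)) ffunE.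
rewrite /chi -big_split; apply: eq_bigr => j _.
by rewrite mkmE fexpE ffunE /ngexp /= exprMn.
Qed.

Lemma poissonM_hpoly n r M f w : H1 f -> poissonM n r M f w =
  hpoly (mbox n M) (fun alpha => hcoef f alpha * \prod_(i <- finsupp alpha) r%:C ^+ alpha i) w.
Proof.
move=> fH; rewrite poissonM_H1// /hpoly !big_seq; apply: eq_bigr => alpha ab.
have a0 j := mbox0 (j := j) ab.
rewrite /mono (prod_finsupp (fun=> r%:C) a0) (prod_finsupp (tcoord w) a0) -mulrA -big_split.
by congr (_ * _); apply: eq_bigr => j _; rewrite exprMn.
Qed.

Lemma poissonM_bound n r M f w : 0 <= r < 1 -> cintb m f ->
  cabs (poissonM n r M f w) <= (2 / (1 - r)) ^+ n * L1n f.
Proof.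
move=> r01 fi; have ki : cintb m (fun v => f v * kernM n r M w v).
  by apply: cintbM fi (cmeas_kernM n r M w) (fun v => kernM_bound n M w v r01).
apply: (le_trans (cabs_cintegral_L1n ki)); apply: L1n_le => // [v|].
  by rewrite cabsM mulrC ler_wpM2r ?cabs_ge0// kernM_bound.
by rewrite exprn_ge0// divr_ge0// subr_ge0 ltW//; case/andP: r01.
Qed.

Lemma cmeas_poissonM n r M f : cintb m f -> cmeas (poissonM n r M f).
Proof.
move=> fi; apply: (eq_cmeas (fun w => poissonME n r M w fi)).
by apply: cmeas_sum => p; apply: cmeasM; [apply: cmeasZ; exact: cmeas_chi|exact: cmeas_cst].
Qed.

Lemma cintb_poissonM n r M f : 0 <= r < 1 -> cintb m f -> cintb m (poissonM n r M f).
Proof.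
move=> r01 fi; apply: (@cintb_bound _ _ _ _ _ ((2 / (1 - r)) ^+ n * L1n f)).
  exact: cmeas_poissonM.
by move=> w; exact: poissonM_bound.
Qed.

Lemma poissonM_L1 n r f : 0 <= r < 1 -> cintb m f ->
  L1cvg (fun M => poissonM n r M f) (poisson n r f).
Proof.
move=> r01 fi; apply: (proj2 (@cint_dct1 _ _ _ m _ (fun M => poissonM n r M f)
  (fun=> (2 / (1 - r)) ^+ n * L1n f) _ _ _ _)).
- by move=> M; exact: cmeas_poissonM.
- by move=> w; exact: poissonM_cvg.
- exact: integrable_cst_prob.
- by move=> M w; exact: poissonM_bound.
Qed.

Lemma L1nD f g : cintb m f -> cintb m g -> L1n (fun w => f w + g w) <= L1n f + L1n g.
Proof.
move=> fi gi; rewrite -lee_fin EFinD !L1nE//; last exact: cintbD.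
exact: L1_triangle.
Qed.

Lemma L1cvg_L1n F f : (forall k, cintb m (F k)) -> cintb m f -> L1cvg F f ->
  forall e : R, 0 < e -> \forall k \near \oo, L1n (fun w => F k w - f w) <= e.
Proof.
move=> Fi fi /(L1cvgP Fi fi) h e /h; apply: filterS => k.
by rewrite -L1nE; [rewrite lee_fin|exact: cintbB].
Qed.

(** As [f] is not a polynomial, the estimate is applied to its Poisson integrals with truncated
    kernels, whose L_1 norms do not exceed that of [f] in the limit; then r tends to 1 in a finite
    sum. *)
Lemma hcoef_l1 f (A : {fset midx}) (rho : nat -> R) N : H1 f ->
  (forall j, 0 <= rho j < 1) -> (forall alpha j, alpha \in A -> (N <= j)%N -> alpha j = 0%N) ->
  \sum_(alpha <- A) cabs (hcoef f alpha) * \prod_(j < N) rho j ^+ alpha j <=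
  (\prod_(j < N) Bfac (rho j)) * L1n f.
Proof.
move=> fH r01 AN; have [fi _] := fH.
set P := \prod_(j < N) Bfac (rho j).
have P0 : 0 <= P by apply: prodr_ge0 => j _; rewrite (le_trans ler01)// Bfac_ge1.
have rp alpha : 0 <= \prod_(j < N) rho j ^+ alpha j.
  by apply: prodr_ge0 => j _; rewrite exprn_ge0//; case/andP: (r01 j).
have step r : 0 <= r < 1 ->
    \sum_(alpha <- A) cabs (hcoef f alpha) * \prod_(j < N) (r * rho j) ^+ alpha j <= P * L1n f.
  move=> r1; have /andP[r0 _] := r1.
  have pi := cintb_poisson N r1 fi; have pMi M := cintb_poissonM N M r1 fi.
  apply: (@le_trans _ _ (P * L1n (poisson N r f))); last first.
    by rewrite ler_wpM2l// -lee_fin !L1nE//; exact: poisson_L1.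
  apply/ler_addgt0Pr => e e0; have e1 : 0 < e / (P + 1) by rewrite divr_gt0// ltr_wpDl.
  pose M0 := (\sum_(alpha <- A) \sum_(j < N) alpha j)%N.
  have [M1 _ hM1] := L1cvg_L1n pMi pi (poissonM_L1 N r1 fi) e1.
  pose M := maxn M0 M1; have MA : {subset A <= mbox N M}.
    move=> alpha aA; apply: mem_mbox => j jN; first exact: AN aA jN.
    rewrite leq_max; apply/orP; left; rewrite /M0 (big_fsetD1 alpha)//= (bigD1 (Ordinal jN))//=.
    by rewrite -addnA leq_addr.
  pose c alpha := hcoef f alpha * \prod_(i <- finsupp alpha) r%:C ^+ alpha i.
  have hb := @hpoly_l1 R (mbox N M) rho N c r01.
  apply: (@le_trans _ _ (\sum_(alpha <- mbox N M) cabs (c alpha) * \prod_(j < N) rho j ^+ alpha j)).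
    apply: (@le_trans _ _ (\sum_(alpha <- A) cabs (c alpha) * \prod_(j < N) rho j ^+ alpha j)).
      rewrite !big_seq; apply: ler_sum => alpha aA.
      rewrite /c cabsM (prod_finsupp (fun=> r%:C) (fun j => AN alpha j aA)) cabs_prod -mulrA -big_split/=.
      rewrite le_eqVlt; apply/orP; left; apply/eqP; congr (_ * _); apply: eq_bigr => j _.
      by rewrite cabsX cabs_real ger0_norm// exprMn.
    apply: fset_sum_le => [alpha|]; first by rewrite mulr_ge0 ?cabs_ge0.
    exact/fsubsetP.
  apply: (le_trans (hb _)) => [alpha beta aM bM _ _ j Nj|].
    by rewrite (mbox0 aM Nj) (mbox0 bM Nj).
  have -> : hpoly (mbox N M) c = poissonM N r M f.
    by apply/funext => w; rewrite poissonM_hpoly.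
  have : L1n (poissonM N r M f) <= L1n (poisson N r f) + e / (P + 1).
    have := L1nD (cintbB (pMi M) pi) pi.
    rewrite (_ : (fun w => _) = poissonM N r M f); last by apply/funext => w; rewrite subrK.
    move=> /le_trans; apply; rewrite addrC lerD2l; apply: hM1.
    by rewrite /= leq_maxr.
  move=> /(ler_wpM2l P0) /le_trans; apply; rewrite mulrDr lerD2l mulrCA.
  apply: ler_piMr; first exact: ltW.
  by rewrite ler_pdivrMr ?mul1r ?lerDl// ltr_wpDl.
have cv : ccvg (fun k => (\sum_(alpha <- A) cabs (hcoef f alpha) *
    \prod_(j < N) (prad k * rho j) ^+ alpha j)%:C)
    (\sum_(alpha <- A) cabs (hcoef f alpha) * \prod_(j < N) rho j ^+ alpha j)%:C.
  under eq_fun do rewrite rmorph_sum; rewrite rmorph_sum; apply: ccvg_sum => alpha _.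
  rewrite rmorphM; under eq_fun do rewrite rmorphM; apply: ccvgZ.
  under eq_fun do rewrite rmorph_prod; rewrite rmorph_prod; apply: ccvg_prod => j _.
  under eq_fun do rewrite rmorphXn; rewrite rmorphXn; apply: ccvgX.
  rewrite -[X in ccvg _ X]mul1r; under eq_fun do rewrite rmorphM.
  by apply: ccvgM; [exact: ccvg_prad|exact: ccvg_cst].
have := ccvg_bound (B := P * L1n f) _ cv; rewrite cabs_real => h.
apply: (le_trans (ler_norm _)); apply: h; near=> k.
rewrite cabs_real ger0_norm; first by apply: step; exact: prad01.
apply: sumr_ge0 => alpha _; rewrite mulr_ge0 ?cabs_ge0// prodr_ge0// => j _.
by rewrite exprn_ge0// mulr_ge0//; [case/andP: (prad01 (R := R) k)|case/andP: (r01 j)].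
Unshelve. all: by end_near. Qed.

(** 1 + x <= exp x turns the product into the exponential of a sum of squares; the common bound s <
    1 keeps the denominators away from 0. *)
Lemma Bfac_prod (rho : nat -> R) (s K : R) N : s < 1 -> (forall j, 0 <= rho j <= s) ->
  \sum_(j < N) rho j ^+ 2 <= K ->
  \prod_(j < N) Bfac (rho j) <= expR (2 * K / (1 - s) ^+ 2).
Proof.
move=> s1 rs rK; have s10 : 0 < 1 - s by rewrite subr_gt0.
apply: (@le_trans _ _ (\prod_(j < N) expR (2 * rho j ^+ 2 / (1 - s) ^+ 2))).
  apply: ler_prod => j _; rewrite (le_trans ler01 (Bfac_ge1 _))/=.
  apply: le_trans (expR_ge1Dx _); rewrite /Bfac lerD2l -mulrA ler_wpM2l//.
  have /andP[r0 r1] := rs j; have rj1 := le_lt_trans r1 s1.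
  have h : rho j / (1 - rho j) <= rho j / (1 - s).
    by rewrite ler_wpM2l// lef_pV2 ?posrE ?subr_gt0// lerD2l lerN2.
  have h0 : 0 <= rho j / (1 - rho j) by rewrite divr_ge0// subr_ge0 ltW.
  by rewrite -expr_div_n ler_sqr ?nnegrE// (le_trans h0).
rewrite -expR_sum ler_expR -mulr_suml -mulr_sumr ler_wpM2r ?invr_ge0 ?sqr_ge0//.
by rewrite ler_wpM2l.
Qed.

Lemma hcoef_bound f (A : {fset midx}) (rho : nat -> R) (s K : R) : H1 f -> s < 1 ->
  (forall j, 0 <= rho j <= s) -> (forall N, \sum_(j < N) rho j ^+ 2 <= K) ->
  \sum_(alpha <- A) cabs (hcoef f alpha) * \prod_(i <- finsupp alpha) rho i ^+ alpha i <=
  expR (2 * K / (1 - s) ^+ 2) * L1n f.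
Proof.
move=> fH s1 rs rK.
have [N AN] : exists N, forall alpha j, alpha \in A -> (N <= j)%N -> alpha j = 0%N.
  exists (\sum_(alpha <- A) \sum_(i <- finsupp alpha) i.+1)%N => alpha j aA.
  rewrite (big_fsetD1 alpha)//= => h; apply/eqP; apply: contraLR h => aj.
  rewrite -ltnNge (leq_trans _ (leq_addr _ _))// (big_fsetD1 j) ?mem_finsupp//=.
  by rewrite leq_addr.
have r01 j : 0 <= rho j < 1 by have /andP[-> /le_lt_trans ->] := rs j.
apply: le_trans (_ : _ <= (\prod_(j < N) Bfac (rho j)) * L1n f) _.
  apply: le_trans (hcoef_l1 fH r01 AN); rewrite !big_seq; apply: ler_sum => alpha aA.
  by rewrite (prod_finsuppR rho (fun j => AN alpha j aA)).
by rewrite ler_wpM2r ?L1n_ge0//; exact: Bfac_prod.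
Qed.

End hardy_coefficients.

Lemma sqrD_le {R : realFieldType} (a b : R) : (a + b) ^+ 2 <= 2 * a ^+ 2 + 2 * b ^+ 2.
Proof. by have := sqr_ge0 (a - b); rewrite sqrrB sqrrD; lra. Qed.

(** * The function phi f *)

Section ell2_norm.
Context {R : realType}.
Implicit Types z h : ell2 R.

Definition l2n z : R := fine (l2norm z).

Lemma l2n_ge0 z : 0 <= l2n z.
Proof. by rewrite /l2n fine_ge0// Lnorm_ge0. Qed.

Lemma ell2_normE z : `|z| = (l2n z)%:C.
Proof. by []. Qed.

Lemma l2n_series z : (\sum_(0 <= n <oo) (cabs (z n) ^+ 2)%:E = (l2n z ^+ 2)%:E)%E.
Proof.
have := l2norm_fin z; rewrite -/(l2n z) l2normE; set S := (X in (X `^ _)%E) => h.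
have S0 : (0 <= S)%E by apply: nneseries_ge0 => n _ _; rewrite lee_fin exprn_ge0 ?cabs_ge0.
have : ((S `^ 2^-1) `^ 2 = (l2n z ^+ 2)%:E)%E.
  by rewrite h poweR_EFin powR_mulrn ?l2n_ge0.
by rewrite -poweRrM mulVf ?pnatr_eq0// poweRe1.
Qed.

Lemma l2n_sum z N : \sum_(j < N) cabs (z j) ^+ 2 <= l2n z ^+ 2.
Proof.
rewrite -lee_fin -l2n_series -sumEFin -(big_mkord xpredT (fun j => (cabs (z j) ^+ 2)%:E)).
by apply: nneseries_lim_ge => n _ _; rewrite lee_fin exprn_ge0 ?cabs_ge0.
Qed.

Lemma cabs_le_l2n z j : cabs (z j) <= l2n z.
Proof.
rewrite -ler_sqr ?nnegrE ?cabs_ge0 ?l2n_ge0//; apply: le_trans (l2n_sum z j.+1).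
by rewrite big_ord_recr/= lerDr sumr_ge0// => i _; rewrite sqr_ge0.
Qed.

Lemma l2n_le z (K : R) : 0 <= K -> (forall N, \sum_(j < N) cabs (z j) ^+ 2 <= K ^+ 2) -> l2n z <= K.
Proof.
move=> K0 h; rewrite -ler_sqr ?nnegrE ?l2n_ge0// -lee_fin -l2n_series.
apply: lime_le; first by apply: is_cvg_nneseries => n _ _; rewrite lee_fin exprn_ge0 ?cabs_ge0.
by near=> N; rewrite big_mkord sumEFin lee_fin.
Unshelve. all: by end_near. Qed.

Lemma l2nZ a z : l2n (a *: z) = cabs a * l2n z.
Proof.
have : `|a *: z| = `|a| * `|z| by exact: normrZ.
by rewrite !ell2_normE cabsE -RtoCM => /(congr1 (@complex.Re R)).
Qed.

Lemma polydisc2P z : polydisc2 z -> exists2 s : R, 0 <= s < 1 & forall n, cabs (z n) <= s.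
Proof.
rewrite /polydisc2 /=; set S := ereal_sup _ => S1.
have zS n : ((cabs (z n))%:E <= S)%E by apply: ereal_sup_ubound; exists n.
have S0 : (0 <= S)%E by apply: le_trans (zS 0%N); rewrite lee_fin cabs_ge0.
have Sf : S \is a fin_num by rewrite ge0_fin_numE// (lt_trans S1)// ltry.
exists (fine S); first by rewrite fine_ge0//= -lte_fin fineK.
by move=> n; rewrite -lee_fin fineK.
Qed.

Lemma polydisc2_le z (s : R) : s < 1 -> (forall n, cabs (z n) <= s) -> polydisc2 z.
Proof.
move=> s1 zs; rewrite /polydisc2 /=; apply: (@le_lt_trans _ _ s%:E); last by rewrite lte_fin.
by apply: ge_ereal_sup => _ [n _ <-]; rewrite lee_fin.
Qed.

Lemma gt0_RtoC (e : R[i]) : 0 < e -> e = (complex.Re e)%:C /\ 0 < complex.Re e.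
Proof.
move=> e0; have ee : e = (complex.Re e)%:C by rewrite RRe_real// gtr0_real.
by split=> //; rewrite -ltcR -ee.
Qed.

(** Power series come with a remainder quadratic in the increment; this reads the Frechet
    differential off such an expansion. *)
Lemma differentiable_ell2 (g : ell2 R -> R[i]) z (L : ell2 R -> R[i]) (B K d : R) :
  (forall a h h', L (a *: h + h') = a * L h + L h') ->
  (forall h, cabs (L h) <= B * l2n h) -> 0 < d -> 0 <= K ->
  (forall h, l2n h < d -> cabs (g (z + h) - g z - L h) <= K * l2n h ^+ 2) ->
  differentiable (g : ell2 R -> R[i]^o) z.
Proof.
move=> Ll LB d0 K0 gL.
have Llin : linear (L : ell2 R -> R[i]^o) by move=> a h h'; rewrite Ll.
pose LL : {linear ell2 R -> R[i]^o} := HB.pack (L : ell2 R -> R[i]^o)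
  (GRing.isLinear.Build R[i] (ell2 R) R[i]^o _ (L : ell2 R -> R[i]^o) Llin).
have cL : continuous (LL : ell2 R -> R[i]^o).
  apply: bounded_linear_continuous; apply/linear_boundedP; exists (`|B|)%:C.
  split=> [|r rB h]; first by rewrite ger0_real// lecR.
  rewrite cabsE ell2_normE; apply: (@le_trans _ _ (`|B| * l2n h)%:C).
    by rewrite lecR (le_trans (LB h))// ler_wpM2r ?l2n_ge0// ler_norm.
  by rewrite RtoCM ler_wpM2r ?lecR ?l2n_ge0// ltW.
have eL : (g : ell2 R -> R[i]^o) \o shift z = cst (g z : R[i]^o) + (LL : ell2 R -> R[i]^o) +o_ (0 : ell2 R) id.
  apply/eqaddoP => e e0; have [ee e0'] := gt0_RtoC e0.
  have K1 : 0 < K + 1 by rewrite ltr_wpDl.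
  apply/nbhs_norm0P; exists (Num.min d (complex.Re e / (K + 1)))%:C.
    by rewrite /= ltcR lt_min d0 divr_gt0.
  move=> h /=; rewrite ell2_normE ltcR lt_min => /andP[hd he].
  rewrite [X in `|X|](_ : _ = g (z + h) - g z - L h); last first.
    by rewrite -[LHS]/(g (h + z) - (g z + L h)) opprD addrA (addrC h).
  rewrite cabsE [in leRHS]ee -RtoCM lecR; apply: (le_trans (gL h hd)).
  rewrite expr2 mulrA ler_wpM2r ?l2n_ge0//; move: he; rewrite ltr_pdivlMr// => /ltW he.
  by apply: le_trans he; rewrite mulrC ler_wpM2l ?l2n_ge0// lerDl.
by apply/diff_locallyP; rewrite (diff_unique cL eL).
Qed.

Lemma differentiable_ell2_expand (g : ell2 R -> R[i]) z :
  differentiable (g : ell2 R -> R[i]^o) z ->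
  exists L : ell2 R -> R[i], (forall a h, L (a *: h) = a * L h) /\
   forall e : R, 0 < e -> exists2 d : R, 0 < d & forall h, l2n h < d ->
     cabs (g (z + h) - g z - L h) <= e * l2n h.
Proof.
move=> /diff_locallyP[cL eL].
exists ('d (g : ell2 R -> R[i]^o) z); split; first by move=> a h; rewrite linearZ.
move=> e e0; move/eqaddoP : eL => /(_ e%:C); rewrite ltcR => /(_ e0)/nbhs_norm0P[d /= d0 hd].
have [dd d0'] := gt0_RtoC d0; exists (complex.Re d) => // h hlt.
have := hd h; rewrite /= ell2_normE dd ltcR => /(_ hlt).
rewrite [X in `|X| <= _](_ : _ = g (z + h) - g z - 'd (g : ell2 R -> R[i]^o) z h); last first.
  by rewrite -[LHS]/(g (h + z) - (g z + 'd (g : ell2 R -> R[i]^o) z h)) opprD addrA (addrC h).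
by rewrite cabsE -RtoCM lecR.
Qed.

Lemma differentiable_ell2_continuous (g : ell2 R -> R[i]) z :
  differentiable (g : ell2 R -> R[i]^o) z ->
  forall e : R, 0 < e -> exists2 d : R, 0 < d & forall h, l2n h < d ->
     cabs (g (z + h) - g z) < e.
Proof.
move=> /differentiable_continuous /cvgrPdist_lt cg e e0.
have := cg e%:C; rewrite ltcR => /(_ e0) /nbhs_normP[d /= d0 hd].
have [dd d0'] := gt0_RtoC d0; exists (complex.Re d) => // h hlt.
have := hd (z + h); rewrite /ball_ /= opprD addrA subrr sub0r normrN ell2_normE dd ltcR => /(_ hlt).
by rewrite distrC cabsE ltcR.
Qed.

End ell2_norm.

(** * First-order expansion of monomials *)

Section monomial_expansion.
Context {R : realType}.

(** The part of the product of the a_i + b_i that is linear in b. Lists with repetitions, as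
    produced by [mseq], take the place of exponents, so that no binomial coefficients appear. *)
Fixpoint dprod (s : seq nat) (a b : nat -> R[i]) : R[i] :=
  if s is i :: s' then b i * (\prod_(j <- s') a j) + a i * dprod s' a b else 0.

Lemma dprod_linear s a c (b b' : nat -> R[i]) :
  dprod s a (fun j => c * b j + b' j) = c * dprod s a b + dprod s a b'.
Proof. by elim: s => [|i s IH] /=; rewrite ?mulr0 ?addr0// IH; ring. Qed.

(** Expand the products: each term is majorised by the corresponding term of the product of the A_j
    + B_j. Terms with at least one factor b gain a factor t, those with at least two gain t^2,
    because t <= 1. *)
Lemma dprod_bound s (a b : nat -> R[i]) (A B : nat -> R) (t : R) : 0 <= t <= 1 ->
  (forall j, cabs (a j) <= A j) -> (forall j, cabs (b j) <= t * B j) ->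
  (forall j, 0 <= B j) ->
  let P := \prod_(j <- s) (A j + B j) in
  [/\ cabs (\prod_(j <- s) (a j + b j)) <= P, cabs (\prod_(j <- s) a j) <= P,
     cabs (dprod s a b) <= t * P,
     cabs (\prod_(j <- s) (a j + b j) - \prod_(j <- s) a j) <= t * P &
     cabs (\prod_(j <- s) (a j + b j) - \prod_(j <- s) a j - dprod s a b) <= t ^+ 2 * P].
Proof.
move=> /andP[t0 t1] aA bB B0.
have A0 j : 0 <= A j by rewrite (le_trans _ (aA j))// cabs_ge0.
elim: s => [|i s IH] /=.
  by rewrite !big_nil !subrr cabs0 cabs1 lexx !mulr_ge0// sqr_ge0.
rewrite !big_cons; move: IH.
set P := \prod_(j <- s) (A j + B j); set p' := \prod_(j <- s) (a j + b j).
set p := \prod_(j <- s) a j; set D := dprod s a b => -[h1 h2 h3 h4 h5].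
have P0 : 0 <= P by rewrite (le_trans _ h1)// cabs_ge0.
have ABP : (A i + B i) * P = A i * P + B i * P by rewrite mulrDl.
have tB : t * B i <= B i by rewrite ler_piMl.
have mulC (x y : R[i]) (X Y : R) : cabs x <= X -> cabs y <= Y -> cabs (x * y) <= X * Y.
  by move=> hx hy; rewrite cabsM ler_pM ?cabs_ge0.
have bB' : cabs (b i) <= B i by rewrite (le_trans (bB i)).
split.
- apply: mulC => //; apply: (le_trans (cabsD _ _)); exact: lerD.
- by apply: mulC => //; rewrite (le_trans (aA i))// lerDl.
- apply: (le_trans (cabsD _ _)); have e1 := mulC _ _ _ _ (bB i) h2; have e2 := mulC _ _ _ _ (aA i) h3.
  apply: (le_trans (lerD e1 e2)); rewrite ABP; lra.
- have -> : (a i + b i) * p' - a i * p = a i * (p' - p) + b i * p' by ring.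
  apply: (le_trans (cabsD _ _)); have e1 := mulC _ _ _ _ (aA i) h4; have e2 := mulC _ _ _ _ (bB i) h1.
  apply: (le_trans (lerD e1 e2)); rewrite ABP; lra.
- have -> : (a i + b i) * p' - a i * p - (b i * p + a i * D) = a i * (p' - p - D) + b i * (p' - p) by ring.
  apply: (le_trans (cabsD _ _)); have e1 := mulC _ _ _ _ (aA i) h5; have e2 := mulC _ _ _ _ (bB i) h4.
  apply: (le_trans (lerD e1 e2)); rewrite ABP; rewrite le_eqVlt; apply/orP; left; apply/eqP; ring.
Qed.

Definition mseq (alpha : midx) : seq nat := flatten [seq nseq (alpha j) j | j <- finsupp alpha].

Lemma mseqE (T : comPzRingType) (alpha : midx) (x : nat -> T) :
  \prod_(j <- finsupp alpha) x j ^+ alpha j = \prod_(i <- mseq alpha) x i.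
Proof.
rewrite /mseq big_flatten big_map; apply: eq_bigr => j _.
by rewrite big_nseq -Monoid.iteropE; elim: (alpha j) => [|n IH] //=; rewrite exprS IH.
Qed.

End monomial_expansion.

Section phi_theory.
Context {R : realType}.
Local Notation m := (torus_measure R nat).
Implicit Types (w v : torus R nat) (alpha : midx) (f : torus R nat -> R[i]) (z : ell2 R).

Lemma phi_l1 f z (s K : R) (A : {fset midx}) : H1 f -> s < 1 ->
  (forall n, cabs (z n) <= s) -> (forall N, \sum_(j < N) cabs (z j) ^+ 2 <= K) ->
  \sum_(alpha <- A) cabs (hardy_term f z alpha) <= expR (2 * K / (1 - s) ^+ 2) * L1n f.
Proof.
move=> fH s1 zs zK.
apply: le_trans (hcoef_bound A (rho := fun j => cabs (z j)) fH s1 _ zK); last first.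
  by move=> j; rewrite cabs_ge0 zs.
rewrite le_eqVlt; apply/orP; left; apply/eqP; apply: eq_bigr => alpha _.
rewrite /hardy_term cabsM /monomial cabs_prod; congr (_ * _).
by apply: eq_bigr => j _; rewrite cabsX.
Qed.

Lemma phi_csum f z : H1 f -> polydisc2 z -> csum (hardy_term f z) (phi f z).
Proof.
move=> fH /polydisc2P[s /andP[s0 s1] zs].
have [S hS] := csum_ex (fun A => phi_l1 A fH s1 zs (l2n_sum z)).
by rewrite /phi (csum_sum hS).
Qed.

Definition zseq n (x : nat -> R[i]) (j : nat) : R[i] := if (j < n)%N then x j else 0.

Lemma zseq_subproof n x : (l2norm (zseq n x) < +oo)%E.
Proof.
rewrite l2normE; apply: poweR_lty.
rewrite (nneseries_split 0 n) => [|k _]; last by rewrite lee_fin exprn_ge0 ?cabs_ge0.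
rewrite add0n eseries0 ?adde0 ?sumEFin ?ltry// => k nk _.
by rewrite /zseq ltnNge nk cabs0 expr0n.
Qed.

(** Finitely supported points with arbitrary coordinates, whereas [torus_point] has the same radius
    in all of them. *)
Definition zpt n x : ell2 R := Ell2 (zseq_subproof n x).

Lemma zptE n x j : zpt n x j = if (j < n)%N then x j else 0. Proof. by []. Qed.

Lemma zpt_polydisc n x (s : R) : 0 <= s < 1 -> (forall j, (j < n)%N -> cabs (x j) <= s) ->
  polydisc2 (zpt n x).
Proof.
move=> /andP[s0 s1] xs; apply: (polydisc2_le s1) => j; rewrite zptE.
by case: ifPn => [/xs//|_]; rewrite cabs0.
Qed.

Lemma monomial_zpt n x alpha : (forall j, (n <= j)%N -> alpha j = 0%N) ->
  monomial alpha (zpt n x) = \prod_(j < n) x j ^+ alpha j.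
Proof.
move=> a0; rewrite /monomial (prod_finsupp (zpt n x) a0); apply: eq_bigr => j _.
by rewrite zptE ltn_ord.
Qed.

Lemma monomial_zpt0 n x alpha j : (n <= j)%N -> alpha j != 0%N -> monomial alpha (zpt n x) = 0.
Proof.
move=> nj aj; rewrite /monomial (big_fsetD1 j) ?mem_finsupp// zptE ltnNge nj /=.
by rewrite expr0n (negbTE aj) mul0r.
Qed.

Lemma phi_zpt f n x (s : R) : H1 f -> 0 <= s < 1 -> (forall j, (j < n)%N -> cabs (x j) <= s) ->
  ccvg (fun M => \sum_(alpha <- mbox n M) hcoef f alpha * \prod_(j < n) x j ^+ alpha j)
    (phi f (zpt n x)).
Proof.
move=> fH s01 xs; have := csum_seq (X := mbox n) (phi_csum fH (zpt_polydisc s01 xs)).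
have -> : (fun M => \sum_(alpha <- mbox n M) hardy_term f (zpt n x) alpha) =
    (fun M => \sum_(alpha <- mbox n M) hcoef f alpha * \prod_(j < n) x j ^+ alpha j).
  apply/funext => M; rewrite big_seq [RHS]big_seq; apply: eq_bigr => alpha ab.
  by rewrite /hardy_term monomial_zpt// => j nj; exact: (mbox0 ab nj).
apply=> alpha; rewrite /hardy_term mulf_eq0 negb_or => /andP[_ ma].
have a0 j : (n <= j)%N -> alpha j = 0%N.
  by move=> nj; apply/eqP; apply: contra_neqT ma => aj; rewrite (monomial_zpt0 _ nj).
exists (\sum_(j < n) alpha j)%N => // M /= aM; apply: mem_mbox => // j jn.
by rewrite (leq_trans _ aM)// (bigD1 (Ordinal jn))//= leq_addr.
Qed.

(** Both sides are limits of the same finite sums: the boxes exhaust the power series at a finitely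
    supported point, and the truncated kernels tend to the Poisson kernel. *)
Lemma phi_poisson f n (r : R) w : H1 f -> 0 <= r < 1 ->
  phi f (zpt n (fun j => r%:C * tcoord w j)) = poisson n r f w.
Proof.
move=> fH r01; have [fi _] := fH; have /andP[r0 r1] := r01.
apply: ccvg_unique (poissonM_cvg n w r01 fi).
under eq_fun do rewrite poissonM_H1//.
apply: (phi_zpt fH r01) => j _.
by rewrite cabsM cabs_tcoord mulr1 cabs_real ger0_norm.
Qed.

(** The coefficients are summable against the larger point |z_j| + B_j of ell_2, where B is the
    increment rescaled to length d. Relative to B an increment h has size t = |h| / d, and
    [dprod_bound] gives the remainder the factor t^2. *)
Lemma phi_holomorphic f : H1 f -> holomorphic (phi f).
Proof.
move=> fH z z1; have [s /andP[s0 s1] zs] := polydisc2P z1.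
(* Half the distance from s to 1, so that |z_j| + B_j stays below s + d < 1. *)
pose d : R := (1 - s) / 2; have d0 : 0 < d by rewrite divr_gt0// subr_gt0.
have dneq : d != 0 by rewrite gt_eqF.
have sd1 : s + d < 1 by rewrite /d; lra.
pose K := 2 * (l2n z ^+ 2 + d ^+ 2).
pose C0 := expR (2 * K / (1 - (s + d)) ^+ 2) * L1n f.
have C00 : 0 <= C0 by rewrite mulr_ge0 ?expR_ge0 ?L1n_ge0.
pose Bh (h : ell2 R) j := d * cabs (h j) / l2n h.
have Bh0 h j : l2n h = 0 -> Bh h j = 0 by rewrite /Bh => ->; rewrite invr0 mulr0.
have Bge0 h j : 0 <= Bh h j.
  by rewrite /Bh divr_ge0 ?l2n_ge0// mulr_ge0 ?cabs_ge0// ltW.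
have tP (h : ell2 R) j : cabs (h j) <= l2n h / d * Bh h j.
  have [h0|h0] := eqVneq (l2n h) 0; first by rewrite h0 !mul0r -h0 cabs_le_l2n.
  rewrite le_eqVlt; apply/orP; left; apply/eqP; rewrite /Bh; field.
  by rewrite h0 dneq.
have Bd h j : Bh h j <= d.
  have [h0|h0] := eqVneq (l2n h) 0; first by rewrite Bh0// ltW.
  have h0' : 0 < l2n h by rewrite lt_def h0 l2n_ge0.
  have : d * cabs (h j) <= d * l2n h by rewrite ler_wpM2l ?cabs_le_l2n// ltW.
  by rewrite /Bh ler_pdivrMr.
have key h (A : {fset midx}) :
    \sum_(alpha <- A) cabs (hcoef f alpha) * \prod_(j <- finsupp alpha) (cabs (z j) + Bh h j) ^+ alpha j <= C0.
  apply: (hcoef_bound A (rho := fun j => cabs (z j) + Bh h j)) => //.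
    by move=> j; rewrite addr_ge0 ?cabs_ge0//= lerD.
  move=> N; apply: (@le_trans _ _ (\sum_(j < N) (2 * cabs (z j) ^+ 2 + 2 * Bh h j ^+ 2))).
    by apply: ler_sum => j _; exact: sqrD_le.
  rewrite big_split/= -!mulr_sumr -mulrDr ler_wpM2l// lerD ?l2n_sum//.
  have [h0|h0] := eqVneq (l2n h) 0.
    by rewrite big1 ?sqr_ge0// => j _; rewrite Bh0// expr0n.
  have -> : \sum_(j < N) Bh h j ^+ 2 = (d / l2n h) ^+ 2 * \sum_(j < N) cabs (h j) ^+ 2.
    by rewrite mulr_sumr; apply: eq_bigr => j _; rewrite /Bh mulrAC exprMn.
  apply: (@le_trans _ _ ((d / l2n h) ^+ 2 * l2n h ^+ 2)); first by rewrite ler_wpM2l ?sqr_ge0 ?l2n_sum.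
  by rewrite -exprMn divfK.
pose Dt (h : ell2 R) alpha := hcoef f alpha * dprod (mseq alpha) z h.
have Dbound h (A : {fset midx}) : l2n h <= d ->
    \sum_(alpha <- A) cabs (Dt h alpha) <= l2n h / d * C0 /\
    \sum_(alpha <- A) cabs (hardy_term f (z + h) alpha - hardy_term f z alpha - Dt h alpha)
       <= (l2n h / d) ^+ 2 * C0.
  move=> hd.
  have t0 : 0 <= l2n h / d by rewrite divr_ge0 ?l2n_ge0 ?(ltW d0).
  have t1 : l2n h / d <= 1 by rewrite ler_pdivrMr ?mul1r.
  have t01 : 0 <= l2n h / d <= 1 by rewrite t0 t1.
  have db alpha := @dprod_bound R (mseq alpha) z h (fun j => cabs (z j)) (Bh h) _ t01
    (fun j => lexx _) (tP h) (Bge0 h).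
  split.
    apply: le_trans (ler_wpM2l t0 (key h A)); rewrite mulr_sumr; apply: ler_sum => alpha _.
    rewrite /Dt cabsM mulrCA ler_wpM2l ?cabs_ge0// mseqE.
    by have [] := db alpha.
  apply: le_trans (ler_wpM2l (sqr_ge0 (l2n h / d)) (key h A)); rewrite mulr_sumr; apply: ler_sum => alpha _.
  rewrite /hardy_term /Dt -/(hcoef f alpha) -!mulrBr cabsM mulrCA ler_wpM2l ?cabs_ge0//.
  rewrite /monomial !mseqE.
  by have [] := db alpha.
have dprodZ c (h : ell2 R) alpha : Dt (c *: h) alpha = c * Dt h alpha.
  rewrite /Dt mulrCA; congr (_ * _).
  by elim: (mseq alpha) => [|i l IH] /=; rewrite ?mulr0// IH; ring.
(* By homogeneity the bound for small increments extends to all: scaling h by d / (|h| + d) makes it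
   short without dividing by |h|, which may be 0. *)
have DB h (A : {fset midx}) : \sum_(alpha <- A) cabs (Dt h alpha) <= C0 / d * l2n h.
  have c0 : 0 < l2n h + d by rewrite ltr_wpDl ?l2n_ge0.
  have e1 : l2n ((d / (l2n h + d))%:C *: h) = d / (l2n h + d) * l2n h.
    by rewrite l2nZ cabs_real ger0_norm// divr_ge0// ltW.
  have [|+ _] := Dbound ((d / (l2n h + d))%:C *: h) A.
    rewrite e1 mulrAC ler_pdivrMr// ler_wpM2l ?(ltW d0)// lerDl; exact: ltW.
  rewrite e1; have -> : \sum_(alpha <- A) cabs (Dt ((d / (l2n h + d))%:C *: h) alpha) =
      d / (l2n h + d) * \sum_(alpha <- A) cabs (Dt h alpha).
    rewrite mulr_sumr; apply: eq_bigr => alpha _.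
    by rewrite dprodZ cabsM cabs_real ger0_norm// divr_ge0// ltW.
  have dd0 : 0 < d / (l2n h + d) by rewrite divr_gt0.
  set q := d / (l2n h + d) in dd0 *.
  have -> : q * l2n h / d * C0 = q * (C0 / d * l2n h) by ring.
  by rewrite ler_pM2l.
have Dc h := csum_ex (DB h).
pose L h := unordered_sum (Dt h).
have LE h : csum (Dt h) (L h) by have [S hS] := Dc h; rewrite /L (csum_sum hS).
apply: (@differentiable_ell2 R (phi f) z L (C0 / d) (C0 / d ^+ 2) d) => //.
- move=> a h h'; rewrite /L; apply: csum_sum.
  have := csumD (csumZ a (LE h)) (LE h').
  have -> : (fun i => a * Dt h i + Dt h' i) = Dt (a *: h + h') => //.
  apply/funext => alpha; rewrite /Dt -[in RHS]/(fun j => a * h j + h' j).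
  by rewrite dprod_linear; ring.
- by move=> h; exact: csum_bound (DB h) (LE h).
- by rewrite divr_ge0// sqr_ge0.
- move=> h hd; have zh : polydisc2 (z + h).
    apply: (polydisc2_le sd1) => j; apply: (le_trans (cabsD _ _)).
    by rewrite lerD// (le_trans (cabs_le_l2n _ _))// ltW.
  have := csumB (csumB (phi_csum fH zh) (phi_csum fH z1)) (LE h).
  apply: csum_bound => A; have [_] := Dbound h A (ltW hd); move=> hh.
  by apply: (le_trans hh); rewrite expr_div_n mulrAC -mulrA mulrC.
Qed.

End phi_theory.

(** * Restrictions of holomorphic functions to finite tori *)

Section slices.
Context {R : realType}.
Local Notation m := (torus_measure R nat).
Implicit Types (g : ell2 R -> R[i]) (w v : torus R nat) (rho : nat -> R).

Lemma sum_sqr_le n (a : nat -> R) : (forall j, 0 <= a j) ->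
  \sum_(j < n) a j ^+ 2 <= (\sum_(j < n) a j) ^+ 2.
Proof.
move=> a0; elim: n => [|n IH]; first by rewrite !big_ord0 expr0n.
rewrite !big_ord_recr/= sqrrD lerD2r (le_trans IH)// lerDl mulrn_wge0// mulr_ge0//.
exact: sumr_ge0.
Qed.

Lemma l2n_zpt n (x : nat -> R[i]) : l2n (zpt n x) <= \sum_(j < n) cabs (x j).
Proof.
apply: l2n_le => [|N]; first by apply: sumr_ge0 => j _; exact: cabs_ge0.
apply: (@le_trans _ _ (\sum_(j < n) cabs (x j) ^+ 2)); last exact: sum_sqr_le (fun j => cabs_ge0 (x j)).
rewrite -!(big_mkord xpredT (fun j => cabs (_ j) ^+ 2)).
have [Nn|/ltnW nN] := leqP N n.
  rewrite [leRHS](@big_cat_nat _ _ _ N)//= -[leLHS]addr0 lerD//.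
    rewrite [leLHS]big_nat [leRHS]big_nat; apply: ler_sum => j /andP[_ jN].
    by rewrite /zseq (leq_trans jN Nn).
  by apply: sumr_ge0 => j _; rewrite sqr_ge0.
rewrite (@big_cat_nat _ _ _ n)//= [X in _ + X]big1_seq ?addr0.
  by rewrite [leLHS]big_nat [leRHS]big_nat; apply: ler_sum => j /andP[_ jN]; rewrite /zseq jN.
by move=> j; rewrite mem_index_iota /zseq => /andP[_ /andP[nj _]]; rewrite ltnNge nj cabs0 expr0n.
Qed.

Lemma zptD n (x y : nat -> R[i]) : zpt n y = zpt n x + zpt n (fun j => y j - x j).
Proof.
apply: ell2_inj => j; rewrite -[RHS]/(zpt n x j + zpt n (fun j => y j - x j) j) !zptE.
by case: ifP => _; rewrite ?addr0// addrC subrK.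
Qed.

Lemma holomorphic_zpt g n (x : nat -> R[i]) (e : R) : holomorphic g ->
  polydisc2 (zpt n x) -> 0 < e ->
  exists2 d : R, 0 < d & forall y, (forall j, (j < n)%N -> cabs (y j - x j) < d) ->
    cabs (g (zpt n y) - g (zpt n x)) < e.
Proof.
move=> gh xP e0; have [d d0 hd] := differentiable_ell2_continuous (gh _ xP) e0.
exists (d / n.+1%:R) => [|y xy]; first by rewrite divr_gt0.
rewrite (zptD n x y); apply: hd; apply: (le_lt_trans (l2n_zpt _ _)).
apply: (@le_lt_trans _ _ (\sum_(j < n) d / n.+1%:R)).
  by apply: ler_sum => j _; rewrite ltW// xy.
rewrite sumr_const card_ord -[_ *+ n]mulr_natl mulrCA gtr_pMr// ltr_pdivrMr// mul1r.
by rewrite ltr_nat.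
Qed.

Lemma zpt_cvg g n (u : nat -> nat -> R[i]) (x : nat -> R[i]) : holomorphic g ->
  polydisc2 (zpt n x) -> (forall j, (j < n)%N -> ccvg (fun k => u k j) (x j)) ->
  ccvg (fun k => g (zpt n (u k))) (g (zpt n x)).
Proof.
move=> gh xP ux; apply/ccvgP => e e0; have [d d0 hd] := holomorphic_zpt gh xP e0.
have : \forall k \near \oo, forall j : 'I_n, cabs (u k j - x j) < d.
  by apply: filter_forall => j; move/ccvgP: (ux j (ltn_ord j)) => /(_ _ d0).
by apply: filterS => k h; apply: hd => j jn; exact: (h (Ordinal jn)).
Qed.

Section discretization.
Context {d} {X : measurableType d}.

Lemma cmeas_countable (C : countType) (q : X -> C) (G : C -> R[i]) :
  (forall c, measurable (q @^-1` [set c])) -> cmeas (fun x => G (q x)).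
Proof.
move=> mq; have H (u : C -> R) : measurable_fun setT (fun x => u (q x)).
  move=> _ B mB; rewrite setTI.
  have -> : (fun x => u (q x)) @^-1` B =
      \bigcup_c (if `[< B (u c) >] then q @^-1` [set c] else set0).
    apply/seteqP; split=> x /=; first by move=> h; exists (q x) => //=; case: asboolP.
    by move=> [c _]; case: asboolP => //= h ->.
  by apply: countable_bigcupT_measurable => [//|c]; case: ifP.
by split; [exact: (H (fun c => complex.Re (G c)))|exact: (H (fun c => complex.Im (G c)))].
Qed.

Definition cgrid (k : nat) (z : R[i]) : int * int :=
  (Num.floor (k.+1%:R * complex.Re z), Num.floor (k.+1%:R * complex.Im z)).

Definition cgrid_val (k : nat) (c : int * int) : R[i] :=
  (c.1%:~R / k.+1%:R) +i* (c.2%:~R / k.+1%:R).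

Lemma cgrid_le k z : cabs (cgrid_val k (cgrid k z) - z) <= 2 / k.+1%:R.
Proof.
have H (t : R) : `|(Num.floor (k.+1%:R * t))%:~R / k.+1%:R - t| <= k.+1%:R^-1.
  have -> : (Num.floor (k.+1%:R * t))%:~R / k.+1%:R - t =
      ((Num.floor (k.+1%:R * t))%:~R - k.+1%:R * t) / k.+1%:R :> R.
    by rewrite mulrBl mulrAC mulfV ?mul1r// pnatr_eq0.
  rewrite normrM [X in _ * X]ger0_norm// ler_piMl// distrC.
  have := floor_itv (k.+1%:R * t); rewrite intrD => /andP[h1 h2].
  by rewrite ger0_norm ?subr_ge0//; lra.
apply: (le_trans (cabs_le_ReIm _)); rewrite cReD cImD cReN cImN /= mulrDl mul1r.
by apply: lerD; exact: H.
Qed.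

Lemma measurable_cgrid k (f : X -> R[i]) c : cmeas f -> measurable ((fun x => cgrid k (f x)) @^-1` [set c]).
Proof.
move=> [mr mi]; have H (h : X -> R) (z : int) : measurable_fun setT h ->
    measurable [set x | Num.floor (k.+1%:R * h x) = z].
  move=> mh; have -> : [set x | Num.floor (k.+1%:R * h x) = z] =
      setT `&` (fun x => k.+1%:R * h x) @^-1` `[z%:~R, (z + 1)%:~R[%classic.
    rewrite setTI; apply/seteqP; split=> x /=; rewrite in_itv/=.
      by move=> /eqP; rewrite floor_eq.
    by rewrite -floor_eq => /eqP.
  by apply: measurable_funM => //; exact: measurable_cst.
have -> : (fun x => cgrid k (f x)) @^-1` [set c] =
    [set x | Num.floor (k.+1%:R * complex.Re (f x)) = c.1] `&`
    [set x | Num.floor (k.+1%:R * complex.Im (f x)) = c.2].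
  by apply/seteqP; split=> x /=; rewrite /cgrid; [move=> <-|case: c => a b /= [-> ->]].
by apply: measurableI; exact: H.
Qed.

(* Outside the grid points the values of g are irrelevant: only countably many
   values enter at each stage, whatever g is outside the polydisc. *)
Lemma cmeas_holomorphic g n (y : X -> nat -> R[i]) : holomorphic g ->
  (forall j, (j < n)%N -> cmeas (fun x => y x j)) -> (forall x, polydisc2 (zpt n (y x))) ->
  cmeas (fun x => g (zpt n (y x))).
Proof.
move=> gh my yP.
pose q k x : {ffun 'I_n -> int * int} := [ffun j : 'I_n => cgrid k (y x j)].
pose u k (c : {ffun 'I_n -> int * int}) (j : nat) : R[i] :=
  if insub j is Some i then cgrid_val k (c i) else 0.
apply: (@cmeas_lim _ _ _ (fun k x => g (zpt n (u k (q k x))))) => [k|x].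
  apply: (cmeas_countable (q := q k) (fun c => g (zpt n (u k c)))) => c.
  have -> : q k @^-1` [set c] = \bigcap_(j in [set: 'I_n]) ((fun x => cgrid k (y x j)) @^-1` [set c j]).
    apply/seteqP; split=> x /=; first by move=> <- j _; rewrite /= ffunE.
    by move=> h; apply/ffunP => j; rewrite ffunE; exact: h.
  by apply: fin_bigcap_measurable => [|j _]; [exact: finite_finset|apply: measurable_cgrid; exact: my].
apply: zpt_cvg => // j jn; rewrite /u insubT /q.
apply: (@ccvg_dom _ _ _ (fun k => 2 / k.+1%:R)).
  by near=> k; rewrite ffunE; exact: cgrid_le.
rewrite -(mulr0 2); apply: cvgM; [exact: cvg_cst|exact: cvg_harmonic].
Unshelve. all: by end_near. Qed.
End discretization.

(** Each coordinate has its own radius, so that radii can be changed one at a time. *)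
Definition slice g n rho w : R[i] := g (zpt n (fun j => (rho j)%:C * tcoord w j)).

Lemma slice_polydisc n rho (x : nat -> R[i]) : (forall j, 0 <= rho j < 1) ->
  (forall j, cabs (x j) = 1) -> polydisc2 (zpt n (fun j => (rho j)%:C * x j)).
Proof.
move=> r01 x1; have r0 j : 0 <= rho j by have /andP[] := r01 j.
have [s s1 rs] : exists2 s : R, 0 <= s < 1 & forall j, (j < n)%N -> rho j <= s.
  elim: n => [|n [s /andP[s0 s1] IH]]; first by exists 0; rewrite ?lexx ?ltr01.
  exists (Num.max s (rho n)); first by rewrite le_max s0 gt_max s1; have /andP[] := r01 n.
  by move=> j; rewrite ltnS leq_eqVlt le_max => /orP[/eqP->|/IH->//]; rewrite lexx orbT.
by apply: (zpt_polydisc s1) => j jn; rewrite cabsM x1 mulr1 cabs_real ger0_norm ?rs.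
Qed.

Lemma cmeas_slice g n rho : holomorphic g -> (forall j, 0 <= rho j < 1) -> cmeas (slice g n rho).
Proof.
move=> gh r01; apply: cmeas_holomorphic => // [j _|w].
  by apply: cmeasZ; exact: (@cmeas_tcoord R nat j).
by apply: slice_polydisc => // j; exact: cabs_tcoord.
Qed.

Lemma slice_cvg g n (rho : nat -> nat -> R) (r : nat -> R) w : holomorphic g ->
  (forall j, 0 <= r j < 1) -> (forall j, ccvg (fun k => (rho k j)%:C) (r j)%:C) ->
  ccvg (fun k => slice g n (rho k) w) (slice g n r w).
Proof.
move=> gh r01 rr; apply: zpt_cvg => // [|j _].
  by apply: slice_polydisc => // j; exact: cabs_tcoord.
by apply: ccvgM => //; exact: ccvg_cst.
Qed.

Lemma slice_cyl g n rho w : holomorphic g -> (forall j, 0 <= rho j < 1) ->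
  forall e : R, 0 < e -> exists2 d : R, 0 < d &
  forall v, (forall j, (j < n)%N -> cabs (tcoord v j - tcoord w j) < d) ->
    cabs (slice g n rho v - slice g n rho w) <= e.
Proof.
move=> gh r01 e e0; have wP := slice_polydisc n r01 (fun j => cabs_tcoord w j).
have [d d0 hd] := holomorphic_zpt gh wP e0.
exists d => // v vw; apply/ltW/hd => j jn; rewrite -mulrBr cabsM cabs_real.
have /andP[r0 r1] := r01 j; rewrite ger0_norm//; apply: le_lt_trans (vw j jn).
by rewrite ler_piMl ?cabs_ge0// ltW.
Qed.

Lemma circle_exp_continuous (t e : R) : 0 < e ->
  \forall s \near t, cabs (circle_val (circle_exp s) - circle_val (circle_exp t)) < e.
Proof.
move=> e0; have e2 : 0 < e / 2 by rewrite divr_gt0.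
have c2 : (fun s : R => 2 * pi * s) @ t --> 2 * pi * t.
  by apply: cvgM; [exact: cvg_cst|exact: cvg_id].
have cc : (fun s : R => cos (2 * pi * s)) @ t --> cos (2 * pi * t).
  exact: (cvg_comp _ _ c2 (@continuous_cos R _)).
have cs : (fun s : R => sin (2 * pi * s)) @ t --> sin (2 * pi * t).
  exact: (cvg_comp _ _ c2 (@continuous_sin R _)).
move/cvgrPdist_lt: cc => /(_ _ e2); move/cvgrPdist_lt: cs => /(_ _ e2).
apply: filterS2 => s h1 h2; rewrite /= in h1 h2.
apply: (le_lt_trans (cabs_le_ReIm _)); rewrite cReD cImD cReN cImN /=.
by rewrite distrC (distrC (sin _)); lra.
Qed.

(** Compactness comes from the cube of angles [[0, 1]]^n, whose image under [circle_exp] is the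
    whole finite torus. *)
Lemma slice_bounded g n rho : holomorphic g -> (forall j, 0 <= rho j < 1) ->
  exists B : R, forall w, cabs (slice g n rho w) <= B.
Proof.
move=> gh r01.
pose x (t : 'rV[R]_n) (j : nat) : R[i] := if insub j is Some i then
  (rho j)%:C * circle_val (circle_exp (t ord0 i)) else 0.
have xP t : polydisc2 (zpt n (x t)).
  have -> : zpt n (x t) = zpt n (fun j => (rho j)%:C *
      (if insub j is Some i then circle_val (circle_exp (t ord0 i)) else 1)).
    apply: ell2_inj => j; rewrite !zptE; case: ifP => // jn; rewrite /x.
    by case: insubP => //=; rewrite jn.
  by apply: slice_polydisc => // j; case: insub => [i|]; rewrite ?cabs1 ?cabs_circle.
pose F (t : 'rV[R]_n) : R := cabs (g (zpt n (x t))).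
have cF : continuous F.
  move=> t; have FF : Filter (nbhs t) := nbhs_filter t.
  apply/(@cvgrPdist_lt _ _ _ _ FF) => e e0.
  have [d d0 hd] := holomorphic_zpt gh (xP t) e0.
  have : \forall s \near nbhs t, forall j : 'I_n,
      cabs (circle_val (circle_exp ((s : 'rV[R]_n) ord0 j)) - circle_val (circle_exp (t ord0 j))) < d.
    apply: filter_forall => j.
    exists (fun _ k => [set s | k = j ->
        cabs (circle_val (circle_exp s) - circle_val (circle_exp (t ord0 j))) < d]).
      move=> i k /=; have [->|kj] := eqVneq k j; last first.
        by apply: filterE => s kj'; rewrite kj' eqxx in kj.
      by rewrite ord1; apply: filterS (circle_exp_continuous (t ord0 j) d0) => s h _.
    by move=> s /(_ ord0 j); exact.
  apply: filterS => s h; rewrite distrC; apply: (le_lt_trans (cabs_dist_dist _ _)).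
  apply: hd => j jn; rewrite /x insubT/= -mulrBr cabsM cabs_real.
  have /andP[r0 r1] := r01 j; rewrite ger0_norm//; apply: le_lt_trans (h (Ordinal jn)).
  by rewrite ler_piMl ?cabs_ge0// ltW.
have cK : compact [set t : 'rV[R]_n | forall i, `[0, 1]%classic (t ord0 i)].
  exact: (rV_compact (fun=> @segment_compact R 0 1)).
have := compact_bounded (continuous_compact (continuous_subspaceT cF) cK).
move=> [B [_ hB]]; exists (B + 1) => w.
have hs (j : 'I_n) : {s : R | 0 <= s <= 1 & w j = circle_exp s}.
  by apply/cid2; exact: circle_exp_surj.
pose t : 'rV[R]_n := \row_j s2val (hs j).
have -> : slice g n rho w = g (zpt n (x t)).
  congr g; apply: ell2_inj => j; rewrite !zptE; case: ifP => // jn; rewrite /x insubT/=.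
  by rewrite mxE; case: (hs _) => s /= _ <-.
apply: le_trans (hB (B + 1) _ (F t) _); rewrite ?ltrDl//; first exact: ler_norm.
by exists t => // i; rewrite /= mxE in_itv/=; case: (hs _).
Qed.

Lemma cintb_slice g n rho : holomorphic g -> (forall j, 0 <= rho j < 1) -> cintb m (slice g n rho).
Proof.
move=> gh r01; have [B hB] := slice_bounded n gh r01.
by apply: (@cintb_bound _ _ _ _ _ B) => //; exact: cmeas_slice.
Qed.

End slices.

(** * Linearity of Fourier coefficients and of [phi] *)

Section hardy_linear.
Context {R : realType}.
Local Notation m := (torus_measure R nat).
Implicit Types (f g : torus R nat -> R[i]).

Lemma fourier_coef_four (alpha : zmidx) : exists n, forall h : torus R nat -> R[i], fourier_coef h alpha = four n alpha h.
Proof.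
exists (\max_(j <- finsupp alpha) j).+1 => h; apply: fourier_coefE => j; apply: contraTeq.
by rewrite -mem_finsupp -ltnNge ltnS => ja; exact: leq_bigmax_seq.
Qed.

Lemma fourD n a f g : cintb m f -> cintb m g -> four n a (fun w => f w + g w) = four n a f + four n a g.
Proof.
move=> fi gi; rewrite -cintegralD; [|exact: cintb_four..].
by apply: eq_cintegral => w; rewrite mulrDl.
Qed.

Lemma fourZ n a c f : cintb m f -> four n a (fun w => c * f w) = c * four n a f.
Proof.
move=> fi; rewrite -cintegralZ; last exact: cintb_four.
by apply: eq_cintegral => w; rewrite mulrA.
Qed.

Lemma fourB n a f g : cintb m f -> cintb m g -> four n a (fun w => f w - g w) = four n a f - four n a g.
Proof.
move=> fi gi; rewrite -cintegralB; [|exact: cintb_four..].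
by apply: eq_cintegral => w; rewrite mulrBl.
Qed.

Lemma fourier_coefD f g alpha : cintb m f -> cintb m g ->
  fourier_coef (fun w => f w + g w) alpha = fourier_coef f alpha + fourier_coef g alpha.
Proof. by move=> fi gi; have [n nE] := fourier_coef_four alpha; rewrite !nE fourD. Qed.

Lemma fourier_coefZ c f alpha : cintb m f ->
  fourier_coef (fun w => c * f w) alpha = c * fourier_coef f alpha.
Proof. by move=> fi; have [n nE] := fourier_coef_four alpha; rewrite !nE fourZ. Qed.

Lemma H1_lin a f g : H1 f -> H1 g -> H1 (fun w => a * f w + g w).
Proof.
move=> [fi f0] [gi g0]; split=> [|alpha na]; first by apply: cintbD => //; exact: cintbZ.
by rewrite fourier_coefD ?fourier_coefZ ?f0 ?g0 ?mulr0 ?addr0//; exact: cintbZ.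
Qed.

Lemma phi_lin a f g z : H1 f -> H1 g -> polydisc2 z ->
  phi (fun w => a * f w + g w) z = a * phi f z + phi g z.
Proof.
move=> fH gH z1; apply: csum_sum.
have -> : hardy_term (fun w => a * f w + g w) z =
    (fun alpha => a * hardy_term f z alpha + hardy_term g z alpha).
  apply/funext => alpha; rewrite /hardy_term.
  by rewrite fourier_coefD ?fourier_coefZ; [ring|case: fH|apply: cintbZ; case: fH|case: gH].
by apply: csumD; [apply: csumZ|]; exact: phi_csum.
Qed.

Lemma H1B f g : H1 f -> H1 g -> H1 (fun w => f w - g w).
Proof.
move=> fH gH; have := H1_lin (-1) gH fH.
by have -> : (fun w => -1 * g w + f w) = (fun w => f w - g w)
  by apply/funext => w; rewrite mulN1r addrC.
Qed.

Lemma phiB f g z : H1 f -> H1 g -> polydisc2 z -> phi (fun w => f w - g w) z = phi f z - phi g z.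
Proof.
move=> fH gH z1; rewrite addrC -mulN1r -(phi_lin (-1) gH fH z1); congr (phi _ z).
by apply/funext => w; rewrite mulN1r addrC.
Qed.

End hardy_linear.

(** * The isometry *)

Section power_integral.
Context {R : realType} (p : R) (hp : 1 <= p).
Local Notation m := (torus_measure R nat).
Implicit Types (f F : torus R nat -> R[i]) (g : ell2 R -> R[i]).

Let p0 : 0 < p. Proof. exact: lt_le_trans hp. Qed.
Let pn0 : p != 0. Proof. by rewrite gt_eqF. Qed.

Definition pint F : \bar R := (\int[m]_w (cabs (F w) `^ p)%:E)%E.

Lemma pint_ge0 F : (0 <= pint F)%E.
Proof. by apply: integral_ge0 => w _; rewrite lee_fin powR_ge0. Qed.

Lemma poweRK (x : \bar R) : (0 <= x)%E -> ((x `^ p) `^ p^-1 = x)%E.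
Proof. by move=> x0; rewrite -poweRrM mulfV// poweRe1. Qed.

Lemma LnormE {d} {T : measurableType d} (mu : {measure set T -> \bar R}) (F : T -> R[i]) :
  ('N[mu]_p%:E[EFin \o (fun w => cabs (F w))] = (\int[mu]_w (cabs (F w) `^ p)%:E) `^ p^-1)%E.
Proof.
set g := (X in 'N[mu]_p%:E[X]%E); rewrite -[LHS](poweRK (Lnorm_ge0 mu p%:E g)) (powR_Lnorm mu g pn0) /g; congr (_ `^ _)%E.
by apply: eq_integral => w _; rewrite abse_EFin ger0_norm ?cabs_ge0// poweR_EFin.
Qed.

Lemma Lp_normE F : Lp_norm p F = (pint F `^ p^-1)%E.
Proof. exact: LnormE. Qed.

Lemma measurable_pint {d} {T : measurableType d} (F : T -> R[i]) : cmeas F ->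
  measurable_fun setT (fun w => (cabs (F w) `^ p)%:E).
Proof.
move=> mF; apply/measurable_EFinP.
exact: (measurableT_comp (measurable_powR p) (cmeas_cabs mF)).
Qed.

(** Young's inequality for b and a^(p-1) with conjugate exponent p / (p - 1); for p = 1, where this
    exponent is not finite, the claim is an equality. *)
Lemma powR_tangent (a b : R) : 0 <= a -> 0 <= b ->
  a `^ p + p * a `^ (p - 1) * (b - a) <= b `^ p.
Proof.
move=> a0 b0; have [p1|p1] := eqVneq p 1.
  by rewrite p1 subrr powRr0 !powRr1// !mul1r addrC subrK.
have p1' : 0 < p - 1 by rewrite subr_gt0 lt_def p1.
pose q := p / (p - 1); have q0 : 0 < q by rewrite divr_gt0.
have pq : p^-1 + q^-1 = 1.
  by rewrite /q invf_div -{1}[p^-1]mul1r -mulrDl addrC subrK divff.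
have := conjugate_powR b0 (powR_ge0 a (p - 1)) p0 q0 pq.
rewrite -powRrM (_ : (p - 1) * q = p); last by rewrite /q mulrC divfK// gt_eqF.
have q1 : q^-1 = 1 - p^-1 by rewrite -pq addrAC subrr add0r.
rewrite q1 => h; have := mulr_powRB1 a0 p0; set u := a `^ p; set v := a `^ (p - 1) in h * => uv.
have := ler_wpM2l (ltW p0) h; rewrite mulrDr [p * (b `^ p / p)]mulrCA divff// mulr1.
rewrite mulrBr mulr1 mulrBr [p * (u / p)]mulrCA divff// mulr1 -/u.
by rewrite -uv; nra.
Qed.

Lemma pint_poisson n r f : 0 <= r < 1 -> cintb m f -> (pint (poisson n r f) <= pint f)%E.
Proof.
move=> r01 fi; apply: (poisson_jensen n (Phi := fun x => cabs x `^ p)) => //.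
- by move=> x; exact: powR_ge0.
- by move=> h mh; exact: (measurableT_comp (measurable_powR p) (cmeas_cabs mh)).
(* The tangent of t^p at |a|, composed with the functional supporting the modulus at [a]. *)
move=> a; exists ((p * cabs a `^ (p - 1))%:C * (phase a)^*%C) => x.
apply: le_trans (powR_tangent (cabs_ge0 a) (cabs_ge0 x)); rewrite lerD2l.
have ReZ (c : R) (z : R[i]) : complex.Re (c%:C * z) = c * complex.Re z.
  by case: z => u v /=; rewrite mul0r subr0.
rewrite -(mulrA _%:C) ReZ ler_wpM2l ?mulr_ge0 ?powR_ge0 ?(ltW p0)//.
have -> : (phase a)^*%C * (x - a) = (phase a)^*%C * x - (cabs a)%:C.
  rewrite mulrBr [X in _ - _ * X](phaseE a) mulrCA; congr (_ - _).
  by rewrite [_^*%C * _]mulrC phaseJ mulr1.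
rewrite cReD cReN /= lerD2r (le_trans (ler_norm _))// (le_trans (Re_le_cabs _))//.
by rewrite cabsM cabsJ cabs_phase mul1r.
Qed.

Lemma Lp_pint f : Lp p f <-> cmeas f /\ (pint f < +oo)%E.
Proof.
split=> [[h1 h2]|[[h1 h2] h3]]; last by split=> //; rewrite Lp_normE poweR_lty.
rewrite Lp_normE => h; split=> //; apply: (lty_poweRy _ h).
by rewrite invr_neq0.
Qed.

(** t <= 1 + t^p for p >= 1, and constants are integrable. *)
Lemma pint_cintb f : cmeas f -> (pint f < +oo)%E -> cintb m f.
Proof.
move=> mf fp; split=> //.
apply: (@le_lt_trans _ _ (\int[m]_w (1%:E + (cabs (f w) `^ p)%:E))%E).
  apply: ge0_le_integral => //.
  - by move=> w _; rewrite lee_fin cabs_ge0.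
  - exact: cmeas_cabsE.
  - by apply: emeasurable_funD; [exact: measurable_cst|exact: measurable_pint].
  move=> w _; rewrite -EFinD lee_fin; have [c1|c1] := leP (cabs (f w)) 1.
    by rewrite (le_trans c1)// lerDl powR_ge0.
  by apply: (le_trans (le1r_powR (ltW c1) hp)); rewrite lerDr.
rewrite ge0_integralD//; last 2 first.
- by move=> w _; rewrite lee_fin powR_ge0.
- exact: measurable_pint.
by rewrite lte_add_pinfty// (integral_cst m measurableT 1) mul1e (le_lt_trans (probability_le1 m measurableT))// ltry.
Qed.

Lemma Hp_torus_H1 f : Hp_torus p f -> H1 f.
Proof. by move=> [/Lp_pint[mf fp] f0]; split=> //; exact: pint_cintb. Qed.

Lemma torus_point_tres n r (w : torus R nat) :
  torus_point r (tres w : torus R 'I_n) = zpt n (fun j => r%:C * tcoord w j).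
Proof.
apply: ell2_inj => j; rewrite zptE /torus_point /= /torus_point_seq.
by case: insubP => [i jn /= <-|/negbTE->//]; rewrite ltn_ord.
Qed.

Lemma torus_point_polydisc n (r : R) (w : torus R 'I_n) : 0 <= r < 1 -> polydisc2 (torus_point r w).
Proof.
move=> /andP[r0 r1]; apply: (polydisc2_le r1) => j /=; rewrite /torus_point_seq.
case: insub => [i|]; last by rewrite cabs0.
by rewrite cabsM cabs_circle mulr1 cabs_real ger0_norm.
Qed.

Lemma slice_norm n r g : holomorphic g -> 0 <= r < 1 ->
  'N[torus_measure R 'I_n]_p%:E[EFin \o (fun w => cabs (g (torus_point r w)))]%E =
  (pint (slice g n (fun=> r)) `^ p^-1)%E.
Proof.
move=> gh r01; rewrite LnormE; congr (_ `^ _)%E.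
have mg : cmeas (fun w : torus R 'I_n => g (torus_point r w)).
  pose y (w : torus R 'I_n) j := if insub j is Some i then r%:C * tcoord w i else 0.
  have E w : torus_point r w = zpt n (y w).
    apply: ell2_inj => j; rewrite zptE /y /= /torus_point_seq.
    by case: insubP => [i ->//|/negbTE->].
  have -> : (fun w => g (torus_point r w)) = (fun w => g (zpt n (y w))).
    by apply/funext => w; rewrite E.
  apply: cmeas_holomorphic => // [j jn|w]; last by rewrite -E; exact: torus_point_polydisc.
  rewrite /y insubT; apply: cmeasZ; exact: cmeas_tcoord.
rewrite (ge0_integral_mp (@measurable_tres R n) (@haar_tres R n)); last 2 first.
- exact: measurable_pint.
- by move=> w; rewrite lee_fin powR_ge0.
by apply: eq_integral => w _; rewrite torus_point_tres.
Qed.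

Lemma poweR_le (x y : \bar R) (r : R) : 0 <= r -> (0 <= x)%E -> (x <= y)%E -> (x `^ r <= y `^ r)%E.
Proof.
move=> r0 x0 xy; apply: gt0_ler_poweR => //; rewrite in_itv/= leey andbT//.
exact: le_trans xy.
Qed.

Lemma poweRVK (x : \bar R) : (0 <= x)%E -> ((x `^ p^-1) `^ p = x)%E.
Proof. by move=> x0; rewrite -poweRrM mulVf// poweRe1. Qed.

Lemma pint_slice g n r : holomorphic g -> (0 < n)%N -> 0 < r < 1 ->
  (pint (slice g n (fun=> r)) <= Hp_norm p g `^ p)%E.
Proof.
move=> gh n0 /andP[r0 r1]; have r01 : 0 <= r < 1 by rewrite (ltW r0).
rewrite -[leLHS]poweRVK ?pint_ge0//; apply: poweR_le; rewrite ?(ltW p0) ?poweR_ge0//.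
apply: ereal_sup_ubound; exists n, r; split=> //; first by rewrite r0.
by rewrite slice_norm.
Qed.

Lemma Hp_norm_le g (C : \bar R) : holomorphic g ->
  (forall n r, (0 < n)%N -> 0 < r < 1 -> (pint (slice g n (fun=> r)) <= C)%E) ->
  (Hp_norm p g <= C `^ p^-1)%E.
Proof.
move=> gh gC; apply: ge_ereal_sup => _ [n [r [n0 /andP[r0 r1] ->]]].
rewrite slice_norm ?(ltW r0)//; apply: poweR_le; rewrite ?invr_ge0 ?(ltW p0) ?pint_ge0//.
by apply: gC => //; rewrite r0.
Qed.

Lemma eq_Hp_norm g h : (forall z, polydisc2 z -> g z = h z) -> Hp_norm p g = Hp_norm p h.
Proof.
move=> gh; congr ereal_sup; apply/seteqP; split=> _ [n [r [n0 r01 ->]]]; exists n, r; split=> //;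
  apply: eq_Lnorm => w /=; (rewrite gh//; apply: torus_point_polydisc; case/andP: r01 => /ltW r0 r1; exact/andP).
Qed.

Lemma Hp_norm_ge0 g : (0 <= Hp_norm p g)%E.
Proof.
apply: le_ereal_sup_tmp; exists 'N[torus_measure R 'I_1]_p%:E[
   EFin \o (fun w => cabs (g (torus_point 2^-1 w)))]%E; last exact: Lnorm_ge0.
by exists 1%N, 2^-1; split=> //; rewrite invr_gt0 ltr0n invf_lt1// ltr1n.
Qed.

Definition ptrunc (N : nat) (x : R[i]) : R := Num.min (cabs x) N%:R `^ p.

(** Tangent inequality at min(|x|, N), where the slope is at most p N^(p-1). *)
Lemma ptrunc_le N x y : ptrunc N x <= cabs y `^ p + p * N%:R `^ (p - 1) * cabs (x - y).
Proof.
rewrite /ptrunc; set a := Num.min _ _.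
have a0 : 0 <= a by rewrite le_min cabs_ge0/=.
have c0 : 0 <= p * a `^ (p - 1) by rewrite mulr_ge0 ?powR_ge0 ?(ltW p0).
have := powR_tangent a0 (cabs_ge0 y); set ap := a `^ p => h.
have aN : a `^ (p - 1) <= N%:R `^ (p - 1).
  by rewrite ge0_ler_powR ?nnegrE ?subr_ge0 ?ler0n// ge_min lexx orbT.
have xy : a - cabs y <= cabs (x - y).
  apply: (@le_trans _ _ (cabs x - cabs y)); first by rewrite lerD2r ge_min lexx.
  by rewrite (le_trans (ler_norm _))// cabs_dist_dist.
have h2 : p * a `^ (p - 1) * (a - cabs y) <= p * N%:R `^ (p - 1) * cabs (x - y).
  apply: (le_trans (ler_wpM2l c0 xy)); rewrite ler_wpM2r ?cabs_ge0//.
  by rewrite ler_wpM2l// ltW.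
by move: h h2; lra.
Qed.

(** Lower semicontinuity of the L_p norm under L_1 convergence, without passing to an almost
    everywhere convergent subsequence: L_1 distances control the truncated powers by [ptrunc_le],
    and N tends to infinity by monotone convergence. It makes L_1 convergence sufficient for the
    isometry at every p. *)
Lemma pint_L1_le (F : nat -> torus R nat -> R[i]) f (C : \bar R) :
  (forall k, cintb m (F k)) -> cintb m f -> L1cvg F f ->
  (\forall k \near \oo, pint (F k) <= C)%E -> (pint f <= C)%E.
Proof.
move=> Fi fi Ff FC.
have mt N : measurable_fun setT (fun w => (ptrunc N (f w))%:E).
  apply/measurable_EFinP; apply: (measurableT_comp (measurable_powR p)).
  by apply: measurable_minr; [exact: cmeas_cabs fi.1|exact: measurable_cst].
have tC N : (\int[m]_w (ptrunc N (f w))%:E <= C)%E.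
  apply/lee_addgt0Pr => e e0; pose L := p * N%:R `^ (p - 1).
  have L0 : 0 <= L by rewrite mulr_ge0 ?powR_ge0 ?(ltW p0).
  have d0 : 0 < e / (L + 1) by rewrite divr_gt0// ltr_wpDl.
  have [k _ /(_ k (leqnn k)) /= [kC kd]] : \forall k \near \oo,
     (pint (F k) <= C)%E /\ (\int[m]_w (cabs (F k w - f w))%:E <= (e / (L + 1))%:E)%E.
    move/(L1cvgP Fi fi): Ff => /(_ _ d0) Ff.
    by apply: filterS2 FC Ff => k h1 h2.
  apply: (@le_trans _ _ (\int[m]_w ((cabs (F k w) `^ p)%:E + L%:E * (cabs (F k w - f w))%:E))%E).
    apply: ge0_le_integral => //.
    - by move=> w _; rewrite lee_fin powR_ge0.
    - apply: emeasurable_funD; first exact: measurable_pint (Fi k).1.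
      apply: emeasurable_funM; first exact: measurable_cst.
      by apply: cmeas_cabsE; exact: cmeasB (Fi k).1 fi.1.
    by move=> w _; rewrite -EFinM -EFinD lee_fin cabs_distC; exact: ptrunc_le.
  have mB : measurable_fun setT (fun w => (cabs (F k w - f w))%:E).
    by apply: cmeas_cabsE; exact: cmeasB (Fi k).1 fi.1.
  rewrite ge0_integralD//; first last.
  - by apply: emeasurable_funM => //; exact: measurable_cst.
  - by move=> w _; rewrite -EFinM lee_fin mulr_ge0 ?cabs_ge0.
  - exact: measurable_pint (Fi k).1.
  - by move=> w _; rewrite lee_fin powR_ge0.
  rewrite ge0_integralZl//; last by move=> w _; rewrite lee_fin cabs_ge0.
  apply: leeD => //; apply: (@le_trans _ _ (L%:E * (e / (L + 1))%:E)%E).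
    by rewrite lee_wpmul2l.
  rewrite -EFinM lee_fin mulrCA ler_piMr ?(ltW e0)// ler_pdivrMr ?mul1r ?lerDl//.
  by rewrite ltr_wpDl.
have nd w : {homo (fun N => (ptrunc N (f w))%:E) : n k / (n <= k)%N >-> (n <= k)%E}.
  move=> n k nk; rewrite lee_fin ge0_ler_powR ?nnegrE ?le_min ?cabs_ge0 ?ler0n ?(ltW p0)//=.
  by rewrite ge_min lexx/= ge_min ler_nat nk orbT.
have := @cvg_monotone_convergence _ _ _ m setT measurableT (fun N w => (ptrunc N (f w))%:E) mt.
move=> /(_ (fun N w _ => powR_ge0 _ _))/(_ (fun w _ => nd w)).
rewrite (eq_integral (fun w => (cabs (f w) `^ p)%:E)) => [h|w _].
  rewrite -[leLHS](cvg_lim _ h)//; apply: lime_le; first by apply/cvg_ex; eexists; exact: h.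
  exact: nearW.
apply/cvg_lim => //; apply: cvg_near_cst; near=> N; rewrite /ptrunc min_l//.
by near: N; exact: nbhs_infty_ger.
Unshelve. all: by end_near. Qed.

Lemma slice_phi f n r : H1 f -> 0 <= r < 1 -> slice (phi f) n (fun=> r) = poisson n r f.
Proof. by move=> fH r01; apply/funext => w; exact: phi_poisson. Qed.

Lemma phi_isometry f : H1 f -> Hp_norm p (phi f) = Lp_norm p f.
Proof.
move=> fH; have [fi _] := fH; have ph := phi_holomorphic fH; rewrite Lp_normE; apply/eqP; rewrite eq_le.
apply/andP; split.
  apply: (Hp_norm_le ph) => n r _ /andP[/ltW r0 r1]; have r01 : 0 <= r < 1 by rewrite r0.
  by rewrite (slice_phi n fH r01); exact: (pint_poisson n r01 fi).
rewrite -[leRHS]poweRK ?Hp_norm_ge0//; apply: poweR_le.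
- by rewrite invr_ge0 ltW.
- exact: pint_ge0.
have Fi k : cintb m (poisson k (prad k) f) by exact: (cintb_poisson k (prad01 k) fi).
apply: (pint_L1_le Fi fi (poisson_cvg_L1 fi)).
near=> k; rewrite -(slice_phi k fH (prad01 k)).
by apply: pint_slice => //; [near: k; exact: nbhs_infty_gt|exact: prad_gt0].
Unshelve. all: by end_near. Qed.

End power_integral.

(** * Circle means of holomorphic functions of one variable *)

Section goursat.
Context {R : realType}.
Implicit Types (p q : R -> R -> R) (f : R -> R).

(* Differentiability of p at (x0, t0), with partial derivatives A and B. *)
Definition d2 p (x0 t0 A B : R) := forall e : R, 0 < e -> exists2 d : R, 0 < d &
  forall x t, `|x - x0| < d -> `|t - t0| < d ->
    `|p x t - p x0 t0 - A * (x - x0) - B * (t - t0)| <= e * (`|x - x0| + `|t - t0|).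

Lemma d2_continuous p x0 t0 A B : d2 p x0 t0 A B -> forall e : R, 0 < e -> exists2 d : R, 0 < d &
  forall x t, `|x - x0| < d -> `|t - t0| < d -> `|p x t - p x0 t0| < e.
Proof.
move=> h e e0; have [d d0 hd] := h 1 ltr01.
pose M := `|A| + `|B| + 1; have M0 : 0 < M by rewrite ltr_wpDl// addr_ge0.
exists (Num.min d (e / 2 / M)); first by rewrite lt_min d0 !divr_gt0.
move=> x t; rewrite !lt_min => /andP[x1 x2] /andP[t1 t2].
have := hd x t x1 t1; set X := x - x0 in x2 *; set T := t - t0 in t2 *.
set D := p x t - p x0 t0 => h1.
have h2 : `|D| <= `|D - A * X - B * T| + (`|A| * `|X| + `|B| * `|T|).
  rewrite -!normrM; have := ler_normD (D - A * X - B * T) (A * X + B * T).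
  have := ler_normD (A * X) (B * T).
  have -> : D - A * X - B * T + (A * X + B * T) = D by ring.
  lra.
rewrite ltr_pdivlMr// in x2; rewrite ltr_pdivlMr// in t2.
have hh : `|D| <= M * `|X| + M * `|T|.
  apply: (le_trans h2); apply: (le_trans (lerD h1 (lexx _))); rewrite /M mul1r.
  have := mulr_ge0 (normr_ge0 A) (normr_ge0 T); have := mulr_ge0 (normr_ge0 B) (normr_ge0 X).
  by rewrite !mulrDl !mul1r; lra.
apply: (le_lt_trans hh); rewrite mulrC in x2; rewrite mulrC in t2; lra.
Qed.

Lemma d2_cvgt p x0 t0 A B : d2 p x0 t0 A B -> p x0 t @[t --> t0] --> p x0 t0.
Proof.
move=> h; apply/cvgrPdist_lt => e e0; have [d d0 hd] := d2_continuous h e0.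
apply/nbhs_ballP; exists d => //= t; rewrite /ball/= => td.
by rewrite distrC; apply: hd; rewrite ?subrr ?normr0// distrC.
Qed.

Lemma d2_cvgx p x0 t0 A B : d2 p x0 t0 A B -> p x t0 @[x --> x0] --> p x0 t0.
Proof.
move=> h; apply/cvgrPdist_lt => e e0; have [d d0 hd] := d2_continuous h e0.
apply/nbhs_ballP; exists d => //= x; rewrite /ball/= => xd.
by rewrite distrC; apply: hd; rewrite ?subrr ?normr0// distrC.
Qed.

Definition itg f (a b : R) : R := \int[lebesgue_measure]_(x in `[a, b]) f x.

Definition contab f (a b : R) := forall t0, a <= t0 <= b -> f t @[t --> t0] --> f t0.

Lemma contabB f g a b : contab f a b -> contab g a b -> contab (fun t => f t - g t) a b.
Proof. by move=> h1 h2 t tab; apply: cvgB; [exact: h1|exact: h2]. Qed.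

Lemma contab_integrable f a b : contab f a b ->
  lebesgue_measure.-integrable `[a, b] (EFin \o f).
Proof.
move=> h; apply: continuous_compact_integrable; first exact: segment_compact.
apply: continuous_in_subspaceT => t; rewrite inE/= in_itv/=; exact: h.
Qed.

Lemma itg_split f a m b : a <= m <= b -> contab f a b -> itg f a b = itg f a m + itg f m b.
Proof.
move=> /andP[am mb] h; have hi := contab_integrable h.
have := @Rintegral_itvB R f (BLeft a) (BRight b) m hi; rewrite !bnd_simp => /(_ am mb) E.
apply/eqP; rewrite addrC -subr_eq; apply/eqP; rewrite E Rintegral_itv_obnd_cbnd//.
apply: integrableS hi => //.
by apply: subset_itv; rewrite bnd_simp.
Qed.

Lemma itgB f g a b : contab f a b -> contab g a b ->
  itg (fun t => f t - g t) a b = itg f a b - itg g a b.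
Proof. by move=> h1 h2; apply: RintegralB => //; exact: contab_integrable. Qed.

Lemma itg_cst c a b : a <= b -> itg (fun=> c) a b = c * (b - a).
Proof.
move=> ab; rewrite /itg Rintegral_cst//; congr (_ * _).
have E := @lebesgue_measure_itv R `[a, b]; rewrite /= lte_fin -EFinD in E.
transitivity (fine (if a < b then (b - a)%:E else 0%E)); first exact: (congr1 fine E).
by case: ltgtP ab => //= ->; rewrite subrr.
Qed.

Lemma itg_bound f a b (al eta : R) : a <= b -> contab f a b ->
  (forall t, a <= t <= b -> `|f t - al| <= eta) ->
  `|itg f a b - al * (b - a)| <= eta * (b - a).
Proof.
move=> ab h hb; have hc (c : R) : contab (fun=> c) a b by move=> t _; exact: cvg_cst.
rewrite -itg_cst// -(itgB h (hc al)).
have hB := contab_integrable (contabB h (hc al)).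
rewrite -[leRHS]itg_cst//; apply: le_trans (le_normr_Rintegral _ hB) _ => //.
apply: le_Rintegral => //.
- exact: integrable_norm hB.
- exact: contab_integrable (hc eta).
Qed.

Lemma nested_intervals (a b : nat -> R) : (forall n, a n <= b n) ->
  (forall n, a n <= a n.+1) -> (forall n, b n.+1 <= b n) ->
  exists x, forall n, a n <= x <= b n.
Proof.
move=> ab an bn.
have am : {homo a : n k / (n <= k)%N >-> n <= k} by exact: homo_leq lexx le_trans an.
have bm n k : (n <= k)%N -> b k <= b n.
  move=> /subnK <-; elim: (k - n)%N => [|i IH] //=.
  by rewrite addSn (le_trans (bn _)).
have abk n k : a n <= b k.
  have [nk|/ltnW kn] := leqP n k; first exact: le_trans (am _ _ nk) (ab k).
  exact: le_trans (ab n) (bm _ _ kn).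
have hs : has_sup (range a) by split; [exists (a 0), 0|exists (b 0) => _ [n _ <-]].
exists (sup (range a)) => n; apply/andP; split.
  by apply: (ub_le_sup hs.2); exists n.
by apply: ge_sup hs.1 _ => _ [k _ <-].
Qed.

(* Goursat's lemma for the form p dt - q dx, closed in the sense that
   dp/dx = dq/dt at each point, without continuity of the derivatives. *)
Section rectangle.
Variables (p q : R -> R -> R) (xa xb ta tb : R).
Hypothesis closed_form : forall x t, xa <= x <= xb -> ta <= t <= tb ->
  exists A B C, d2 p x t A B /\ d2 q x t C A.

(** With opposite sides grouped, this is the counterclockwise integral of q dx + p dt, whose
    exterior derivative vanishes when dp/dx = dq/dt. *)
Definition bdint (r : (R * R) * (R * R)) : R :=
  itg (fun t => p r.1.2 t - p r.1.1 t) r.2.1 r.2.2 +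
  itg (fun x => q x r.2.1 - q x r.2.2) r.1.1 r.1.2.

Definition inrect (r : (R * R) * (R * R)) :=
  [/\ xa <= r.1.1, r.1.1 <= r.1.2, r.1.2 <= xb & [/\ ta <= r.2.1, r.2.1 <= r.2.2 & r.2.2 <= tb]].

Lemma rect_contp x a b : xa <= x <= xb -> ta <= a -> b <= tb -> contab (p x) a b.
Proof.
move=> xab ha hb t /andP[t1 t2]; have [|A [B [C [h _]]]] := closed_form xab (t := t).
  by rewrite (le_trans ha)// (le_trans t2).
exact: d2_cvgt h.
Qed.

Lemma rect_contq t a b : ta <= t <= tb -> xa <= a -> b <= xb -> contab (fun x => q x t) a b.
Proof.
move=> tab ha hb x /andP[t1 t2]; have [|A [B [C [_ h]]]] := closed_form (x := x) _ tab.
  by rewrite (le_trans ha)// (le_trans t2).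
exact: d2_cvgx h.
Qed.

Definition mid (a b : R) := (a + b) / 2.

Lemma mid_itv a b : a <= b -> a <= mid a b <= b.
Proof. by move=> ab; rewrite /mid; lra. Qed.

Definition half (g : R * R -> R) (s : R * R) : R * R :=
  if `|g s| <= 2 * `|g (s.1, mid s.1 s.2)| then (s.1, mid s.1 s.2) else (mid s.1 s.2, s.2).

Lemma halfP g s : s.1 <= s.2 -> g s = g (s.1, mid s.1 s.2) + g (mid s.1 s.2, s.2) ->
  [/\ s.1 <= (half g s).1, (half g s).1 <= (half g s).2, (half g s).2 <= s.2,
     (half g s).2 - (half g s).1 = (s.2 - s.1) / 2 & `|g s| <= 2 * `|g (half g s)|].
Proof.
case: s => a b /= ab gE; have /andP[m1 m2] := mid_itv ab.
rewrite /half /=; case: ifPn => /= [h|]; first by split=> //; rewrite /mid; lra.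
rewrite -ltNge => h; split=> //; first by rewrite /mid; lra.
have := ler_normD (g (a, mid a b)) (g (mid a b, b)); rewrite -gE; lra.
Qed.

Lemma bdint_x r : inrect r -> let m := mid r.1.1 r.1.2 in
  bdint r = bdint ((r.1.1, m), r.2) + bdint ((m, r.1.2), r.2).
Proof.
case: r => [[a b] [c d]] [/= ha ab hb [hc cd hd]]; have /andP[m1 m2] := mid_itv ab.
set m := mid a b in m1 m2 *; rewrite /bdint /=.
have cx x : a <= x <= b -> contab (p x) c d.
  by move=> /andP[x1 x2]; apply: rect_contp => //; rewrite (le_trans ha)// (le_trans x2).
have ct t : c <= t <= d -> contab (fun x => q x t) a b.
  by move=> /andP[x1 x2]; apply: rect_contq => //; rewrite (le_trans hc)// (le_trans x2).
rewrite (@itg_split _ a m b) ?m1//; last by apply: contabB; [apply: (ct c)|apply: (ct d)]; rewrite ?lexx ?cd.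
have pa : contab (p a) c d by apply: cx; rewrite lexx.
have pm : contab (p m) c d by apply: cx; rewrite m1.
have pb : contab (p b) c d by apply: cx; rewrite lexx andbT.
rewrite (itgB pb pa) (itgB pm pa) (itgB pb pm); ring.
Qed.

Lemma bdint_t r : inrect r -> let m := mid r.2.1 r.2.2 in
  bdint r = bdint (r.1, (r.2.1, m)) + bdint (r.1, (m, r.2.2)).
Proof.
case: r => [[a b] [c d]] [/= ha ab hb [hc cd hd]]; have /andP[m1 m2] := mid_itv cd.
set m := mid c d in m1 m2 *; rewrite /bdint /=.
have cx x : a <= x <= b -> contab (p x) c d.
  by move=> /andP[x1 x2]; apply: rect_contp => //; rewrite (le_trans ha)// (le_trans x2).
have ct t : c <= t <= d -> contab (fun x => q x t) a b.
  by move=> /andP[x1 x2]; apply: rect_contq => //; rewrite (le_trans hc)// (le_trans x2).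
rewrite (@itg_split _ c m d) ?m1//; last by apply: contabB; [apply: (cx b)|apply: (cx a)]; rewrite ?lexx ?ab.
have hc0 : contab (fun x => q x c) a b by apply: (ct c); rewrite lexx.
have hm0 : contab (fun x => q x m) a b by apply: (ct m); rewrite m1.
have hd0 : contab (fun x => q x d) a b by apply: (ct d); rewrite lexx andbT.
rewrite (itgB hc0 hd0) (itgB hc0 hm0) (itgB hm0 hd0); ring.
Qed.

Definition quarter (r : (R * R) * (R * R)) :=
  let r1 := (half (fun s => bdint (s, r.2)) r.1, r.2) in
  (r1.1, half (fun s => bdint (r1.1, s)) r1.2).

Lemma quarterP r : inrect r -> [/\ inrect (quarter r),
  [/\ r.1.1 <= (quarter r).1.1, (quarter r).1.2 <= r.1.2,
     r.2.1 <= (quarter r).2.1 & (quarter r).2.2 <= r.2.2],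
  (quarter r).1.2 - (quarter r).1.1 = (r.1.2 - r.1.1) / 2,
  (quarter r).2.2 - (quarter r).2.1 = (r.2.2 - r.2.1) / 2 &
  `|bdint r| <= 4 * `|bdint (quarter r)|].
Proof.
move=> rr; have [ha ab hb [hc cd hd]] := rr.
have E1 : (fun s => bdint (s, r.2)) r.1 = (fun s => bdint (s, r.2)) (r.1.1, mid r.1.1 r.1.2) +
   (fun s => bdint (s, r.2)) (mid r.1.1 r.1.2, r.1.2).
  by rewrite -bdint_x//; case: (r).
have [a1 a2 a3 a4 a5] := halfP (g := fun s => bdint (s, r.2)) ab E1; rewrite /quarter.
set s := half _ r.1 in a1 a2 a3 a4 a5 *; rewrite /=.
have r1 : inrect (s, r.2) by split=> //=; [exact: le_trans a1|exact: le_trans hb].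
have E2 : (fun u => bdint (s, u)) r.2 = (fun u => bdint (s, u)) (r.2.1, mid r.2.1 r.2.2) +
   (fun u => bdint (s, u)) (mid r.2.1 r.2.2, r.2.2).
  by rewrite -(bdint_t r1)/=; case: (r.2).
have [b1 b2 b3 b4 b5] := halfP (g := fun u => bdint (s, u)) cd E2.
set u := half _ r.2 in b1 b2 b3 b4 b5 *.
split=> //; first by split=> //=; [exact: le_trans a1|exact: le_trans hb|split=> //; [exact: le_trans b1|exact: le_trans hd]].
have -> : bdint r = bdint (r.1, r.2) by case: (r).
by move: a5 b5; lra.
Qed.

(** Quartering keeps at least a quarter of the integral. At the common point of the nested
    rectangles the linear parts contribute A (b - a) (d - c) from the vertical sides and its
    opposite from the horizontal ones; what remains is of order e L^2, where L^2 shrinks like 1 /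
    4^n and compensates the factor 4^n. *)
Lemma bdint0 : xa <= xb -> ta <= tb -> bdint ((xa, xb), (ta, tb)) = 0.
Proof.
move=> xab tab; pose r0 := ((xa, xb), (ta, tb)); pose r n := iter n quarter r0.
have rin n : inrect (r n).
  by elim: n => [|n IH]; [split=> //=; split|have [] := quarterP IH].
have rS n := quarterP (rin n).
have [x hx] : exists x, forall n, (r n).1.1 <= x <= (r n).1.2.
  by apply: nested_intervals => n; [case: (rin n)|case: (rS n) => _ []..].
have [t ht] : exists t, forall n, (r n).2.1 <= t <= (r n).2.2.
  by apply: nested_intervals => n; [case: (rin n) => _ _ _ []|case: (rS n) => _ []..].
have Lx n : (r n).1.2 - (r n).1.1 = (xb - xa) / 2 ^+ n.
  elim: n => [|n IH]; first by rewrite expr0 divr1.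
  by have [_ _ -> _ _] := rS n; rewrite IH exprSr invfM mulrA.
have Lt n : (r n).2.2 - (r n).2.1 = (tb - ta) / 2 ^+ n.
  elim: n => [|n IH]; first by rewrite expr0 divr1.
  by have [_ _ _ -> _] := rS n; rewrite IH exprSr invfM mulrA.
have Jn n : `|bdint r0| <= 4 ^+ n * `|bdint (r n)|.
  elim: n => [|n IH]; first by rewrite mul1r.
  apply: (le_trans IH); rewrite exprSr -mulrA ler_wpM2l ?exprn_ge0//.
  by have [] := rS n.
have [A [B [C [hp hq]]]] := closed_form (hx 0%N) (ht 0%N).
pose M := (xb - xa) + (tb - ta); have M0 : 0 <= M by rewrite addr_ge0 ?subr_ge0.
have key (e : R) : 0 < e -> `|bdint r0| <= e * (2 * M ^+ 2).
  move=> e0; have [d1 d10 hd1] := hp _ e0; have [d2 d20 hd2] := hq _ e0.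
  have d0 : 0 < Num.min d1 d2 by rewrite lt_min d10.
  have [n nM] : exists n, M / 2 ^+ n < Num.min d1 d2.
    have : (fun n => M * 2^-1 ^+ n) @ \oo --> (0 : R).
      rewrite -(mulr0 M); apply: cvgM; first exact: cvg_cst.
      by apply: cvg_expr; rewrite ger0_norm ?invf_lt1// ltr1n.
    move/cvgrPdist_lt => /(_ _ d0) [n _ /(_ n (leqnn n)) /=]; rewrite sub0r normrN => h.
    by exists n; rewrite -exprVn (le_lt_trans (ler_norm _)).
  have [ha ab hb [hc cd hd]] := rin n.
  have /andP[x1 x2] := hx n; have /andP[t1 t2] := ht n.
  have LX := Lx n; have LT := Lt n; set L := M / 2 ^+ n in nM.
  have LE : L = ((r n).1.2 - (r n).1.1) + ((r n).2.2 - (r n).2.1).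
    by rewrite LX LT -mulrDl.
  have bx y : (r n).1.1 <= y <= (r n).1.2 -> `|y - x| <= (r n).1.2 - (r n).1.1.
    by move: x1 x2 t1 t2 => + + + + /andP[]; rewrite ler_norml; clear; move=> *; apply/andP; split; lra.
  have bt y : (r n).2.1 <= y <= (r n).2.2 -> `|y - t| <= (r n).2.2 - (r n).2.1.
    by move: x1 x2 t1 t2 => + + + + /andP[]; rewrite ler_norml; clear; move=> *; apply/andP; split; lra.
  have near y s : (r n).1.1 <= y <= (r n).1.2 -> (r n).2.1 <= s <= (r n).2.2 ->
     `|p y s - p x t - A * (y - x) - B * (s - t)| <= e * L /\
     `|q y s - q x t - C * (y - x) - A * (s - t)| <= e * L.
    move=> hy hs; have b1 := bx _ hy; have b2 := bt _ hs.
    have lt1 : `|y - x| < Num.min d1 d2 by apply: le_lt_trans nM; rewrite LE; lra.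
    have lt2 : `|s - t| < Num.min d1 d2 by apply: le_lt_trans nM; rewrite LE; lra.
    move: lt1 lt2; rewrite !lt_min => /andP[u1 u2] /andP[v1 v2].
    have w : e * (`|y - x| + `|s - t|) <= e * L by rewrite ler_pM2l// LE; lra.
    by split; [apply: le_trans (hd1 _ _ u1 v1) w|apply: le_trans (hd2 _ _ u2 v2) w].
  have ax : (r n).1.1 <= (r n).1.1 <= (r n).1.2 by rewrite lexx.
  have bxx : (r n).1.1 <= (r n).1.2 <= (r n).1.2 by rewrite lexx andbT.
  have ct : (r n).2.1 <= (r n).2.1 <= (r n).2.2 by rewrite lexx.
  have dt : (r n).2.1 <= (r n).2.2 <= (r n).2.2 by rewrite lexx andbT.
  set a := (r n).1.1 in x1 ax bxx bx near ha ab LE LX *; set b := (r n).1.2 in x2 ax bxx bx near ab hb LE LX *.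
  set c := (r n).2.1 in t1 ct dt bt near hc cd LE LT *; set d := (r n).2.2 in t2 ct dt bt near cd hd LE LT *.
  have h1 : `|itg (fun s => p b s - p a s) c d - A * (b - a) * (d - c)| <= 2 * (e * L) * (d - c).
    apply: itg_bound => //.
      by apply: contabB; apply: rect_contp => //; rewrite ?ha ?hb ?(le_trans ha ab) ?(le_trans ab hb).
    move=> s hs; have [n1 _] := near b s bxx hs; have [n2 _] := near a s ax hs.
    have := ler_normB (p b s - p x t - A * (b - x) - B * (s - t)) (p a s - p x t - A * (a - x) - B * (s - t)).
    have -> : p b s - p x t - A * (b - x) - B * (s - t) - (p a s - p x t - A * (a - x) - B * (s - t)) =
       p b s - p a s - A * (b - a) by ring.
    lra.
  have h2 : `|itg (fun y => q y c - q y d) a b - (- A * (d - c)) * (b - a)| <= 2 * (e * L) * (b - a).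
    apply: itg_bound => //.
      by apply: contabB; apply: rect_contq => //; rewrite ?hc ?hd ?(le_trans hc cd) ?(le_trans cd hd).
    move=> y hy; have [_ n1] := near y c hy ct; have [_ n2] := near y d hy dt.
    have := ler_normB (q y c - q x t - C * (y - x) - A * (c - t)) (q y d - q x t - C * (y - x) - A * (d - t)).
    have -> : q y c - q x t - C * (y - x) - A * (c - t) - (q y d - q x t - C * (y - x) - A * (d - t)) =
       q y c - q y d - - A * (d - c) by ring.
    lra.
  apply: (le_trans (Jn n)).
  have h3 : `|bdint (r n)| <= 2 * (e * L) * L.
    rewrite /bdint -/a -/b -/c -/d; move: h1 h2; set I1 := itg _ _ _; set I2 := itg _ _ _ => h1 h2.
    have := ler_normD (I1 - A * (b - a) * (d - c)) (I2 - (- A * (d - c)) * (b - a)).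
    have -> : I1 - A * (b - a) * (d - c) + (I2 - (- A * (d - c)) * (b - a)) = I1 + I2 by ring.
    have -> : 2 * (e * L) * L = 2 * (e * L) * (d - c) + 2 * (e * L) * (b - a).
      by rewrite -mulrDr (addrC (d - c)) -LE.
    by move: h1 h2; clear; lra.
  apply: (le_trans (ler_wpM2l _ h3)); first by rewrite exprn_ge0.
  have p2 : (2 : R) ^+ n != 0 by rewrite expf_neq0// pnatr_eq0.
  rewrite le_eqVlt; apply/orP; left; apply/eqP; rewrite /L.
  have -> : (4 : R) ^+ n = 2 ^+ n * 2 ^+ n by rewrite -exprMn; congr (_ ^+ n); ring.
  by field.
apply/eqP; rewrite -normr_eq0 eq_le normr_ge0 andbT.
apply/ler_addgt0Pr => e e0; rewrite add0r.
have M1 : 0 < 2 * M ^+ 2 + 1 by rewrite ltr_wpDl// mulr_ge0// sqr_ge0.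
apply: (le_trans (key (e / (2 * M ^+ 2 + 1)) (divr_gt0 e0 M1))).
by rewrite mulrAC ler_pdivrMr// ler_wpM2l ?(ltW e0)// lerDl.
Qed.

End rectangle.
End goursat.

Lemma cabs_cintegral_le {R : realType} {d} {T : measurableType d} (mu : probability T R)
  (f : T -> R[i]) (B : R) : cintb mu f -> (forall x, cabs (f x) <= B) -> cabs (cintegral mu f) <= B.
Proof.
move=> fi fB; rewrite -lee_fin; apply: (le_trans (cabs_cintegral fi)).
have -> : (B%:E = \int[mu]_x B%:E)%E by rewrite integral_cst//= probability_setT mule1.
apply: ge0_le_integral => //.
- by move=> w _; rewrite lee_fin cabs_ge0.
- exact: cmeas_cabsE fi.1.
- by move=> w _; rewrite lee_fin.
Qed.

(** * Complex differentiability in logarithmic polar coordinates *)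

Section log_polar.
Context {R : realType}.
Implicit Types (u v : R -> R -> R[i]) (f : R -> R).

Definition cd2 u (x0 t0 : R) (A B : R[i]) := forall e : R, 0 < e -> exists2 d : R, 0 < d &
  forall x t, `|x - x0| < d -> `|t - t0| < d ->
    cabs (u x t - u x0 t0 - A * (x - x0)%:C - B * (t - t0)%:C) <= e * (`|x - x0| + `|t - t0|).

Lemma cd2_Re u x0 t0 A B : cd2 u x0 t0 A B ->
  d2 (fun x t => complex.Re (u x t)) x0 t0 (complex.Re A) (complex.Re B).
Proof.
move=> h e e0; have [d d0 hd] := h e e0; exists d => // x t hx ht.
apply: le_trans (hd x t hx ht); apply: le_trans (Re_le_cabs _).
rewrite !(cReD, cReN) /= !cReM /= !mulr0 !subr0; exact: lexx.
Qed.

Lemma cd2_Im u x0 t0 A B : cd2 u x0 t0 A B ->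
  d2 (fun x t => complex.Im (u x t)) x0 t0 (complex.Im A) (complex.Im B).
Proof.
move=> h e e0; have [d d0 hd] := h e e0; exists d => // x t hx ht.
apply: le_trans (hd x t hx ht); apply: le_trans (Im_le_cabs _).
rewrite !(cImD, cImN) /= !cImM /= !mulr0 !add0r; exact: lexx.
Qed.

Lemma d2Z c (p : R -> R -> R) x0 t0 A B : d2 p x0 t0 A B ->
  d2 (fun x t => c * p x t) x0 t0 (c * A) (c * B).
Proof.
move=> h e e0; have c0 : 0 < `|c| + 1 by rewrite ltr_wpDl.
have [d d0 hd] := h _ (divr_gt0 e0 c0); exists d => // x t hx ht.
have -> : c * p x t - c * p x0 t0 - c * A * (x - x0) - c * B * (t - t0) =
  c * (p x t - p x0 t0 - A * (x - x0) - B * (t - t0)) by ring.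
rewrite normrM; apply: (le_trans (ler_wpM2l (normr_ge0 c) (hd x t hx ht))).
rewrite mulrA ler_wpM2r ?addr_ge0// mulrCA ler_piMr ?(ltW e0)//.
by rewrite ler_pdivrMr// mul1r lerDl.
Qed.

Lemma cd2_lip u x0 t0 A B : cd2 u x0 t0 A B -> exists2 d : R, 0 < d &
  forall x t, `|x - x0| < d -> `|t - t0| < d ->
    cabs (u x t - u x0 t0) <= (cabs A + cabs B + 1) * (`|x - x0| + `|t - t0|).
Proof.
move=> h; have [d d0 hd] := h 1 ltr01; exists d => // x t hx ht.
have := hd x t hx ht; set X := `|x - x0|; set T := `|t - t0|; set r := _ - _ - _ - _ => hr.
have -> : u x t - u x0 t0 = r + (A * (x - x0)%:C + B * (t - t0)%:C) by rewrite /r; ring.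
apply: (le_trans (cabsD _ _)); apply: (le_trans (lerD hr (cabsD _ _))).
rewrite !cabsM !cabs_real -/X -/T.
have := mulr_ge0 (cabs_ge0 A) (normr_ge0 (t - t0)); have := mulr_ge0 (cabs_ge0 B) (normr_ge0 (x - x0)).
by rewrite -/X -/T !mulrDl !mulrDr !mul1r; lra.
Qed.

Lemma cd2M u v x0 t0 A B A' B' : cd2 u x0 t0 A B -> cd2 v x0 t0 A' B' ->
  cd2 (fun x t => u x t * v x t) x0 t0 (A * v x0 t0 + u x0 t0 * A') (B * v x0 t0 + u x0 t0 * B').
Proof.
move=> hu hv e e0; set u0 := u x0 t0; set v0 := v x0 t0.
have [d1 d10 l1] := cd2_lip hu; have [d2 d20 l2] := cd2_lip hv.
set C := cabs A + cabs B + 1 in l1; set C' := cabs A' + cabs B' + 1 in l2.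
have C0 : 0 <= C by rewrite !addr_ge0 ?cabs_ge0. have C0' : 0 <= C' by rewrite !addr_ge0 ?cabs_ge0.
pose M := cabs u0 + cabs v0 + C * C' + 1.
have M0 : 0 < M by rewrite ltr_wpDl// !addr_ge0 ?cabs_ge0 ?mulr_ge0.
have eM : 0 < e / M by rewrite divr_gt0.
have [d3 d30 h3] := hu _ eM; have [d4 d40 h4] := hv _ eM.
(* The bound e / M / 2 on each variable makes the quadratic cross term at most C C' e / M times the
   linear size; [M] collects all three contributions. *)
exists (Num.min (Num.min (Num.min d1 d2) (Num.min d3 d4)) (e / M / 2)).
  by rewrite !lt_min d10 d20 d30 d40 !divr_gt0.
move=> x t; rewrite !lt_min => /andP[/andP[/andP[x1 x2] /andP[x3 x4]] x5].
move=> /andP[/andP[/andP[t1 t2] /andP[t3 t4]] t5].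
have := l1 x t x1 t1; have := l2 x t x2 t2; have := h3 x t x3 t3; have := h4 x t x4 t4.
rewrite -/u0 -/v0; set s := `|x - x0| + `|t - t0|; set ux := u x t; set vx := v x t.
set X := (x - x0)%:C; set T := (t - t0)%:C.
set ru := _ - _ - A * _ - _; set rv := _ - _ - A' * _ - _ => b4 b3 b2 b1.
have s0 : 0 <= s by rewrite addr_ge0.
have sM : s <= e / M by rewrite /s; move: x5 t5; clear; lra.
have -> : ux * vx - u0 * v0 - (A * v0 + u0 * A') * X - (B * v0 + u0 * B') * T =
   ru * v0 + u0 * rv + (ux - u0) * (vx - v0) by rewrite /ru /rv; ring.
have bb : cabs (ux - u0) * cabs (vx - v0) <= C * C' * (e / M * s).
  apply: (@le_trans _ _ ((C * s) * (C' * s))); first by rewrite ler_pM ?cabs_ge0.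
  by rewrite mulrACA ler_wpM2l ?mulr_ge0// ler_wpM2r.
have bu : cabs ru * cabs v0 <= e / M * s * cabs v0 by rewrite ler_wpM2r ?cabs_ge0.
have bv : cabs u0 * cabs rv <= cabs u0 * (e / M * s) by rewrite ler_wpM2l ?cabs_ge0.
apply: (le_trans (cabsD _ _)); apply: (le_trans (lerD (cabsD _ _) (lexx _))); rewrite !cabsM.
apply: (le_trans (lerD (lerD bu bv) bb)).
have -> : e * s = M * (e / M * s) by rewrite mulrA mulrCA divff ?mulr1// gt_eqF.
have q0 : 0 <= e / M * s by rewrite mulr_ge0// ltW.
by move: q0; rewrite /M; set q := e / _ * s; clear; nra.
Qed.

Lemma cd2_comp (H : R[i] -> R[i]) l u x0 t0 A B : cd2 u x0 t0 A B ->
  (forall e : R, 0 < e -> exists2 d : R, 0 < d & forall h, cabs h < d ->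
     cabs (H (u x0 t0 + h) - H (u x0 t0) - l * h) <= e * cabs h) ->
  cd2 (fun x t => H (u x t)) x0 t0 (l * A) (l * B).
Proof.
move=> hu hH e e0; set u0 := u x0 t0.
have [d1 d10 l1] := cd2_lip hu; set C := cabs A + cabs B + 1 in l1.
have C0 : 0 < C by rewrite ltr_wpDl ?addr_ge0 ?cabs_ge0.
pose M := C + cabs l + 1; have M0 : 0 < M by rewrite ltr_wpDl// addr_ge0 ?cabs_ge0// ltW.
have eM : 0 < e / M by rewrite divr_gt0.
have [d2 d20 h2] := hH _ eM; have [d3 d30 h3] := hu _ eM.
exists (Num.min (Num.min d1 d3) (d2 / C / 2)); first by rewrite !lt_min d10 d30 !divr_gt0.
move=> x t; rewrite !lt_min => /andP[/andP[x1 x3] x4] /andP[/andP[t1 t3] t4].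
have := l1 x t x1 t1; have := h3 x t x3 t3; rewrite -/u0.
set s := `|x - x0| + `|t - t0|; set ux := u x t; set ru := _ - _ - _ - _ => b3 b1.
have s0 : 0 <= s by rewrite addr_ge0.
have sd : s < d2 / C by rewrite /s; move: x4 t4; clear; lra.
have cd : cabs (ux - u0) < d2.
  by apply: (le_lt_trans b1); rewrite mulrC -ltr_pdivlMr.
have := h2 _ cd; rewrite -/u0 (addrC u0) subrK => b2.
have -> : H ux - H u0 - l * A * (x - x0)%:C - l * B * (t - t0)%:C =
  (H ux - H u0 - l * (ux - u0)) + l * ru by rewrite /ru; ring.
apply: (le_trans (cabsD _ _)); rewrite cabsM.
have b4 : e / M * cabs (ux - u0) <= e / M * (C * s) by rewrite ler_wpM2l// ltW.
have b5 : cabs l * cabs ru <= cabs l * (e / M * s) by rewrite ler_wpM2l ?cabs_ge0.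
apply: (le_trans (lerD (le_trans b2 b4) b5)).
have -> : e * s = M * (e / M * s) by rewrite mulrA mulrCA divff ?mulr1// gt_eqF.
have q0 : 0 <= e / M * s by rewrite mulr_ge0// ltW.
rewrite [e / M * (C * s)]mulrCA.
by move: q0; rewrite /M; set q := e / _ * s; clear; nra.
Qed.

Definition expands f (x0 df : R) := forall e : R, 0 < e -> exists2 d : R, 0 < d &
  forall x, `|x - x0| < d -> `|f x - f x0 - df * (x - x0)| <= e * `|x - x0|.

Lemma is_derive_expands f (x0 df : R) : is_derive x0 (1 : R) f df -> expands f x0 df.
Proof.
move=> [fd fE] e e0; have /cvgrPdist_lt : h^-1 *: ((f \o shift x0) (h *: 1) - f x0) @[h --> (0 : R)^'] --> df.
  by rewrite -fE; exact: fd.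
move=> /(_ _ e0); rewrite /dnbhs /within /= => /nbhs_ballP[d /= d0 hd].
exists d => // x hx; have [->|xx0] := eqVneq x x0; first by rewrite !subrr mulr0 subrr normr0 mulr0.
have h0 : x - x0 != 0 by rewrite subr_eq0.
have := hd (x - x0); rewrite /ball/= sub0r normrN => /(_ hx h0).
rewrite -[_ *: (1 : R)]/((x - x0) * 1) mulr1 subrK distrC => /ltW hh.
have -> : f x - f x0 - df * (x - x0) = ((x - x0)^-1 * (f x - f x0) - df) * (x - x0).
  by rewrite mulrBl mulrAC mulVf// mul1r.
by rewrite normrM ler_wpM2r.
Qed.

Lemma expands_scale f k x0 df : expands f (k * x0) df -> expands (fun x => f (k * x)) x0 (k * df).
Proof.
move=> h e e0; have k0 : 0 < `|k| + 1 by rewrite ltr_wpDl.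
have [d d0 hd] := h _ (divr_gt0 e0 k0); exists (d / (`|k| + 1)); first by rewrite divr_gt0.
move=> x; rewrite ltr_pdivlMr// => hx.
have kx : `|k * x - k * x0| = `|k| * `|x - x0| by rewrite -mulrBr normrM.
have := hd (k * x); rewrite kx => hh.
have -> : k * df * (x - x0) = df * (k * x - k * x0) by ring.
apply: (le_trans (hh _)).
  by apply: le_lt_trans hx; rewrite mulrC ler_wpM2l// lerDl.
rewrite mulrA ler_wpM2r// mulrAC -mulrA ler_piMr ?(ltW e0)//.
by rewrite ler_pdivrMr// mul1r lerDl.
Qed.

Lemma cd2_x f x0 t0 df : expands f x0 df -> cd2 (fun x _ => (f x)%:C) x0 t0 df%:C 0.
Proof.
move=> h e e0; have [d d0 hd] := h e e0; exists d => // x t hx ht.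
rewrite mul0r subr0 -RtoCM -!rmorphB cabs_real; apply: (le_trans (hd x hx)).
by rewrite ler_wpM2l ?(ltW e0)// lerDl.
Qed.

Lemma cd2_t (f g : R -> R) x0 t0 df dg : expands f t0 df -> expands g t0 dg ->
  cd2 (fun _ t => f t +i* g t) x0 t0 0 (df +i* dg).
Proof.
move=> hf hg e e0; have e2 : 0 < e / 2 by rewrite divr_gt0.
have [d d0 hd] := hf _ e2; have [d' d0' hd'] := hg _ e2.
exists (Num.min d d'); first by rewrite lt_min d0.
move=> x t _; rewrite lt_min => /andP[/hd h1 /hd' h2]; rewrite mul0r subr0.
apply: (le_trans (cabs_le_ReIm _)); rewrite !(cReD, cImD, cReN, cImN, cReM, cImM) /= !mulr0 subr0 add0r.
apply: (le_trans (lerD h1 h2)); rewrite -mulrDl -splitr ler_wpM2l ?(ltW e0)//.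
by rewrite lerDr.
Qed.

(* exp (k (x + 2 pi i t)) *)
Definition cexp (k : int) (x t : R) : R[i] :=
  (expR (k%:~R * x))%:C * circle_val (circle_exp (k%:~R * t)).

Lemma cd2_cexp k x t :
  cd2 (cexp k) x t (k%:~R * cexp k x t) ('i * (2 * pi * k%:~R)%:C * cexp k x t).
Proof.
pose c : R := 2 * pi * k%:~R.
have E : cexp k = fun x t => (expR (k%:~R * x))%:C * (cos (c * t) +i* sin (c * t)).
  by apply/funext => y; apply/funext => s; rewrite /cexp circle_exp_val mulrA.
have h1 : expands (fun y => expR (k%:~R * y)) x (k%:~R * expR (k%:~R * x)).
  by apply: (expands_scale (f := expR)); exact: is_derive_expands.
have h2 : expands (fun s => cos (c * s)) t (c * - sin (c * t)).
  by apply: (expands_scale (f := cos)); exact: is_derive_expands.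
have h3 : expands (fun s => sin (c * s)) t (c * cos (c * t)).
  by apply: (expands_scale (f := sin)); exact: is_derive_expands.
have := cd2M (cd2_x t h1) (cd2_t x h2 h3); rewrite -/c.
set A := _ + _; set B := _ + _ => h.
have <- : A = k%:~R * cexp k x t.
  by rewrite /A E mulr0 addr0 RtoCM rmorph_int mulrA.
have <- : B = 'i * c%:C * cexp k x t.
  rewrite /B E mul0r add0r; apply: complex_eqE; rewrite !(cReM, cImM) /=; ring.
by rewrite E.
Qed.

Lemma expR_intmul (k : int) (x : R) : expR (k%:~R * x) = expR x ^ k.
Proof.
case: k => n; first by rewrite -exprnP -expRM_natl.
by rewrite NegzE mulrNz mulNr expRN expRM_natl exprnN.
Qed.

Lemma circle_exp_intmul (k : int) (t : R) :
  circle_val (circle_exp (k%:~R * t)) = circle_val (circle_exp t) ^ k.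
Proof.
case: k => n; first by rewrite -exprnP -circle_exp_natmul.
set s : R := n.+1%:R * t.
have E : circle_val (circle_exp (- s)) * circle_val (circle_exp s) = 1.
  by rewrite -circle_mulE -circle_expD addNr circle_exp_val mulr0 cos0 sin0.
rewrite NegzE mulrNz mulNr -exprnN -circle_exp_natmul -/s.
by apply: (mulIf (circle_neq0 (circle_exp s))); rewrite E mulVf ?circle_neq0.
Qed.

Lemma cabs_cexp k x t : cabs (cexp k x t) = expR x ^ k.
Proof. by rewrite cabsM cabs_circle mulr1 cabs_real ger0_norm ?expR_ge0 ?expR_intmul. Qed.

Lemma cexpE k x t : cexp k x t = ((expR x) ^ k)%:C * circle_val (circle_exp t) ^ k.
Proof. by rewrite /cexp circle_exp_intmul expR_intmul. Qed.

Lemma cexp_period k x : cexp k x 0 = cexp k x 1.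
Proof.
have e : circle_exp (0 : R) = circle_exp 1.
  by rewrite -(circle_expB1 (1 : R)) subrr.
by rewrite !cexpE e.
Qed.

Definition cdiff (H : R[i] -> R[i]) z := exists l, forall e : R, 0 < e ->
  exists2 d : R, 0 < d & forall h, cabs h < d -> cabs (H (z + h) - H z - l * h) <= e * cabs h.

Section circle_means.
Variables (H : R[i] -> R[i]) (a : int).
Hypothesis Hd : forall z, cabs z < 1 -> cdiff H z.

Let u x t := H (cexp 1 x t) * cexp (- a) x t.

(** [u] is a holomorphic function of x + 2 pi i t, so its t-derivative is 2 pi i times its
    x-derivative: the Cauchy-Riemann equations. The condition x < 0 says that the radius exp x is
    below 1. *)
Lemma polar_cd2 x t : x < 0 -> exists A, cd2 u x t A ('i * (2 * pi)%:C * A).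
Proof.
move=> x0; have [|l hl] := Hd (z := cexp 1 x t); first by rewrite cabs_cexp expr1z expR_lt1.
have := cd2M (cd2_comp (cd2_cexp 1 x t) hl) (cd2_cexp (- a) x t).
set A := _ + _; set B := _ + _ => h; exists A.
suff <- : B = 'i * (2 * pi)%:C * A by [].
rewrite /A /B !RtoCM !rmorph_int; ring.
Qed.

(** The sides t = 0 and t = 1 of the rectangle cancel by periodicity, so the integrals over the
    other two sides agree. *)
Lemma mean_closed (p q : R -> R -> R) xa xb : xa <= xb -> xb < 0 ->
  (forall x t, x < 0 -> exists A B C, d2 p x t A B /\ d2 q x t C A) ->
  (forall x, q x 0 = q x 1) -> itg (p xa) 0 1 = itg (p xb) 0 1.
Proof.
move=> ab b0 pq qp.
have cl x t : xa <= x <= xb -> 0 <= t <= 1 -> exists A B C, d2 p x t A B /\ d2 q x t C A.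
  by move=> /andP[_ xb'] _; apply: pq; exact: le_lt_trans b0.
have := bdint0 cl ab ler01; rewrite /bdint /=.
have -> : (fun x => q x 0 - q x 1) = (fun=> 0) by apply/funext => x; rewrite qp subrr.
rewrite itg_cst// mul0r addr0.
have cp x : x < 0 -> contab (p x) 0 1.
  by move=> x0 t _; have [A [B [C [h _]]]] := pq x t x0; exact: d2_cvgt h.
rewrite itgB; [|exact: cp|exact: cp (le_lt_trans ab b0)].
by move/eqP; rewrite subr_eq0 => /eqP.
Qed.

Lemma polar_mean xa xb : xa <= xb -> xb < 0 ->
  itg (fun t => complex.Re (u xa t)) 0 1 = itg (fun t => complex.Re (u xb t)) 0 1 /\
  itg (fun t => complex.Im (u xa t)) 0 1 = itg (fun t => complex.Im (u xb t)) 0 1.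
Proof.
move=> ab b0; have pi2 : (2 * pi : R) != 0 by rewrite mulf_neq0 ?pnatr_eq0// gt_eqF ?pi_gt0.
have up x : u x 0 = u x 1 by rewrite /u !cexp_period.
have ReE (A : R[i]) : complex.Re ('i * (2 * pi)%:C * A) = - (2 * pi * complex.Im A).
  by rewrite !cReM /= ; ring.
have ImE (A : R[i]) : complex.Im ('i * (2 * pi)%:C * A) = 2 * pi * complex.Re A.
  by rewrite !cImM /= ; ring.
split.
  (* By the Cauchy-Riemann equations the partner of Re u is Im u / (2 pi), and that of Im u is - Re
     u / (2 pi). *)
  apply: (@mean_closed (fun x t => complex.Re (u x t)) (fun x t => (2 * pi)^-1 * complex.Im (u x t))) => //.
    move=> x t x0; have [A hA] := polar_cd2 t x0.
    have := d2Z (2 * pi)^-1 (cd2_Im hA); rewrite ImE mulKf// => h.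
    by do 3 eexists; split; [exact: cd2_Re hA|exact: h].
  by move=> x; rewrite up.
apply: (@mean_closed (fun x t => complex.Im (u x t)) (fun x t => - (2 * pi)^-1 * complex.Re (u x t))) => //.
  move=> x t x0; have [A hA] := polar_cd2 t x0.
  have := d2Z (- (2 * pi)^-1) (cd2_Re hA); rewrite ReE mulrNN mulKf// => h.
  by do 3 eexists; split; [exact: cd2_Im hA|exact: h].
by move=> x; rewrite up.
Qed.

End circle_means.

Lemma integral_uniform01 (h : measurableTypeR R -> \bar R) : measurable_fun setT h ->
  (\int[uniform_prob (@ltr01 R)]_t h t = \int[lebesgue_measure]_(t in `[0%R, 1%R]) h t)%E.
Proof.
move=> mh; rewrite integralE [RHS]integralE !integral_uniform ?subr0 ?invr1 ?mul1e//.
- exact: measurable_funeneg.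
- exact: measurable_funepos.
Qed.

Lemma coord_mean (F : circle R -> R[i]) j : cmeas F ->
  cintb (torus_measure R nat) (fun w => F (w j)) ->
  cintegral (torus_measure R nat) (fun w => F (w j)) =
    itg (fun t => complex.Re (F (circle_exp t))) 0 1 +i* itg (fun t => complex.Im (F (circle_exp t))) 0 1.
Proof.
move=> mF Fi; have mj : measurable_fun setT (fun v : torus R nat => v j) by exact: measurable_coord.
have Fc : cintb (@circle_measure R) F.
  split=> //; rewrite (ge0_integral_mp mj (haar_coord j)); first exact: Fi.2.
    exact: cmeas_cabsE.
  by move=> x; rewrite lee_fin cabs_ge0.
rewrite -(cintegral_mp mj (haar_coord j) Fc).
have me := @measurable_circle_exp R.
have hc A : measurable A -> circle_measure A = uniform_prob (@ltr01 R) (circle_exp @^-1` A) by [].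
rewrite (cintegral_mp me hc Fc) /cintegral /Rintegral /itg.
have [mr mi] := cmeas_comp mF me.
by congr (_ +i* _); rewrite integral_uniform01//; apply/measurable_EFinP.
Qed.

(** On positive radii r^(-a) M(r) is constant by [polar_mean]. The relation is cross-multiplied so
    as to include radius 0, which has no logarithm and is reached through the expansion of [H] at 0;
    the same expansion excludes negative exponents. *)
Lemma circle_coef_scale (H : R[i] -> R[i]) (j : nat) (a : int) :
  (forall z, cabs z < 1 -> cdiff H z) ->
  (forall r : R, 0 <= r < 1 -> cintb (torus_measure R nat) (fun w => H (r%:C * tcoord w j))) ->
  let M (r : R) := cintegral (torus_measure R nat) (fun w => H (r%:C * tcoord w j) * tcoord w j ^ (- a)) in
  (forall r s : R, 0 <= r < 1 -> 0 <= s < 1 -> (s ^+ `|a|)%:C * M r = (r ^+ `|a|)%:C * M s) /\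
  (a < 0 -> forall r : R, 0 <= r < 1 -> M r = 0).
Proof.
set m := torus_measure R nat => Hd Hi M.
have Mi (r : R) : 0 <= r < 1 -> cintb m (fun w => H (r%:C * tcoord w j) * tcoord w j ^ (- a)).
  move=> r01; apply: (@cintbM _ _ _ _ _ _ 1) (Hi r r01) _ _; first exact: cmeas_tcoordX.
  by move=> v; rewrite cabsXz cabs_tcoord exp1rz.
have Mpos (r s : R) : 0 < r -> r <= s -> s < 1 -> (r ^ (- a))%:C * M r = (s ^ (- a))%:C * M s.
  move=> r0 rs s1; have s0 := lt_le_trans r0 rs.
  have lnlt : ln r <= ln s by rewrite ler_ln ?posrE.
  have ln0 : ln s < 0 by rewrite ln_lt0// s0.
  have step (t : R) : 0 < t -> t < 1 -> (t ^ (- a))%:C * M t =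
      itg (fun x => complex.Re (H (cexp 1 (ln t) x) * cexp (- a) (ln t) x)) 0 1 +i*
      itg (fun x => complex.Im (H (cexp 1 (ln t) x) * cexp (- a) (ln t) x)) 0 1.
    move=> t0 t1; have t01 : 0 <= t < 1 by rewrite ltW.
    pose F (c : circle R) := (t ^ (- a))%:C * (H (t%:C * circle_val c) * circle_val c ^ (- a)).
    rewrite -cintegralZ; last exact: Mi.
    have sec : measurable_fun setT (fun (c : circle R) => (fun i => if i == j then c else circle_one) : torus R nat).
      apply: measurable_to_torus => i; rewrite /tcoord; case: eqP => _; first exact: cmeas_circle_val.
      exact: cmeas_cst.
    have mF : cmeas F.
      have := cmeas_comp (Mi t t01).1 sec; rewrite /comp /tcoord eqxx => h.
      exact: cmeasZ.
    have := @coord_mean F j mF (cintbZ _ (Mi t t01)) => ->.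
    have E x : F (circle_exp x) = H (cexp 1 (ln t) x) * cexp (- a) (ln t) x.
      by rewrite !cexpE lnK ?posrE// !expr1z /F mulrCA.
    by congr (_ +i* _); congr (itg _ 0 1); apply/funext => x; rewrite E.
  have [e1 e2] := polar_mean a Hd lnlt ln0.
  by rewrite (step r r0 (le_lt_trans rs s1)) (step s s0 s1) e1 e2.
have [|l hl] := Hd 0; first by rewrite cabs0.
have [d d0 hd] := hl 1 ltr01.
pose C := cabs l + 1; have C0 : 0 <= C by rewrite addr_ge0 ?cabs_ge0.
pose c0 : R[i] := H 0 * (a == 0)%:R.
(* Only the constant [H 0] survives at radius 0, and the linear expansion of [H] there gives the
   rate of convergence. *)
have Mnear (r : R) : 0 <= r < 1 -> r < d -> cabs (M r - c0) <= C * r.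
  move=> r01 rd; have /andP[r0 _] := r01.
  have -> : c0 = cintegral m (fun w => H 0 * tcoord w j ^ (- a)).
    by rewrite cintegralZ ?cintegral_tcoordX ?oppr_eq0//; exact: cintb_tcoordX.
  have ci0 : cintb m (fun w => H 0 * tcoord w j ^ (- a)) by apply: cintbZ; exact: cintb_tcoordX.
  rewrite -(cintegralB (Mi r r01) ci0).
  apply: (cabs_cintegral_le (cintbB (Mi r r01) ci0)) => w; rewrite -mulrBl cabsM cabsXz cabs_tcoord exp1rz mulr1.
  have zr : cabs (r%:C * tcoord w j) = r by rewrite cabsM cabs_tcoord mulr1 cabs_real ger0_norm.
  have := hd (r%:C * tcoord w j); rewrite zr add0r mul1r => /(_ rd) h.
  have -> : H (r%:C * tcoord w j) - H 0 =
     (H (r%:C * tcoord w j) - H 0 - l * (r%:C * tcoord w j)) + l * (r%:C * tcoord w j) by ring.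
  by apply: (le_trans (cabsD _ _)); rewrite [cabs (l * _)]cabsM zr /C mulrDl mul1r addrC lerD2l.
have M0 : M 0 = c0.
  apply/eqP; rewrite -subr_eq0 -cabs_eq0 eq_le cabs_ge0 andbT -[leRHS](mulr0 C).
  by apply: Mnear => //; rewrite lexx ltr01.
have small (x : R[i]) : (forall r : R, 0 < r -> r < 1 -> r < d -> cabs x <= C * r) -> x = 0.
  move=> hx; apply/eqP; rewrite -cabs_eq0 eq_le cabs_ge0 andbT; apply/ler_addgt0Pr => e e0.
  have C1 : 0 < C + 1 by rewrite ltr_wpDl.
  pose r := Num.min (Num.min 2^-1 (d / 2)) (e / (C + 1)).
  have r0 : 0 < r by rewrite /r !lt_min invr_gt0 ltr0n !divr_gt0.
  have r1 : r < 1 by rewrite /r !gt_min invf_lt1 ?ltr1n.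
  have dd : d / 2 < d by move: d0; clear; lra.
  have rd : r < d by rewrite /r !gt_min dd orbT.
  apply: (le_trans (hx r r0 r1 rd)); rewrite add0r.
  have re : r <= e / (C + 1) by rewrite /r ge_min lexx orbT.
  apply: (le_trans (ler_wpM2l C0 re)); rewrite mulrCA ler_piMr ?(ltW e0)//.
  by rewrite ler_pdivrMr// mul1r lerDl.
have c0E : a != 0 -> c0 = 0 by move=> /negbTE a0; rewrite /c0 a0 mulr0.
clear Mi; clearbody M c0; case: a Mpos c0E => n Mpos c0E; last first.
  (* For a negative exponent, s^(-a) M(s) tends to 0 with s but does not depend on s. *)
  have {c0E} c00 := c0E isT.
  have Mz (r : R) : 0 <= r < 1 -> M r = 0.
    move=> /andP[]; rewrite le_eqVlt => /orP[/eqP <- _|r0 r1]; first by rewrite M0.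
    suff : (r ^ (- Negz n))%:C * M r = 0.
      have rn : (r ^ (- Negz n))%:C != 0.
        by rewrite -cabs_eq0 cabs_real normr_eq0 expfz_neq0// gt_eqF.
      by move=> /eqP; rewrite mulf_eq0 (negbTE rn) => /eqP.
    apply: small => s s0 s1 sd.
    have sr : (r ^ (- Negz n))%:C * M r = (s ^ (- Negz n))%:C * M s.
      by have [rs|/ltW rs] := leP r s; [exact: Mpos|symmetry; exact: Mpos].
    rewrite sr cabsM cabs_real; have := Mnear s; rewrite c00 subr0 (ltW s0) s1 => /(_ isT sd).
    apply: le_trans; rewrite ler_piMl ?cabs_ge0// NegzE opprK -exprnP ger0_norm ?exprn_ge0 ?(ltW s0)//.
    by rewrite exprn_ile1 ?(ltW s0) ?(ltW s1).
  by split=> [r s r01 s01|_ r r01]; rewrite !Mz// !mulr0.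
split=> //.
have Mrs (r s : R) : 0 < r -> 0 < s -> r < 1 -> s < 1 -> (s ^+ n)%:C * M r = (r ^+ n)%:C * M s.
  move=> r0 s0 r1 s1.
  have sr : (r ^ (- n%:Z))%:C * M r = (s ^ (- n%:Z))%:C * M s.
    by have [rs|/ltW rs] := leP r s; [exact: Mpos|symmetry; exact: Mpos].
  have := congr1 (fun x => (r ^+ n * s ^+ n)%:C * x) sr; rewrite /= !mulrA -!RtoCM -!exprnN.
  rewrite [r ^+ n * s ^+ n]mulrC mulfK ?expf_neq0 ?gt_eqF// => ->.
  by rewrite mulrAC divff ?expf_neq0 ?gt_eqF// mul1r.
(* Radius 0: for n = 0 both powers are 1 and M is constant by continuity; for n > 0 both sides
   vanish. *)
have Mz (s' : R) : 0 < s' -> s' < 1 -> (s' ^+ n)%:C * M 0 = (0 ^+ n)%:C * M s'.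
  move=> s'0 s'1; rewrite M0; case: n Mpos Mrs c0E => [|k] Mpos Mrs c0E.
    rewrite !expr0 !mul1r; apply/esym/eqP; rewrite -subr_eq0; apply/eqP/small => t t0 t1 td.
    have := Mrs s' t s'0 t0 s'1 t1; rewrite !expr0 !mul1r => ->.
    by have := Mnear t; rewrite (ltW t0) t1 => /(_ isT td).
  by rewrite (c0E isT) mulr0 expr0n mul0r.
move=> r s /andP[r0 r1] /andP[s0 s1].
move: r0 s0; rewrite le_eqVlt => /orP[/eqP r0|r0]; rewrite le_eqVlt => /orP[/eqP s0|s0].
- by rewrite -r0 -s0.
- by rewrite -r0; exact: Mz.
- by rewrite -s0; symmetry; exact: Mz.
- exact: Mrs.
Qed.

End log_polar.

(** * Fourier coefficients of slices *)

Section slice_coefficients.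
Context {R : realType}.
Local Notation m := (torus_measure R nat).
Implicit Types (g : ell2 R -> R[i]) (w v : torus R nat) (rho sig : nat -> R) (a : nat -> int).

Lemma cintegral_section j (F : torus R nat -> R[i]) (B : R) : cmeas F -> (forall w, cabs (F w) <= B) ->
  cintegral m F = cintegral m (fun w => cintegral m (fun v => F (tmul w (tproj j v)))).
Proof.
move=> mF FB; have Fi : cintb m F := cintb_bound m mF FB.
have mG := cmeas_comp mF (measurable_tmul_tproj j).
have [-> _ _] := cintegral_fubini_bound m m mG (fun z => FB _).
transitivity (cintegral m (fun _ : torus R nat => cintegral m F)); first by rewrite cintegral_cst.
apply: eq_cintegral => v; rewrite (cintegral_tmul (tproj j v) Fi).
by apply: eq_cintegral => w; congr F; apply/funext => i; apply: circle_inj; rewrite !circle_mulE mulrC.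
Qed.

Definition upd rho j (r : R) : nat -> R := fun i => if i == j then r else rho i.

Lemma upd_id rho j : upd rho j (rho j) = rho.
Proof. by apply/funext => i; rewrite /upd; case: eqP => [->|]. Qed.

Lemma upd01 rho j r : (forall i, 0 <= rho i < 1) -> 0 <= r < 1 -> forall i, 0 <= upd rho j r i < 1.
Proof. by move=> h r01 i; rewrite /upd; case: eqP. Qed.

Lemma slice_coord_cdiff g n rho w j : holomorphic g -> (forall i, 0 <= rho i < 1) ->
  forall z, cabs z < 1 -> cdiff (fun z => g (zpt n (fun i =>
    if i == j then z * tcoord w j else (rho i)%:C * tcoord w i))) z.
Proof.
move=> gh r01 z z1; set y := fun (z : R[i]) i => if i == j then z * tcoord w j else (rho i)%:C * tcoord w i.
have yP : polydisc2 (zpt n (y z)).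
  have -> : zpt n (y z) = zpt n (fun i => (upd rho j (cabs z) i)%:C *
      (if i == j then phase z * tcoord w j else tcoord w i)).
    congr (zpt n); apply/funext => i; rewrite /y /upd; case: eqP => // _.
    by rewrite mulrA -phaseE.
  apply: slice_polydisc => [|i]; first by apply: upd01; rewrite ?cabs_ge0.
  by case: eqP; rewrite ?cabsM ?cabs_phase cabs_tcoord ?mulr1.
have [L [LZ hL]] := differentiable_ell2_expand (gh _ yP).
pose ej : ell2 R := zpt n (fun i => if i == j then tcoord w j else 0).
have yD h : zpt n (y (z + h)) = zpt n (y z) + h *: ej.
  apply: ell2_inj => i; rewrite -[RHS]/(zpt n (y z) i + h * ej i) !zptE.
  by case: ifP => _; rewrite ?mulr0 ?addr0// /y; case: eqP => _; rewrite ?mulr0 ?addr0// mulrDl.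
exists (L ej) => e e0; have k0 : 0 < l2n ej + 1 by rewrite ltr_wpDl ?l2n_ge0.
have [d d0 hd] := hL _ (divr_gt0 e0 k0).
exists (d / (l2n ej + 1)) => [|h]; first by rewrite divr_gt0.
rewrite ltr_pdivlMr// => hh; rewrite -/(y (z + h)) -/(y z) yD mulrC -LZ.
apply: (le_trans (hd _ _)); rewrite l2nZ.
  by apply: le_lt_trans hh; rewrite ler_wpM2l ?cabs_ge0// lerDl.
rewrite mulrCA mulrC ler_wpM2r ?cabs_ge0// mulrAC ler_pdivrMr//.
by rewrite ler_wpM2l ?(ltW e0)// lerDl.
Qed.

Lemma chi_tproj n a w v (j : nat) : (j < n)%N ->
  chi n a (tmul w (tproj j v)) = chi n a w * tcoord v j ^ a j.
Proof.
move=> jn; rewrite chi_tmul; congr (_ * _); rewrite /chi (bigD1 (Ordinal jn))//= tcoord_tproj eqxx.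
by rewrite big1 ?mulr1// => i; rewrite -val_eqE/= tcoord_tproj => /negbTE ->; rewrite exp1rz.
Qed.

(** Rotating coordinate [j] turns the slice into a function [H w] of one complex variable on a
    circle, to which [circle_coef_scale] applies for each [w]; the other coordinates are integrated
    afterwards. *)
Lemma four_slice_coord g n a rho (j : nat) (r s : R) : holomorphic g -> (forall i, 0 <= rho i < 1) ->
  (j < n)%N -> 0 <= r < 1 -> 0 <= s < 1 ->
  (s ^+ `|a j|)%:C * four n a (slice g n (upd rho j r)) =
    (r ^+ `|a j|)%:C * four n a (slice g n (upd rho j s)) /\
  (a j < 0 -> four n a (slice g n (upd rho j r)) = 0).
Proof.
move=> gh r01 jn hr hs.
pose H w z := g (zpt n (fun i => if i == j then z * tcoord w j else (rho i)%:C * tcoord w i)).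
have HE w (t : R) v : slice g n (upd rho j t) (tmul w (tproj j v)) = H w (t%:C * tcoord v j).
  congr (g (zpt n _)); apply/funext => i; rewrite /upd tmulE tcoord_tproj.
  by case: eqP => [->|]; rewrite ?mulr1// [tcoord w j * _]mulrC mulrA.
have sl w (t : R) : 0 <= t < 1 -> cmeas (fun v => H w (t%:C * tcoord v j)) /\
    exists B : R, forall v, cabs (H w (t%:C * tcoord v j)) <= B.
  move=> t01; have u01 := upd01 j r01 t01; have [B hB] := slice_bounded n gh u01; split.
    apply: (eq_cmeas (fun v => esym (HE w t v))).
    exact: (cmeas_pair1 w (cmeas_comp (cmeas_slice n gh u01) (measurable_tmul_tproj j))).
  by exists B => v; rewrite -HE.
have Hi w (t : R) : 0 <= t < 1 -> cintb m (fun v => H w (t%:C * tcoord v j)).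
  by move=> t01; have [mH [B hB]] := sl w t t01; exact: cintb_bound hB.
pose M w (t : R) := cintegral m (fun v => H w (t%:C * tcoord v j) * tcoord v j ^ (- a j)).
have MP w := circle_coef_scale (a j) (slice_coord_cdiff n w j gh r01) (Hi w).
have key (c : R[i]) (t : R) : 0 <= t < 1 -> c * four n a (slice g n (upd rho j t)) =
    cintegral m (fun w => chi n (fun i => - a i) w * (c * M w t)).
  move=> t01; have u01 := upd01 j r01 t01; have [B hB] := slice_bounded n gh u01.
  have fi := cintb_four n (fun i => - a i) (cintb_slice n gh u01).
  rewrite /four -cintegralZ//.
  rewrite (@cintegral_section j _ (cabs c * B)); last 2 first.
  - exact: (cintbZ c fi).1.
  - by move=> w; rewrite !cabsM cabs_chi mulr1 ler_wpM2l ?cabs_ge0.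
  apply: eq_cintegral => w.
  have ci : cintb m (fun v => H w (t%:C * tcoord v j) * tcoord v j ^ (- a j)).
    apply: (@cintbM _ _ _ _ _ _ 1) (Hi w t t01) _ _; first exact: cmeas_tcoordX.
    by move=> v; rewrite cabsXz cabs_tcoord exp1rz.
  rewrite mulrA -cintegralZ//; apply: eq_cintegral => v.
  by rewrite HE (chi_tproj (fun i => - a i) w v jn); ring.
split=> [|aj].
  rewrite [LHS](key (s ^+ `|a j|)%:C r hr) [RHS](key (r ^+ `|a j|)%:C s hs); apply: eq_cintegral => w; congr (_ * _).
  by have [E _] := MP w; exact: E.
rewrite -[LHS]mul1r key//; transitivity (cintegral m (fun _ : torus R nat => 0 : R[i])).
  by apply: eq_cintegral => w; have [_ /(_ aj r hr) E] := MP w; rewrite /M E !mulr0.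
by rewrite cintegral_cst.
Qed.

Lemma eq_slice g n rho sig : (forall i, (i < n)%N -> rho i = sig i) -> slice g n rho = slice g n sig.
Proof.
move=> h; apply/funext => w; congr g; apply: ell2_inj => i; rewrite !zptE.
by case: ifP => // /h ->.
Qed.

Lemma slice_widen g n k rho : (n <= k)%N ->
  slice g n rho = slice g k (fun i => if (i < n)%N then rho i else 0).
Proof.
move=> nk; apply/funext => w; congr g; apply: ell2_inj => i; rewrite !zptE.
case: ifP => [i_n|i_n]; first by rewrite (leq_trans i_n nk).
by rewrite mul0r; case: ifP.
Qed.

Lemma four_slice_scale g n a rho sig : holomorphic g -> (forall i, 0 <= rho i < 1) ->
  (forall i, 0 <= sig i < 1) ->
  (\prod_(i < n) sig i ^+ `|a i|)%:C * four n a (slice g n rho) =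
  (\prod_(i < n) rho i ^+ `|a i|)%:C * four n a (slice g n sig).
Proof.
(* Radii are exchanged one coordinate at a time; [tau k] has the new radii in the first [k]
   coordinates. *)
move=> gh r01 s01; pose tau k i := if (i < k)%N then sig i else rho i.
have t01 k i : 0 <= tau k i < 1 by rewrite /tau; case: ifP.
have -> : slice g n sig = slice g n (tau n) by apply: eq_slice => i i_n; rewrite /tau i_n.
suff H k : (k <= n)%N -> (\prod_(i < k) sig i ^+ `|a i|)%:C * four n a (slice g n rho) =
    (\prod_(i < k) rho i ^+ `|a i|)%:C * four n a (slice g n (tau k)) by exact: H.
elim: k => [_|k IH kn]; first by rewrite !big_ord0 !mul1r.
have e1 : upd (tau k) k (rho k) = tau k.
  by apply/funext => i; rewrite /upd /tau; case: eqP => // ->; rewrite ltnn.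
have e2 : upd (tau k) k (sig k) = tau k.+1.
  by apply/funext => i; rewrite /upd /tau ltnS [(i <= k)%N]leq_eqVlt; case: eqP => [->|_]//=.
have [+ _] := four_slice_coord a gh (t01 k) kn (r01 k) (s01 k); rewrite e1 e2 => E.
rewrite !big_ord_recr /= !RtoCM mulrAC IH ?(ltnW kn)//.
by rewrite -[RHS]mulrA -E; ring.
Qed.

Lemma four_slice_neg g n a rho (j : nat) : holomorphic g -> (forall i, 0 <= rho i < 1) ->
  (j < n)%N -> a j < 0 -> four n a (slice g n rho) = 0.
Proof.
move=> gh r01 jn aj; have [_ /(_ aj)] := four_slice_coord a gh r01 jn (r01 j) (r01 j).
by rewrite upd_id.
Qed.

Lemma H1_slice g n rho : holomorphic g -> (forall i, 0 <= rho i < 1) -> H1 (slice g n rho).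
Proof.
move=> gh r01; split=> [|alpha na]; first exact: cintb_slice.
have [j aj] : exists j, alpha j < 0.
  by apply: contrapT => h; apply: na => j; rewrite leNgt; apply/negP => aj; apply: h; exists j.
(* Room for both the slice and the support of [alpha]: the slice is viewed in [N] variables, with
   radius 0 in the added ones. *)
pose N := maxn n (\max_(j <- finsupp alpha) j).+1.
have aN i : (N <= i)%N -> alpha i = 0.
  move=> Ni; apply/eqP; rewrite -[_ == _]negbK -mem_finsupp; apply/negP => ia.
  have : (i <= \max_(j <- finsupp alpha) j)%N by exact: leq_bigmax_seq.
  rewrite leqNgt => /negP; apply.
  by apply: leq_trans Ni; rewrite leq_max leqnn orbT.
rewrite (fourier_coefE _ aN) (slice_widen g rho (leq_maxl n _ : (n <= N)%N)); apply: (@four_slice_neg _ _ _ _ j) => //.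
  by move=> i; case: ifP; rewrite ?lexx ?ltr01.
by rewrite ltnNge; apply/negP => /aN a0; rewrite a0 ltxx in aj.
Qed.

Lemma four_pad n k a (f : torus R nat -> R[i]) : (n <= k)%N ->
  four n a f = four k (fun i => if (i < n)%N then a i else 0) f.
Proof.
move=> nk; apply: eq_cintegral => w; congr (_ * _); rewrite /chi.
rewrite -!(big_mkord xpredT (fun i => tcoord w i ^ (- _ i))).
rewrite -(big_mkord xpredT (fun i => tcoord w i ^ (- (if (i < n)%N then a i else 0)))).
rewrite (@big_cat_nat _ _ _ n _ k)//= [X in _ * X]big1_seq ?mulr1; last first.
  by move=> i; rewrite mem_index_iota => /andP[_ /andP[ni _]]; rewrite ltnNge ni oppr0 expr0z.
by rewrite big_nat [RHS]big_nat; apply: eq_bigr => i /andP[_ ->].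
Qed.

Lemma poisson_four n r f w : 0 <= r < 1 -> cintb m f -> (forall a, four n a f = 0) -> poisson n r f w = 0.
Proof.
move=> r01 fi f0; apply: ccvg_unique (poissonM_cvg n w r01 fi) _.
have -> : (fun M => poissonM n r M f w) = (fun=> 0).
  by apply/funext => M; rewrite poissonME// big1// => p _; rewrite f0 mulr0.
exact: ccvg_cst.
Qed.

Lemma ell2_tail (z : ell2 R) (e : R) : 0 < e -> exists n, l2n (zpt n z - z) < e.
Proof.
move=> e0; have e20 : 0 < e / 2 by rewrite divr_gt0.
have c : (fun N => (\sum_(j < N) cabs (z j) ^+ 2)%:E) @ \oo --> (l2n z ^+ 2)%:E.
  rewrite -l2n_series.
  have -> : (fun N => (\sum_(j < N) cabs (z j) ^+ 2)%:E) = (fun N => \sum_(0 <= j < N) (cabs (z j) ^+ 2)%:E)%E.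
    by apply/funext => N; rewrite big_mkord sumEFin.
  by apply: is_cvg_nneseries => n _ _; rewrite lee_fin exprn_ge0 ?cabs_ge0.
have /fine_cvgP[_ /cvgrPdist_lt] := c => /(_ ((e / 2) ^+ 2)); rewrite exprn_gt0// => /(_ isT).
move=> [n _ /(_ n (leqnn n))]; rewrite /= => hn.
have {}hn : l2n z ^+ 2 - \sum_(j < n) cabs (z j) ^+ 2 < (e / 2) ^+ 2.
  exact: le_lt_trans (ler_norm _) hn.
exists n; apply: (@le_lt_trans _ _ (e / 2)); last by rewrite ltr_pdivrMr// mulr_natr ltr_pwDl.
apply: l2n_le => [|N]; first exact: ltW.
pose F j := cabs ((zpt n z - z : ell2 R) j) ^+ 2.
have FE j : F j = if (j < n)%N then 0 else cabs (z j) ^+ 2.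
  rewrite /F -[(_ - _ : ell2 R) j]/(zpt n z j + (-1) * z j) zptE mulN1r.
  by case: ifP => _; rewrite ?subrr ?cabs0 ?expr0n// add0r cabsN.
apply: le_trans (ltW hn); rewrite lerBrDr -/(F _).
have nM : (n <= maxn N n)%N by rewrite leq_maxr.
apply: (@le_trans _ _ (\sum_(j < maxn N n) cabs (z j) ^+ 2)); last exact: l2n_sum.
have -> : \sum_(j < maxn N n) cabs (z j) ^+ 2 =
    \sum_(j < n) cabs (z j) ^+ 2 + \sum_(n <= j < maxn N n) cabs (z j) ^+ 2.
  by rewrite -!(big_mkord xpredT (fun j => cabs (z j) ^+ 2)) (@big_cat_nat _ _ _ n).
rewrite addrC lerD2l.
have -> : \sum_(j < N) cabs ((zpt n z - z : ell2 R) j) ^+ 2 = \sum_(0 <= j < N) F j by rewrite big_mkord.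
have [nN|Nn] := leqP n N.
  rewrite (@big_cat_nat _ _ _ n)//= big1_seq ?add0r.
    rewrite big_nat [leRHS]big_nat; apply: ler_sum => j /andP[nj _].
    by rewrite FE ltnNge nj.
  by move=> j; rewrite mem_index_iota => /andP[_ /andP[_ jn]]; rewrite FE jn.
rewrite big1_seq ?sumr_ge0// => [j _|j]; first exact: sqr_ge0.
by rewrite mem_index_iota => /andP[_ /andP[_ jN]]; rewrite FE (ltn_trans jN Nn).
Qed.

Lemma zpt_dense g h : holomorphic g -> holomorphic h ->
  (forall n x, polydisc2 (zpt n x) -> g (zpt n x) = h (zpt n x)) ->
  forall z, polydisc2 z -> g z = h z.
Proof.
move=> gh hh E z z1; apply/eqP; rewrite -subr_eq0 -cabs_eq0 eq_le cabs_ge0 andbT.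
apply/ler_addgt0Pr => e e0; rewrite add0r; have e20 : 0 < e / 2 by rewrite divr_gt0.
have [d d0 hd] := differentiable_ell2_continuous (gh z z1) e20.
have [d' d0' hd'] := differentiable_ell2_continuous (hh z z1) e20.
have dd : 0 < Num.min d d' by rewrite lt_min d0.
have [n hn] := ell2_tail z dd; have zn : z + (zpt n z - z) = zpt n z by rewrite addrC subrK.
move: hn; rewrite lt_min => /andP[/hd h1 /hd' h2]; rewrite zn in h1 h2.
have [s /andP[s0 s1] zs] := polydisc2P z1.
have En : g (zpt n z) = h (zpt n z) by apply: E; apply: (@zpt_polydisc _ _ _ s); rewrite ?s0// => j _; exact: zs.
have -> : g z - h z = (h (zpt n z) - h z) - (g (zpt n z) - g z) by rewrite En; ring.
by apply: (le_trans (cabsB _ _)); rewrite (splitr e) lerD// ltW.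
Qed.

Lemma zpt_slice n (x : nat -> R[i]) : (forall j, cabs (x j) < 1) ->
  exists rho w, (forall j, 0 <= rho j < 1) /\ zpt n x = zpt n (fun j => (rho j)%:C * tcoord w j).
Proof.
move=> x1; exists (fun j => cabs (x j)), (fun j => circle_of (cabs_phase (x j))); split=> [j|].
  by rewrite cabs_ge0 x1.
congr (zpt n); apply/funext => j; rewrite /tcoord circle_ofE; exact: phaseE.
Qed.

(** Equal Fourier coefficients give equal Poisson integrals of the slices; these tend to the slices
    pointwise, as the slices are continuous in finitely many coordinates. Finitely supported points
    are dense. *)
Lemma holomorphic_unique g h : holomorphic g -> holomorphic h ->
  (forall n a r, (0 < n)%N -> 0 < r < 1 ->
    four n a (slice g n (fun=> r)) = four n a (slice h n (fun=> r))) ->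
  forall z, polydisc2 z -> g z = h z.
Proof.
move=> gh hh E; apply: zpt_dense => // n x xP.
have [|rho [w [r01 xE]]] := @zpt_slice n (zpt n x).
  by have [s /andP[_ s1] xs] := polydisc2P xP; move=> j; exact: le_lt_trans s1.
have {xE} xE : zpt n x = zpt n (fun j => (rho j)%:C * tcoord w j).
  by rewrite -xE; apply: ell2_inj => j; rewrite !zptE; case: ifP.
have F0 k a : (n <= k)%N -> (0 < k)%N -> four k a (slice g n rho) = four k a (slice h n rho).
  move=> nk k0; rewrite !(slice_widen _ rho nk); set rho' := fun _ => _.
  have r01' i : 0 <= rho' i < 1 by rewrite /rho'; case: ifP; rewrite ?lexx ?ltr01.
  (* The scaling law carries the hypothesis from a constant radius to arbitrary radii; 1 / 2 is
     nonzero, so its powers can be cancelled. *)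
  pose sig (i : nat) : R := 2^-1.
  have s01 (i : nat) : 0 <= sig i < 1 by rewrite invr_ge0 ler0n invf_lt1// ltr1n.
  have p0 : (\prod_(i < k) sig i ^+ `|a i|)%:C != 0.
    rewrite -cabs_eq0 cabs_real normr_eq0; apply/prodf_neq0 => i _.
    by rewrite expf_neq0// invr_eq0 pnatr_eq0.
  apply: (mulfI p0); rewrite (four_slice_scale _ a gh r01' s01) (four_slice_scale _ a hh r01' s01).
  congr (_ * _); apply: E => //.
  by rewrite invr_gt0 ltr0n invf_lt1 ?ltr1n.
have gi := cintb_slice n gh r01; have hi := cintb_slice n hh r01.
have [B hB] := slice_bounded n gh r01; have [C hC] := slice_bounded n hh r01.
have c1 := poisson_cvg_pt (nbhs_infty_ge n) gi.1 hB (slice_cyl n w gh r01).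
have c2 := poisson_cvg_pt (nbhs_infty_ge n) hi.1 hC (slice_cyl n w hh r01).
have c3 := ccvgB c1 c2; apply/eqP; rewrite xE -subr_eq0; apply/eqP.
apply: ccvg_unique c3 _; apply: (@ccvg_dom _ _ _ (fun=> 0)); last exact: cvg_cst.
near=> k; rewrite subr0 -poissonB//; last exact: prad01.
rewrite poisson_four ?cabs0//; [exact: prad01|exact: cintbB|move=> a].
by rewrite fourB// F0 ?subrr//; near: k; [exact: nbhs_infty_ge|exact: nbhs_infty_gt].
Unshelve. all: by end_near. Qed.

Lemma prod_pad (T : comPzRingType) n k a (x : T) : (n <= k)%N ->
  \prod_(i < k) x ^+ `|if (i < n)%N then a i else 0| = \prod_(i < n) x ^+ `|a i|.
Proof.
move=> nk; rewrite -(big_mkord xpredT (fun i => x ^+ `|if (i < n)%N then a i else 0|)).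
rewrite -(big_mkord xpredT (fun i => x ^+ `|a i|)) (@big_cat_nat _ _ _ n)//=.
rewrite [X in _ * X]big1_seq ?mulr1; last first.
  by move=> i; rewrite mem_index_iota => /andP[_ /andP[ni _]]; rewrite ltnNge ni.
by rewrite big_nat [RHS]big_nat; apply: eq_bigr => i /andP[_ ->].
Qed.

(** In the variables that are dropped the exponent is 0, so setting their radius to 0 does not
    affect these coefficients, 0^0 being 1. *)
Lemma four_slice_shrink g n k a (r s : R) : holomorphic g -> (n <= k)%N -> 0 < r < 1 -> 0 <= s < 1 ->
  four n a (slice g n (fun=> s * r)) = (\prod_(i < n) s ^+ `|a i|)%:C * four n a (slice g k (fun=> r)).
Proof.
move=> gh nk /andP[r0 r1] /andP[s0 s1]; have r01 (i : nat) : 0 <= r < 1 by rewrite ltW.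
rewrite !(four_pad a _ nk) (slice_widen g _ nk); set a' := fun i : nat => if _ then a i else _.
set rho := fun i : nat => _.
have rho01 (i : nat) : 0 <= rho i < 1.
  rewrite /rho; case: ifP; rewrite ?lexx ?ltr01// mulr_ge0 ?(ltW r0)//= => _.
  by rewrite (le_lt_trans _ r1)// ler_piMl ?(ltW r0) ?(ltW s1).
have p0 : (\prod_(i < k) r ^+ `|a' i|)%:C != 0.
  rewrite -cabs_eq0 cabs_real normr_eq0; apply/prodf_neq0 => i _.
  by rewrite expf_neq0// gt_eqF.
apply: (mulfI p0); rewrite (four_slice_scale _ a' gh rho01 r01) mulrA -RtoCM -(prod_pad a s nk) -/a'.
congr (_%:C * _); rewrite -big_split; apply: eq_bigr => i _ /=.
by rewrite -exprMn mulrC /rho /a'; case: ifP.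
Qed.

(** The claim is compared after a further Poisson integration of radius t, where only Fourier
    coefficients matter; as t tends to 1 this integration disappears on both sides. *)
Lemma poisson_slice g n k (r s : R) w : holomorphic g -> (n <= k)%N -> 0 < r < 1 -> 0 <= s < 1 ->
  poisson n s (slice g k (fun=> r)) w = slice g n (fun=> s * r) w.
Proof.
move=> gh nk rP s01; have /andP[r0 r1] := rP; have /andP[s0 s1] := s01.
have r01 (i : nat) : 0 <= r < 1 by rewrite ltW.
have sr01 (i : nat) : 0 <= s * r < 1.
  by rewrite mulr_ge0 ?(ltW r0)//= (le_lt_trans _ r1)// ler_piMl ?(ltW r0) ?(ltW s1).
have fH := H1_slice k gh r01; have fi := fH.1; have fi' := cintb_slice n gh sr01.
set F := slice g k _ in fH fi *; set F' := slice g n _ in fi' *.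
(* The coefficients of [F'] are those of [F] damped by powers of s, hence the radii multiply. *)
have E (t : R) : 0 <= t < 1 -> poisson n t F' w = poisson n (t * s) F w.
  move=> t01; have /andP[t0 t1] := t01; have ts01 : 0 <= t * s < 1.
    by rewrite mulr_ge0//= (le_lt_trans _ s1)// ler_piMl// ltW.
  apply: ccvg_unique (poissonM_cvg n w t01 fi') _.
  suff -> : (fun M => poissonM n t M F' w) = (fun M => poissonM n (t * s) M F w).
    exact: poissonM_cvg.
  apply/funext => M; rewrite (poissonME n t M w fi') (poissonME n (t * s) M w fi); apply: eq_bigr => p _.
  rewrite (four_slice_shrink _ gh nk rP s01) rmorph_prod mulrACA mulrA -big_split.
  congr (_ * _ * _).
  by apply: eq_bigr => j _; rewrite rmorphXn RtoCM exprMn.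
have [B hB] := slice_bounded n gh sr01.
have nn : \forall k \near \oo, (n <= n)%N by exact: nearW.
have c1 := poisson_cvg_pt (N := fun=> n) nn fi'.1 hB (slice_cyl n w gh sr01).
apply/esym; apply: ccvg_unique c1 _.
(* Continuity in the radius of the Poisson integral of [F] is read off the holomorphic function
   [phi F]. *)
have -> : (fun k => poisson n (prad k) F' w) = (fun k => slice (phi F) n (fun=> prad k * s) w).
  apply/funext => i; rewrite (E _ (prad01 i)) slice_phi//.
  have /andP[t0 t1] := prad01 (R := R) i.
  by rewrite mulr_ge0//= (le_lt_trans _ s1)// ler_piMl// ltW.
rewrite -(slice_phi n fH s01); apply: slice_cvg => [|//|j]; first exact: phi_holomorphic.
have -> : (fun i => (prad i * s)%:C) = (fun i => s%:C * (prad i : R)%:C).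
  by apply/funext => i; rewrite -RtoCM mulrC.
rewrite -[X in ccvg _ X]mulr1; apply: ccvgZ; exact: ccvg_prad.
Qed.

End slice_coefficients.

(** * Convergence of slices for p > 1 *)

Section L1_completeness.
Context {R : realType}.
Local Notation m := (torus_measure R nat).
Implicit Types (f g : torus R nat -> R[i]) (F : nat -> torus R nat -> R[i]).

Lemma ccvg_bounded_variation (u : nat -> R[i]) (B : R) :
  (forall n, \sum_(i < n) cabs (u i.+1 - u i) <= B) -> exists l, ccvg u l.
Proof.
move=> uB; have memX n i : (i \in [fset j | j in iota 0 n]%fset) = (i < n)%N by rewrite !inE mem_iota.
have [A|S hS] := @csum_ex R nat (fun i => u i.+1 - u i) B.
  have AN : (A `<=` [fset i | i in iota 0 (\max_(j <- A) j).+1])%fset.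
    apply/fsubsetP => i iA; rewrite memX ltnS.
    exact: leq_bigmax_seq.
  apply: le_trans (fset_sum_le _ AN) _ => [i|]; first exact: cabs_ge0.
  apply: le_trans (uB (\max_(j <- A) j).+1).
  rewrite -(big_mkord xpredT (fun i => cabs (u i.+1 - u i))) /index_iota subn0.
  rewrite le_eqVlt; apply/orP; left; apply/eqP; apply: perm_big; apply: uniq_perm.
  - exact: fset_uniq.
  - exact: iota_uniq.
  - by move=> i; rewrite !inE.
have := csum_seq (X := fun n => [fset i | i in iota 0 n]%fset) hS.
have -> : (fun n => \sum_(i <- [fset i | i in iota 0 n]%fset) (u i.+1 - u i)) = fun n => u n - u 0%N.
  apply/funext => n; rewrite -(telescope_sumr _ (leq0n n)) /index_iota subn0.
  apply: perm_big; apply: uniq_perm; [exact: fset_uniq|exact: iota_uniq|].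
  by move=> i; rewrite !inE.
move=> h; exists (S + u 0%N).
suff : ccvg (fun n => (u n - u 0%N) + u 0%N) (S + u 0%N).
  by rewrite (_ : (fun n => _) = u)//; apply/funext => n; rewrite subrK.
apply: ccvgD; last exact: ccvg_cst.
by apply: h => i _; exists i.+1 => // n /= i_n; rewrite memX.
Qed.

Lemma L1_sub_triangle f g h : cintb m f -> cintb m g -> cintb m h ->
  (\int[m]_w (cabs (f w - h w))%:E <=
   \int[m]_w (cabs (f w - g w))%:E + \int[m]_w (cabs (g w - h w))%:E)%E.
Proof.
move=> fi gi hi; apply: le_trans (L1_triangle (cintbB fi gi) (cintbB gi hi)).
by under [leRHS]eq_integral do rewrite addrA subrK.
Qed.

(** Riesz-Fischer: a subsequence with summable L_1 increments converges almost everywhere, dominated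
    by its first term plus the sum of the moduli of its increments. *)
Lemma L1_complete F : (forall k, cintb m (F k)) ->
  (forall e : R, 0 < e -> exists N, forall k l, (N <= k)%N -> (N <= l)%N ->
     (\int[m]_w (cabs (F k w - F l w))%:E <= e%:E)%E) ->
  exists2 f, cintb m f & L1cvg F f.
Proof.
move=> Fi FC; have e_gt0 i : 0 < 2^-1 ^+ i :> R by rewrite exprn_gt0.
pose N i := sval (cid (FC _ (e_gt0 i))).
have NP i := svalP (cid (FC _ (e_gt0 i))).
(* Cumulative sums make the indices nondecreasing while keeping each at least [N i]. *)
pose s i := (\sum_(j < i.+1) N j)%N.
have Ns i : (N i <= s i)%N by rewrite /s big_ord_recr/= leq_addl.
have sS i : (s i <= s i.+1)%N by rewrite /s [leqRHS]big_ord_recr/= leq_addr.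
pose G i := F (s i); pose D i w := cabs (G i.+1 w - G i w).
have mD i : measurable_fun setT (fun w => (D i w)%:E).
  by apply: cmeas_cabsE; apply: cmeasB; [exact: (Fi _).1|exact: (Fi _).1].
have D0 i w : (0 <= (D i w)%:E)%E by rewrite lee_fin cabs_ge0.
have ID i : (\int[m]_w (D i w)%:E <= (2^-1 ^+ i)%:E)%E.
  by apply: NP; [exact: leq_trans (Ns i) (sS i)|exact: Ns].
pose S w := (\sum_(0 <= i <oo) (D i w)%:E)%E.
have S0 w : (0 <= S w)%E by apply: nneseries_ge0 => i _ _; exact: D0.
have mS : measurable_fun setT S by apply: ge0_emeasurable_sum => [i w _ _|i _]; [exact: D0|exact: mD].
have IS : (\int[m]_w S w <= 2%:E)%E.
  rewrite integral_nneseries//; apply: lime_le.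
    by apply: is_cvg_nneseries => n _ _; apply: integral_ge0 => w _; exact: D0.
  apply: nearW => n; apply: (@le_trans _ _ (\sum_(0 <= i < n) (2^-1 ^+ i)%:E)%E).
    by apply: lee_sum => i _; exact: ID.
  rewrite big_mkord sumEFin lee_fin.
  have h01 : 0 <= (2^-1 : R) < 1 by rewrite invr_ge0 ler0n invf_lt1// ltr1n.
  apply: (le_trans (real_geom_sum_le n h01)); rewrite le_eqVlt; apply/orP; left; apply/eqP.
  have -> : 1 - 2^-1 = 2^-1 :> R by lra.
  by rewrite invrK.
have Si : m.-integrable setT S.
  apply/integrableP; split=> //; rewrite (eq_integral S); first exact: le_lt_trans IS (ltry _).
  by move=> w _; rewrite gee0_abs.
pose A := [set w | S w \is a fin_num].
have mA : measurable A by rewrite -[A]setTI; exact: emeasurable_fin_num.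
have AE w : cind A w = if S w \is a fin_num then 1 else 0.
  by rewrite /cind indicE; case: ifPn => wA; [rewrite mem_set|rewrite memNset//; exact/negP].
(* Putting 0 on the null set where the sum of increments is infinite makes the sequence converge at
   every point, as [cint_dct1] asks. *)
pose G' i w := cind A w * G i w.
have mG' i : cmeas (G' i) by apply: cmeasM; [exact: cmeas_cind|exact: (Fi _).1].
have DS n w : ((\sum_(i < n) D i w)%:E <= S w)%E.
  rewrite -sumEFin -(big_mkord xpredT (fun i => (D i w)%:E)).
  by apply: nneseries_lim_ge => i _ _; exact: D0.
have G'l w : exists l, ccvg (G'^~ w) l.
  rewrite /G' AE; case: ifPn => Sf; last by exists 0; rewrite (_ : (fun=> _) = fun=> 0);
    [exact: ccvg_cst|apply/funext => i; rewrite mul0r].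
  have -> : (fun i => 1 * G i w) = G^~ w by apply/funext => i; rewrite mul1r.
  apply: (@ccvg_bounded_variation _ (fine (S w))) => n.
  by rewrite -lee_fin fineK//; exact: DS.
pose f w := sval (cid (G'l w)); have fP w : ccvg (G'^~ w) (f w) := svalP (cid (G'l w)).
pose h w := cabs (G 0%N w) + fine (S w).
have mfS : measurable_fun setT (fun w => fine (S w)) by exact: (measurableT_comp (fine_measurable measurableT) mS).
have fSi : m.-integrable setT (EFin \o (fun w => fine (S w))).
  apply/integrableP; split; first exact/measurable_EFinP.
  apply: (@le_lt_trans _ _ (\int[m]_w S w)%E); last exact: le_lt_trans IS (ltry _).
  apply: ge0_le_integral => //.
  - by apply: measurableT_comp => //; exact/measurable_EFinP.
  - move=> w _; rewrite /= ger0_norm ?fine_ge0//.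
    by have [/fineK ->//|] := boolP (S w \is a fin_num); rewrite ge0_fin_numE// -leNgt leye_eq => /eqP ->; rewrite leey.
have hi : m.-integrable setT (EFin \o h).
  by apply: (@eq_integrable _ _ _ _ _ measurableT _ _ _ (integrableD measurableT (cintb_cabs (Fi (s 0%N))) fSi)).
have Gh i w : cabs (G' i w) <= h w.
  rewrite /G' AE /h; case: ifPn => Sf; last by rewrite mul0r cabs0 addr_ge0 ?cabs_ge0 ?fine_ge0.
  rewrite mul1r; have -> : G i w = G 0%N w + \sum_(j < i) (G j.+1 w - G j w).
    rewrite -(big_mkord xpredT (fun j => G j.+1 w - G j w)) telescope_sumr//.
    by rewrite addrC subrK.
  apply: (le_trans (cabsD _ _)); rewrite lerD2l; apply: (le_trans (cabs_sum _ _ _)).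
  by rewrite -lee_fin fineK//; exact: DS.
have [fi cv] := cint_dct1 mG' fP hi Gh.
have G'i i : cintb m (G' i) by exact: cintb_dom (mG' i) hi (Gh i).
have GG' i : (\int[m]_w (cabs (G i w - f w))%:E = \int[m]_w (cabs (G' i w - f w))%:E)%E.
  apply: ge0_ae_eq_integral => //.
  - by apply: cmeas_cabsE; exact: cmeasB (Fi _).1 fi.1.
  - by apply: cmeas_cabsE; exact: cmeasB (mG' i) fi.1.
  - by move=> w _; rewrite lee_fin cabs_ge0.
  - by move=> w _; rewrite lee_fin cabs_ge0.
  have := integrable_ae measurableT Si; apply: filterS => w /(_ I) Sf _.
  by rewrite /G' AE Sf mul1r.
exists f => //; apply/(L1cvgP Fi fi) => e e0; have e20 : 0 < e / 2 by rewrite divr_gt0.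
have [j _ hj] : \forall j \near \oo, (2^-1 ^+ j <= e / 2) /\ (\int[m]_w (cabs (G' j w - f w))%:E <= (e / 2)%:E)%E.
  move/(L1cvgP G'i fi): cv => /(_ _ e20).
  have : (fun j => (2^-1 : R) ^+ j) @ \oo --> (0 : R) by apply: cvg_expr; rewrite ger0_norm ?invf_lt1// ltr1n.
  move/cvgrPdist_le => /(_ _ e20); apply: filterS2 => j; rewrite sub0r normrN => h1 h2.
  by split=> //; rewrite (le_trans (ler_norm _)).
have [j1 j2] := hj j (leqnn j).
near=> k; apply: (le_trans (L1_sub_triangle (Fi k) (Fi (s j)) fi)).
rewrite (splitr e) EFinD; apply: leeD; last by rewrite GG'.
apply: (@le_trans _ _ (2^-1 ^+ j)%:E); last by rewrite lee_fin.
by apply: NP; [near: k; exact: nbhs_infty_ge|exact: Ns].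
Unshelve. all: by end_near. Qed.

End L1_completeness.

(** * A quantitative midpoint inequality for sqrt (1 + |x|^2) *)

Section uniform_convexity.
Context {R : realType}.
Local Notation m := (torus_measure R nat).
Implicit Types (x y : R[i]) (f g : torus R nat -> R[i]).

(* A strictly convex function of linear growth: its integral is finite on L_1,
   decreases under Poisson integrals and detects L_1 distances through
   midpoints. *)
Definition jap x : R := Num.sqrt (1 + cabs x ^+ 2).

Lemma jap_sqr x : jap x ^+ 2 = 1 + cabs x ^+ 2.
Proof. by rewrite sqr_sqrtr// addr_ge0 ?sqr_ge0. Qed.

Lemma jap_ge0 x : 0 <= jap x. Proof. exact: sqrtr_ge0. Qed.

Lemma jap_gt0 x : 0 < jap x.
Proof. by rewrite sqrtr_gt0 ltr_pwDl ?sqr_ge0. Qed.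

Lemma cabs_le_jap x : cabs x <= jap x.
Proof. by rewrite -ler_sqr ?nnegrE ?cabs_ge0 ?jap_ge0// jap_sqr lerDr. Qed.

Lemma jap_lip x y : jap x <= jap y + cabs (x - y).
Proof.
rewrite -ler_sqr ?nnegrE ?addr_ge0 ?jap_ge0 ?cabs_ge0// sqrrD !jap_sqr.
have h : cabs x <= cabs y + cabs (x - y) by rewrite -{1}(subrK y x) addrC cabsD.
have : cabs x ^+ 2 <= (cabs y + cabs (x - y)) ^+ 2 by rewrite ler_sqr ?nnegrE ?addr_ge0 ?cabs_ge0.
rewrite sqrrD => h2; have := ler_wpM2r (cabs_ge0 (x - y)) (cabs_le_jap y).
by move: (cabs x ^+ 2) (cabs y ^+ 2) (cabs y * _) (jap y * _) h2 => a b c d; rewrite !mulr2n; lra.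
Qed.

Lemma jap_le x : jap x <= 1 + cabs x.
Proof.
have := jap_lip x 0; rewrite subr0 => h; apply: (le_trans h).
by rewrite lerD2r /jap cabs0 expr0n addr0 sqrtr1.
Qed.

Lemma ReJ_le x y : complex.Re (x^*%C * y) + 1 <= jap x * jap y.
Proof.
apply: (@le_trans _ _ (cabs x * cabs y + 1)).
  by rewrite lerD2r (le_trans (ler_norm _))// (le_trans (Re_le_cabs _))// cabsM cabsJ.
rewrite -ler_sqr ?nnegrE ?mulr_ge0 ?jap_ge0 ?addr_ge0 ?mulr_ge0 ?cabs_ge0//.
rewrite exprMn !jap_sqr -subr_ge0; move: (cabs x) (cabs y) => a b.
have -> : (1 + a ^+ 2) * (1 + b ^+ 2) - (a * b + 1) ^+ 2 = (a - b) ^+ 2 by ring.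
exact: sqr_ge0.
Qed.

Lemma jap_support x : exists c : R[i], forall y, jap x + complex.Re (c * (y - x)) <= jap y.
Proof.
exists ((jap x)^-1%:C * x^*%C) => y; have j0 := jap_gt0 x.
have -> : complex.Re ((jap x)^-1%:C * x^*%C * (y - x)) =
    (complex.Re (x^*%C * y) - cabs x ^+ 2) / jap x.
  have -> : (jap x)^-1%:C * x^*%C * (y - x) = (jap x)^-1%:C * (x^*%C * y - x * x^*%C) by ring.
  by rewrite mulJc cReM /= mul0r subr0 cReD cReN /= mulrC.
rewrite -(ler_pM2l j0) mulrDr [jap x * (_ / _)]mulrC divfK ?gt_eqF// -expr2 jap_sqr.
by have := ReJ_le x y; lra.
Qed.

(** Meant for u = [jap x], v = [jap y], t = [jap] of the midpoint, X = |x|, Y = |y| and D = |x - y|;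
    the equation for t is the parallelogram law. The gap s - 2 t, with s = u + v, is estimated
    through s^2 - 4 t^2. *)
Lemma jap_mid_real (u v t D X Y : R) : 0 <= u -> 0 <= v -> 0 <= t -> 0 <= X -> 0 <= Y ->
  u ^+ 2 = 1 + X ^+ 2 -> v ^+ 2 = 1 + Y ^+ 2 ->
  4 * t ^+ 2 = 4 + 2 * X ^+ 2 + 2 * Y ^+ 2 - D ^+ 2 -> (X - Y) ^+ 2 <= D ^+ 2 ->
  D ^+ 2 <= (u + v) ^+ 3 * ((u + v) / 2 - t).
Proof.
move=> u0 v0 t0 X0 Y0 u2 v2 t2 XYD; pose s := u + v; have s0 : 0 <= s by rewrite addr_ge0.
have XY0 : 0 <= X * Y by rewrite mulr_ge0.
(* [W] is the defect in the Cauchy-Schwarz inequality for the vectors (1, X) and (1, Y), whose norms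
   are u and v. *)
pose W := u * v - (1 + X * Y); pose V := u * v + (1 + X * Y).
have WV : W * V = (X - Y) ^+ 2.
  have -> : W * V = u ^+ 2 * v ^+ 2 - (1 + X * Y) ^+ 2 by rewrite /W /V; ring.
  by rewrite u2 v2; ring.
have W0 : 0 <= W.
  rewrite subr_ge0 -ler_sqr ?nnegrE ?addr_ge0 ?mulr_ge0// exprMn u2 v2 -subr_ge0.
  have -> : (1 + X ^+ 2) * (1 + Y ^+ 2) - (1 + X * Y) ^+ 2 = (X - Y) ^+ 2 by ring.
  exact: sqr_ge0.
have sV : s ^+ 2 = 2 * V + (X - Y) ^+ 2.
  have -> : s ^+ 2 = u ^+ 2 + v ^+ 2 + 2 * (u * v) by rewrite /s; ring.
  by rewrite u2 v2 /V; ring.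
have q0 := sqr_ge0 (X - Y).
have VE : V = W + 2 * (1 + X * Y) by rewrite /V /W; ring.
have s4 : 4 <= s ^+ 2 by rewrite sV VE; move: W0 q0 XY0; clear; lra.
have st : s ^+ 2 - 4 * t ^+ 2 = (D ^+ 2 - (X - Y) ^+ 2) + 2 * W.
  by rewrite t2 sV /V /W; ring.
have st0 : 2 * t <= s.
  rewrite -ler_sqr ?nnegrE ?mulr_ge0// -subr_ge0.
  have -> : (2 * t) ^+ 2 = 4 * t ^+ 2 by ring.
  by rewrite st; move: W0 XYD; clear; lra.
have e5 : 4 * D ^+ 2 <= (s ^+ 2 - 4 * t ^+ 2) * s ^+ 2.
  have h1 : 4 * (D ^+ 2 - (X - Y) ^+ 2) <= (D ^+ 2 - (X - Y) ^+ 2) * s ^+ 2.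
    by rewrite mulrC ler_wpM2l// subr_ge0.
  have h2 : 4 * (X - Y) ^+ 2 <= 2 * W * s ^+ 2.
    rewrite -{1}WV sV; have := mulr_ge0 W0 q0; move: (X - Y) => z; clear; nra.
  by rewrite st mulrDl; move: h1 h2; clear; lra.
have e7 : (s ^+ 2 - 4 * t ^+ 2) * s ^+ 2 <= 4 * (s ^+ 3 * (s / 2 - t)).
  have -> : (s ^+ 2 - 4 * t ^+ 2) * s ^+ 2 = ((s - 2 * t) * s ^+ 2) * (s + 2 * t) by ring.
  have -> : 4 * (s ^+ 3 * (s / 2 - t)) = ((s - 2 * t) * s ^+ 2) * (s + s) by field.
  by rewrite ler_wpM2l ?lerD2l// mulr_ge0 ?sqr_ge0 ?subr_ge0.
have := le_trans e5 e7; rewrite ler_pM2l//.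
Qed.

Lemma jap_mid x y : cabs (x - y) ^+ 2 <=
  (jap x + jap y) ^+ 3 * ((jap x + jap y) / 2 - jap ((x + y) / 2)).
Proof.
apply: (@jap_mid_real _ _ _ _ (cabs x) (cabs y)); rewrite ?jap_ge0 ?cabs_ge0 ?jap_sqr//.
  rewrite !cabs_sqr.
  have -> : (x + y) / 2 = (2^-1)%:C * (x + y) by rewrite mulrC fmorphV rmorph_nat.
  by rewrite !(cReM, cImM, cReD, cImD, cReN, cImN) /= ; field.
by rewrite -(real_normK (num_real (cabs x - cabs y))) ler_sqr ?nnegrE ?cabs_ge0// cabs_dist_dist.
Qed.

Lemma jap_mid_le x y : jap ((x + y) / 2) <= (jap x + jap y) / 2.
Proof.
have s0 : 0 < (jap x + jap y) ^+ 3 by rewrite exprn_gt0// addr_gt0 ?jap_gt0.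
by have := le_trans (sqr_ge0 _) (jap_mid x y); rewrite pmulr_rge0// subr_ge0.
Qed.

(** If both moduli are at most N, the midpoint inequality applies; otherwise the larger one exceeds
    N and is at most its p-th power divided by N^(p-1). Both sides consist of nonnegative terms, so
    that they can be integrated without subtraction. *)
Lemma jap_pointwise (p N e : R) x y : 1 < p -> 0 < N -> 0 < e ->
  cabs (x - y) + 2 * (1 + N) ^+ 3 / e * jap ((x + y) / 2) <=
  e + 2 * (1 + N) ^+ 3 / e * ((jap x + jap y) / 2) + 2 / N `^ (p - 1) * (cabs x `^ p + cabs y `^ p).
Proof.
move=> p1 N0 e0; set c := 2 * _ / _; have N1 : 0 <= 1 + N by rewrite addr_ge0// ltW.
have c0 : 0 <= c by rewrite divr_ge0 ?mulr_ge0 ?exprn_ge0 ?(ltW e0).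
have Np : 0 < N `^ (p - 1) by rewrite powR_gt0.
have mid0 : 0 <= c * ((jap x + jap y) / 2 - jap ((x + y) / 2)).
  by rewrite mulr_ge0 ?subr_ge0 ?jap_mid_le.
have pw0 (z : R[i]) : 0 <= 2 / N `^ (p - 1) * cabs z `^ p.
  by rewrite mulr_ge0 ?powR_ge0// divr_ge0// ltW.
have big (z : R[i]) : N < cabs z -> 2 * cabs z <= 2 / N `^ (p - 1) * cabs z `^ p.
  move=> Nz; rewrite mulrAC -mulrA ler_pM2l// ler_pdivlMr//.
  rewrite -(mulr_powRB1 (cabs_ge0 z) (lt_trans ltr01 p1)) ler_wpM2l ?cabs_ge0//.
  by rewrite ge0_ler_powR ?nnegrE ?subr_ge0 ?cabs_ge0 ?(ltW p1) ?(ltW N0) ?(ltW Nz).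
set sig := (jap x + jap y) / 2 in mid0 *; set t := jap ((x + y) / 2) in mid0 *.
suff : cabs (x - y) <= e + c * (sig - t) + (2 / N `^ (p - 1) * cabs x `^ p + 2 / N `^ (p - 1) * cabs y `^ p).
  by rewrite mulrBr mulrDr; set a := c * sig; set b := c * t; clear; lra.
have := cabsB x y; move: (pw0 x) (pw0 y) (big x) (big y).
set P := _ * cabs x `^ p; set Q := _ * cabs y `^ p => P0 Q0 bx by_ hxy.
have [|xN] := boolP ((cabs x <= N) && (cabs y <= N)); last first.
  have hP : cabs (x - y) <= P + Q.
    have [yx|/ltW xy] := leP (cabs y) (cabs x).
      have /bx hx : N < cabs x.
        by move: xN; rewrite negb_and -!ltNge => /orP[//|/lt_le_trans]; apply.
      by move: hx yx hxy Q0; clear; lra.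
    have /by_ hy : N < cabs y.
      by move: xN; rewrite negb_and -!ltNge => /orP[/lt_le_trans|//]; apply.
    by move: hy xy hxy P0; clear; lra.
  by move: mid0 hP e0; clear; lra.
move=> /andP[xN yN].
have uv : (jap x + jap y) ^+ 3 <= 8 * (1 + N) ^+ 3.
  have -> : 8 * (1 + N) ^+ 3 = (2 * (1 + N)) ^+ 3 by ring.
  rewrite lerXn2r ?nnegrE ?addr_ge0 ?mulr_ge0 ?jap_ge0//.
  by have := jap_le x; have := jap_le y; move: xN yN; clear; lra.
have d0 : 0 <= sig - t by rewrite subr_ge0 jap_mid_le.
(* [c] is chosen so that (2 (1 + N))^3 = 4 e c; then 4 e D <= D^2 + 4 e^2 with D = |x - y| makes the
   bound linear in D. *)
have h1 : cabs (x - y) ^+ 2 <= 4 * e * (c * (sig - t)).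
  apply: (le_trans (jap_mid x y)); apply: (le_trans (ler_wpM2r d0 uv)).
  rewrite le_eqVlt; apply/orP; left; apply/eqP; rewrite /c; field.
  by rewrite gt_eqF.
have h2 : 4 * e * cabs (x - y) <= 4 * e * (c * (sig - t) + e).
  have := sqr_ge0 (cabs (x - y) - 2 * e); move: h1; rewrite [4 * e * (_ + e)]mulrDr.
  move: (4 * e * (c * (sig - t))) (cabs (x - y)) => z D; clear; nra.
have : cabs (x - y) <= c * (sig - t) + e by rewrite -(ler_pM2l (x := 4 * e)) ?mulr_gt0.
by move: P0 Q0; clear; lra.
Qed.

End uniform_convexity.

Section slice_convergence.
Context {R : realType}.
Local Notation m := (torus_measure R nat).
Implicit Types (f g h : torus R nat -> R[i]) (F : nat -> torus R nat -> R[i]).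

Lemma L1_four F f n a : (forall k, cintb m (F k)) -> cintb m f -> L1cvg F f ->
  ccvg (fun k => four n a (F k)) (four n a f).
Proof.
move=> Fi fi Ff; apply: cintb_cvg1 => [|k|]; [exact: cintb_four|exact: cintb_four|].
suff -> : (fun k => \int[m]_w (cabs (F k w * chi n (fun j => - a j) w - f w * chi n (fun j => - a j) w))%:E)%E =
  (fun k => \int[m]_w (cabs (F k w - f w))%:E)%E by [].
by apply/funext => k; apply: eq_integral => w _; rewrite -mulrBl cabsM cabs_chi mulr1.
Qed.

Lemma L1_four_eq F G f g n a : (forall k, cintb m (F k)) -> cintb m f -> L1cvg F f ->
  (forall k, cintb m (G k)) -> cintb m g -> L1cvg G g ->
  (\forall k \near \oo, F k = G k) -> four n a f = four n a g.
Proof.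
move=> Fi fi Ff Gi gi Gg FG.
have c := ccvgB (L1_four n a Fi fi Ff) (L1_four n a Gi gi Gg).
apply/eqP; rewrite -subr_eq0; apply/eqP; apply: (ccvg_unique c).
apply: (@ccvg_dom _ _ _ (fun=> 0)); last exact: cvg_cst.
by apply: filterS FG => k ->; rewrite subrr subr0 cabs0.
Qed.

Lemma H1_lim F f : (forall k, H1 (F k)) -> cintb m f -> L1cvg F f -> H1 f.
Proof.
move=> FH fi Ff; split; first exact: fi.
move=> alpha na; have [n nE] := @fourier_coef_four R alpha; rewrite nE.
apply: (ccvg_unique (L1_four n alpha (fun k => (FH k).1) fi Ff)).
have -> : (fun k => four n alpha (F k)) = fun=> 0; last exact: ccvg_cst.
by apply/funext => k; rewrite -nE; exact: (FH k).2.
Qed.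

Lemma L1cvg_poisson F f n r : 0 <= r < 1 -> (forall k, cintb m (F k)) -> cintb m f -> L1cvg F f ->
  L1cvg (fun k => poisson n r (F k)) (poisson n r f).
Proof.
move=> r01 Fi fi Ff.
apply/(L1cvgP (fun k => cintb_poisson n r01 (Fi k)) (cintb_poisson n r01 fi)) => e e0.
move/(L1cvgP Fi fi): Ff => /(_ e e0); apply: filterS => k; apply: le_trans.
apply: le_trans (poisson_L1 n r01 (cintbB (Fi k) fi)).
by rewrite le_eqVlt; apply/orP; left; apply/eqP; apply: eq_integral => w _; rewrite poissonB.
Qed.

(** The smaller slices are Poisson integrals of the given one, hence share its bound, and they
    converge pointwise by continuity. *)
Lemma slice_L1cvg (g : ell2 R -> R[i]) n (s : R) : holomorphic g -> 0 < s < 1 ->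
  L1cvg (fun k => slice g n (fun=> prad k * s)) (slice g n (fun=> s)).
Proof.
move=> gh s01; have /andP[s0 s1] := s01; have hs (i : nat) : 0 <= s < 1 by rewrite ltW.
have [B hB] := slice_bounded n gh hs; have gi := cintb_slice n gh hs.
have E k : slice g n (fun=> prad k * s) = poisson n (prad k) (slice g n (fun=> s)).
  by apply/funext => w; rewrite (poisson_slice w gh (leqnn n) s01 (prad01 k)).
apply: (proj2 (@cint_dct1 _ _ _ m _ (fun k => slice g n (fun=> prad k * s)) (fun=> B) _ _ _ _)).
- by move=> k; rewrite E; exact: cmeas_poisson (prad01 k) gi.
- move=> w; apply: slice_cvg => // j.
  have -> : (fun k => (prad k * s)%:C) = (fun k => s%:C * (prad k : R)%:C).
    by apply/funext => k; rewrite -RtoCM mulrC.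
  rewrite -[X in ccvg _ X]mulr1; apply: ccvgZ; exact: ccvg_prad.
- exact: integrable_cst_prob.
- by move=> k w; rewrite E; exact: (poisson_bound n w (prad01 k) gi.1 hB).
Qed.

Lemma measurable_jap f : cmeas f -> measurable_fun setT (fun w => jap (f w)).
Proof.
move=> mf; have -> : (fun w => jap (f w)) = (fun w => (1 + cabs (f w) ^+ 2) `^ 2^-1).
  by apply/funext => w; rewrite powR12_sqrt// addr_ge0 ?sqr_ge0.
apply: (measurableT_comp (measurable_powR 2^-1)).
apply: measurable_funD; first exact: measurable_cst.
by rewrite /=; apply: measurable_funX; exact: cmeas_cabs.
Qed.

Definition japint f : R := fine (\int[m]_w (jap (f w))%:E).

Lemma integral_jap f : cintb m f -> (\int[m]_w (jap (f w))%:E <= 1 + \int[m]_w (cabs (f w))%:E)%E.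
Proof.
move=> fi; apply: (@le_trans _ _ (\int[m]_w (1 + cabs (f w))%:E)%E).
  apply: ge0_int_le; [exact: measurable_jap fi.1| |by move=> w; exact: jap_ge0|by move=> w; exact: jap_le].
  by apply: measurable_funD; [exact: measurable_cst|exact: cmeas_cabs fi.1].
rewrite ge0_intD//; [|exact: cmeas_cabs fi.1|by move=> w; exact: cabs_ge0].
by rewrite integral_cst//= probability_setT mule1.
Qed.

Lemma japintE f : cintb m f -> (\int[m]_w (jap (f w))%:E = (japint f)%:E)%E.
Proof.
move=> fi; rewrite /japint fineK// ge0_fin_numE.
  by apply: (le_lt_trans (integral_jap fi)); rewrite lte_add_pinfty ?ltry//; case: fi.
by apply: integral_ge0 => w _; rewrite lee_fin jap_ge0.
Qed.

Lemma japint_le f : cintb m f -> japint f <= 1 + L1n f.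
Proof. by move=> fi; rewrite -lee_fin -japintE// EFinD L1nE//; exact: integral_jap. Qed.

Lemma japint_poisson n r f : 0 <= r < 1 -> cintb m f -> japint (poisson n r f) <= japint f.
Proof.
move=> r01 fi; rewrite -lee_fin -(japintE fi) -(japintE (cintb_poisson n r01 fi)).
apply: poisson_jensen => //; [exact: jap_ge0|by move=> h; exact: measurable_jap|exact: jap_support].
Qed.

Definition midpt f g w : R[i] := (f w + g w) / 2.

Lemma cintb_midpt f g : cintb m f -> cintb m g -> cintb m (midpt f g).
Proof.
move=> fi gi; apply: (eq_cintb (g := fun w => 2^-1 * (f w + g w))).
  by move=> w; rewrite /midpt mulrC.
by apply: cintbZ; exact: cintbD.
Qed.

Lemma poisson_midpt n r f g : 0 <= r < 1 -> cintb m f -> cintb m g ->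
  poisson n r (midpt f g) = midpt (poisson n r f) (poisson n r g).
Proof.
move=> r01 fi gi; have -> : midpt f g = fun w => 2^-1 * (f w + g w).
  by apply/funext => w; rewrite /midpt mulrC.
apply/funext => w; rewrite poissonZ ?poissonD//; last exact: cintbD.
by rewrite /midpt mulrC.
Qed.

(** [jap] is 1-Lipschitz, and h differs from the midpoint by half the sum of its differences with f
    and g. *)
Lemma japint_midpt f g h : cintb m f -> cintb m g -> cintb m h ->
  japint h <= japint (midpt f g) + L1n (fun w => f w - h w) + L1n (fun w => g w - h w).
Proof.
move=> fi gi hi; have mi := cintb_midpt fi gi.
have fh := cintbB fi hi; have gh := cintbB gi hi.
rewrite -lee_fin !EFinD -!japintE// !L1nE// -!ge0_intD; last first.
- by move=> w; exact: cabs_ge0.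
- by move=> w; exact: jap_ge0.
- exact: cmeas_cabs fh.1.
- exact: measurable_jap mi.1.
- by move=> w; exact: cabs_ge0.
- by move=> w; rewrite addr_ge0 ?jap_ge0 ?cabs_ge0.
- exact: cmeas_cabs gh.1.
- by apply: measurable_funD; [exact: measurable_jap mi.1|exact: cmeas_cabs fh.1].
apply: ge0_int_le.
- exact: measurable_jap hi.1.
- apply: measurable_funD; last exact: cmeas_cabs gh.1.
  by apply: measurable_funD; [exact: measurable_jap mi.1|exact: cmeas_cabs fh.1].
- by move=> w; exact: jap_ge0.
move=> w; rewrite -addrA; apply: (le_trans (jap_lip _ (midpt f g w))); rewrite lerD2l.
have -> : h w - midpt f g w = - (2^-1 * ((f w - h w) + (g w - h w))) by rewrite /midpt; field.
have c2 : cabs (2^-1 : R[i]) = 2^-1.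
  have -> : (2^-1 : R[i]) = (2^-1)%:C by rewrite fmorphV rmorph_nat.
  by rewrite cabs_real ger0_norm.
rewrite cabsN cabsM c2; have := cabsD (f w - h w) (g w - h w).
have := cabs_ge0 (f w - h w); have := cabs_ge0 (g w - h w).
move: (cabs _) (cabs _) (cabs _) => a b c; lra.
Qed.

Lemma jap_integrated p (N e : R) f g (C : R) : 1 < p -> 0 < N -> 0 < e -> cintb m f -> cintb m g ->
  (pint p f <= C%:E)%E -> (pint p g <= C%:E)%E ->
  L1n (fun w => f w - g w) + 2 * (1 + N) ^+ 3 / e * japint (midpt f g) <=
  e + 2 * (1 + N) ^+ 3 / e * ((japint f + japint g) / 2) + 2 / N `^ (p - 1) * (C + C).
Proof.
move=> p1 N0 e0 fi gi fC gC; have fg := cintbB fi gi; have mi := cintb_midpt fi gi.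
set c := 2 * _ / e; set k := 2 / _.
have c0 : 0 <= c by rewrite divr_ge0 ?(ltW e0)// mulr_ge0// exprn_ge0// addr_ge0// ltW.
have k0 : 0 <= k by rewrite divr_ge0// powR_ge0.
have mp h : cintb m h -> measurable_fun setT (fun w => cabs (h w) `^ p).
  by move=> hi; exact: (measurableT_comp (measurable_powR p) (cmeas_cabs hi.1)).
have p0 h w : 0 <= cabs (h w) `^ p by exact: powR_ge0.
have fj := measurable_jap fi.1; have gj := measurable_jap gi.1; have mj := measurable_jap mi.1.
have fgj : measurable_fun setT (fun w => jap (f w) + jap (g w)) by exact: measurable_funD.
have fgp : measurable_fun setT (fun w => cabs (f w) `^ p + cabs (g w) `^ p).
  by apply: measurable_funD; exact: mp.
have mc (u : torus R nat -> R) (a : R) : measurable_fun setT u -> measurable_fun setT (fun w => a * u w).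
  by move=> mu; apply: measurable_funM => //; exact: measurable_cst.
have j0 h w : 0 <= jap (h w) by exact: jap_ge0.
have jj0 w : 0 <= jap (f w) + jap (g w) by rewrite addr_ge0.
have pp0 w : 0 <= cabs (f w) `^ p + cabs (g w) `^ p by rewrite addr_ge0.
have c20 : 0 <= c / 2 by rewrite divr_ge0.
have H : (\int[m]_w (cabs (f w - g w) + c * jap (midpt f g w))%:E <=
   \int[m]_w (e + c / 2 * (jap (f w) + jap (g w)) + k * (cabs (f w) `^ p + cabs (g w) `^ p))%:E)%E.
  apply: ge0_int_le.
  - by apply: measurable_funD; [exact: cmeas_cabs fg.1|exact: mc].
  - apply: measurable_funD; last exact: mc.
    by apply: measurable_funD; [exact: measurable_cst|exact: mc].
  - by move=> w; rewrite addr_ge0 ?cabs_ge0// mulr_ge0// jap_ge0.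
  move=> w; have -> : c / 2 * (jap (f w) + jap (g w)) = c * ((jap (f w) + jap (g w)) / 2) by ring.
  exact: jap_pointwise.
have e1 : (\int[m]_w (cabs (f w - g w) + c * jap (midpt f g w))%:E =
    (L1n (fun w => f w - g w) + c * japint (midpt f g))%:E)%E.
  rewrite ge0_intD ?ge0_intZ//; first by rewrite japintE// -L1nE// EFinD EFinM.
  - exact: cmeas_cabs fg.1.
  - exact: mc.
  - by move=> w; exact: cabs_ge0.
  - by move=> w; exact: mulr_ge0.
have e2 : (\int[m]_w (e + c / 2 * (jap (f w) + jap (g w)) + k * (cabs (f w) `^ p + cabs (g w) `^ p))%:E =
    e%:E + (c / 2)%:E * (japint f + japint g)%:E + k%:E * (pint p f + pint p g))%E.
  rewrite ge0_intD; last first.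
  - by move=> w; exact: mulr_ge0.
  - by move=> w; rewrite addr_ge0 ?(ltW e0)// mulr_ge0.
  - exact: mc.
  - by apply: measurable_funD; [exact: measurable_cst|exact: mc].
  rewrite ge0_intD; last first.
  - by move=> w; exact: mulr_ge0.
  - by move=> w; exact: ltW.
  - exact: mc.
  - exact: measurable_cst.
  rewrite !ge0_intZ// integral_cst//= probability_setT mule1.
  rewrite (ge0_intD fj gj (j0 f) (j0 g)) (ge0_intD (mp f fi) (mp g gi) (p0 f) (p0 g)).
  by rewrite EFinD !japintE.
rewrite -lee_fin -e1; apply: (le_trans H); rewrite e2 [leRHS]EFinD; apply: leeD.
  by rewrite -EFinM -EFinD lee_fin lerD2l mulrAC mulrA.
have k0' : (0 <= k%:E)%E by rewrite lee_fin.
by rewrite (EFinM k) EFinD; exact: (lee_wpmul2l k0' (leeD fC gC)).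
Qed.

End slice_convergence.

(** * Surjectivity for p > 1 *)

Section onto.
Context {R : realType}.
Local Notation m := (torus_measure R nat).
Implicit Types (f h : torus R nat -> R[i]) (F : nat -> torus R nat -> R[i]) (g : ell2 R -> R[i]).

Lemma japint_cauchy p F (C : R) : 1 < p -> (forall k, cintb m (F k)) ->
  (forall k, (pint p (F k) <= C%:E)%E) ->
  (forall eta : R, 0 < eta -> exists K, forall k l, (K <= k)%N -> (K <= l)%N ->
     (japint (F k) + japint (F l)) / 2 <= japint (midpt (F k) (F l)) + eta) ->
  forall e : R, 0 < e -> exists K, forall k l, (K <= k)%N -> (K <= l)%N ->
     (\int[m]_w (cabs (F k w - F l w))%:E <= e%:E)%E.
Proof.
move=> p1 Fi FC Fconv e e0; have e30 : 0 < e / 3 by rewrite divr_gt0.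
have C0 : 0 <= C by rewrite -lee_fin (le_trans _ (FC 0%N))// pint_ge0.
have p10 : 0 < p - 1 by rewrite subr_gt0.
(* Here p > 1 enters: N^(p-1) can be given the value M, for which the tail 2 / M * (C + C) is at
   most e / 3. *)
pose M := 12 * (C + 1) / e; have M0 : 0 < M by rewrite divr_gt0// mulr_gt0// ltr_wpDl.
pose N := M `^ (p - 1)^-1; have N0 : 0 < N by rewrite powR_gt0.
have NM : N `^ (p - 1) = M by rewrite -powRrM mulVf ?gt_eqF// powRr1// ltW.
pose c := 2 * (1 + N) ^+ 3 / (e / 3).
have c0 : 0 <= c by rewrite divr_ge0 ?(ltW e30)// mulr_ge0// exprn_ge0// addr_ge0// ltW.
have c1 : 0 < c + 1 by rewrite ltr_wpDl.
have [K hK] := Fconv (e / 3 / (c + 1)) (divr_gt0 e30 c1).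
exists K => k l Kk Kl; have hi := cintbB (Fi k) (Fi l).
rewrite -L1nE// lee_fin; have := jap_integrated p1 N0 e30 (Fi k) (Fi l) (FC k) (FC l).
rewrite NM -/c => h1; have h2 := ler_wpM2l c0 (hK k l Kk Kl).
have h3 : c * (e / 3 / (c + 1)) <= e / 3.
  by rewrite mulrCA ler_piMr ?(ltW e30)// ler_pdivrMr// mul1r lerDl.
have h4 : 2 / M * (C + C) <= e / 3.
  have -> : 2 / M * (C + C) = e / 3 * (C / (C + 1)).
    by rewrite /M; field; rewrite !gt_eqF// ltr_wpDl.
  by rewrite ler_piMr ?(ltW e30)// ler_pdivrMr ?ltr_wpDl// mul1r lerDl.
rewrite mulrDr in h2; move: h1 h2 h3 h4.
set a := c * _; set b := c * _; set d := c * _; set x := 2 / M * _; clear; lra.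
Qed.

Lemma L1n_le_pint p f (C : R) : 1 <= p -> cintb m f -> (pint p f <= C%:E)%E -> L1n f <= 1 + C.
Proof.
move=> p1 fi fC; rewrite -lee_fin L1nE// EFinD; apply: le_trans (leeD (lexx _) fC).
have mp : measurable_fun setT (fun w => cabs (f w) `^ p).
  exact: (measurableT_comp (measurable_powR p) (cmeas_cabs fi.1)).
apply: (@le_trans _ _ (\int[m]_w (1 + cabs (f w) `^ p)%:E)%E).
  apply: ge0_int_le; [exact: cmeas_cabs fi.1| |by move=> w; exact: cabs_ge0|].
    by apply: measurable_funD; [exact: measurable_cst|exact: mp].
  move=> w; have [c1|c1] := leP (cabs (f w)) 1.
    by rewrite (le_trans c1)// lerDl powR_ge0.
  by apply: (le_trans (le1r_powR (ltW c1) p1)); rewrite lerDr.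
rewrite ge0_intD//; last by move=> w; exact: powR_ge0.
by rewrite integral_cst//= probability_setT mule1.
Qed.

(** Choose K0 with [japint (F K0)] within eta / 3 of the supremum. Poisson integration with K0 + 1
    variables and radius [prad K0] sends all later slices, hence also their midpoints, L_1-close to
    F K0, and it does not increase [japint]. So the midpoints nearly reach the supremum, which
    bounds the average. *)
Lemma slices_midpoint g p (C : R) : 1 <= p -> holomorphic g ->
  (forall n (r : R), (0 < n)%N -> 0 < r < 1 -> (pint p (slice g n (fun=> r)) <= C%:E)%E) ->
  let F k := slice g k.+1 (fun=> prad k) in
  forall eta : R, 0 < eta -> exists K, forall k l, (K <= k)%N -> (K <= l)%N ->
     (japint (F k) + japint (F l)) / 2 <= japint (midpt (F k) (F l)) + eta.
Proof.
move=> p1 gh gC F eta eta0.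
have Fi k : cintb m (F k) by apply: cintb_slice => // _; exact: prad01.
have FB k : japint (F k) <= 2 + C.
  apply: (le_trans (japint_le (Fi k))); rewrite -[2]/(1 + 1) -addrA lerD2l.
  by apply: (@L1n_le_pint p) => //; apply: gC => //; exact: prad_gt0.
pose E := range (fun k => japint (F k)).
have Es : has_sup E by split; [exists (japint (F 0%N)), 0%N|exists (2 + C) => _ [k _ <-]].
have eta3 : 0 < eta / 3 by rewrite divr_gt0.
have [_ [K0 _ <-] hK0] := sup_adherent eta3 Es.
have Fsup k : japint (F k) <= sup E by apply: (ub_le_sup Es.2); exists k.
have hcv := slice_L1cvg K0.+1 gh (prad_gt0 (R := R) K0).
have gi k : cintb m (slice g K0.+1 (fun=> prad k * prad K0)).
  apply: cintb_slice => // _; have /andP[a0 a1] := prad01 (R := R) k.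
  have /andP[b0 b1] := prad01 (R := R) K0.
  by rewrite mulr_ge0//= (le_lt_trans _ b1)// ler_piMl// ltW.
move/(L1cvgP gi (Fi K0)): hcv => /(_ _ eta3) [K1 _ hK1].
exists (maxn K0 K1) => k l; rewrite !geq_max => /andP[k0 k1] /andP[l0 l1].
have PF i : (K0 <= i)%N -> poisson K0.+1 (prad K0) (F i) = slice g K0.+1 (fun=> prad i * prad K0).
  move=> Ki; apply/funext => w; rewrite (poisson_slice w gh _ (prad_gt0 (R := R) i) (prad01 K0))//.
  by rewrite mulrC.
have d i : (K1 <= i)%N -> L1n (fun w => slice g K0.+1 (fun=> prad i * prad K0) w - F K0 w) <= eta / 3.
  by move=> Ki; rewrite -lee_fin L1nE; [exact: hK1|exact: cintbB].
have h1 := japint_poisson K0.+1 (prad01 (R := R) K0) (cintb_midpt (Fi k) (Fi l)).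
rewrite (poisson_midpt K0.+1 (prad01 (R := R) K0) (Fi k) (Fi l)) !PF// in h1.
have h2 := japint_midpt (gi k) (gi l) (Fi K0).
have := d k k1; have := d l l1; have := Fsup k; have := Fsup l; move: h1 h2 hK0; rewrite /F.
set x1 := japint _; set x2 := japint _; set x3 := japint _; set x4 := japint _.
set x5 := L1n _; set x6 := L1n _; set x7 := sup E.
clear; lra.
Qed.

Lemma slices_L1cvg g p (C : R) : 1 < p -> holomorphic g ->
  (forall n (r : R), (0 < n)%N -> 0 < r < 1 -> (pint p (slice g n (fun=> r)) <= C%:E)%E) ->
  exists2 f, cintb m f & L1cvg (fun k => slice g k.+1 (fun=> prad k)) f.
Proof.
move=> p1 gh gC; apply: L1_complete => [k|]; first by apply: cintb_slice => // _; exact: prad01.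
apply: (japint_cauchy p1 (C := C)) => [k|k|].
- by apply: cintb_slice => // _; exact: prad01.
- by apply: gC => //; exact: prad_gt0.
- exact: (slices_midpoint (ltW p1) gh gC).
Qed.

(** Poisson integration takes the k-th slice to the slice of radius [prad k * r]; its L_1 limit is
    the Poisson integral of f on one side and the slice of g of radius r on the other. *)
Lemma slice_limit_phi g f : holomorphic g -> cintb m f ->
  L1cvg (fun k => slice g k.+1 (fun=> prad k)) f ->
  H1 f /\ forall z, polydisc2 z -> phi f z = g z.
Proof.
move=> gh fi Ff; have FH k : H1 (slice g k.+1 (fun=> prad k)).
  by apply: H1_slice => // _; exact: prad01.
have fH := H1_lim FH fi Ff; split=> //.
apply: holomorphic_unique => // [|n a r n0 r01]; first exact: phi_holomorphic.
have /andP[r0 r1] := r01; have hr : 0 <= r < 1 by rewrite ltW.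
rewrite (slice_phi n fH hr).
have Fi k := (FH k).1; have gi k : cintb m (slice g n (fun=> prad k * r)).
  apply: cintb_slice => // _; have /andP[a0 a1] := prad01 (R := R) k.
  by rewrite mulr_ge0 ?(ltW r0)//= (le_lt_trans _ r1)// ler_piMl ?(ltW r0)// ltW.
apply: (L1_four_eq n a (fun k => cintb_poisson n hr (Fi k)) (cintb_poisson n hr fi)
   (L1cvg_poisson n hr Fi fi Ff) gi _ (slice_L1cvg n gh r01)).
  by apply: cintb_slice.
near=> k; apply/funext => w; rewrite (poisson_slice w gh _ (prad_gt0 (R := R) k) hr).
  by rewrite mulrC.
by rewrite leqW//; near: k; exact: nbhs_infty_ge.
Unshelve. all: by end_near. Qed.

Lemma phi_onto p g : 1 < p -> Hp_ball p g ->
  exists2 f, Hp_torus p f & forall z, polydisc2 z -> phi f z = g z.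
Proof.
move=> p1 [gh gf]; have p1' := ltW p1; have p0 := lt_trans ltr01 p1.
have Cf : (Hp_norm p g `^ p)%E \is a fin_num.
  by rewrite ge0_fin_numE ?poweR_ge0// poweR_lty.
pose C := fine (Hp_norm p g `^ p)%E.
have gC n (r : R) : (0 < n)%N -> 0 < r < 1 -> (pint p (slice g n (fun=> r)) <= C%:E)%E.
  by move=> n0 r01; rewrite /C fineK//; exact: pint_slice.
have [f fi Ff] := slices_L1cvg p1 gh gC.
have [fH E] := slice_limit_phi gh fi Ff; exists f => //; split; last by case: fH.
apply/(Lp_pint p1'); split; first by case: fi.
apply: (@le_lt_trans _ _ C%:E); last exact: ltry.
apply: (pint_L1_le p1' _ fi Ff) => [k|]; first by apply: cintb_slice => // _; exact: prad01.
by apply: nearW => k; apply: gC => //; exact: prad_gt0.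
Qed.

End onto.

(** * The case p = 1 *)

Section hardy_one.
Context {R : realType}.
Local Notation m := (torus_measure R nat).
Implicit Types (f h : torus R nat -> R[i]) (F : nat -> torus R nat -> R[i]) (g : ell2 R -> R[i]).

Lemma pint1 f : pint 1 f = (\int[m]_w (cabs (f w))%:E)%E.
Proof. by apply: eq_integral => w _; rewrite powRr1// cabs_ge0. Qed.

Lemma int_cabs_ge0 f : (0 <= \int[m]_w (cabs (f w))%:E)%E.
Proof. by apply: integral_ge0 => w _; rewrite lee_fin cabs_ge0. Qed.

Lemma Lp_norm1 f : Lp_norm 1 f = (\int[m]_w (cabs (f w))%:E)%E.
Proof. by rewrite Lp_normE// pint1 invr1 poweRe1// int_cabs_ge0. Qed.

Lemma H1_Hp_torus f : H1 f -> Hp_torus 1 f.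
Proof.
move=> [fi f0]; split=> //; apply/(Lp_pint (lexx 1)); split; first by case: fi.
by rewrite pint1; case: fi.
Qed.

Lemma Hp_norm1_slice g n (r : R) : holomorphic g -> (0 < n)%N -> 0 < r < 1 ->
  (\int[m]_w (cabs (slice g n (fun=> r) w))%:E <= Hp_norm 1 g)%E.
Proof.
move=> gh n0 r01; have := pint_slice (lexx 1) gh n0 r01.
by rewrite pint1 poweRe1// Hp_norm_ge0.
Qed.

Lemma Hp_norm1_le g (C : \bar R) : holomorphic g -> (0 <= C)%E ->
  (forall n (r : R), (0 < n)%N -> 0 < r < 1 ->
    (\int[m]_w (cabs (slice g n (fun=> r) w))%:E <= C)%E) -> (Hp_norm 1 g <= C)%E.
Proof.
move=> gh C0 gC; rewrite -[leRHS]poweRe1// -[X in (_ `^ X)%E]invr1.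
by apply: Hp_norm_le => // n r n0 r01; rewrite pint1; exact: gC.
Qed.

Lemma mono_chi n (alpha : midx) (w : torus R nat) : (forall j, (n <= j)%N -> alpha j = 0%N) ->
  mono alpha w = chi n (fun j => (alpha j)%:Z) w.
Proof. by move=> a0; rewrite /mono (prod_finsupp (tcoord w) a0). Qed.

Lemma fourier_coef_mono (alpha : midx) (beta : zmidx) :
  fourier_coef (mono alpha : torus R nat -> R[i]) beta = (zmidx_of alpha == beta)%:R.
Proof.
pose n := maxn (\max_(j <- finsupp alpha) j).+1 (\max_(j <- finsupp beta) j).+1.
have an j : (n <= j)%N -> alpha j = 0%N.
  move=> nj; apply/eqP; rewrite -[_ == _]negbK -mem_finsupp; apply/negP => ja.
  have : (j <= \max_(j <- finsupp alpha) j)%N by exact: leq_bigmax_seq.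
  by rewrite leqNgt => /negP; apply; apply: leq_trans nj; rewrite leq_max leqnn.
have bn j : (n <= j)%N -> beta j = 0.
  move=> nj; apply/eqP; rewrite -[_ == _]negbK -mem_finsupp; apply/negP => ja.
  have : (j <= \max_(j <- finsupp beta) j)%N by exact: leq_bigmax_seq.
  by rewrite leqNgt => /negP; apply; apply: leq_trans nj; rewrite leq_max leqnn orbT.
rewrite (fourier_coefE _ bn).
have -> : (mono alpha : torus R nat -> R[i]) = chi n (fun j => (alpha j)%:Z).
  by apply/funext => w; exact: mono_chi.
rewrite four_chi; congr (nat_of_bool _)%:R; apply/forallP/eqP => [E|<- j].
  apply/fsfunP => j; rewrite zmidx_ofE; have [nj|jn] := leqP n j; first by rewrite an ?bn.
  by have /eqP := E (Ordinal jn).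
by rewrite zmidx_ofE.
Qed.

Lemma H1_mono (alpha : midx) : H1 (mono alpha : torus R nat -> R[i]).
Proof.
split=> [|beta nb].
  apply: (@cintb_bound _ _ _ _ _ 1); first exact: cmeas_mono.
  by move=> w; rewrite cabs_mono.
rewrite fourier_coef_mono; case: eqP => // E; exfalso; apply: nb => j.
by rewrite -E zmidx_ofE.
Qed.

Lemma phi_mono (alpha : midx) (z : ell2 R) : phi (mono alpha) z = monomial alpha z.
Proof.
apply: csum_sum => e e0; exists [fset alpha]%fset => B; rewrite fsub1set => aB.
have zinj : injective zmidx_of.
  move=> a b /fsfunP ab; apply/fsfunP => j; have := ab j; rewrite !zmidx_ofE; by case.
rewrite (big_fsetD1 alpha aB)/= big_seq big1 => [|beta].
  by rewrite /hardy_term fourier_coef_mono eqxx mul1r addr0 subrr cabs0.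
rewrite !inE => /andP[ba _]; rewrite /hardy_term fourier_coef_mono.
by rewrite (inj_eq zinj) eq_sym (negbTE ba) mul0r.
Qed.

Definition tpoly (s : seq midx) (c : midx -> R[i]) (w : torus R nat) : R[i] :=
  \sum_(alpha <- s) c alpha * mono alpha w.

Lemma tpoly_cons alpha s c : tpoly (alpha :: s) c = fun w => c alpha * mono alpha w + tpoly s c w.
Proof. by apply/funext => w; rewrite /tpoly big_cons. Qed.

(** Zero is written as a combination of two constants, so that linearity covers the empty
    polynomial. *)
Lemma tpoly_nil c : tpoly [::] c = fun w => -1 * mono [fsfun] w + mono [fsfun] w.
Proof. by apply/funext => w; rewrite /tpoly big_nil mulN1r addNr. Qed.

Lemma H1_tpoly s c : H1 (tpoly s c).
Proof.
elim: s => [|alpha s IH]; first by rewrite tpoly_nil; apply: H1_lin; exact: H1_mono.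
by rewrite tpoly_cons; apply: H1_lin => //; exact: H1_mono.
Qed.

Lemma phi_tpoly s c z : polydisc2 z ->
  phi (tpoly s c) z = \sum_(alpha <- s) c alpha * monomial alpha z.
Proof.
move=> z1; elim: s => [|alpha s IH].
  rewrite tpoly_nil (phi_lin (-1) (H1_mono _) (H1_mono _) z1).
  by rewrite big_nil mulN1r addNr.
by rewrite tpoly_cons (phi_lin _ (H1_mono _) (H1_tpoly s c) z1) IH phi_mono big_cons.
Qed.

(** Differentiability is local and the polydisc is open: a ball of radius 1 - s around z stays
    inside, as coordinates are bounded by the ell_2 norm. *)
Lemma eq_holomorphic g (h : ell2 R -> R[i]) : (forall z, polydisc2 z -> g z = h z) -> holomorphic h -> holomorphic g.
Proof.
move=> gh hh z z1; have [s /andP[s0 s1] zs] := polydisc2P z1.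
have /diff_locallyP[cL eL] := hh z z1.
have eG : (g : ell2 R -> R[i]^o) \o shift z =
    cst (g z : R[i]^o) + ('d (h : ell2 R -> R[i]^o) z : ell2 R -> R[i]^o) +o_ (0 : ell2 R) id.
  apply/eqaddoP => e e0; move/eqaddoP: eL => /(_ e e0).
  have : \forall x \near (0 : ell2 R), g (x + z) = h (x + z).
    apply/nbhs_norm0P; exists (1 - s)%:C; first by rewrite /= ltcR subr_gt0.
    move=> x /=; rewrite ell2_normE ltcR => xs; apply: gh.
    apply: (@polydisc2_le _ _ (l2n x + s)); first by rewrite -ltrBrDr.
    move=> j; apply: (le_trans (cabsD _ _)); apply: lerD; [exact: cabs_le_l2n|exact: zs].
  apply: filterS2 => x E; suff -> : ((g \o shift z) - (cst (g z : R[i]^o) + 'd (h : ell2 R -> R[i]^o) z)) x =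
     ((h \o shift z) - (cst (h z : R[i]^o) + 'd (h : ell2 R -> R[i]^o) z)) x by [].
  by rewrite -[LHS]/(g (x + z) - (g z + 'd (h : ell2 R -> R[i]^o) z x)) E (gh z z1).
by apply/diff_locallyP; rewrite (diff_unique cL eG).
Qed.

Lemma holomorphicB g (h : ell2 R -> R[i]) : holomorphic g -> holomorphic h -> holomorphic (fun z => g z - h z).
Proof. by move=> gh hh z z1; exact: differentiableB (gh z z1) (hh z z1). Qed.

End hardy_one.

(** * The closed span of the monomials *)

Section monomial_closure.
Context {R : realType}.
Local Notation m := (torus_measure R nat).
Implicit Types (f h : torus R nat -> R[i]) (g : ell2 R -> R[i]).

Lemma phi_Hp_ball p f : 1 <= p -> Hp_torus p f -> Hp_ball p (phi f).
Proof.
move=> p1 fp; have fH := Hp_torus_H1 p1 fp; split; first exact: phi_holomorphic.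
by rewrite (phi_isometry p1 fH); case: fp.1.
Qed.

Lemma phi_ae_eq f h : H1 f -> H1 h -> {ae m, forall w, f w = h w} ->
  phi f = phi h.
Proof.
move=> fH hH fh; apply/funext => z; congr unordered_sum; apply/funext => alpha.
rewrite /hardy_term; congr (_ * _).
have [n nE] := @fourier_coef_four R (zmidx_of alpha); rewrite !nE.
apply/eqP; rewrite -subr_eq0 -(fourB n _ fH.1 hH.1); apply/eqP.
apply: ComplexField.Normc.eq0_normc; apply/eqP; rewrite eq_le cabs_ge0 andbT -lee_fin.
apply: (le_trans (cabs_four n _ (cintbB fH.1 hH.1))).
rewrite le_eqVlt; apply/orP; left; apply/eqP.
rewrite -[RHS](@integral0 _ _ _ m setT); apply: ae_eq_integral => //.
- by apply/measurable_EFinP; exact: cmeas_cabs (cintbB fH.1 hH.1).1.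
- by apply: filterS fh => w /= -> _; rewrite subrr cabs0.
Qed.

Lemma L1_subC f h : (\int[m]_w (cabs (f w - h w))%:E = \int[m]_w (cabs (h w - f w))%:E)%E.
Proof. by apply: eq_integral => w _; rewrite -cabsN opprB. Qed.

Lemma slice_phi_dist g f n (r : R) : holomorphic g -> H1 f -> (0 < n)%N -> 0 < r < 1 ->
  (\int[m]_w (cabs (poisson n r f w - slice g n (fun=> r) w))%:E <=
    Hp_norm 1 (fun z => (g z - phi f z)%R))%E.
Proof.
move=> gh fH n0 r01; have /andP[r0 r1] := r01; have hr : 0 <= r < 1 by rewrite ltW.
have := Hp_norm1_slice (holomorphicB gh (phi_holomorphic fH)) n0 r01.
by rewrite L1_subC -(slice_phi n fH hr).
Qed.

(** The isometry for f - h combined with the triangle inequality on each slice; g is not assumed to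
    lie in the image of [phi], so this turns approximation of g into a Cauchy condition on the
    torus. *)
Lemma phi_dist g f h : holomorphic g -> H1 f -> H1 h ->
  (\int[m]_w (cabs (f w - h w))%:E <=
    Hp_norm 1 (fun z => (g z - phi f z)%R) + Hp_norm 1 (fun z => (g z - phi h z)%R))%E.
Proof.
move=> gh fH hH; have fhH := H1B fH hH.
rewrite -Lp_norm1 -(phi_isometry (lexx 1) fhH).
apply: Hp_norm1_le => [||n r n0 r01]; first exact: phi_holomorphic.
  by apply: adde_ge0; exact: Hp_norm_ge0.
have /andP[r0 r1] := r01; have hr : 0 <= r < 1 by rewrite ltW.
rewrite (slice_phi n fhH hr).
have -> : poisson n r (fun w => f w - h w) = (fun w => poisson n r f w - poisson n r h w).
  by apply/funext => w; rewrite (poissonB n _ hr fH.1 hH.1).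
have si : cintb m (slice g n (fun=> r)) by exact: cintb_slice.
apply: le_trans (L1_sub_triangle (cintb_poisson n hr fH.1) si (cintb_poisson n hr hH.1)) _.
by rewrite [X in (_ + X)%E]L1_subC; apply: leeD; exact: slice_phi_dist.
Qed.

Lemma phi_closure g f : H1 f -> (forall z, polydisc2 z -> phi f z = g z) ->
  Hp_closure 1 (@monomial_span R) g.
Proof.
move=> fH fg; have Eg z : polydisc2 z -> g z = phi f z by move=> /fg.
split; first split.
- exact: eq_holomorphic Eg (phi_holomorphic fH).
- rewrite (eq_Hp_norm 1 Eg); exact: (phi_Hp_ball (lexx 1) (H1_Hp_torus fH)).2.
(* Two thirds of [e] are spent, on the Poisson integral and on the truncation of its kernel; the
   remaining third makes the inequality strict. *)
move=> e e0; have e30 : 0 < e / 3 by rewrite divr_gt0.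
have fi := fH.1.
have Pi k : cintb m (poisson k (prad k) f) by exact: cintb_poisson (prad01 k) fi.
have [k _ /(_ k (leqnn k)) hk] := (proj1 (L1cvgP Pi fi) (poisson_cvg_L1 fi)) _ e30.
have Mi M : cintb m (poissonM k (prad k) M f) by exact: cintb_poissonM (prad01 k) fi.
have [M _ /(_ M (leqnn M)) hM] :=
  (proj1 (L1cvgP Mi (Pi k)) (poissonM_L1 k (prad01 k) fi)) _ e30.
have [s [c sc]] : exists s c, poissonM k (prad k) M f = tpoly s c.
  exists (mbox k M : seq midx), (fun alpha => hcoef f alpha * \prod_(i <- finsupp alpha) (prad k)%:C ^+ alpha i).
  by apply/funext => w; exact: poissonM_hpoly.
have tH : H1 (tpoly s c) by exact: H1_tpoly.
exists (fun z => \sum_(alpha <- s) c alpha * monomial alpha z); first by exists s, c.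
have -> : Hp_norm 1 (fun z => g z - \sum_(alpha <- s) c alpha * monomial alpha z) =
    Hp_norm 1 (phi (fun w => f w - tpoly s c w)).
  by apply: eq_Hp_norm => z z1; rewrite (phiB fH tH z1) (phi_tpoly _ _ z1) Eg.
rewrite (phi_isometry (lexx 1) (H1B fH tH)) Lp_norm1.
have t := L1_sub_triangle fi (Pi k) (Mi M).
rewrite -sc; apply: le_lt_trans t _.
rewrite [X in (X + _)%E]L1_subC [X in (_ + X)%E]L1_subC.
apply: le_lt_trans (leeD hk hM) _; rewrite -EFinD lte_fin; move: e0; clear; lra.
Qed.

Lemma closure_phi g : Hp_closure 1 (@monomial_span R) g ->
  exists2 f, H1 f & forall z, polydisc2 z -> phi f z = g z.
Proof.
move=> [[gh _] gcl].
have F_ex k : exists F, H1 F /\ (Hp_norm 1 (fun z => (g z - phi F z)%R) < (k.+1%:R^-1)%:E)%E.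
  have [|_ [s [c ->]] hk] := gcl k.+1%:R^-1; first by rewrite invr_gt0.
  exists (tpoly s c); split; first exact: H1_tpoly.
  rewrite (@eq_Hp_norm _ _ _ (fun z => g z - \sum_(alpha <- s) c alpha * monomial alpha z))//.
  by move=> z z1; rewrite phi_tpoly.
pose F k := sval (cid (F_ex k)).
have FH k : H1 (F k) by exact: (svalP (cid (F_ex k))).1.
have Fg k : (Hp_norm 1 (fun z => (g z - phi (F k) z)%R) <= (k.+1%:R^-1)%:E)%E.
  by apply: ltW; exact: (svalP (cid (F_ex k))).2.
have Fi k := (FH k).1.
have inv_le (e : R) : 0 < e -> \forall k \near \oo, k.+1%:R^-1 <= e.
  move=> e0; have [K hK] := near_infty_natSinv_lt (PosNum e0).
  by move=> h; exists K => // k Kk; apply: ltW; exact: h.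
have [|f fi Ff] := L1_complete Fi.
  move=> e e0; have e20 : 0 < e / 2 by rewrite divr_gt0.
  have [K _ hK] := inv_le _ e20; exists K => k l Kk Kl.
  apply: le_trans (phi_dist gh (FH k) (FH l)) _.
  apply: le_trans (leeD (Fg k) (Fg l)) _.
  by rewrite -EFinD lee_fin [leRHS]splitr; apply: lerD; exact: hK.
have fH := H1_lim FH fi Ff; exists f => //.
apply: holomorphic_unique => // [|n a r n0 r01]; first exact: phi_holomorphic.
have /andP[r0 r1] := r01; have hr : 0 <= r < 1 by rewrite ltW.
have Pi k := cintb_poisson n hr (Fi k).
have si : cintb m (slice g n (fun=> r)) by exact: cintb_slice.
rewrite (slice_phi n fH hr).
(* The same sequence of Poisson integrals has two L_1 limits, the Poisson integral of [f] and the
   slice of [g]. *)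
apply: (L1_four_eq n a Pi (cintb_poisson n hr fi) (L1cvg_poisson n hr Fi fi Ff) Pi si).
  apply/(L1cvgP Pi si) => e /inv_le; apply: filterS => k ke.
  apply: le_trans (slice_phi_dist gh (FH k) n0 r01) _.
  by apply: le_trans (Fg k) _; rewrite lee_fin.
exact: nearW.
Qed.

End monomial_closure.

Theorem theorem5p1 (R : realType) (p : R) (hp : 1 <= p) :
  (* phi is a well-defined map from H_p(T^oo) to H_p(D^oo) *)
  (forall f : torus R nat -> R[i], Hp_torus p f ->
     (forall z, polydisc2 z -> unordered_summable (hardy_term f z)) /\
     Hp_ball p (phi f)) /\
  (forall f g : torus R nat -> R[i], Hp_torus p f -> Hp_torus p g ->
     {ae torus_measure R nat, forall w, f w = g w} ->
     forall z, polydisc2 z -> phi f z = phi g z) /\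
  (* it is a linear isometry *)
  (forall (a : R[i]) (f g : torus R nat -> R[i]),
     Hp_torus p f -> Hp_torus p g ->
     forall z, polydisc2 z ->
     phi (fun w => a * f w + g w) z = a * phi f z + phi g z) /\
  (forall f g : torus R nat -> R[i], Hp_torus p f -> Hp_torus p g ->
     Hp_norm p (fun z => phi f z - phi g z) = Lp_norm p (fun w => f w - g w)) /\
  (* it is onto if 1 < p, and its image is the closed span of the monomials
     if p = 1 *)
  (1 < p -> forall g : ell2 R -> R[i], Hp_ball p g ->
     exists2 f, Hp_torus p f & forall z, polydisc2 z -> phi f z = g z) /\
  (p = 1 ->
     [set g : ell2 R -> R[i] | exists2 f, Hp_torus p f &
        forall z, polydisc2 z -> phi f z = g z] =
     Hp_closure p (@monomial_span R)).
Proof.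
have HH f := @Hp_torus_H1 R p hp f.
split=> [f fp|].
  split; last exact: phi_Hp_ball.
  by move=> z z1; exact: csum_summable (phi_csum (HH f fp) z1).
split=> [f g /HH fH /HH gH fg z _|]; first by rewrite (phi_ae_eq fH gH fg).
split=> [a f g /HH fH /HH gH z z1|]; first exact: phi_lin.
split=> [f g /HH fH /HH gH|].
  rewrite -(phi_isometry hp (H1B fH gH)).
  by apply: eq_Hp_norm => z z1; rewrite phiB.
split=> [p1 g|p1]; first exact: phi_onto.
rewrite p1; apply/seteqP; split=> g /=.
  by move=> [f /(Hp_torus_H1 (lexx 1)) fH fg]; exact: (phi_closure fH fg).
by move=> /closure_phi [f fH fg]; exists f => //; exact: H1_Hp_torus.
Qed.
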